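(* Let $G$ be a finite dimensional real Lie group with Lie algebra $\mathfrak{g}$, let $\mathcal{X}=\mathcal{E}(\mathfrak{g})$ be the complex universal enveloping algebra of $\mathfrak{g}$, and let $\mathcal{B}=C_0^\infty(G)$ be the normed convolution $*$-algebra, with the left action $x\triangleright a=\tilde{x}a$ of $\mathcal{X}$ on $\mathcal{B}$ by right-invariant differential operators (all as specified in the context). Then the $*$-representations $\rho'$ of $\mathcal{E}(\mathfrak{g})$ associated with non-degenerate continuous $*$-representations $\rho$ of $\mathcal{B}$ are precisely the $*$-representations $dU$ associated with unitary representations $U$ of $G$. That is: (i) for every non-degenerate continuous $*$-representation $\rho$ of $\mathcal{B}$ on a Hilbert space $\mathcal{H}$ there exists a unitary representation $U$ of $G$ on $\mathcal{H}$ such that $\rho'=dU$; and (ii) for every unitary representation $U$ of $G$ on a Hilbert space $\mathcal{H}$ there exists a non-degenerate continuous $*$-representation $\rho$ of $\mathcal{B}$ on $\mathcal{H}$ such that $\rho'=dU$. Here equality of $*$-representations includes equality of domains.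
   Context: Algebras. $\mathcal{E}(\mathfrak{g})$ is a unital $*$-algebra with the (antilinear) involution determined by $x^+=-x$ for $x\in\mathfrak{g}$. Let $\mu_l$ be a left Haar measure on $G$ and let $m$ be the modular function of $G$, normalized so that $d\mu_l(g)=m(g)\,d\mu_r(g)$ for a suitable right Haar measure $\mu_r$. $C_0^\infty(G)$ denotes the compactly supported complex $C^\infty$-functions on $G$; it is a normed $*$-algebra with $$(a\cdot b)(g)=\int_G a(h)b(h^{-1}g)\,d\mu_l(h),\qquad a^+(g)=m(g)^{-1}\overline{a(g^{-1})},\qquad \|a\|=\int_G|a(g)|\,d\mu_l(g).$$ Action. For $x\in\mathfrak{g}$ and $a\in C_0^\infty(G)$ put $(\tilde{x}a)(g)=\frac{d}{dt}\big|_{t=0}a(e^{-tx}g)$, where $x\mapsto e^x$ is the exponential map. The map $x\mapsto\tilde{x}$ extends to an algebra homomorphism of $\mathcal{E}(\mathfrak{g})$ into the differential operators on $G$, and $x\triangleright a:=\tilde{x}a$ for $x\in\mathcal{E}(\mathfrak{g})$. This action satisfies $(x\triangleright a)^+\cdot b=a^+\cdot(x^+\triangleright b)$ for all $x\in\mathcal{E}(\mathfrak{g})$, $a,b\in C_0^\infty(G)$. Representations. For a dense linear subspace $\mathcal{D}$ of a Hilbert space $\mathcal{H}$, $\mathcal{L}^+(\mathcal{D})$ is the $*$-algebra of linear maps $x:\mathcal{D}\to\mathcal{D}$ with $\mathcal{D}\subseteq\mathcal{D}(x^* )$ and $x^*\mathcal{D}\subseteq\mathcal{D}$, with involution $x^+=x^*|_{\mathcal{D}}$.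 A $*$-representation of a $*$-algebra $A$ on the domain $\mathcal{D}$ is a $*$-homomorphism $A\to\mathcal{L}^+(\mathcal{D})$. The closure of a $*$-representation $\pi$ of $A$ on $\mathcal{D}$ is the $*$-representation of $A$ with domain $\bigcap_{x\in A}\mathcal{D}(\overline{\pi(x)})$ on which $x$ acts as the restriction of the operator closure $\overline{\pi(x)}$. A continuous $*$-representation $\rho$ of the normed $*$-algebra $\mathcal{B}$ on $\mathcal{H}$ is here a $*$-homomorphism into the bounded operators on $\mathcal{H}$ with $\|\rho(a)\|\le C\|a\|$ for some constant $C$ and all $a$; it is non-degenerate if the linear span of $\rho(\mathcal{B})\mathcal{H}$ is dense in $\mathcal{H}$. Definition of $\rho'$. For $\rho$ non-degenerate and continuous there is a unique $*$-representation $\tilde\rho$ of $\mathcal{X}$ on the domain $\operatorname{span}\,\rho(\mathcal{B})\mathcal{H}$ with $\tilde\rho(x)\rho(b)\varphi=\rho(x\triangleright b)\varphi$ for $x\in\mathcal{X}$, $b\in\mathcal{B}$, $\varphi\in\mathcal{H}$; $\rho'$ denotes the closure of $\tilde\rho$. Definition of $dU$. A unitary representation $U$ of $G$ on $\mathcal{H}$ is a homomorphism of $G$ into the unitary group of $\mathcal{H}$ such that $g\mapsto U(g)\varphi$ is continuous for every $\varphi\in\mathcal{H}$. $\mathcal{D}^\infty(U)$ is the space of $C^\infty$-vectors, i.e. of those $\varphi\in\mathcal{H}$ for which $g\mapsto U(g)\varphi$ is a $C^\infty$-map. $dU$ is the unique $*$-representation of $\mathcal{E}(\mathfrak{g})$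 on the domain $\mathcal{D}^\infty(U)$ such that $dU(x)\varphi=\frac{d}{dt}\big|_{t=0}U(e^{tx})\varphi$ for $x\in\mathfrak{g}$, $\varphi\in\mathcal{D}^\infty(U)$. *)

(* Defs.v *)
From HB Require Import structures.
From mathcomp Require Import all_boot all_order all_algebra.
From mathcomp Require Import all_classical all_reals all_analysis.
From mathcomp Require Import generic_quotient complex ring.

Set Implicit Arguments.
Unset Strict Implicit.
Unset Printing Implicit Defensive.

Import Order.TTheory GRing.Theory Num.Theory numFieldNormedType.Exports.

Local Open Scope classical_set_scope.
Local Open Scope complex_scope.
Local Open Scope ring_scope.

(* Smooth maps between normed spaces: the target is a normed space over K,
   seen as a real space through kappa; used with kappa = idfun (K = R) and
   with the embedding R -> R[i]. *)
Section Smooth.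
Context {R : realType} {K : numFieldType} (kappa : R -> K).
Context {V : normedModType R} {W : normedModType K}.

Definition is_dirder (f : V -> W) (x v : V) (l : W) : Prop :=
  kappa t^-1 *: (f (x + t *: v) - f x) @[t --> (0 : R)^'] --> l.

(* On an open set of a finite dimensional V this is the class C^k: all
   iterated directional derivatives up to order k exist and are continuous. *)
Fixpoint Ck (k : nat) (O : set V) (f : V -> W) : Prop :=
  (forall x, O x -> {for x, continuous f}) /\
  if k is k'.+1 then
    forall v, exists g : V -> W,
      (forall x, O x -> is_dirder f x v (g x)) /\ Ck k' O g
  else True.

Definition smooth_on (O : set V) (f : V -> W) : Prop := forall k, Ck k O f.

End Smooth.

(* [chart_inv] is only meaningful on the image of [chart_dom]. *)
Record chart (R : realType) (n : nat) (G : topologicalType) := Chart {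
  chart_dom : set G ;
  chart_map : G -> 'rV[R]_n ;
  chart_inv : 'rV[R]_n -> G }.

Definition chart_img {R : realType} {n : nat} {G : topologicalType}
  (c : chart R n G) : set 'rV[R]_n := chart_map c @` chart_dom c.

Definition is_chart {R : realType} {n : nat} {G : topologicalType}
    (c : chart R n G) : Prop :=
  [/\ open (chart_dom c), open (chart_img c),
      (forall g, chart_dom c g -> chart_inv c (chart_map c g) = g),
      (forall g, chart_dom c g -> {for g, continuous (chart_map c)}) &
      (forall u, chart_img c u -> {for u, continuous (chart_inv c)})].

(* Second countability is not required; the [point] inherited from the
   pointed topology plays no role. *)
HB.mixin Record isLieGroup (R : realType) (n : nat) G
    of Group G & PointedTopological G := {
  lie_hausdorff : hausdorff_space G ;
  lie_mul_continuous : continuous (fun p : G * G => (p.1 * p.2)%g) ;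
  lie_inv_continuous : continuous (fun g : G => (g^-1)%g) ;
  atlas : set (chart R n G) ;
  atlas_chart : forall c, atlas c -> is_chart c ;
  atlas_cover : forall g : G, exists2 c, atlas c & chart_dom c g ;
  atlas_transition : forall c d, atlas c -> atlas d ->
    smooth_on (idfun : R -> R)
      (chart_map c @` (chart_dom c `&` chart_dom d))
      (fun u => chart_map d (chart_inv c u)) ;
  lie_mul_smooth : forall c d e, atlas c -> atlas d -> atlas e ->
    smooth_on (idfun : R -> R)
      [set p : 'rV[R]_n * 'rV[R]_n | [/\ chart_img c p.1, chart_img d p.2 &
         chart_dom e (chart_inv c p.1 * chart_inv d p.2)%g]]
      (fun p => chart_map e (chart_inv c p.1 * chart_inv d p.2)%g) ;
  lie_inv_smooth : forall c d, atlas c -> atlas d ->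
    smooth_on (idfun : R -> R)
      [set u : 'rV[R]_n | chart_img c u /\ chart_dom d (chart_inv c u)^-1%g]
      (fun u => chart_map d (chart_inv c u)^-1%g) }.

#[short(type="lieGroupType")]
HB.structure Definition LieGroup (R : realType) (n : nat) :=
  { G of isLieGroup R n G & Group G & PointedTopological G }.

Definition smooth_map {R : realType} {n : nat} {G : lieGroupType R n}
    {K : numFieldType} (kappa : R -> K) {W : normedModType K} (f : G -> W) :=
  forall c : chart R n G, atlas c ->
    smooth_on kappa (chart_img c) (fun u => f (chart_inv c u)).

(* The Lie algebra of G is realized as the left-invariant derivations of
   C^oo(G, R), with the commutator bracket. *)
Section SmoothLinear.
Context {R : realType} {n : nat} {G : lieGroupType R n}.

Lemma Ck_lin (V W : normedModType R) k (O : set V) (r : R) (f g : V -> W) :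
  Ck idfun k O f -> Ck idfun k O g -> Ck idfun k O (fun x => r *: f x + g x).
Proof.
elim: k f g => [|k IH] f g [cf Df] [cg Dg]; split => //.
- by move=> x Ox; apply: continuousD;
    [apply: continuousZr; exact: cf | exact: cg].
- by move=> x Ox; apply: continuousD;
    [apply: continuousZr; exact: cf | exact: cg].
move=> v; have [f' [f'D f'C]] := Df v; have [g' [g'D g'C]] := Dg v.
exists (fun x => r *: f' x + g' x); split; last exact: IH.
move=> x Ox; rewrite /is_dirder /=.
under eq_fun do rewrite opprD addrACA -scalerBr scalerDr scalerA mulrC -scalerA.
by apply: cvgD; [apply: cvgZr; exact: f'D | exact: g'D].
Qed.

Lemma Ck_pred (V W : normedModType R) k (O : set V) (f : V -> W) :
  Ck idfun k.+1 O f -> Ck idfun k O f.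
Proof.
elim: k f => [|k IH] f [cf Df]; first by split.
split=> // v; have [g [gD gC]] := Df v; exists g; split=> //; exact: IH.
Qed.

Lemma Ck_mul (V : normedModType R) k (O : set V) (f g : V -> R^o) :
  Ck idfun k O f -> Ck idfun k O g -> Ck idfun k O (fun x => f x * g x).
Proof.
elim: k f g => [|k IH] f g Hf Hg; have [cf Df] := Hf; have [cg Dg] := Hg;
  (split; first by move=> x Ox; apply: (@continuousM R V f g); [exact: cf|exact: cg]).
  by [].
move=> v; have [f' [f'D f'C]] := Df v; have [g' [g'D g'C]] := Dg v.
exists (fun x => 1 *: (f' x * g x) + f x * g' x); split; last first.
  by apply: Ck_lin; apply: IH => //; exact: Ck_pred.
move=> x Ox; rewrite /is_dirder scale1r.
have -> : (fun t : R => t^-1 *: (f (x + t *: v) * g (x + t *: v) - f x * g x)) =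
    (fun t : R => t^-1 *: (f (x + t *: v) - f x) * g (x + t *: v) +
      f x * (t^-1 *: (g (x + t *: v) - g x))).
  apply/funext => t; rewrite /GRing.scale /=; ring.
have xt : x + t *: v @[t --> (0 : R)^'] --> x.
  rewrite -[X in _ --> X]addr0 -(scale0r v).
  apply: cvgD; first exact: cvg_cst.
  by apply: cvgZr_tmp; exact: cvg_within.
apply: cvgD; last by apply: cvgM; [exact: cvg_cst | exact: g'D].
by apply: cvgM; [exact: f'D | apply: cvg_comp xt _; exact: cg].
Qed.

Definition smooth_real : {pred G -> R^o} :=
  [pred f : G -> R^o | `[< smooth_map idfun f >]].

Lemma smooth_real_submod : submod_closed smooth_real.
Proof.
split=> [|r f g].
  apply/asboolP => c _ k; elim: k => [|k IH] /=; split=> //.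
  - by move=> x _; exact: cst_continuous.
  - by move=> x _; exact: cst_continuous.
  move=> v; exists (fun=> 0); split=> // x _; rewrite /is_dirder.
  by under eq_fun do rewrite subrr scaler0; exact: cvg_cst.
move=> /asboolP sf /asboolP sg; apply/asboolP => c ac k.
exact: Ck_lin (sf c ac k) (sg c ac k).
Qed.

Lemma smooth_real_mul (f g : G -> R^o) :
  f \in smooth_real -> g \in smooth_real -> (fun x => f x * g x) \in smooth_real.
Proof.
move=> /asboolP sf /asboolP sg; apply/asboolP => c ac k.
exact: Ck_mul (sf c ac k) (sg c ac k).
Qed.

HB.instance Definition _ :=
  GRing.isSubmodClosed.Build R (G -> R^o) smooth_real smooth_real_submod.

End SmoothLinear.


Section LieAlgebra.
Context (R : realType) (n : nat) (G : lieGroupType R n).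

Record smoothfun := SmoothFun {
  smoothfun_val :> G -> R^o ; smoothfunP : smoothfun_val \in @smooth_real R n G }.
HB.instance Definition _ := [isSub for smoothfun_val].
HB.instance Definition _ := [Choice of smoothfun by <:].
HB.instance Definition _ := [SubChoice_isSubLmodule of smoothfun by <:].

Definition smooth_mul (f g : smoothfun) : smoothfun :=
  SmoothFun (smooth_real_mul (smoothfunP f) (smoothfunP g)).

(* In the last clause h is the left translate of f by a. *)
Definition left_invariant_derivation (D : smoothfun -> smoothfun) : Prop :=
  [/\ forall (r : R) f g, D (r *: f + g) = r *: D f + D g,
      forall f g, D (smooth_mul f g) = smooth_mul (D f) g + smooth_mul f (D g) &
      forall (a : G) (f h : smoothfun), (forall g, h g = f (a * g)%g) ->
        forall g, D h g = D f (a * g)%g].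

Definition lie_pred : {pred smoothfun -> smoothfun} :=
  [pred D : smoothfun -> smoothfun | `[< left_invariant_derivation D >]].

Lemma lie_pred_submod : submod_closed lie_pred.
Proof.
split=> [|r D E].
  apply/asboolP; split=> [r f g|f g|//]; first by rewrite scaler0 addr0.
  apply/val_inj/funext => x; change ((0 : R) = 0 * g x + f x * 0).
  by rewrite mul0r mulr0 addr0.
move=> /asboolP[Dl DL Di] /asboolP[El EL Ei]; apply/asboolP; split.
- move=> s f g; rewrite !fctE Dl El !scalerDr !scalerA (mulrC r s).
  by rewrite addrACA.
- move=> f g; rewrite !fctE DL EL; apply/val_inj/funext => x.
  rewrite /= !fctE /GRing.scale /=. ring.
- by move=> a f h fh g; rewrite /= !fctE (Di a f) // (Ei a f).
Qed.
HB.instance Definition _ :=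
  GRing.isSubmodClosed.Build R (smoothfun -> smoothfun) lie_pred lie_pred_submod.

Record lieAlg := LieAlg {
  lieAlg_val :> smoothfun -> smoothfun ; lieAlgP : lieAlg_val \in lie_pred }.
HB.instance Definition _ := [isSub for lieAlg_val].
HB.instance Definition _ := [Choice of lieAlg by <:].
HB.instance Definition _ := [SubChoice_isSubLmodule of lieAlg by <:].

Lemma lie_bracket_subproof (x y : lieAlg) :
  (fun f => x (y f) - y (x f)) \in lie_pred.
Proof.
case: x y => [D /= /asboolP[Dl DL Di]] [E /= /asboolP[El EL Ei]].
have Dadd f g : D (f + g) = D f + D g by rewrite -[f in LHS]scale1r Dl scale1r.
have Eadd f g : E (f + g) = E f + E g by rewrite -[f in LHS]scale1r El scale1r.
apply/asboolP; split.
- by move=> r f g; rewrite El !Dl El scalerBr opprD addrACA.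
- move=> f g; rewrite EL DL Dadd Eadd !DL !EL.
  apply/val_inj/funext => x; rewrite /= !fctE /=. ring.
- move=> a f h fh g; rewrite /= !fctE (Di a (E f) (E h)) ?(Ei a (D f) (D h)) //.
    by move=> z; exact: Di.
  by move=> z; exact: Ei.
Qed.
Definition lie_bracket (x y : lieAlg) : lieAlg :=
  LieAlg (lie_bracket_subproof x y).

End LieAlgebra.

(* The complex universal enveloping algebra of a real Lie algebra g: formal
   noncommutative polynomials over R[i] in the elements of g, modulo the
   algebra axioms, real linearity of the inclusion of g, and
   x * y - y * x = [x, y]. *)
Section UniversalEnveloping.
Context (R : realType) (g : lmodType R) (br : g -> g -> g).

Inductive uterm : Type :=
| UGen of g
| UCst of R[i]
| UAdd of uterm & uterm
| UMul of uterm & uterm.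

HB.instance Definition _ := gen_eqMixin uterm.
HB.instance Definition _ := gen_choiceMixin uterm.

Local Notation "s + t" := (UAdd s t).
Local Notation "s * t" := (UMul s t).

Inductive ueq : uterm -> uterm -> Prop :=
| ueq_refl s : ueq s s
| ueq_sym s t : ueq s t -> ueq t s
| ueq_trans s t u : ueq s t -> ueq t u -> ueq s u
| ueq_add s s' t t' : ueq s s' -> ueq t t' -> ueq (s + t) (s' + t')
| ueq_mul s s' t t' : ueq s s' -> ueq t t' -> ueq (s * t) (s' * t')
| ueq_addA s t u : ueq (s + (t + u)) (s + t + u)
| ueq_addC s t : ueq (s + t) (t + s)
| ueq_add0 s : ueq (UCst 0 + s) s
| ueq_mulA s t u : ueq (s * (t * u)) (s * t * u)
| ueq_mul1l s : ueq (UCst 1 * s) s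
| ueq_mul1r s : ueq (s * UCst 1) s
| ueq_mulDl s t u : ueq ((s + t) * u) (s * u + t * u)
| ueq_mulDr s t u : ueq (s * (t + u)) (s * t + s * u)
| ueq_cstD a b : ueq (UCst (a + b)%R) (UCst a + UCst b)
| ueq_cstM a b : ueq (UCst (a * b)%R) (UCst a * UCst b)
| ueq_cst_mul0 s : ueq (UCst 0 * s) (UCst 0)
| ueq_cstC a s : ueq (UCst a * s) (s * UCst a)
| ueq_genD x y : ueq (UGen (x + y)%R) (UGen x + UGen y)
| ueq_genZ (r : R) x : ueq (UGen (r *: x)) (UCst r%:C * UGen x)
| ueq_gen_br x y :
    ueq (UGen (br x y)) (UGen x * UGen y + UCst (-1) * (UGen y * UGen x)).

Definition ueqb : rel uterm := fun s t => `[< ueq s t >].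

Lemma ueqb_equiv : equiv_class_of ueqb.
Proof.
split=> [s|s t|t s u].
- exact/asboolP/ueq_refl.
- by apply/asboolP/asboolP; exact: ueq_sym.
- by move=> /asboolP st /asboolP tu; apply/asboolP; exact: ueq_trans st tu.
Qed.
Canonical ueqb_rel := EquivRelPack ueqb_equiv.

Definition uea : Type := {eq_quot ueqb_rel}%qT.
HB.instance Definition _ := Choice.on uea.
HB.instance Definition _ := EqQuotient.on uea.

Definition ucls (s : uterm) : uea := (\pi_uea s)%qT.

Lemma uclsP s t : ucls s = ucls t <-> ueq s t.
Proof.
split=> [/eqP|st]; first by rewrite /ucls eqmodE => /asboolP.
by apply/eqP; rewrite /ucls eqmodE; exact/asboolP.
Qed.

Lemma ucls_repr (u : uea) : ucls (repr u) = u.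
Proof. exact: reprK. Qed.

Lemma repr_ucls s : ueq (repr (ucls s)) s.
Proof. by apply/uclsP; rewrite ucls_repr. Qed.

Lemma ucls_ind (P : uea -> Prop) : (forall s, P (ucls s)) -> forall u, P u.
Proof. by move=> h u; rewrite -(ucls_repr u). Qed.

Definition uadd (u v : uea) : uea := ucls (repr u + repr v).
Definition umul (u v : uea) : uea := ucls (repr u * repr v).
Definition ucst (a : R[i]) : uea := ucls (UCst a).
Definition ugen (x : g) : uea := ucls (UGen x).
Definition uopp (u : uea) : uea := umul (ucst (-1)) u.
Definition uscale (a : R[i]) (u : uea) : uea := umul (ucst a) u.

Lemma uaddE s t : uadd (ucls s) (ucls t) = ucls (s + t).
Proof. by apply/uclsP; apply: ueq_add; exact: repr_ucls. Qed.
Lemma umulE s t : umul (ucls s) (ucls t) = ucls (s * t).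
Proof. by apply/uclsP; apply: ueq_mul; exact: repr_ucls. Qed.

Fact uaddA : associative uadd.
Proof.
elim/ucls_ind=> s; elim/ucls_ind=> t; elim/ucls_ind=> u.
by rewrite !uaddE; exact/uclsP/ueq_addA.
Qed.
Fact uaddC : commutative uadd.
Proof.
elim/ucls_ind=> s; elim/ucls_ind=> t.
by rewrite !uaddE; exact/uclsP/ueq_addC.
Qed.
Fact uadd0 : left_id (ucst 0) uadd.
Proof. by elim/ucls_ind=> s; rewrite uaddE; exact/uclsP/ueq_add0. Qed.
Fact umulA : associative umul.
Proof.
elim/ucls_ind=> s; elim/ucls_ind=> t; elim/ucls_ind=> u.
by rewrite !umulE; exact/uclsP/ueq_mulA.
Qed.
Fact umul1l : left_id (ucst 1) umul.
Proof. by elim/ucls_ind=> s; rewrite umulE; exact/uclsP/ueq_mul1l. Qed.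
Fact umul1r : right_id (ucst 1) umul.
Proof. by elim/ucls_ind=> s; rewrite umulE; exact/uclsP/ueq_mul1r. Qed.
Fact umulDl : left_distributive umul uadd.
Proof.
elim/ucls_ind=> s; elim/ucls_ind=> t; elim/ucls_ind=> u.
by rewrite !(uaddE, umulE); exact/uclsP/ueq_mulDl.
Qed.
Fact umulDr : right_distributive umul uadd.
Proof.
elim/ucls_ind=> s; elim/ucls_ind=> t; elim/ucls_ind=> u.
by rewrite !(uaddE, umulE); exact/uclsP/ueq_mulDr.
Qed.
Fact ucstD a b : ucst (a + b)%R = uadd (ucst a) (ucst b).
Proof. by rewrite uaddE; exact/uclsP/ueq_cstD. Qed.
Fact ucstM a b : ucst (a * b)%R = umul (ucst a) (ucst b).
Proof. by rewrite umulE; exact/uclsP/ueq_cstM. Qed.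
Fact ucst_mul0 u : umul (ucst 0) u = ucst 0.
Proof. by elim/ucls_ind: u => s; rewrite umulE; exact/uclsP/ueq_cst_mul0. Qed.
Fact ucstC a u : umul (ucst a) u = umul u (ucst a).
Proof. by elim/ucls_ind: u => s; rewrite !umulE; exact/uclsP/ueq_cstC. Qed.
Fact uaddN : left_inverse (ucst 0) uopp uadd.
Proof.
by move=> u; rewrite -[X in uadd _ X]umul1l -umulDl -ucstD addNr ucst_mul0.
Qed.

(* The augmentation; it shows that 1 != 0. *)
Fixpoint ueps (s : uterm) : R[i] :=
  match s with
  | UGen _ => 0
  | UCst a => a
  | UAdd s t => (ueps s + ueps t)%R
  | UMul s t => (ueps s * ueps t)%R
  end.

Fact ueps_ueq s t : ueq s t -> ueps s = ueps t.
Proof.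
elim=> //= *; rewrite ?(mulr0, mul0r, addr0, mulr1, mul1r, add0r) //;
  by [congruence | ring].
Qed.

Fact ucst1_neq0 : ucst 1 != ucst 0.
Proof.
apply/eqP => /uclsP/ueps_ueq /=; apply/eqP; exact: oner_neq0.
Qed.

HB.instance Definition _ :=
  GRing.isZmodule.Build uea uaddA uaddC uadd0 uaddN.
HB.instance Definition _ :=
  GRing.Zmodule_isNzRing.Build uea umulA umul1l umul1r umulDl umulDr ucst1_neq0.

Fact uscaleA a b u : uscale a (uscale b u) = uscale (a * b)%R u.
Proof. by rewrite /uscale umulA -ucstM. Qed.
Fact uscale1 : left_id 1%R uscale.
Proof. exact: umul1l. Qed.
Fact uscaleDr : right_distributive uscale +%R.
Proof. by move=> a u v; exact: umulDr. Qed.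
Fact uscaleDl u : {morph uscale^~ u : a b / (a + b)%R}.
Proof. by move=> a b; rewrite /uscale ucstD; exact: umulDl. Qed.
HB.instance Definition _ := GRing.Zmodule_isLmodule.Build R[i] uea
  uscaleA uscale1 uscaleDr uscaleDl.
Fact uscaleAl a (u v : uea) : (a *: (u * v) = a *: u * v)%R.
Proof. exact: umulA. Qed.
HB.instance Definition _ := GRing.Lmodule_isLalgebra.Build R[i] uea uscaleAl.
Fact uscaleAr a (u v : uea) : (a *: (u * v) = u * (a *: v))%R.
Proof.
change (umul (ucst a) (umul u v) = umul u (umul (ucst a) v)).
by rewrite umulA ucstC umulA.
Qed.
HB.instance Definition _ := GRing.Lalgebra_isAlgebra.Build R[i] uea uscaleAr.

Fixpoint uterm_star (s : uterm) : uterm :=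
  match s with
  | UGen x => UGen (- x)
  | UCst a => UCst a^*
  | UAdd s t => uterm_star s + uterm_star t
  | UMul s t => uterm_star t * uterm_star s
  end.

(* The antilinear involution with x^+ = - x for x in g; it does not depend on
   the representative, see ustarE. *)
Definition ustar (u : uea) : uea := ucls (uterm_star (repr u)).

Lemma ugenN x : ugen (- x) = (- ugen x)%R.
Proof.
have -> : (- x)%R = ((-1 : R) *: x) by rewrite scaleN1r.
have -> : ugen ((-1 : R) *: x) = umul (ucst (-1)%:C) (ugen x).
  by rewrite umulE; exact/uclsP/ueq_genZ.
by rewrite rmorphN1.
Qed.

Lemma ustarE s : ustar (ucls s) = ucls (uterm_star s).
Proof.
have addE t u : ucls (t + u) = (ucls t + ucls u)%R by rewrite -uaddE.
have mulE t u : ucls (t * u) = (ucls t * ucls u)%R by rewrite -umulE.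
suff H t u : ueq t u -> ucls (uterm_star t) = ucls (uterm_star u).
  exact/H/repr_ucls.
have genE x : ucls (UGen (- x)) = (- ucls (UGen x))%R by exact: ugenN.
have cC a (v : uea) : (ucls (UCst a) * v = v * ucls (UCst a))%R.
  exact: ucstC.
have cD a b : ucls (UCst (a + b)%R) = (ucls (UCst a) + ucls (UCst b))%R.
  exact: ucstD.
have cM a b : ucls (UCst (a * b)%R) = (ucls (UCst a) * ucls (UCst b))%R.
  exact: ucstM.
have c0 : ucls (UCst 0) = 0%R by [].
have c1 : ucls (UCst 1) = 1%R by [].
have cN : ucls (UCst (-1)) = (-1)%R.
  by change (ucst (-1) = umul (ucst (-1)) (ucst 1)); rewrite -ucstM mulr1.
elim=> {t u} //=; rewrite ?(addE, mulE, genE).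
- by move=> *; congruence.
- by move=> s0 s' t t' _ e1 _ e2; rewrite !addE e1 e2.
- by move=> s0 s' t t' _ e1 _ e2; rewrite !mulE e1 e2.
- by move=> *; rewrite !addE addrA.
- by move=> *; rewrite !addE addrC.
- by move=> *; rewrite !addE rmorph0 c0 add0r.
- by move=> *; rewrite !mulE mulrA.
- by move=> *; rewrite !mulE rmorph1 c1 mulr1.
- by move=> *; rewrite !mulE rmorph1 c1 mul1r.
- by move=> *; rewrite !(addE, mulE) mulrDr.
- by move=> *; rewrite !(addE, mulE) mulrDl.
- by move=> a b; rewrite addE rmorphD cD.
- by move=> a b; rewrite mulE rmorphM cM cC.
- by move=> *; rewrite mulE rmorph0 c0 mulr0.
- by move=> a u; rewrite !mulE cC.
- move=> x y; rewrite addE !genE -opprD; congr (- _)%R.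
  by rewrite -addE; exact/uclsP/ueq_genD.
- move=> r x; rewrite mulE !genE mulNr -cC; congr (- _)%R.
  have -> : ((r%:C)^* = r%:C)%R by apply/eqP; rewrite eq_complex /= oppr0 !eqxx.
  by rewrite -mulE; exact/uclsP/ueq_genZ.
- move=> x y; rewrite !(addE, mulE) !genE rmorphN1 cN mulrNN mulrN1 mulrNN.
  have /uclsP -> := ueq_gen_br x y.
  by rewrite !(addE, mulE) cN mulN1r opprD opprK addrC.
Qed.

End UniversalEnveloping.

Notation borel G := (g_sigma_algebraType (@open G)).

Section Haar.
Context {R : realType} {n : nat} {G : lieGroupType R n}.
Implicit Types mu : {measure set (borel G) -> \bar R}.

Definition radon mu : Prop :=
  [/\ forall K : set G, compact K -> (mu K < +oo)%E,
      forall A : set (borel G), measurable A ->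
        mu A = ereal_inf [set mu O | O in [set O : set G | open O /\ A `<=` O]] &
      forall O : set G, open O ->
        mu O = ereal_sup [set mu K | K in [set K : set G | compact K /\ K `<=` O]]].

Definition left_haar mu : Prop :=
  [/\ radon mu, mu setT != 0%E &
      forall (g : G) (A : set (borel G)), measurable A ->
        mu [set (g * a)%g | a in A] = mu A].

Definition right_haar mu : Prop :=
  [/\ radon mu, mu setT != 0%E &
      forall (g : G) (A : set (borel G)), measurable A ->
        mu [set (a * g)%g | a in A] = mu A].

(* The continuous homomorphism m : G -> ]0, +oo[ such that d mu = m d mur
   for some right Haar measure mur. *)
Definition modular_function (mu : {measure set (borel G) -> \bar R})
    (m : G -> R) : Prop :=
  [/\ continuous m, (forall g, 0 < m g), {morph m : g h / (g * h)%g >-> g * h} &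
      exists2 mur : {measure set (borel G) -> \bar R}, right_haar mur &
        forall A : set (borel G), measurable A ->
          mu A = (\int[mur]_(g in A) (m g)%:E)%E].

Definition Cintegral mu (f : G -> R[i]) : R[i] :=
  Rintegral mu setT (fun g => complex.Re (f g)) +i*
  Rintegral mu setT (fun g => complex.Im (f g)).

End Haar.

Section TestFunctions.
Context {R : realType} {n : nat} {G : lieGroupType R n}.

Definition test_function (a : G -> R[i]) : Prop :=
  smooth_map (fun r : R => r%:C) (a : G -> R[i]^o) /\
  compact (closure [set g : G | a g != 0]).

Variables (mu : {measure set (borel G) -> \bar R}) (m : G -> R).

Definition conv (a b : G -> R[i]) : G -> R[i] :=
  fun g => Cintegral mu (fun h => a h * b (h^-1 * g)%g).

Definition tf_star (a : G -> R[i]) : G -> R[i] :=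
  fun g => (m g)^-1%:C * (a (g^-1)%g)^*.

Definition L1norm (a : G -> R[i]) : R :=
  Rintegral mu setT (fun g => complex.Re `|a g|).

End TestFunctions.

Section Action.
Context {R : realType} {n : nat} {G : lieGroupType R n}.

Definition lie_env : algType R[i] := uea (@lie_bracket R n G).

Definition lie_gen : lieAlg G -> lie_env := @ugen R _ (@lie_bracket R n G).

(* gam is the integral curve through 1 of the left-invariant field x *)
Definition integral_curve (x : lieAlg G) (gam : R -> G) : Prop :=
  gam 0 = 1%g /\
  forall (t : R) (f : smoothfun G),
    is_derive t 1 (fun s : R => f (gam s) : R^o) (x f (gam t)).

Definition lexp (x : lieAlg G) : G :=
  xget (fun=> 1%g) [set gam | integral_curve x gam] 1.

(* F'(0) = l, for F : R -> W with W a complex normed space *)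
Definition is_deriv0 {W : normedModType R[i]} (F : R -> W) (l : W) : Prop :=
  (t^-1)%:C *: (F t - F 0) @[t --> (0 : R)^'] --> l.

Definition vtilde (x : lieAlg G) (a : G -> R[i]) : G -> R[i] :=
  fun g => xget 0 [set l : R[i]^o |
    is_deriv0 (fun t : R => a (lexp (- (t *: x)) * g)%g : R[i]^o) l].

Fixpoint uterm_act (s : uterm (lieAlg G)) (a : G -> R[i]) : G -> R[i] :=
  match s with
  | UGen x => vtilde x a
  | UCst c => fun g => c * a g
  | UAdd s t => fun g => uterm_act s a g + uterm_act t a g
  | UMul s t => uterm_act s (uterm_act t a)
  end.

(* x |> a, the extension of x |-> vtilde x to an algebra homomorphism,
   computed on a representative of x: on smooth functions the result does not
   depend on the representative. *)
Definition env_act (x : lie_env) (a : G -> R[i]) : G -> R[i] :=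
  uterm_act (repr (x : uea (@lie_bracket R n G))) a.

End Action.
Arguments lie_env {R n} G.

HB.mixin Record isHilbert (R : realType) H of CompleteNormedModule R[i] H := {
  dot : H -> H -> R[i] ;
  dot_linear : forall (c : R[i]) (u v w : H),
    dot (c *: u + v) w = c * dot u w + dot v w ;
  dot_conj : forall u v : H, dot v u = (dot u v)^* ;
  dot_norm : forall u : H, dot u u = `|u| ^+ 2 }.

#[short(type="hilbertType")]
HB.structure Definition Hilbert (R : realType) :=
  { H of isHilbert R H & CompleteNormedModule R[i] H }.

Section StarRepresentations.
Context {R : realType} {H : hilbertType R}.

Definition linear_on (D : set H) (T : H -> H) : Prop :=
  forall (c : R[i]) u v, D u -> D v -> T (c *: u + v) = c *: T u + T v.

Definition subspace (D : set H) : Prop :=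
  D 0 /\ forall (c : R[i]) u v, D u -> D v -> D (c *: u + v).

Definition linear_span (A : set H) : set H :=
  [set u | exists k (c : 'I_k -> R[i]) (v : 'I_k -> H),
     (forall i, A (v i)) /\ u = \sum_(i < k) c i *: v i].

(* D lies in the domain of the adjoint of T|_D, and T^* = S on D *)
Definition adjoint_on (D : set H) (T S : H -> H) : Prop :=
  forall u v, D u -> D v -> dot (T u) v = dot u (S v).

(* T and S belong to L^+(D) and S = T^+ *)
Definition Lplus_adjoint (D : set H) (T S : H -> H) : Prop :=
  [/\ linear_on D T, (forall u, D u -> D (T u)),
      linear_on D S, (forall u, D u -> D (S u)) & adjoint_on D T S].

Context {n : nat} {G : lieGroupType R n}.

(* A representation of the enveloping algebra by operators with common domain
   [rdom]; the values of [rop] outside [rdom] are meaningless. *)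
Record oprep := OpRep { rdom : set H ; rop : lie_env G -> H -> H }.
HB.instance Definition _ := gen_eqMixin oprep.
HB.instance Definition _ := gen_choiceMixin oprep.

Definition same_rep (p q : oprep) : Prop :=
  rdom p = rdom q /\ forall x u, rdom p u -> rop p x u = rop q x u.

(* A unital *-homomorphism into L^+(rdom p). *)
Definition star_rep (p : oprep) : Prop :=
  [/\ subspace (rdom p) /\ dense (rdom p),
      forall x, Lplus_adjoint (rdom p) (rop p x) (rop p (ustar x)),
      forall (c : R[i]) x y u, rdom p u ->
        rop p (c *: x + y) u = c *: rop p x u + rop p y u,
      forall x y u, rdom p u -> rop p (x * y) u = rop p x (rop p y u) &
      forall u, rdom p u -> rop p 1 u = u].

Definition op_graph (D : set H) (T : H -> H) : set (H * H) :=
  [set uv | D uv.1 /\ uv.2 = T uv.1].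

(* The graph of the operator closure is the closure of the graph in H * H. *)
Definition rep_closure (p : oprep) : oprep :=
  OpRep
    [set u | forall x, exists v, closure (op_graph (rdom p) (rop p x)) (u, v)]
    (fun x u => xget 0 [set v | closure (op_graph (rdom p) (rop p x)) (u, v)]).

(* Only the values of rho at test functions are relevant. *)
Definition star_rep_tf (mu : {measure set (borel G) -> \bar R}) (m : G -> R)
    (rho : (G -> R[i]) -> H -> H) : Prop :=
  [/\ forall a, test_function a -> linear_on setT (rho a),
      forall (c : R[i]) a b, test_function a -> test_function b ->
        forall u, rho (fun g => c * a g + b g) u = c *: rho a u + rho b u,
      forall a b, test_function a -> test_function b ->
        forall u, rho (conv mu a b) u = rho a (rho b u) &
      forall a, test_function a -> adjoint_on setT (rho a) (rho (tf_star m a))].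

(* This says that every rho a is bounded, with operator norm at most
   C * L1norm mu a. *)
Definition continuous_tf (mu : {measure set (borel G) -> \bar R})
    (rho : (G -> R[i]) -> H -> H) : Prop :=
  exists C : R, forall a, test_function a ->
    forall u, `|rho a u| <= (C * L1norm mu a)%:C * `|u|.

Definition range_span (rho : (G -> R[i]) -> H -> H) : set H :=
  linear_span [set v | exists a u, test_function a /\ v = rho a u].

Definition nondegenerate_tf (rho : (G -> R[i]) -> H -> H) : Prop :=
  dense (range_span rho).

Definition is_rho_tilde (rho : (G -> R[i]) -> H -> H) (p : oprep) : Prop :=
  [/\ star_rep p, rdom p = range_span rho &
      forall x b u, test_function b -> rop p x (rho b u) = rho (env_act x b) u].

(* The unique such representation; the default value is never reached for
   nondegenerate continuous rho. *)
Definition rho_tilde (rho : (G -> R[i]) -> H -> H) : oprep :=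
  xget (OpRep set0 (fun _ u => u)) [set p | is_rho_tilde rho p].

Definition rho_prime (rho : (G -> R[i]) -> H -> H) : oprep :=
  rep_closure (rho_tilde rho).

Definition unitary (T : H -> H) : Prop :=
  [/\ linear_on setT T, (forall u v, dot (T u) (T v) = dot u v) &
      forall v, exists u, T u = v].

Definition unitary_rep (U : G -> H -> H) : Prop :=
  [/\ forall g, unitary (U g),
      forall g h u, U (g * h)%g u = U g (U h u) &
      forall u, continuous (fun g => U g u)].

Definition smooth_vectors (U : G -> H -> H) : set H :=
  [set u | smooth_map (fun r : R => r%:C) (fun g => U g u)].

Definition is_dU (U : G -> H -> H) (p : oprep) : Prop :=
  [/\ star_rep p, rdom p = smooth_vectors U &
      forall (x : lieAlg G) u, smooth_vectors U u ->
        is_deriv0 (fun t : R => U (lexp (t *: x)) u) (rop p (lie_gen x) u)].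

Definition dU (U : G -> H -> H) : oprep :=
  xget (OpRep set0 (fun _ u => u)) [set p | is_dU U p].

End StarRepresentations.

(* Main.v *)
Require Import Defs.
From HB Require Import structures.
From mathcomp Require Import all_boot all_order all_algebra.
From mathcomp Require Import all_classical all_reals all_analysis.
From mathcomp Require Import complex measurable_realfun ring lra.
Set Implicit Arguments.
Unset Strict Implicit.
Unset Printing Implicit Defensive.
Import Order.TTheory GRing.Theory Num.Theory numFieldNormedType.Exports.

Local Open Scope classical_set_scope.
Local Open Scope complex_scope.
Local Open Scope ring_scope.

(* Left translation of a test function is differentiated under the integral:
   every x in the Lie algebra is the derivative along a tangent vector at 1
   (Hadamard's lemma), so that x |> b is the derivative at 1, along x, of
   g |-> L_g b, where (L_g b)(h) = b(g^-1 h).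

   Given rho, the maps rho(b) u |-> rho(L_g b) u are isometric because
   (L_g a)^+ * b = a^+ * L_(g^-1) b.  They extend to a unitary representation U
   with <rho(a) u, v> = \int a(g) <U(g) u, v> dg, as one sees by approximating
   a * b by Riemann sums of left translates of b.  Given U, this formula
   defines rho.

   In both cases rho~ is the restriction of dU to the span of the range of rho.
   If u is in the domain of the closure, then g |-> U(g) u has weak
   derivatives of all orders that are again of the form U(g) v; testing the
   mean value inequality on smooth vectors shows that it is C^oo.  Conversely,
   if u is smooth and a tends to the Dirac mass at 1, then rho(a) u tends to u
   and dU(x) rho(a) u to dU(x) u, because
   <dU(x) rho(a) u, v> = \int a(g) <dU(x) U(g) u, v> dg for smooth v, and
   g |-> dU(x) U(g) u is continuous. *)

(** Several objects of the statement are picked by a choice operator: [lexp], [vtilde], [dU],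
    [rho_tilde]. They mean nothing until existence and uniqueness are proved, which is why
    differential equations and Hadamard's lemma take up so much space. Smoothness is phrased by
    iterated directional derivatives, so linearity in the direction and the chain rule have to be
    derived; both come from the mean value inequality and a finite basis. The group may fail to be
    second countable, hence Haar measure may fail to be sigma-finite, and Fubini's theorem for
    product measures is out of reach. The integrals that matter are those of continuous functions
    with compact support, and one device serves for interchanging them, for vector-valued integrals
    and for passing [rho] under a convolution integral: an equicontinuous family, however large, has
    common Riemann sums. The modular function enters through right translation and inversion of Haar
    measure, which is what makes the involution of test functions compatible with adjoints. *)

Section Realify.
Context {R : realType}.

Lemma RRe_real_ge0 (W : normedModType R[i]) (w : W) : `|w| = (complex.Re `|w|)%:C.
Proof. by apply/esym/RRe_real/normr_real. Qed.

(** The underlying real normed space of a complex one, as an alias, so that real differential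
    calculus applies to maps into [H] and [R[i]]. The uniform structure is copied, hence convergence
    has literally the same meaning on both sides. *)
Definition realify (W : normedModType R[i]) : Type := W.

Section Inst.
Variable W : normedModType R[i].
HB.instance Definition _ := GRing.Zmodule.copy (realify W) W.
HB.instance Definition _ := PointedUniform.copy (realify W) W.

Let rball (x : realify W) (e : R) (y : realify W) : Prop := ball (x : W) e%:C y.
Let rball_center (x : realify W) (e : R) : 0 < e -> rball x e x.
Proof. by move=> e0; apply: ballxx; rewrite ltcR. Qed.
Let rball_sym (x y : realify W) (e : R) : rball x e y -> rball y e x.
Proof. exact: ball_sym. Qed.
Let rball_triangle (x y z : realify W) (e1 e2 : R) :
  rball x e1 y -> rball y e2 z -> rball x (e1 + e2) z.
Proof. by rewrite /rball rmorphD; exact: ball_triangle. Qed.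
Let rentourageE : entourage = entourage_ rball.
Proof.
rewrite (@entourageE_subproof _ W); apply/seteqP; split=> A [e /= e0 eA].
  (* A positive complex number is real, so its real part is the radius sought. *)
  exists (complex.Re e); last first.
    move=> p pe; apply: eA; move: pe; rewrite /= /rball RRe_real //.
    by rewrite realE ltW.
  by move: e0 => /=; case: e {eA} => a b; rewrite ltcE /= => /andP[].
by exists e%:C => //=; rewrite ltcR.
Qed.
HB.instance Definition _ := @Uniform_isPseudoMetric.Build R (realify W)
  rball rball_center rball_sym rball_triangle rentourageE.

Let rscale (r : R) (x : realify W) : realify W := (r%:C *: (x : W)).
Let rscaleA a b u : rscale a (rscale b u) = rscale (a * b) u.
Proof. by rewrite /rscale scalerA rmorphM. Qed.
Let rscale1 : left_id 1%R rscale.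
Proof. by move=> u; rewrite /rscale rmorph1 scale1r. Qed.
Let rscaleDr : right_distributive rscale +%R.
Proof. by move=> a u v; rewrite /rscale scalerDr. Qed.
Let rscaleDl u : {morph rscale^~ u : a b / (a + b)%R}.
Proof. by move=> a b; rewrite /rscale rmorphD scalerDl. Qed.
HB.instance Definition _ := GRing.Zmodule_isLmodule.Build R (realify W)
  rscaleA rscale1 rscaleDr rscaleDl.

Let rnorm (x : realify W) : R := complex.Re `|x : W|.
Let rnormC x : (rnorm x)%:C = `|x : W|.
Proof. exact/esym/RRe_real_ge0. Qed.
Let rnormD (x y : realify W) : rnorm (x + y) <= rnorm x + rnorm y.
Proof. rewrite -lecR rmorphD /= !rnormC. exact: (@ler_normD _ W x y). Qed.
Let rnorm0 (x : realify W) : rnorm x = 0 -> x = 0.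
Proof. by move=> h; apply/normr0_eq0; rewrite -rnormC h. Qed.
Let rnormMn (x : realify W) k : rnorm (x *+ k) = rnorm x *+ k.
Proof. by apply: complexI; rewrite rnormC rmorphMn /= rnormC; exact: (@normrMn _ W x k). Qed.
Let rnormN (x : realify W) : rnorm (- x) = rnorm x.
Proof. by congr complex.Re; exact: (@normrN _ W x). Qed.
HB.instance Definition _ := Num.Zmodule_isNormed.Build R (realify W)
  rnormD rnorm0 rnormMn rnormN.
Let rball_norm : @ball R (realify W) = ball_ (fun x => `|x|).
Proof.
apply/funext => x; apply/funext => e; apply/funext => y; apply/propext.
change (ball (x : W) e%:C y <-> rnorm (x - y) < e).
by rewrite -ball_normE /= -ltcR rnormC.
Qed.
HB.instance Definition _ := NormedZmod_PseudoMetric_eq.Build R (realify W) rball_norm.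
Let rnormZ (l : R) (x : realify W) : `| l *: x | = `| l | * `| x |.
Proof.
apply: complexI; change ((rnorm (l *: x))%:C = (`|l| * rnorm x)%:C).
rewrite rnormC rmorphM /= rnormC normrZ; congr (_ * _).
by rewrite normc_def /= expr0n addr0 sqrtr_sqr.
Qed.
HB.instance Definition _ :=
  PseudoMetricNormedZmod_Lmodule_isNormedModule.Build R (realify W) rnormZ.

Lemma rify_normE (x : realify W) : `|x|%:C = `|x : W|.
Proof. exact: rnormC. Qed.
Lemma rify_scaleE (r : R) (x : realify W) : r *: x = r%:C *: (x : W).
Proof. by []. Qed.
End Inst.

Lemma Ck_realify (V : normedModType R) (W : normedModType R[i]) k (O : set V) (f : V -> W) :
  Ck (fun r : R => r%:C) k O f = Ck idfun k O (f : V -> realify W).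
Proof.
elim: k f => [|k IH] f //=; congr (_ /\ _).
Qed.
End Realify.

(** * Smooth maps between real normed spaces *)

Section Calculus.
Context {R : realType}.
Implicit Types V W : normedModType R.

Lemma cvg_eq1 (T : Type) (U : nbhsType) (F : set_system T) (f g : T -> U) (l : U) :
  f =1 g -> f x @[x --> F] --> l -> g x @[x --> F] --> l.
Proof. by move=> /funext ->. Qed.

Lemma cvg_cont (T : Type) (U U' : nbhsType) (F : set_system T) (f : T -> U)
    (L : U -> U') (l : U) :
  f x @[x --> F] --> l -> {for l, continuous L} -> L (f x) @[x --> F] --> L l.
Proof. by move=> fl Ll A /Ll /fl. Qed.

Lemma cvg_nbhs (T : Type) (U : nbhsType) (F : set_system T) (f : T -> U)
    (l : U) (P : set U) :
  f x @[x --> F] --> l -> nbhs l P -> \forall x \near F, P (f x).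
Proof. by move=> h lP; exact: h lP. Qed.

Lemma cvg_pairN V W (T : Type) (F : set_system T) (f : T -> V) (g : T -> W)
    (a : V) (b : W) : Filter F -> f x @[x --> F] --> a -> g x @[x --> F] --> b ->
  (f x, g x) @[x --> F] --> ((a, b) : (V * W)%type).
Proof. by move=> FF fa gb; exact: cvg_pair. Qed.

Lemma dnbhs0P (P : R -> Prop) :
  (\forall t \near (0 : R)^', P t) <->
  exists2 d : R, 0 < d & forall t, t != 0 -> `|t| < d -> P t.
Proof.
split.
  move=> /nbhs_ballP[d /= d0 dP]; exists d => // t t0 td.
  by apply: dP => //; rewrite -ball_normE /= sub0r normrN.
move=> [d d0 dP]; apply/nbhs_ballP; exists d => //= t.
by rewrite -ball_normE /= sub0r normrN => td t0; exact: dP.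
Qed.

Lemma nbhs0P (P : R -> Prop) :
  (\forall t \near (0 : R), P t) <->
  exists2 d : R, 0 < d & forall t, `|t| < d -> P t.
Proof.
split.
  move=> /nbhs_ballP[d /= d0 dP]; exists d => // t td.
  by apply: dP => //; rewrite -ball_normE /= sub0r normrN.
move=> [d d0 dP]; apply/nbhs_ballP; exists d => //= t.
by rewrite -ball_normE /= sub0r normrN => td; exact: dP.
Qed.

Notation dirder := (is_dirder (idfun : R -> R)).

Lemma dirderP V W (f : V -> W) x v l : dirder f x v l <->
  forall e : R, 0 < e -> exists2 d : R, 0 < d & forall t : R, `|t| < d ->
    `|f (x + t *: v) - f x - t *: l| <= e * `|t|.
Proof.
split.
  move=> /cvgrPdist_le H e e0; have /dnbhs0P[d d0 dP] := H e e0.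
  exists d => // t td; have [->|t0] := eqVneq t 0.
    by rewrite !scale0r addr0 !subrr !normr0 mulr0.
  rewrite mulrC -ler_pdivrMl ?normr_gt0// -normfV -normrZ.
  rewrite scalerBr scalerA mulVf// scale1r distrC.
  exact: dP.
move=> H; apply/cvgrPdist_le => e e0; have [d d0 dP] := H e e0.
apply/dnbhs0P; exists d => // t t0 td; have := dP t td.
rewrite mulrC -ler_pdivrMl ?normr_gt0// -normfV -normrZ.
by rewrite scalerBr scalerA mulVf// scale1r distrC.
Qed.

Lemma dirder_unique V W (f : V -> W) x v l l' :
  dirder f x v l -> dirder f x v l' -> l = l'.
Proof. by move=> h h'; exact: (cvg_unique (@norm_hausdorff _ _) h h'). Qed.

Lemma dirder_near V W (f g : V -> W) x v l :
  (\forall y \near x, f y = g y) -> dirder f x v l -> dirder g x v l.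
Proof.
move=> fg; apply: cvg_trans; apply: near_eq_cvg.
have fgx : f x = g x by exact: nbhs_singleton fg.
have : \forall t \near (0 : R)^', f (x + t *: v) = g (x + t *: v).
  have xt : x + t *: v @[t --> (0 : R)^'] --> x.
    rewrite -[X in _ --> X]addr0 -(scale0r v).
    apply: cvgD; first exact: cvg_cst.
    by apply: cvgZr_tmp; exact: cvg_within.
  exact: xt fg.
by apply: filterS => t e; rewrite e fgx.
Qed.

Lemma dirderZ V W (f : V -> W) x v l (a : R) :
  dirder f x v l -> dirder f x (a *: v) (a *: l).
Proof.
move=> /dirderP H; apply/dirderP => e e0.
(* [|a| + 1] replaces [|a|] so that [a = 0] is no special case. *)
have a1 : 0 < `|a| + 1 by rewrite ltr_wpDl.
have [d d0 dP] := H (e / (`|a| + 1)) (divr_gt0 e0 a1).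
exists (d / (`|a| + 1)); first exact: divr_gt0.
move=> t td; rewrite !scalerA; apply: (le_trans (dP _ _)).
  rewrite normrM; apply: (@le_lt_trans _ _ (`|t| * (`|a| + 1))).
    by rewrite ler_wpM2l// lerDl.
  by rewrite -ltr_pdivlMr.
rewrite normrM mulrAC ler_pdivrMr// -!mulrA ler_wpM2l ?(ltW e0)//.
by rewrite ler_wpM2l// lerDl.
Qed.

Lemma dirder_cont_line V W (f : V -> W) x v l : dirder f x v l ->
  f (x + t *: v) @[t --> (0 : R)] --> f x.
Proof.
move=> /dirderP /(_ 1 ltr01) [d d0 dP].
have l1 : 0 < `|l| + 1 by rewrite ltr_wpDl.
apply/cvgrPdist_le => e e0; apply/nbhs0P.
exists (Num.min d (e / (`|l| + 1))); first by rewrite lt_min d0 divr_gt0.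
move=> t; rewrite lt_min => /andP[td te].
rewrite distrC (@le_trans _ _ (`|t| * (`|l| + 1)))//; last first.
  by rewrite -ler_pdivlMr// ltW.
have := dP t td; rewrite mul1r mulrDr mulr1 => h.
rewrite -[X in `|X|](subrK (t *: l)) (le_trans (ler_normD _ _))// addrC.
by rewrite lerD// normrZ.
Qed.

Lemma dirder_cont_R W (f : R -> W) (s : R) l :
  dirder (f : R^o -> W) s (1 : R^o) l -> {for s, continuous f}.
Proof.
move/dirder_cont_line => dl.
have us : u - s @[u --> s] --> (0 : R).
  rewrite -[X in _ --> X](subrr s).
  by apply: cvgB; [exact: cvg_id|exact: cvg_cst].
move=> A fA; apply: (@filterS _ (nbhs s) _ _ _ _ (us _ (dl A fA))) => u /=.
by rewrite /GRing.scale /= mulr1 addrC subrK.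
Qed.

(* The set of times where the bound with slope [M + e] holds contains its
   supremum, and cannot stop before 1. *)
Lemma mean_value_ineq W (f : R -> W) (M : R) :
  (forall s : R, 0 <= s <= 1 -> exists2 l, dirder (f : R^o -> W) s (1 : R^o) l & `|l| <= M) ->
  `|f 1 - f 0| <= M.
Proof.
move=> H; apply/ler_addgt0Pr => e e0.
pose phi (t : R) : R := `|f t - f 0| - (M + e) * t.
rewrite leNgt; apply/negP => f1.
have phic s : 0 <= s <= 1 -> {for s, continuous phi}.
  move=> s01; have [l dl _] := H s s01.
  have fc : {for s, continuous f} by exact: dirder_cont_R dl.
  apply: (@continuousB _ _ _ (fun t => `|f t - f 0|) (fun t => (M + e) * t)).
    apply: cvg_norm; apply: (@continuousB _ _ _ f (fun=> f 0)) => //.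
    exact: cst_continuous.
  by apply: (@continuousM _ _ (fun=> M + e) id); [exact: cst_continuous|exact: cvg_id].
pose S := [set t : R | 0 <= t <= 1 /\ phi t <= 0].
have S0 : S 0 by split; rewrite ?lexx ?ler01// /phi subrr normr0 mulr0 subr0.
have supS : has_sup S.
  by split; [exists 0 | exists 1 => t [/andP[_ ]]].
set c := sup S.
have c0 : 0 <= c by exact: ub_le_sup supS.2 _ S0.
have c1 : c <= 1 by apply: ge_sup; [exists 0|move=> t [/andP[]]].
have c01 : 0 <= c <= 1 by rewrite c0.
have phic0 : phi c <= 0.
  rewrite leNgt; apply/negP => pc.
  have : \forall t \near c, 0 < phi t by exact: (cvgr_gt (phi c) (phic c c01)).
  move=> /nbhs_ballP[d /= d0 dP].
  have [t St ct] := sup_adherent d0 supS.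
  have tc : t <= c by exact: ub_le_sup supS.2 _ St.
  have : 0 < phi t.
    by apply: dP; rewrite -ball_normE /= ger0_norm ?subr_ge0// ltrBlDr -ltrBlDl.
  by rewrite ltNge St.2.
have cn1 : c < 1.
  rewrite lt_neqAle c1 andbT; apply/eqP => cE; move: phic0 f1.
  by rewrite cE /phi mulr1 subr_le0 leNgt => /negbTE ->.
have [l /dirderP dl lM] := H c c01.
have [d d0 dP] := dl e e0.
(* The step stays strictly inside the radius [d] of the derivative estimate and does not pass 1. *)
pose h := Num.min (d / 2) (1 - c).
have h0 : 0 < h by rewrite lt_min subr_gt0 cn1 andbT divr_gt0.
have hd : `|h| < d.
  rewrite gtr0_norm// /h gt_min; apply/orP; left.
  by rewrite ltr_pdivrMr// ltr_pMr// ltr1n.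
have hc : h <= 1 - c by rewrite /h ge_min lexx orbT.
have : S (c + h).
  split; first by rewrite addr_ge0 ?(ltW h0)//= -lerBrDl.
  have := dP h hd; rewrite /GRing.scale /= mulr1 (gtr0_norm h0) => fh.
  move: phic0; rewrite /phi !subr_le0 => phic0.
  have -> : f (c + h) - f 0 = (f (c + h) - f c - h *: l) + h *: l + (f c - f 0).
    by rewrite subrK addrA subrK.
  rewrite (le_trans (ler_normD _ _))// mulrDr addrC lerD//.
  rewrite (le_trans (ler_normD _ _))// mulrDl addrC lerD// normrZ gtr0_norm//.
  by rewrite mulrC ler_wpM2r// ltW.
move=> /(ub_le_sup supS.2); rewrite -/c => ch.
by move: h0; rewrite ltNge; apply/negP; rewrite negbK -(lerD2l c) addr0.
Unshelve. all: by end_near. Qed.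

(** The mean value inequality for [f] minus the linear term [s *: L]. With a candidate derivative as
    [L], continuity of the derivative at one point becomes a bound on the remainder. *)
Lemma mean_value_seg V W (f : V -> W) (p v : V) (L : W) (M : R) :
  (forall s : R, 0 <= s <= 1 ->
    exists2 l, dirder f (p + s *: v) v l & `|l - L| <= M) ->
  `|f (p + v) - f p - L| <= M.
Proof.
move=> H; pose F (s : R) := f (p + s *: v) - s *: L.
have -> : f (p + v) - f p - L = F 1 - F 0.
  by rewrite /F !scale1r !scale0r addr0 subr0 addrAC.
apply: mean_value_ineq => s s01; have [l /dirderP dl lL] := H s s01.
exists (l - L) => //; apply/dirderP => e e0; have [d d0 dP] := dl e e0.
exists d => // t td; rewrite (le_trans _ (dP t td))//.
have -> : t *: (1 : R^o) = t by rewrite /GRing.scale /= mulr1.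
rewrite le_eqVlt; apply/orP; left; apply/eqP; congr `|_|.
rewrite /F scalerBr !scalerDl !opprD !opprK !addrA.
by rewrite [LHS](AC 7 ((1*4*6)*(2*5)*(3*7)))/= !addNr !addr0.
Qed.

(** Strict differentiability along [b]: since the derivative [g] is continuous at [x], the base
    point [p t] may move while the difference quotient is taken. This is one coordinate's share of
    the chain rule. *)
Lemma dirder_step V W (F g : V -> W) (x b : V) (p : R -> V) (a : R -> R) (al : R) :
  (\forall y \near x, dirder F y b (g y)) -> {for x, continuous g} ->
  p t @[t --> (0 : R)^'] --> x -> t^-1 * a t @[t --> (0 : R)^'] --> al ->
  t^-1 *: (F (p t + a t *: b) - F (p t)) @[t --> (0 : R)^'] --> al *: g x.
Proof.
move=> Fg gc px ata.
have a0 : a t @[t --> (0 : R)^'] --> (0 : R).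
  have : t * (t^-1 * a t) @[t --> (0 : R)^'] --> 0 * al.
    by apply: cvgM => //; exact: cvg_within.
  rewrite mul0r; apply: cvg_trans; apply: near_eq_cvg.
  by apply/dnbhs0P; exists 1 => // t t0 _; rewrite mulrA mulfV// mul1r.
suff : t^-1 *: (F (p t + a t *: b) - F (p t)) - (t^-1 * a t) *: g x
    @[t --> (0 : R)^'] --> (0 : W).
  move=> h; rewrite -[al *: _]add0r.
  apply: cvg_eq1 (cvgD h (cvgZr_tmp (a := g x) ata)) => t /=.
  by rewrite subrK.
apply/cvgr0Pnorm_le => e e0.
have al1 : 0 < `|al| + 1 by rewrite ltr_wpDl.
(* [|al| + 1] bounds the factor [t^-1 * a t] near 0, by which the error will be multiplied. *)
pose e' := e / (`|al| + 1); have e'0 : 0 < e' by exact: divr_gt0.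
have gd : \forall y \near x, dirder F y b (g y) /\ `|g y - g x| <= e'.
  apply: filterI => //; move/cvgrPdist_le : gc => /(_ e' e'0).
  by apply: filterS => y; rewrite distrC.
have [d /= d0 dP] := (iffLR (@nbhs_ballP _ _ _ _)) gd.
have bb : 0 < `|b| + 1 by rewrite ltr_wpDl.
near=> t.
have pd : `|x - p t| < d / 2.
  by near: t; apply: cvgr_dist_lt => //; exact: divr_gt0.
have ad : `|a t| < d / 2 / (`|b| + 1).
  by near: t; apply: cvgr0_norm_lt => //; rewrite !divr_gt0.
have aal : `|t^-1 * a t| <= `|al| + 1.
  near: t; apply: (cvgr_le _ (cvg_norm ata)); by rewrite ltrDl.
have key : `|F (p t + a t *: b) - F (p t) - a t *: g x| <= `|a t| * e'.
  apply: mean_value_seg => s /andP[s0 s1].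
  have [Fy gy] : dirder F (p t + s *: (a t *: b)) b (g (p t + s *: (a t *: b))) /\
      `|g (p t + s *: (a t *: b)) - g x| <= e'.
    apply: dP; rewrite -ball_normE /= opprD addrA (le_lt_trans (ler_normB _ _))//.
    rewrite [ltRHS](splitr d) ltr_leD// scalerA normrZ normrM (ger0_norm s0).
    rewrite -mulrA (le_trans (_ : _ <= `|a t| * `|b|))//.
      by rewrite ler_piMl// mulr_ge0.
    move: ad; rewrite ltr_pdivlMr// => ad.
    by rewrite (le_trans _ (ltW ad))// ler_wpM2l// lerDl.
  exists (a t *: g (p t + s *: (a t *: b))); first exact: dirderZ.
  by rewrite -scalerBr normrZ ler_wpM2l.
have -> : t^-1 *: (F (p t + a t *: b) - F (p t)) - (t^-1 * a t) *: g x =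
    t^-1 *: (F (p t + a t *: b) - F (p t) - a t *: g x).
  by rewrite [RHS]scalerBr scalerA.
rewrite normrZ (le_trans (ler_wpM2l _ key))// mulrA -normrM.
by rewrite (le_trans (ler_wpM2r (ltW e'0) aal))// /e' mulrC divfK// gt_eqF.
Unshelve. all: by end_near. Qed.

End Calculus.

(** * Maps of class C^k: chain rule and closure properties *)

Section CkAlgebra.
Context {R : realType}.
Implicit Types V W : normedModType R.
Notation dirder := (is_dirder (idfun : R -> R)).
Notation Ckr := (Ck (idfun : R -> R)).

Lemma cvg_bigsum V (T I : Type) (F : set_system T) (r : seq I) (P : pred I)
    (f : I -> T -> V) (l : I -> V) : Filter F ->
  (forall i, f i x @[x --> F] --> l i) ->
  \sum_(i <- r | P i) f i x @[x --> F] --> \sum_(i <- r | P i) l i.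
Proof.
move=> FF fl; elim: r => [|i r IH].
  by rewrite big_nil; apply: cvg_eq1 (cvg_cst 0) => t; rewrite big_nil.
rewrite big_cons; case: ifP => Pi.
  by apply: cvg_eq1 (cvgD (fl i) IH) => t; rewrite big_cons Pi.
by apply: cvg_eq1 IH => t; rewrite big_cons Pi.
Qed.

(** Finite dimension is given by explicit continuous linear coordinates: the chain rule sums over
    them, and they pass to products of spaces. *)
Definition fbasis V d (b : 'I_d -> V) (co : 'I_d -> V -> R) : Prop :=
  [/\ forall v, v = \sum_(i < d) co i v *: b i,
      forall i, continuous (co i : V -> R^o) &
      forall i (r : R) u v, co i (r *: u + v) = r * co i u + co i v].

Definition fdim V : Prop := exists d b co, @fbasis V d b co.

(* Coordinates are changed one at a time along the curve. *)
Lemma dirder_curve V W d (b : 'I_d -> V) co (F : V -> W) (g : 'I_d -> V -> W)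
    (x : V) (de : R -> V) (w : V) :
  fbasis b co ->
  (forall i, \forall y \near x, dirder F y (b i) (g i y)) ->
  (forall i, {for x, continuous (g i)}) ->
  t^-1 *: (de t - x) @[t --> (0 : R)^'] --> w ->
  t^-1 *: (F (de t) - F x) @[t --> (0 : R)^'] --> \sum_(i < d) co i w *: g i x.
Proof.
move=> [bE coc col] Fg gc dw.
have coZ i (r : R) u : co i (r *: u) = r * co i u.
  have co0 : co i 0 = 0.
    by have := col i 1 0 0; rewrite scaler0 addr0 mul1r -[LHS]addr0 => /addrI.
  by have := col i r u 0; rewrite co0 !addr0.
have co0 i : co i 0 = 0 by have := coZ i 0 0; rewrite scale0r mul0r.
have dx : de t - x @[t --> (0 : R)^'] --> (0 : V).
  have : t *: (t^-1 *: (de t - x)) @[t --> (0 : R)^'] --> (0 : R) *: w.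
    by apply: cvgZ => //; exact: cvg_within.
  rewrite scale0r; apply: cvg_trans; apply: near_eq_cvg.
  by apply/dnbhs0P; exists 1 => // t t0 _; rewrite scalerA mulfV// scale1r.
pose a i t := co i (de t - x).
have a0 i : a i t @[t --> (0 : R)^'] --> (0 : R).
  by have := cvg_comp _ (co i : V -> R^o) dx (coc i 0); rewrite co0.
pose p (k : nat) t := x + \sum_(i < d | (i < k)%N) a i t *: b i.
have px k : p k t @[t --> (0 : R)^'] --> x.
  rewrite -[X in _ --> X]addr0; apply: cvgD; first exact: cvg_cst.
  have s0 : \sum_(i < d | (i < k)%N) (0 : R) *: b i = 0.
    by rewrite big1// => i _; rewrite scale0r.
  by rewrite -[X in _ --> X]s0; apply: cvg_bigsum => i; apply: cvgZr_tmp.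
have key k : (k <= d)%N ->
    t^-1 *: (F (p k t) - F x) @[t --> (0 : R)^'] -->
    \sum_(i < d | (i < k)%N) co i w *: g i x.
  elim: k => [_|k IH kd].
    rewrite big_pred0//; apply: cvg_eq1 (cvg_cst 0) => t.
    by rewrite /p big_pred0// addr0 subrr scaler0.
  pose j : 'I_d := Ordinal kd.
  have jk (i : 'I_d) : ((i < k.+1) && (i != j))%N = (i < k)%N.
    by rewrite ltnS leq_eqVlt -val_eqE /=; case: ltngtP.
  rewrite (bigD1 j) ?ltnS//= (eq_bigl _ _ jk) addrC.
  have st := @dirder_step R V W F (g j) x (b j) (p k) (a j) (co j w)
    (Fg j) (gc j) (px k).
  have : t^-1 * a j t @[t --> (0 : R)^'] --> co j w.
    apply: (@cvg_eq1 _ _ _ (fun t => co j (t^-1 *: (de t - x)))).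
      by move=> t; rewrite /a coZ.
    exact: (cvg_comp _ (co j : V -> R^o) dw (coc j w)).
  move=> /st{}st; apply: cvg_eq1 (cvgD (IH (ltnW kd)) st) => t /=.
  have pS : p k.+1 t = p k t + a j t *: b j.
    by rewrite /p (bigD1 j) ?ltnS//= (eq_bigl _ _ jk) [a j t *: _ + _]addrC addrA.
  by rewrite -scalerDr pS addrC addrA subrK.
have := key d (leqnn d).
rewrite (eq_bigl xpredT); last by move=> i; rewrite ltn_ord.
apply: cvg_eq1 => t; congr (_ *: (F _ - _)).
rewrite /p (eq_bigl xpredT); last by move=> i; rewrite ltn_ord.
by rewrite -bE addrC subrK.
Qed.

Lemma Ck_cont V W k (O : set V) (f : V -> W) x :
  Ckr k O f -> O x -> {for x, continuous f}.
Proof. by case: k => [|k] [fc _]; exact: fc. Qed.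

Lemma Ck_sub V W k (O O' : set V) (f : V -> W) :
  O' `<=` O -> Ckr k O f -> Ckr k O' f.
Proof.
move=> OO'; elim: k f => [|k IH] f [fc fD]; split=> //.
- by move=> x /OO'; exact: fc.
- by move=> x /OO'; exact: fc.
move=> v; have [g [gD gC]] := fD v; exists g; split; last exact: IH.
by move=> x /OO'; exact: gD.
Qed.

Lemma Ck_eq V W k (O : set V) (f g : V -> W) : open O ->
  (forall x, O x -> f x = g x) -> Ckr k O f -> Ckr k O g.
Proof.
move=> oO fg; have fgn x : O x -> \forall y \near x, f y = g y.
  by move=> Ox; have := open_nbhs_nbhs (conj oO Ox); apply: filterS => y /fg.
have gc x : O x -> {for x, continuous f} -> {for x, continuous g}.
  by move=> Ox; rewrite /prop_for /continuous_at (fg x Ox); apply: cvg_trans;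
    apply: near_eq_cvg; exact: fgn.
case: k => [|k] [fc fD]; split=> //.
- by move=> x Ox; apply: gc => //; exact: fc.
- by move=> x Ox; apply: gc => //; exact: fc.
move=> v; have [h [hD hC]] := fD v; exists h; split=> // x Ox.
by apply: dirder_near (hD x Ox); exact: fgn.
Qed.

Definition dd V W (f : V -> W) (v x : V) : W := xget 0 [set l | dirder f x v l].

Lemma ddE V W (f : V -> W) v x l : dirder f x v l -> dd f v x = l.
Proof.
move=> h; rewrite /dd; case: xgetP => [y _ /= hy|/(_ l)]; last by case.
exact: dirder_unique hy h.
Qed.

(** Limits are unique, so the derivative quantified existentially in [Ck] may be taken to be
    [dd f v]. Openness of [O] ensures that modifying a function outside [O] does not change its
    difference quotients near points of [O]. *)
Lemma CkS V W k (O : set V) (f : V -> W) : open O ->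
  Ckr k.+1 O f <-> (forall x, O x -> {for x, continuous f}) /\
    forall v, (forall x, O x -> dirder f x v (dd f v x)) /\ Ckr k O (dd f v).
Proof.
move=> oO; split=> -[fc fD]; split=> // v.
  have [g [gD gC]] := fD v.
  have E x : O x -> dd f v x = g x by move=> Ox; apply: ddE; exact: gD.
  split; first by move=> x Ox; rewrite E//; exact: gD.
  by apply: Ck_eq gC => // x /E.
by exists (dd f v); exact: fD.
Qed.

(** No gluing of local derivatives is required: each of them agrees with the globally defined
    [dd f v]. *)
Lemma Ck_loc V W k (O : set V) (f : V -> W) : open O ->
  (forall x, O x -> exists O', [/\ open O', O' x & Ckr k O' f]) -> Ckr k O f.
Proof.
move=> oO; elim: k f => [|k IH] f H.
  by split=> // x Ox; have [Q [oQ Qx [fc _]]] := H x Ox; exact: fc.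
apply/CkS => //; split.
  by move=> x Ox; have [Q [oQ Qx [fc _]]] := H x Ox; exact: fc.
move=> v; split.
  move=> x Ox; have [Q [oQ Qx /(CkS _ _ oQ)[_ /(_ v)[h _]]]] := H x Ox.
  exact: h.
apply: IH => x Ox; have [Q [oQ Qx /(CkS _ _ oQ)[_ /(_ v)[_ h]]]] := H x Ox.
by exists Q.
Qed.

Lemma Ck_cst V W k (O : set V) (w : W) : Ckr k O (fun=> w).
Proof.
elim: k w => [|k IH] w /=; split=> //.
- by move=> x _; exact: cst_continuous.
- by move=> x _; exact: cst_continuous.
move=> v; exists (fun=> 0); split=> // x _.
by apply: cvg_eq1 (cvg_cst 0) => t; rewrite subrr scaler0.
Qed.

Lemma Ck_sum V W k (O : set V) (I : Type) (r : seq I) (P : pred I) (f : I -> V -> W) :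
  (forall i, Ckr k O (f i)) -> Ckr k O (fun x => \sum_(i <- r | P i) f i x).
Proof.
move=> fC; elim: r => [|i r IH].
  rewrite (_ : (fun x => _) = (fun=> 0)); first exact: Ck_cst.
  by apply/funext => x; rewrite big_nil.
rewrite (_ : (fun x => _) = (fun x => (P i)%:R *: f i x + \sum_(i <- r | P i) f i x)).
  exact: Ck_lin.
by apply/funext => x; rewrite big_cons; case: (P i); rewrite ?scale1r// scale0r add0r.
Qed.

Lemma cvg_line V (x v : V) : x + t *: v @[t --> (0 : R)^'] --> x.
Proof.
rewrite -[X in _ --> X]addr0 -(scale0r v).
by apply: cvgD; [exact: cvg_cst|apply: cvgZr_tmp; exact: cvg_within].
Qed.

Lemma Ck_scale V W k (O : set V) (a : V -> R^o) (f : V -> W) :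
  Ckr k O a -> Ckr k O f -> Ckr k O (fun x => a x *: f x).
Proof.
elim: k a f => [|k IH] a f Ha Hf; have [ac aD] := Ha; have [fc fD] := Hf;
  (split; first by move=> x Ox; apply: (@cvgZ _ W V _ _ a f); [exact: ac|exact: fc]).
  by [].
move=> v; have [a' [a'D a'C]] := aD v; have [f' [f'D f'C]] := fD v.
exists (fun x => 1 *: (a' x *: f x) + a x *: f' x); split; last first.
  by apply: Ck_lin; apply: IH => //; exact: Ck_pred.
move=> x Ox; rewrite /is_dirder scale1r.
have st : a (x + t *: v) @[t --> (0 : R)^'] --> (a x : R).
  exact: (cvg_comp _ a (@cvg_line V x v) (ac x Ox)).
have h1 : (t^-1 * (a (x + t *: v) - a x)) *: f x @[t --> (0 : R)^'] --> a' x *: f x.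
  by apply: cvgZ; [exact: a'D|exact: cvg_cst].
have h2 : a (x + t *: v) *: (t^-1 *: (f (x + t *: v) - f x)) @[t --> (0 : R)^'] -->
    a x *: f' x by apply: cvgZ => //; exact: f'D.
apply: cvg_eq1 (cvgD h1 h2) => t /=.
rewrite !scalerA [a (x + _) * _]mulrC -!scalerA -scalerDr; congr (_ *: _).
by rewrite scalerBr scalerBl addrC addrA subrK.
Qed.

Lemma Ck_linmap V W W' k (O : set V) (L : W -> W') (f : V -> W) :
  (forall (r : R) u w, L (r *: u + w) = r *: L u + L w) -> continuous L ->
  Ckr k O f -> Ckr k O (fun x => L (f x)).
Proof.
move=> Ll Lc; elim: k f => [|k IH] f [fc fD]; split=> //.
- by move=> x Ox; apply: (cvg_comp f L (fc x Ox)); exact: Lc.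
- by move=> x Ox; apply: (cvg_comp f L (fc x Ox)); exact: Lc.
move=> v; have [g [gD gC]] := fD v; exists (fun x => L (g x)); split; last exact: IH.
move=> x Ox; apply: cvg_eq1 (cvg_cont (L := L) (gD x Ox) (Lc _)) => t /=.
have L0 : L 0 = 0.
  by have := Ll 1 0 0; rewrite scaler0 addr0 scale1r -[LHS]addr0 => /addrI.
rewrite -[X in L X]addr0 Ll L0 addr0; congr (_ *: _).
by rewrite addrC -scaleN1r Ll scaleN1r addrC.
Qed.

Lemma Ck_lincont V W k (O : set V) (L : V -> W) :
  (forall (r : R) u w, L (r *: u + w) = r *: L u + L w) -> continuous L ->
  Ckr k O L.
Proof.
move=> Ll Lc; case: k => [|k]; split=> //.
- by move=> x _; exact: Lc.
- by move=> x _; exact: Lc.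
move=> v; exists (fun=> L v); split; last exact: Ck_cst.
move=> x _; have : L v @[_ --> (0 : R)^'] --> L v by exact: cvg_cst.
apply: cvg_trans; apply: near_eq_cvg; apply/dnbhs0P; exists 1 => // t t0 _.
by rewrite [x + _]addrC Ll addrK scalerA mulVf// scale1r.
Qed.

Lemma Ck_pair V W W' k (O : set V) (f : V -> W) (g : V -> W') :
  Ckr k O f -> Ckr k O g -> Ckr k O (fun x => (f x, g x) : (W * W')%type).
Proof.
move=> fC gC.
have h1 : Ckr k O (fun x => (f x, 0) : (W * W')%type).
  apply: (@Ck_linmap V W _ k O (fun w => (w, 0) : (W * W')%type)) => //.
    by move=> r u w; congr pair; rewrite /= scaler0 addr0.
  by move=> w; apply: cvg_pair; [exact: cvg_id|exact: cvg_cst].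
have h2 : Ckr k O (fun x => (0, g x) : (W * W')%type).
  apply: (@Ck_linmap V W' _ k O (fun w => (0, w) : (W * W')%type)) => //.
    by move=> r u w; congr pair; rewrite /= scaler0 addr0.
  by move=> w; apply: cvg_pair; [exact: cvg_cst|exact: cvg_id].
rewrite (_ : (fun x => _) = (fun x => 1 *: (f x, 0) + (0, g x) : (W * W')%type)).
  exact: Ck_lin.
by apply/funext => x; rewrite scale1r; congr pair; rewrite /= ?addr0 ?add0r.
Qed.

(** The derivative of the composite is the sum of the coordinates of [phi'] times the partial
    derivatives of [F] along [phi]; by induction on [k] each term has one order less than [F] and
    [phi]. *)
Lemma Ck_comp V V' W k (O : set V) (O' : set V') (F : V -> W) (phi : V' -> V) :
  fdim V -> open O -> (forall x, O' x -> O (phi x)) ->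
  Ckr k O F -> Ckr k O' phi -> Ckr k O' (fun x => F (phi x)).
Proof.
move=> [d [b [co bco]]] oO phiO; have [bE coc col] := bco.
elim: k F => [|k IH] F HF Hphi; have [Fc FD] := HF; have [pc pD] := Hphi;
  (split; first by move=> x Ox; apply: (cvg_comp phi F (pc x Ox)); apply: Fc; exact: phiO).
  by [].
move=> v; have [p' [p'D p'C]] := pD v.
have /choice[g gH] : forall i, exists g, (forall x, O x -> dirder F x (b i) (g x)) /\ Ckr k O g.
  by move=> i; exact: FD.
exists (fun x => \sum_(i < d) co i (p' x) *: g i (phi x)); split; last first.
  apply: Ck_sum => i; apply: Ck_scale; last by apply: IH; [exact: (gH i).2|exact: Ck_pred].
  exact: (@Ck_linmap V' V R^o k O' (co i) p').
move=> x Ox; have Opx := phiO x Ox.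
have := @dirder_curve V W d b co F g (phi x) (fun t => phi (x + t *: v)) (p' x) bco.
apply.
- move=> i; have := open_nbhs_nbhs (conj oO Opx); apply: filterS => y Oy.
  exact: (gH i).1.
- by move=> i; apply: Ck_cont (gH i).2 _.
- exact: p'D.
Qed.

End CkAlgebra.

Notation smo := (smooth_on idfun).

Section SmoothAlgebra.
Context {R : realType}.
Implicit Types V W : normedModType R.
Notation dirder := (is_dirder (idfun : R -> R)).
Notation Ckr := (Ck (idfun : R -> R)).

Lemma sm_lin V W (O : set V) (r : R) (f g : V -> W) :
  smo O f -> smo O g -> smo O (fun x => r *: f x + g x).
Proof. by move=> hf hg k; exact: Ck_lin. Qed.

Lemma sm_cst V W (O : set V) (w : W) : smo O (fun=> w).
Proof. by move=> k; exact: Ck_cst. Qed.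

Lemma sm_add V W (O : set V) (f g : V -> W) :
  smo O f -> smo O g -> smo O (fun x => f x + g x).
Proof.
move=> hf hg; rewrite (_ : (fun x => _) = (fun x => 1 *: f x + g x)).
  exact: sm_lin.
by apply/funext => x; rewrite scale1r.
Qed.

Lemma sm_scale V W (O : set V) (a : V -> R^o) (f : V -> W) :
  smo O a -> smo O f -> smo O (fun x => a x *: f x).
Proof. by move=> ha hf k; exact: Ck_scale. Qed.

Lemma sm_mul V (O : set V) (f g : V -> R^o) :
  smo O f -> smo O g -> smo O (fun x => f x * g x : R^o).
Proof. by move=> hf hg; exact: sm_scale. Qed.

Lemma sm_prod V (O : set V) (I : Type) (r : seq I) (P : pred I) (f : I -> V -> R^o) :
  (forall i, smo O (f i)) -> smo O (fun x => \prod_(i <- r | P i) (f i x : R) : R^o).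
Proof.
move=> hf; elim: r => [|i r IH].
  rewrite (_ : (fun x => _) = (fun=> 1 : R^o)); first exact: sm_cst.
  by apply/funext => x; rewrite big_nil.
case Pi : (P i).
  rewrite (_ : (fun x => _) = (fun x => (f i x : R) * \prod_(i <- r | P i) (f i x : R) : R^o)).
    exact: sm_mul.
  by apply/funext => x; rewrite big_cons Pi.
rewrite (_ : (fun x => _) = (fun x => \prod_(i <- r | P i) (f i x : R) : R^o))//.
by apply/funext => x; rewrite big_cons Pi.
Qed.

Lemma sm_linmap V W W' (O : set V) (L : W -> W') (f : V -> W) :
  (forall (r : R) u w, L (r *: u + w) = r *: L u + L w) -> continuous L ->
  smo O f -> smo O (fun x => L (f x)).
Proof. by move=> Ll Lc hf k; exact: Ck_linmap. Qed.

Lemma sm_lincont V W (O : set V) (L : V -> W) :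
  (forall (r : R) u w, L (r *: u + w) = r *: L u + L w) -> continuous L -> smo O L.
Proof. by move=> Ll Lc k; exact: Ck_lincont. Qed.

Lemma sm_id V (O : set V) : smo O (fun x => x).
Proof. by apply: sm_lincont => // x; exact: cvg_id. Qed.

Lemma sm_pair V W W' (O : set V) (f : V -> W) (g : V -> W') :
  smo O f -> smo O g -> smo O (fun x => (f x, g x) : (W * W')%type).
Proof. by move=> hf hg k; exact: Ck_pair. Qed.

Lemma sm_fst V W (O : set (V * W)) : smo O (fun p => p.1).
Proof. by apply: sm_lincont => // x; exact: cvg_fst. Qed.

Lemma sm_snd V W (O : set (V * W)) : smo O (fun p => p.2).
Proof. by apply: sm_lincont => // x; exact: cvg_snd. Qed.

Lemma sm_comp V V' W (O : set V) (O' : set V') (F : V -> W) (phi : V' -> V) :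
  fdim V -> open O -> (forall x, O' x -> O (phi x)) ->
  smo O F -> smo O' phi -> smo O' (fun x => F (phi x)).
Proof. by move=> fV oO h hF hp k; apply: Ck_comp => //. Qed.

Lemma sm_sub V W (O O' : set V) (f : V -> W) : O' `<=` O -> smo O f -> smo O' f.
Proof. by move=> OO' hf k; apply: Ck_sub (hf k). Qed.

Lemma sm_eq V W (O : set V) (f g : V -> W) : open O ->
  (forall x, O x -> f x = g x) -> smo O f -> smo O g.
Proof. by move=> oO fg hf k; apply: Ck_eq (hf k). Qed.

Lemma sm_loc V W (O : set V) (f : V -> W) : open O ->
  (forall x, O x -> exists Q, [/\ open Q, Q x & smo Q f]) -> smo O f.
Proof.
by move=> oO H k; apply: Ck_loc => // x /H[Q [oQ Qx hf]]; exists Q.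
Qed.

Lemma sm_cont V W (O : set V) (f : V -> W) x : smo O f -> O x -> {for x, continuous f}.
Proof. by move=> /(_ 0%N); exact: Ck_cont. Qed.

Lemma sm_dirder V W (O : set V) (f : V -> W) x v : open O ->
  smo O f -> O x -> dirder f x v (dd f v x).
Proof. by move=> oO /(_ 1%N)/(CkS _ _ oO)[_ /(_ v)[h _]]; exact: h. Qed.

Lemma sm_dd V W (O : set V) (f : V -> W) v : open O -> smo O f -> smo O (dd f v).
Proof. by move=> oO hf k; have /(CkS _ _ oO)[_ /(_ v)[]] := hf k.+1. Qed.

(** Coinduction for smoothness. The class [P] records a shape, such as being the integral of some
    integrand, that passes from a function to its derivatives. *)
Lemma sm_intro V W (O : set V) (P : (V -> W) -> Prop) :
  (forall f x, P f -> O x -> {for x, continuous f}) ->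
  (forall f v, P f -> exists2 g, (forall x, O x -> dirder f x v (g x)) & P g) ->
  forall f, P f -> smo O f.
Proof.
move=> Pc Pd f Pf k; elim: k f Pf => [|k IH] f Pf; split=> //.
- by move=> x; exact: Pc.
- by move=> x; exact: Pc.
by move=> v; have [g gD Pg] := Pd f v Pf; exists g; split=> //; exact: IH.
Qed.

Lemma fdim_rV n : fdim ('rV[R]_n : normedModType R).
Proof.
exists n, (fun i => delta_mx 0 i), (fun i (v : 'rV[R]_n) => v 0 i); split.
- by move=> v; exact: row_sum_delta.
- by move=> i; exact: coord_continuous.
- by move=> i r u v; rewrite !mxE.
Qed.

Lemma fdim_R : fdim (R^o : normedModType R).
Proof.
exists 1%N, (fun=> 1 : R^o), (fun _ v => v); split=> //.
  by move=> v; rewrite big_ord1 /GRing.scale /= mulr1.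
by move=> _ v; exact: cvg_id.
Qed.

Lemma fdim_prod V W : fdim V -> fdim W -> fdim ((V * W)%type : normedModType R).
Proof.
move=> [d [b [co [bE coc col]]]] [d' [b' [co' [bE' coc' col']]]].
exists (d + d')%N, (fun i : 'I_(d + d') => match fintype.split i with inl j => (b j, 0) | inr j => (0, b' j) end),
  (fun (i : 'I_(d + d')) (p : V * W) => match fintype.split i with inl j => co j p.1 | inr j => co' j p.2 end); split.
- move=> [v w]; rewrite big_split_ord /=.
  rewrite (eq_bigr (fun i => (co i v *: b i, 0))); last first.
    move=> i _; case: splitP => j /= e; last by have := ltn_ord i; rewrite e ltnNge leq_addr.
    by move/val_inj : e => <-; congr pair; rewrite /= scaler0.
  rewrite [X in _ + X](eq_bigr (fun i => (0, co' i w *: b' i))); last first.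
    move=> i _; case: splitP => j /= e; first by have := ltn_ord j; rewrite -e ltnNge leq_addr.
    by move/addnI : e => /val_inj <-; congr pair; rewrite /= scaler0.
  have s1 (I : finType) (f : I -> V) : \sum_i (f i, 0 : W) = (\sum_i f i, 0).
    apply/esym; apply: (big_morph (fun v : V => (v, 0 : W))) => // x y.
    by congr pair; rewrite /= addr0.
  have s2 (I : finType) (f : I -> W) : \sum_i (0 : V, f i) = (0, \sum_i f i).
    apply/esym; apply: (big_morph (fun w : W => (0 : V, w))) => // x y.
    by congr pair; rewrite /= addr0.
  by rewrite s1 s2 -bE -bE'; congr pair; rewrite /= ?addr0 ?add0r.
- move=> i; case: splitP => j _ p.
    by apply: (cvg_cont (L := co j)); [exact: cvg_fst|exact: coc].
  by apply: (cvg_cont (L := co' j)); [exact: cvg_snd|exact: coc'].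
- by move=> i r u v; case: splitP => j _ /=; rewrite ?col ?col'.
Qed.

Lemma sm_coord n (O : set 'rV[R]_n) i : smo O (fun u => u 0 i : R^o).
Proof. by apply: sm_lincont => [r u v|]; [rewrite !mxE|exact: coord_continuous]. Qed.

Lemma is_derive_dirder V W (f : V -> W) x v df : is_derive x v f df -> dirder f x v df.
Proof.
move=> [dv <-]; apply: cvg_eq1 dv => t /=.
by rewrite [x + _]addrC.
Qed.

Lemma dirder_is_derive V W (f : V -> W) x v df : dirder f x v df -> is_derive x v f df.
Proof.
move=> h.
have h' : h0^-1 *: ((f \o shift x) (h0 *: v) - f x) @[h0 --> (0 : R)^'] --> df.
  by apply: cvg_eq1 h => t /=; rewrite [x + _]addrC.
split; first by apply/cvg_ex; exists df.
exact: cvg_lim h'.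
Qed.

End SmoothAlgebra.

(** * Bump functions *)

Section Bump.
Context {R : realType}.
Notation dirder := (is_dirder (idfun : R -> R)).

(** The powers of [t^-1] are included because differentiating [exp (- 1 / t)] produces them; the
    family is closed under differentiation up to linear combinations. *)
Definition flat_exp (k : nat) (t : R) : R^o :=
  if 0 < t then t^-1 ^+ k * expR (- t^-1) else 0.

(** For [s = t^-1], raising [exp (s / k) >= s / k] to the power [k] gives [s^k exp (- s) <= k^k],
    whence the constant. *)
Lemma flat_exp_le (k : nat) : exists2 C, 0 < C & forall t, 0 < t -> flat_exp k t <= C :> R.
Proof.
case: k => [|k].
  exists 1 => // t t0; rewrite /flat_exp t0 expr0 mul1r -expR0 ler_expR oppr_le0.
  by rewrite invr_ge0 ltW.
exists (k.+1%:R ^+ k.+1); first by rewrite exprn_gt0// ltr0n.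
move=> t t0; rewrite /flat_exp t0.
have s0 : 0 <= t^-1 by rewrite invr_ge0 ltW.
rewrite expRN ler_pdivrMr ?expR_gt0//.
have -> : t^-1 = (t^-1 / k.+1%:R) *+ k.+1.
  by rewrite -[RHS]mulr_natr divfK// pnatr_eq0.
rewrite -[X in expR X]mulr_natl expRM_natl -exprMn.
rewrite lerXn2r// ?nnegrE ?mulr_ge0 ?expR_ge0 ?mulrn_wge0 ?divr_ge0//.
rewrite -[X in X <= _]mulr_natl ler_wpM2l//.
by rewrite (le_trans _ (expR_ge1Dx _))// lerDr.
Qed.

(** For [t > 0], [flat_exp k t] is [t^2] times [flat_exp k.+2 t], which is bounded. The quadratic
    bound yields the derivative 0 at the origin. *)
Lemma flat_exp_quad (k : nat) : exists2 C, 0 < C & forall t, `|flat_exp k t| <= C * t ^+ 2.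
Proof.
have [C C0 CP] := flat_exp_le k.+2; exists C => // t.
case: (ltrP 0 t) => t0; last first.
  by rewrite /flat_exp ltNge t0 normr0 mulr_ge0 ?sqr_ge0 ?ltW.
have := CP t t0; rewrite /flat_exp t0 ger0_norm; last first.
  by rewrite mulr_ge0 ?expR_ge0 ?exprn_ge0 ?invr_ge0 ?ltW.
move=> h; rewrite -ler_pdivrMr ?exprn_gt0// (le_trans _ h)//.
by rewrite mulrAC ler_wpM2r ?expR_ge0// -exprVn -exprD addn2.
Qed.

Definition flat_exp' (k : nat) (t : R) : R^o :=
  (- k%:R) *: flat_exp k.+1 t + flat_exp k.+2 t.

Lemma flat_exp_dirder (k : nat) (t v : R^o) :
  dirder (flat_exp k : R^o -> R^o) t v (v *: flat_exp' k t).
Proof.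
suff h : dirder (flat_exp k : R^o -> R^o) t (1 : R^o) (flat_exp' k t).
  have := @dirderZ _ _ _ _ _ _ _ v h; have -> : v *: (1 : R^o) = v by rewrite /GRing.scale /= mulr1.
  by [].
have z s : s <= 0 -> flat_exp' k s = 0.
  by move=> s0; rewrite /flat_exp' /flat_exp ltNge s0/= scaler0 addr0.
case: (ltrgtP t 0) => t0.
- rewrite z ?(ltW t0)//; apply: (@dirder_near _ _ _ (fun=> 0)); last first.
    by apply: cvg_eq1 (cvg_cst 0) => s; rewrite subrr scaler0.
  have := lt_nbhsl t0; apply: filterS => y y0.
  by rewrite /flat_exp ltNge (ltW y0).
- apply: (@dirder_near _ _ _ (fun s : R^o => s^-1 ^+ k * expR (- s^-1) : R^o)).
    have := lt_nbhsr t0; apply: filterS => y y0; by rewrite /flat_exp y0.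
  apply: is_derive_dirder.
  have tn0 : t != 0 by rewrite gt_eqF.
  have iV : is_derive (t : R) 1 (fun s : R => s^-1 : R) (- t^-1 ^+ 2).
    have := @is_deriveV R id t 1 1 tn0 (is_derive_id _ _).
    by rewrite /GRing.scale /= mulr1 exprVn.
  have iX m : is_derive (t : R) 1 (fun s : R => s^-1 ^+ m : R) (- m%:R * t^-1 ^+ m.+1).
    elim: m => [|m IH].
      rewrite oppr0 mul0r (_ : (fun s => _) = cst (1 : R)); first exact: is_derive_cst.
      by apply/funext => s; rewrite expr0.
    rewrite (_ : (fun s => _) = (fun s : R => s^-1 : R) * (fun s : R => s^-1 ^+ m : R)); last first.
      by apply/funext => s; rewrite exprS.
    apply: (is_derive_eq (is_deriveM iV IH)).
    by rewrite /GRing.scale /= -natr1 !exprS; ring.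
  have iE : is_derive (t : R) 1 (fun s : R => expR (- s^-1) : R) (t^-1 ^+ 2 * expR (- t^-1)).
    have iN := is_deriveN iV.
    have := @is_derive1_comp _ expR (fun s : R => - s^-1) t _ _ (is_derive_expR _) iN.
    by rewrite opprK mulrC.
  apply: (is_derive_eq (is_deriveM (iX k) iE)).
  by rewrite /flat_exp' /flat_exp t0 /GRing.scale /= !exprS; ring.
- rewrite t0 z//; apply/dirderP => e e0; have [C C0 CP] := flat_exp_quad k.
  exists (e / C); first exact: divr_gt0.
  move=> s se; rewrite add0r scaler0 subr0.
  have -> : s *: (1 : R^o) = s by rewrite /GRing.scale /= mulr1.
  rewrite {2}/flat_exp ltxx subr0 (le_trans (CP s))//.
  rewrite -(real_normK (num_real s)) expr2 mulrA ler_wpM2r//.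
  by rewrite mulrC -ler_pdivlMr// ltW.
Qed.

(** The induction on the order treats all [k] at once, since the derivative involves [k + 1] and
    [k + 2]. *)
Lemma sm_flat_exp k : smo setT (flat_exp k : R^o -> R^o).
Proof.
move=> m; elim: m k => [|m IH] k; split=> //.
- by move=> x _; apply: (@dirder_cont_R R R^o _ _ _ (@flat_exp_dirder k x 1)).
- by move=> x _; apply: (@dirder_cont_R R R^o _ _ _ (@flat_exp_dirder k x 1)).
move=> v; exists (fun t => v *: flat_exp' k t); split.
  by move=> x _; exact: flat_exp_dirder.
apply: Ck_scale; first exact: Ck_cst.
exact: Ck_lin.
Qed.

Lemma flat_exp0_ge0 t : 0 <= flat_exp 0 t :> R.
Proof.
by rewrite /flat_exp; case: ifP => // _; rewrite expr0 mul1r expR_ge0.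
Qed.

Lemma flat_exp0_gt0 t : (0 < (flat_exp 0 t : R)) = (0 < t).
Proof.
by rewrite /flat_exp; case: ifP => // _; rewrite ?ltxx// expr0 mul1r expR_gt0.
Qed.

(** The norm of row vectors is the maximum norm, so a product over coordinates is positive exactly
    on the open ball of radius [r > 0]. *)
Definition bump n (p : 'rV[R]_n) (r : R) (u : 'rV[R]_n) : R^o :=
  \prod_(i < n) ((flat_exp 0 (r + (u 0 i - p 0 i)) : R) *
                 (flat_exp 0 (r - (u 0 i - p 0 i)) : R)).

Lemma sm_bump n (p : 'rV[R]_n) r : smo setT (bump p r).
Proof.
have c1 i : smo setT (fun u : 'rV[R]_n => r + (u 0 i - p 0 i) : R^o).
  apply: sm_add; first exact: sm_cst.
  by apply: sm_add; [exact: sm_coord|exact: sm_cst].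
have c2 i : smo setT (fun u : 'rV[R]_n => r - (u 0 i - p 0 i) : R^o).
  rewrite (_ : (fun u => _) = (fun u : 'rV[R]_n => (-1 : R) *: (u 0 i - p 0 i : R^o) + r : R^o)).
    apply: sm_lin; last exact: sm_cst.
    by apply: sm_add; [exact: sm_coord|exact: sm_cst].
  by apply/funext => u; rewrite scaleN1r addrC.
apply: sm_prod => i; apply: sm_mul.
  apply: (@sm_comp R R^o _ R^o setT setT (flat_exp 0)
      (fun u : 'rV[R]_n => r + (u 0 i - p 0 i))) => //;
    [exact: fdim_R|exact: openT|exact: sm_flat_exp].
apply: (@sm_comp R R^o _ R^o setT setT (flat_exp 0)
      (fun u : 'rV[R]_n => r - (u 0 i - p 0 i))) => //;
    [exact: fdim_R|exact: openT|exact: sm_flat_exp].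
Qed.

Lemma bump_ge0 n (p : 'rV[R]_n) r u : 0 <= bump p r u :> R.
Proof. by apply: prodr_ge0 => i _; rewrite mulr_ge0 ?flat_exp0_ge0. Qed.

Lemma bump_gt0 n (p : 'rV[R]_n) r u : 0 < r ->
  (0 < (bump p r u : R)) = (`|u - p| < r).
Proof.
move=> r0; have E i : (0 < (flat_exp 0 (r + (u 0 i - p 0 i)) : R) *
    (flat_exp 0 (r - (u 0 i - p 0 i)) : R)) = (`|(u - p) 0 i| < r).
  have h (a b : R) : 0 <= a -> 0 <= b -> (0 < a * b) = (0 < a) && (0 < b).
    move=> a0 b0; rewrite lt_neqAle eq_sym mulf_eq0 negb_or mulr_ge0// andbT.
    by rewrite !lt_neqAle a0 b0 !andbT ![0 == _]eq_sym.
  rewrite h ?flat_exp0_ge0// !flat_exp0_gt0 ltr_norml !mxE subr_gt0.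
  by congr andb; rewrite -ltrBlDl sub0r.
apply/idP/idP => [b0|ur].
  have bi i : `|(u - p) 0 i| < r.
    rewrite -E lt_neqAle mulr_ge0 ?flat_exp0_ge0// andbT; apply/eqP => e.
    by move: b0; rewrite /bump (bigD1 i)//= -e mul0r ltxx.
  rewrite /Num.norm /= mx_normrE; apply/bigmax_ltP; split=> //= -[a i] _ /=.
  by rewrite (ord1 a).
apply: prodr_gt0 => i _; rewrite E (le_lt_trans _ ur)//.
by rewrite [leRHS]/Num.norm /= mx_normrE; apply/bigmax_geP; right; exists (0, i).
Qed.

End Bump.

(** * Smooth maps on the group and left-invariant fields *)

Lemma open_preim (T U : topologicalType) (O : set T) (Q : set U) (f : T -> U) :
  open O -> open Q -> (forall x, O x -> {for x, continuous f}) ->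
  open (O `&` f @^-1` Q).
Proof.
move=> oO oQ fc; rewrite openE => x [Ox Qfx].
apply: filterI; first exact: open_nbhs_nbhs.
by apply: fc => //; exact: open_nbhs_nbhs.
Qed.

Section LieSmooth.
Context {R : realType} {n : nat} {G : lieGroupType R n}.
Implicit Types V W : normedModType R.
Implicit Types c d e : chart R n G.

Lemma chart_domO c : atlas c -> open (chart_dom c).
Proof. by move=> /atlas_chart[]. Qed.
Lemma chart_imgO c : atlas c -> open (chart_img c).
Proof. by move=> /atlas_chart[]. Qed.
Lemma chart_mapK c g : atlas c -> chart_dom c g -> chart_inv c (chart_map c g) = g.
Proof. by move=> /atlas_chart[_ _ + _ _]; exact. Qed.
Lemma chart_map_cont c g : atlas c -> chart_dom c g -> {for g, continuous (chart_map c)}.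
Proof. by move=> /atlas_chart[_ _ _ + _]; exact. Qed.
Lemma chart_inv_cont c u : atlas c -> chart_img c u -> {for u, continuous (chart_inv c)}.
Proof. by move=> /atlas_chart[_ _ _ _ +]; exact. Qed.
Lemma chart_imgP c g : chart_dom c g -> chart_img c (chart_map c g).
Proof. by move=> cg; exists g. Qed.
Lemma chart_inv_dom c u : atlas c -> chart_img c u -> chart_dom c (chart_inv c u).
Proof. by move=> ac [g cg <-]; rewrite chart_mapK. Qed.
Lemma chart_invK c u : atlas c -> chart_img c u -> chart_map c (chart_inv c u) = u.
Proof. by move=> ac [g cg <-]; rewrite chart_mapK. Qed.

Lemma cvg_mulG (T : Type) (F : set_system T) (f g : T -> G) (a b : G) : Filter F ->
  f x @[x --> F] --> a -> g x @[x --> F] --> b -> (f x * g x)%g @[x --> F] --> (a * b)%g.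
Proof.
move=> FF fa gb A Aab.
have := @lie_mul_continuous R n G (a, b) _ Aab; exact: (cvg_pair fa gb).
Qed.

Lemma cvg_invG (T : Type) (F : set_system T) (f : T -> G) (a : G) : Filter F ->
  f x @[x --> F] --> a -> (f x)^-1%g @[x --> F] --> a^-1%g.
Proof.
by move=> FF fa A Aa; have := @lie_inv_continuous R n G a _ Aa; exact: fa.
Qed.

(** Smooth maps from a normed space into the group, tested in target charts. Continuity is a clause
    of its own because it makes the sets on which the chart expressions are tested open. *)
Definition Gsm V (O : set V) (al : V -> G) : Prop :=
  (forall x, O x -> {for x, continuous al}) /\
  forall e, atlas e -> smo (O `&` al @^-1` chart_dom e) (fun x => chart_map e (al x)).

Lemma Gsm_sub V (O O' : set V) al : O' `<=` O -> Gsm O al -> Gsm O' al.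
Proof.
move=> OO' [alc als]; split=> [x /OO'|e ae]; first exact: alc.
by apply: sm_sub (als e ae) => x [/OO' ? ?].
Qed.

Lemma Gsm_chart c : atlas c -> Gsm (chart_img c) (chart_inv c).
Proof.
move=> ac; split=> [x|e ae]; first exact: chart_inv_cont.
apply: sm_sub (atlas_transition c e ac ae) => u [cu eu].
exists (chart_inv c u); last exact: chart_invK.
by split=> //; exact: chart_inv_dom.
Qed.

Lemma Gsm_cst V (O : set V) (g : G) : Gsm O (fun=> g).
Proof.
by split=> [x _|e ae]; [exact: cst_continuous|exact: sm_cst].
Qed.

Lemma Gsm_comp V V' (O : set V) (O' : set V') (al : V -> G) (phi : V' -> V) :
  fdim V -> open O -> (forall x, O' x -> O (phi x)) ->
  Gsm O al -> smo O' phi -> Gsm O' (fun x => al (phi x)).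
Proof.
move=> fV oO h [alc als] hp; split=> [x Ox|e ae].
  by apply: (cvg_cont (L := al) (sm_cont hp Ox)); apply: alc; exact: h.
apply: (sm_comp _ _ _ (als e ae)) => //.
- by apply: open_preim => //; exact: chart_domO.
- by move=> x [/h ? ?].
- by apply: sm_sub hp => x [].
Qed.

Lemma smooth_comp V W (O : set V) (F : G -> W) (al : V -> G) : open O ->
  smooth_map idfun F -> Gsm O al -> smo O (fun x => F (al x)).
Proof.
move=> oO Fs [alc als]; apply: sm_loc => // x Ox.
have [c ac cx] := atlas_cover (al x).
have oQ : open (O `&` al @^-1` chart_dom c) by apply: open_preim => //; exact: chart_domO.
exists (O `&` al @^-1` chart_dom c); split=> //.
apply: (@sm_eq _ _ _ _ (fun x => F (chart_inv c (chart_map c (al x))))) => //.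
  by move=> y [_ cy]; rewrite chart_mapK.
apply: (@sm_comp _ _ _ _ (chart_img c) _ (fun u => F (chart_inv c u)) (fun y => chart_map c (al y))).
- exact: fdim_rV.
- exact: chart_imgO.
- by move=> y [_ cy]; exact: chart_imgP.
- exact: Fs.
- exact: als.
Qed.

Lemma smooth_map_cont W (F : G -> W) : smooth_map idfun F -> continuous F.
Proof.
move=> Fs g; have [c ac cg] := atlas_cover g.
have h : F (chart_inv c (chart_map c x)) @[x --> g] --> F (chart_inv c (chart_map c g)).
  apply: (cvg_cont (L := fun u => F (chart_inv c u))).
    exact: chart_map_cont.
  by apply: (sm_cont (Fs c ac)); exact: chart_imgP.
rewrite chart_mapK// in h; apply: cvg_trans h; apply: near_eq_cvg.
have := open_nbhs_nbhs (conj (chart_domO ac) cg).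
by apply: filterS => x cx; rewrite chart_mapK.
Qed.

Lemma Gsm_mul V (O : set V) (al be : V -> G) : open O ->
  Gsm O al -> Gsm O be -> Gsm O (fun x => (al x * be x)%g).
Proof.
move=> oO [alc als] [bec bes].
have mulc x : O x -> {for x, continuous (fun x => (al x * be x)%g)}.
  by move=> Ox; apply: cvg_mulG; [exact: alc|exact: bec].
split=> // e ae.
apply: sm_loc; first by apply: open_preim => //; exact: chart_domO.
move=> x [Ox ex].
have [c ac cx] := atlas_cover (al x); have [d ad dx] := atlas_cover (be x).
pose Q := ((O `&` al @^-1` chart_dom c) `&` (O `&` be @^-1` chart_dom d)) `&`
  (O `&` (fun x => (al x * be x)%g) @^-1` chart_dom e).
exists Q; split.
- by apply: openI; [apply: openI|]; apply: open_preim => //; exact: chart_domO.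
- by [].
pose S := [set p : 'rV[R]_n * 'rV[R]_n | [/\ chart_img c p.1, chart_img d p.2 &
         chart_dom e (chart_inv c p.1 * chart_inv d p.2)%g]].
have oS : open S.
  have -> : S = (chart_img c `*` chart_img d) `&`
      (fun p => (chart_inv c p.1 * chart_inv d p.2)%g) @^-1` chart_dom e.
    apply/seteqP; split=> p; first by case.
    by case=> -[].
  apply: open_preim; last first.
  - move=> p [p1 p2].
    apply: cvg_mulG.
      by apply: (cvg_cont (L := chart_inv c)); [exact: cvg_fst|exact: chart_inv_cont].
    by apply: (cvg_cont (L := chart_inv d)); [exact: cvg_snd|exact: chart_inv_cont].
  - exact: chart_domO.
  rewrite openE => -[a b] [/= ca db]; exists (chart_img c, chart_img d) => //=.
  by split; apply: open_nbhs_nbhs; split=> //; exact: chart_imgO.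
apply: (@sm_eq _ _ _ _ (fun y => chart_map e
    (chart_inv c (chart_map c (al y)) * chart_inv d (chart_map d (be y)))%g)).
- by apply: openI; [apply: openI|]; apply: open_preim => //; exact: chart_domO.
- by move=> y [[[_ cy] [_ dy]] _]; rewrite !chart_mapK.
apply: (@sm_comp _ _ _ _ S _ (fun p => chart_map e (chart_inv c p.1 * chart_inv d p.2)%g)
  (fun y => (chart_map c (al y), chart_map d (be y)))) => //.
- by apply: fdim_prod; exact: fdim_rV.
- move=> y [[[_ cy] [_ dy]] [_ ey]]; split => /=; rewrite ?chart_mapK//; exact: chart_imgP.
- exact: lie_mul_smooth.
apply: sm_pair.
  by apply: sm_sub (als c ac) => y [[]].
by apply: sm_sub (bes d ad) => y [[]].
Qed.

Lemma Gsm_inv V (O : set V) (al : V -> G) : open O ->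
  Gsm O al -> Gsm O (fun x => (al x)^-1%g).
Proof.
move=> oO [alc als].
have invc x : O x -> {for x, continuous (fun x => (al x)^-1%g)}.
  by move=> Ox; apply: cvg_invG; exact: alc.
split=> // e ae.
apply: sm_loc; first by apply: open_preim => //; exact: chart_domO.
move=> x [Ox ex]; have [c ac cx] := atlas_cover (al x).
pose Q := (O `&` al @^-1` chart_dom c) `&` (O `&` (fun x => (al x)^-1%g) @^-1` chart_dom e).
have oQ : open Q by apply: openI; apply: open_preim => //; exact: chart_domO.
exists Q; split => //.
apply: (@sm_eq _ _ _ _ (fun y => chart_map e (chart_inv c (chart_map c (al y)))^-1%g)) => //.
  by move=> y [[_ cy] _]; rewrite !chart_mapK.
apply: (@sm_comp _ _ _ _ [set u : 'rV[R]_n | chart_img c u /\ chart_dom e (chart_inv c u)^-1%g]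
  _ (fun u => chart_map e (chart_inv c u)^-1%g) (fun y => chart_map c (al y))) => //.
- exact: fdim_rV.
- apply: (@open_preim _ _ (chart_img c) _ (fun u => (chart_inv c u)^-1%g)).
  + exact: chart_imgO.
  + exact: chart_domO.
  + move=> u cu; have h := chart_inv_cont ac cu.
    by apply: (cvg_invG (f := chart_inv c) (F := nbhs (u : 'rV[R]_n))).
- move=> y [[_ cy] [_ ey]]; split => /=; rewrite ?chart_mapK//; exact: chart_imgP.
- exact: lie_inv_smooth.
by apply: sm_sub (als c ac) => y [[]].
Qed.

Definition chart_ext W c (O : set 'rV[R]_n) (f : 'rV[R]_n -> W) (h : G) : W :=
  if `[< chart_dom c h /\ O (chart_map c h) >] then f (chart_map c h) else 0.

Lemma compact_chart c (K : set 'rV[R]_n) : atlas c -> K `<=` chart_img c ->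
  compact K -> compact (chart_inv c @` K).
Proof.
move=> ac Kc cK; apply: continuous_compact => //.
apply: continuous_in_subspaceT => u /set_mem Ku; apply: chart_inv_cont => //; exact: Kc.
Qed.

(** The image of [K] in the group is compact, hence closed because the group is Hausdorff. Its
    complement, where the extension vanishes, and the part of the chart lying over [O] form an open
    cover on each of which smoothness is clear. *)
Lemma smooth_chart_ext W c (O K : set 'rV[R]_n) (f : 'rV[R]_n -> W) :
  atlas c -> open O -> O `<=` chart_img c -> compact K -> K `<=` O ->
  (forall u, O u -> ~ K u -> f u = 0) -> smo O f ->
  smooth_map idfun (chart_ext c O f).
Proof.
move=> ac oO Oc cK KO f0 fs d ad.
have cKG : compact (chart_inv c @` K).
  by apply: compact_chart => // u /KO /Oc.
have clKG : closed (chart_inv c @` K).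
  by apply: compact_closed => //; exact: lie_hausdorff.
have oc : open (chart_dom c `&` chart_map c @^-1` O).
  by apply: open_preim => //; [exact: chart_domO|move=> x; exact: chart_map_cont].
apply: sm_loc; first exact: chart_imgO.
move=> u du; have [[cu Ou]|nu] := pselect (chart_dom c (chart_inv d u) /\ O (chart_map c (chart_inv d u))).
  have oQ : open (chart_img d `&` chart_inv d @^-1` (chart_dom c `&` chart_map c @^-1` O)).
    by apply: open_preim => //; [exact: chart_imgO|move=> x; exact: chart_inv_cont].
  exists (chart_img d `&` chart_inv d @^-1` (chart_dom c `&` chart_map c @^-1` O)); split=> //.
  apply: (@sm_eq _ _ _ _ (fun u => f (chart_map c (chart_inv d u)))) => //.
    by move=> y [dy [cy Oy]]; rewrite /chart_ext asboolT.
  apply: (@sm_comp _ _ _ _ O _ f (fun u => chart_map c (chart_inv d u))) => //.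
  - exact: fdim_rV.
  - by move=> y [_ []].
  by apply: sm_sub ((Gsm_chart ad).2 c ac) => y [dy [cy _]].
have oQ : open (chart_img d `&` chart_inv d @^-1` (~` (chart_inv c @` K))).
  apply: open_preim => //; [exact: chart_imgO|exact: closed_openC|].
  by move=> x; exact: chart_inv_cont.
exists (chart_img d `&` chart_inv d @^-1` (~` (chart_inv c @` K))); split=> //.
  split=> // -[k Kk ke]; apply: nu; rewrite -ke; split.
    by apply: chart_inv_dom => //; exact/Oc/KO.
  by rewrite chart_invK//; [exact: KO|exact/Oc/KO].
apply: (@sm_eq _ _ _ _ (fun=> 0)) => //; last exact: sm_cst.
move=> y [dy nKy]; rewrite /chart_ext; case: asboolP => // -[cy Oy].
rewrite f0// => Kcy; apply: nKy; exists (chart_map c (chart_inv d y)) => //.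
exact: chart_mapK.
Qed.

End LieSmooth.

(** * Differentiation under a bounded linear map *)

Section ParamSmooth.
Context {R : realType}.
Notation dirder := (is_dirder (idfun : R -> R)).

Lemma near_line (V : normedModType R) (u v : V) (Q : V -> Prop) :
  (\forall y \near u, Q y) -> exists2 d : R, 0 < d & forall s, `|s| < d -> Q (u + s *: v).
Proof.
move=> Qu; apply/nbhs0P.
have h : u + s *: v @[s --> (0 : R)] --> u.
  rewrite -[X in _ --> X]addr0 -(scale0r v).
  by apply: cvgD; [exact: cvg_cst|apply: cvgZr_tmp; exact: cvg_id].
exact: h.
Qed.

Variables (V W E : normedModType R) (T : topologicalType).
Variables (Lam : (T -> E) -> W) (adm : (T -> E) -> Prop).
Variables (KK : set (set T)) (sp : set T -> (T -> E) -> Prop).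
Hypothesis adm_lin : forall (r : R) f g, adm f -> adm g -> adm (fun t => r *: f t + g t).
Hypothesis Lam_lin : forall (r : R) f g, adm f -> adm g ->
  Lam (fun t => r *: f t + g t) = r *: Lam f + Lam g.
Hypothesis sp_lin : forall (r : R) K f g, sp K f -> sp K g ->
  sp K (fun t => r *: f t + g t).
Hypothesis sp_mono : forall K K' f, K `<=` K' -> sp K f -> sp K' f.
Hypothesis KK_U : forall K K', KK K -> KK K' -> KK (K `|` K').
Hypothesis Lam_bnd : forall K, KK K -> exists2 C : R, 0 <= C & forall f (M : R),
  adm f -> sp K f -> 0 <= M -> (forall t, K t -> `|f t| <= M) -> `|Lam f| <= C * M.

(** A class of integrands stable under differentiation in the parameter. [Lam] stands for an
    integral, for the value of a primitive at 1, or for [rho] applied to a fixed vector; [KK] is a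
    family of compact sets and [sp] a support condition. *)
Definition param_family (O : set V) (P : (V -> T -> E) -> Prop) : Prop :=
  forall B, P B ->
  [/\ forall u, O u -> adm (B u),
      forall u, O u -> exists2 K, KK K & \forall u' \near u, sp K (B u'),
      forall u K (e : R), O u -> KK K -> 0 < e ->
        \forall u' \near u, forall t, K t -> `|B u' t - B u t| <= e &
      forall v, exists2 B', P B' &
        forall u t K, O u -> KK K -> K t -> dirder (fun u => B u t) u v (B' u t)].

Let LamB f g : adm f -> adm g -> Lam (fun t => f t - g t) = Lam f - Lam g.
Proof.
move=> af ag; have := @Lam_lin (-1) g f ag af; rewrite scaleN1r addrC => <-.
by congr Lam; apply/funext => t; rewrite scaleN1r addrC.
Qed.
Let admB f g : adm f -> adm g -> adm (fun t => f t - g t).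
Proof.
move=> af ag; have := @adm_lin (-1) g f ag af.
by congr adm; apply/funext => t; rewrite scaleN1r addrC.
Qed.
Let spB K f g : sp K f -> sp K g -> sp K (fun t => f t - g t).
Proof.
move=> af ag; have := @sp_lin (-1) K g f ag af.
by congr sp; apply/funext => t; rewrite scaleN1r addrC.
Qed.

(** For each [t] the mean value inequality bounds the remainder of [B] by the step times the
    oscillation of [B'], which is small uniformly on [K0] and [K1]; the bound on [Lam] then applies
    to the remainder as a whole. *)
Lemma param_dirder (O : set V) (P : (V -> T -> E) -> Prop) (B B' : V -> T -> E) u v :
  open O -> param_family O P -> P B -> P B' -> O u ->
  (forall u t K, O u -> KK K -> K t -> dirder (fun u => B u t) u v (B' u t)) ->
  dirder (fun u => Lam (B u)) u v (Lam (B' u)).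
Proof.
move=> oO HP PB PB' Ou B'd; have [Ba Bs _ _] := HP B PB.
have [B'a B's B'c _] := HP B' PB'.
have [K0 KK0 BK0] := Bs u Ou; have [K1 KK1 BK1] := B's u Ou.
have KKK := KK_U KK0 KK1; have [C C0 CP] := Lam_bnd KKK.
apply/dirderP => e e0.
have C1 : 0 < C + 1 by rewrite ltr_wpDl.
have eC : 0 < e / (C + 1) by exact: divr_gt0.
have good : \forall u' \near u, [/\ O u', sp K0 (B u') &
    forall t, (K0 `|` K1) t -> `|B' u' t - B' u t| <= e / (C + 1)].
  move: (open_nbhs_nbhs (conj oO Ou)) BK0 (B'c u _ _ Ou KKK eC).
  by apply: filterS3 => u' *; split.
have [d d0 dP] := near_line v good; exists d => // s sd.
have [Os Bus _] := dP s sd.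
have Bu0 : sp K0 (B u) by exact: nbhs_singleton BK0.
have B'u0 : sp K1 (B' u) by exact: nbhs_singleton BK1.
pose D t := (- s) *: B' u t + (B (u + s *: v) t - B u t).
have -> : Lam (B (u + s *: v)) - Lam (B u) - s *: Lam (B' u) = Lam D.
  rewrite Lam_lin; [|exact: B'a|by apply: admB; exact: Ba].
  by rewrite LamB; [rewrite scaleNr addrC|exact: Ba|exact: Ba].
rewrite (le_trans (CP D (`|s| * (e / (C + 1))) _ _ _ _))//.
- by apply: adm_lin; [exact: B'a|apply: admB; exact: Ba].
- apply: sp_lin; first by apply: sp_mono B'u0; exact: subsetUr.
  by apply: spB; apply: (@sp_mono K0) => //; exact: subsetUl.
- by rewrite mulr_ge0// ltW.
- move=> t Kt; rewrite /D scaleNr addrC.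
  apply: (@mean_value_seg _ _ _ (fun u => B u t)) => r /andP[r0 r1].
  have rs : `|r * s| < d.
    by rewrite normrM (ger0_norm r0) (le_lt_trans _ sd)// ler_piMl.
  have [Or _ B'r] := dP _ rs; rewrite scalerA.
  exists (s *: B' (u + (r * s) *: v) t).
    by apply: dirderZ; apply: B'd Or KKK Kt.
  by rewrite -scalerBr normrZ ler_wpM2l//; exact: B'r.
by rewrite mulrCA [leRHS]mulrC ler_wpM2l// mulrA ler_pdivrMr// mulrC ler_wpM2l ?(ltW e0)// lerDl.
Qed.

Lemma param_smooth (O : set V) (P : (V -> T -> E) -> Prop) (B : V -> T -> E) :
  open O -> param_family O P -> P B -> smo O (fun u => Lam (B u)).
Proof.
move=> oO HP PB.
pose P' (F : V -> W) := exists2 B, P B & F = (fun u => Lam (B u)).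
suff h : forall F, P' F -> smo O F by apply: h; exists B.
apply: sm_intro => {PB B}.
  move=> _ u [B PB ->] Ou; have [Ba Bs Bc _] := HP B PB.
  have [K KKK BK] := Bs u Ou; have [C C0 CP] := Lam_bnd KKK.
  apply/cvgrPdist_le => e e0.
  have C1 : 0 < C + 1 by rewrite ltr_wpDl.
  have := Bc u K (e / (C + 1)) Ou KKK (divr_gt0 e0 C1).
  have On := open_nbhs_nbhs (conj oO Ou).
  have Bu0 : sp K (B u) by exact: nbhs_singleton BK.
  move: BK On; apply: filterS3 => u' BK On Bc'.
  rewrite distrC -LamB; [|exact: Ba|exact: Ba].
  rewrite (le_trans (CP _ (e / (C + 1)) _ _ _ Bc'))//.
  - by apply: admB; exact: Ba.
  - exact: spB.
  - by rewrite ltW// divr_gt0.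
  by rewrite mulrA ler_pdivrMr// mulrC ler_wpM2l ?(ltW e0)// lerDl.
move=> _ v [B PB ->]; have [Ba Bs Bc Bd] := HP B PB.
have [B' PB' B'd] := Bd v.
exists (fun u => Lam (B' u)); last by exists B'.
move=> u Ou; apply: (@param_dirder O P B B' u v oO HP PB PB' Ou B'd).
Qed.

End ParamSmooth.

(** * Primitives and Hadamard's lemma *)

Section Primitive.
Context {R : realType}.
Notation dirder := (is_dirder (idfun : R -> R)).
Notation leb := (@lebesgue_measure R).

(** The range [|t| < 2] leaves room for derivatives at the points of [[-1, 1]], where primitives are
    used. *)
Definition is_prim (f F : R -> R) : Prop := F 0 = 0 /\
  forall t, `|t| < 2 -> dirder (F : R^o -> R^o) t (1 : R^o) (f t).

Lemma ex_prim (f : R -> R) : continuous f -> exists F, is_prim f F.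
Proof.
move=> fc.
(* The base point lies to the left of the whole range; subtracting [F 0] normalizes afterwards. *)
pose F (x : R) := (\int[leb]_(t in `[(-3 : R), x]) f t)%R.
exists (fun x => F x - F 0); split; first by rewrite subrr.
move=> t; rewrite ltr_norml => /andP[t1 t2].
have fi : leb.-integrable `[(-3 : R), 3] (EFin \o f).
  apply: continuous_compact_integrable; first exact: segment_compact.
  exact: continuous_subspaceT.
have t3 : t < 3 by rewrite (lt_trans t2)// ltr_nat.
have t4 : -3 < t by rewrite (lt_trans _ t1)// ltrN2 ltr_nat.
have [Fd Fe] := @continuous_FTC1_closed R f (-3) t 3 t3 fi t4 (fc t).
have FD : is_derive t 1 F (f t) by apply: DeriveDef; [exact: Fd|rewrite -Fe derive1E].
move: FD => /is_derive_dirder; apply: cvg_eq1 => s /=.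
by rewrite opprB addrA subrK.
Qed.

Definition prim (f : R -> R) : R -> R := xget (fun=> 0) [set F | is_prim f F].

Lemma primP (f : R -> R) : continuous f -> is_prim f (prim f).
Proof. by move=> fc; exact: (xgetPex _ (ex_prim fc)). Qed.

(** The parameter [r] merges two uses: [r = 1] compares two primitives, for uniqueness and for the
    Picard contraction, while [r = 0] bounds a single one. *)
Lemma is_prim_bnd (f g F K : R -> R) (r a M : R) : is_prim f F -> is_prim g K -> `|a| < 2 ->
  (forall s, 0 <= s <= 1 -> `|f (s * a) - r * g (s * a)| <= M) ->
  `|F a - r * K a| <= `|a| * M.
Proof.
move=> [f0 fd] [g0 gd] a2 H.
pose D (s : R) : R^o := F s - r * K s.
have D0 : D 0 = 0 by rewrite /D f0 g0 mulr0 subrr.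
rewrite -/(D a).
have := @mean_value_seg R R^o R^o D 0 (a : R^o) 0 (`|a| * M).
rewrite D0 !subr0 add0r; apply => s /andP[s0 s1].
have as2 : `|s * a| < 2.
  by rewrite normrM (ger0_norm s0) (le_lt_trans _ a2)// ler_piMl.
exists (a * (f (s * a) - r * g (s * a))); last first.
  by rewrite subr0 normrM ler_wpM2l//; apply: H; rewrite s0.
have -> : 0 + s *: (a : R^o) = s * a by rewrite add0r.
have aE : (a : R^o) = a *: (1 : R^o) by rewrite /GRing.scale /= mulr1.
rewrite [X in is_dirder _ _ _ X _]aE; apply: (@dirderZ _ R^o R^o).
have h1 := dirder_is_derive (fd _ as2); have h2 := dirder_is_derive (gd _ as2).
exact: is_derive_dirder.
Qed.

Lemma is_prim_lin (r : R) (f g F K : R -> R) : is_prim f F -> is_prim g K ->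
  is_prim (fun t => r * f t + g t) (fun t => r * F t + K t).
Proof.
move=> [f0 fd] [g0 gd]; split; first by rewrite f0 g0 mulr0 addr0.
move=> t t2; apply: cvg_eq1 (cvgD (cvgZl_tmp (k := r) (fd t t2)) (gd t t2)) => s /=.
by rewrite /GRing.scale /=; ring.
Qed.

Lemma is_prim_eq (f F K : R -> R) (a : R) : is_prim f F -> is_prim f K -> `|a| < 2 ->
  F a = K a.
Proof.
move=> hF hK a2; apply/eqP; rewrite -subr_eq0 -normr_le0.
have := @is_prim_bnd f f F K 1 a 0 hF hK a2; rewrite mulr0 mul1r; apply => s _.
by rewrite mul1r subrr normr0.
Qed.

Lemma prim_lin (r a : R) (f g : R -> R) : continuous f -> continuous g -> `|a| < 2 ->
  prim (fun t => r * f t + g t) a = r * prim f a + prim g a.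
Proof.
move=> fc gc a2.
have hc : continuous (fun t => r * f t + g t : R).
  by move=> t; apply: cvgD; [apply: cvgMr; exact: fc|exact: gc].
exact: (is_prim_eq (primP hc) (is_prim_lin r (primP fc) (primP gc)) a2).
Qed.

Lemma prim_bnd (f : R -> R) (a M : R) : continuous f -> `|a| < 2 ->
  (forall s, 0 <= s <= 1 -> `|f (s * a)| <= M) -> `|prim f a| <= `|a| * M.
Proof.
move=> fc a2 H; have := @is_prim_bnd f f _ _ 0 a M (primP fc) (primP fc) a2.
by rewrite mul0r subr0; apply => s s01; rewrite mul0r subr0; exact: H.
Qed.

Lemma prim_cst (c a : R) : `|a| < 2 -> prim (fun=> c) a = c * a.
Proof.
move=> a2; have h : is_prim (fun=> c) (fun t => c * t).
  split; first by rewrite mulr0.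
  move=> t _; have : c @[_ --> (0 : R)^'] --> c by exact: cvg_cst.
  apply: cvg_trans; apply: near_eq_cvg; apply/dnbhs0P; exists 1 => // s s0 _.
  have -> : s *: (1 : R^o) = s by rewrite /GRing.scale /= mulr1.
  rewrite mulrDr [c * t + _]addrC addrK.
  by change (c = s^-1 * (c * s)); rewrite mulrCA mulVf// mulr1.
apply: (is_prim_eq (primP _) h a2); exact: cst_continuous.
Qed.

End Primitive.

Section Hadamard.
Context {R : realType}.
Notation dirder := (is_dirder (idfun : R -> R)).

Lemma tube_lemma (V T : topologicalType) (E : normedModType R) (K : set T)
    (B : V -> T -> E) (u : V) (e : R) : compact K ->
  (forall t, K t -> {for (u, t), continuous (fun p : V * T => B p.1 p.2)}) -> 0 < e ->
  \forall u' \near u, forall t, K t -> `|B u' t - B u t| <= e.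
Proof.
move=> /compact_near_coveringP cK Bc e0.
apply: (cK V (nbhs u) (fun u' t => `|B u' t - B u t| <= e)) => t Kt.
have /cvgrPdist_lt H := Bc t Kt.
have e2 : 0 < e / 2 by exact: divr_gt0.
have [[Q1 Q2] /= [Q1n Q2n] QP] := H _ e2.
exists (Q2, Q1) => //= -[t' u'] [/= Qt Qu].
have h1 := QP (u', t') (conj Qu Qt).
have h2 := QP (u, t') (conj (nbhs_singleton Q1n) Qt).
rewrite ltW// (splitr e) -(subrKA (B u t)) (le_lt_trans (ler_normD _ _))//.
by rewrite ltrD// distrC.
Qed.

Lemma cont_slice (V T U : topologicalType) (F : V * T -> U) u t :
  {for (u, t), continuous F} -> {for t, continuous (fun t => F (u, t))}.
Proof.
move=> Fc; apply: (cvg_cont (f := fun t => (u, t)) (L := F)) => //.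
by apply: cvg_pair; [exact: cvg_cst|exact: cvg_id].
Qed.

(** Linearity of the derivative in the direction, which is not part of the definition of
    [is_dirder], from the chain rule along a straight line. *)
Lemma dd_rowE n (W : normedModType R) (O : set 'rV[R]_n) (f : 'rV[R]_n -> W) x v :
  open O -> smo O f -> O x ->
  dd f v x = \sum_(i < n) v 0 i *: dd f (delta_mx 0 i) x.
Proof.
move=> oO fs Ox; apply: ddE.
have bco : fbasis (fun i => delta_mx 0 i) (fun i (v : 'rV[R]_n) => v 0 i).
  split.
  - by move=> w; exact: row_sum_delta.
  - by move=> i; exact: coord_continuous.
  - by move=> i r u w; rewrite !mxE.
apply: (@dirder_curve R _ W n _ _ f (fun i => dd f (delta_mx 0 i)) x (fun t => x + t *: v) v bco).
- move=> i; have := open_nbhs_nbhs (conj oO Ox); apply: filterS => y Oy.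
  exact: sm_dirder fs Oy.
- by move=> i; apply: sm_cont Ox; exact: sm_dd.
have : v @[_ --> (0 : R)^'] --> v by exact: cvg_cst.
apply: cvg_trans; apply: near_eq_cvg; apply/dnbhs0P; exists 1 => // t t0 _.
by rewrite addrC addKr scalerA mulVf// scale1r.
Qed.

(** [prim] expects functions continuous on the whole line. Clamping the time keeps
    [p + clamp t *: (u - p)] inside the ball for every real [t]. *)
Definition clamp (t : R) : R := Num.min 1 (Num.max 0 t).
Lemma clamp_cont : continuous clamp.
Proof.
move=> t; apply: continuous_min; first exact: cst_continuous.
by apply: continuous_max; [exact: cst_continuous|exact: cvg_id].
Qed.
Lemma clamp_itv t : 0 <= clamp t <= 1.
Proof. by rewrite /clamp le_min ler01 le_max lexx/= ge_min lexx. Qed.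
Lemma clamp_id t : 0 <= t <= 1 -> clamp t = t.
Proof. by move=> /andP[t0 t1]; rewrite /clamp (max_idPr t0) (min_idPr t1). Qed.

Variables (n : nat) (p : 'rV[R]_n) (rho : R).
Let O := ball p rho.
Let oO : open O.
Proof. exact: ball_open. Qed.
Let Oray t u : O u -> O (p + clamp t *: (u - p)).
Proof.
rewrite /O -ball_normE /= => pu; have /andP[c0 c1] := clamp_itv t.
rewrite opprD addrA subrr sub0r normrN normrZ (ger0_norm c0).
by rewrite distrC in pu; rewrite (le_lt_trans _ pu)// ler_piMl.
Qed.

Let ray_cont (m : nat) (k : 'rV[R]_n -> R^o) u t : smo O k -> O u ->
  {for (u, t), continuous (fun q : 'rV[R]_n * R =>
    clamp q.2 ^+ m * k (p + clamp q.2 *: (q.1 - p)) : R^o)}.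
Proof.
move=> ks Ou.
have cc : clamp q.2 @[q --> ((u, t) : 'rV[R]_n * R)] --> clamp t.
  by apply: (cvg_cont (f := fun q : 'rV[R]_n * R => q.2)); [exact: cvg_snd|exact: clamp_cont].
apply: cvgM.
  elim: m => [|m IH].
    by apply: cvg_eq1 (cvg_cst _) => q /=; rewrite expr0.
  by apply: (@cvg_eq1 _ _ _ (fun q : 'rV[R]_n * R => clamp q.2 * clamp q.2 ^+ m));
    [move=> q; rewrite exprS|rewrite /= exprS; exact: cvgM].
apply: (cvg_cont (f := fun q : 'rV[R]_n * R => p + clamp q.2 *: (q.1 - p)) (L := k)).
  apply: cvgD; first exact: cvg_cst.
  by apply: cvgZ => //; apply: cvgB; [exact: cvg_fst|exact: cvg_cst].
by apply: (sm_cont ks); exact: Oray.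
Qed.

Lemma continuous_prim_smooth (k : 'rV[R]_n -> R^o) : smo O k ->
  smo O (fun u => prim (fun t => k (p + clamp t *: (u - p))) 1 : R^o).
Proof.
move=> ks.
(* Each derivative in [u] brings out one more factor [clamp t], hence the power [m]. *)
pose P (B : 'rV[R]_n -> R -> R^o) := exists m k, smo O k /\
  B = fun u t => clamp t ^+ m * k (p + clamp t *: (u - p)).
have cslice m k' u : smo O k' -> O u ->
    continuous (fun t => clamp t ^+ m * k' (p + clamp t *: (u - p)) : R).
  by move=> ks' Ou t; exact: (cont_slice (@ray_cont m k' u t ks' Ou)).
pose K01 : set R := `[0 : R, 1]%classic.
apply: (@param_smooth R _ R^o R^o R (fun f => prim f 1) (fun f => continuous (f : R -> R))
  [set K01] (fun _ _ => True) _ _ _ _ _ _ O P (fun u t => k (p + clamp t *: (u - p)))) => //.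
- move=> r f g fc gc t; apply: cvgD; last exact: gc.
  by apply: cvgZl_tmp; exact: fc.
- move=> r f g fc gc.
  by apply: prim_lin => //; rewrite normr1 ltr1n.
- by move=> _ _ -> ->; rewrite setUid.
- move=> _ ->; exists 1 => // f M fc _ M0 fM.
  have a1 : `|1 : R| < 2 by rewrite normr1 ltr1n.
  have := @prim_bnd R f 1 M fc a1.
  rewrite normr1 mul1r; apply => s s01.
  by rewrite mulr1; apply: fM; rewrite /K01 /= in_itv.
- move=> B [m [k' [ks' ->]]]; split.
  + by move=> u Ou; exact: cslice.
  + by move=> u _; exists K01; [by []|exact: (@filterT _ (nbhs u))].
  + move=> u K e Ou -> e0.
    apply: (@tube_lemma 'rV[R]_n R R^o K01 (fun u t => clamp t ^+ m * k' (p + clamp t *: (u - p))) u e) => //.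
      exact: segment_compact.
    by move=> t _; exact: ray_cont.
  + move=> v; exists (fun u t => clamp t ^+ m.+1 * dd k' v (p + clamp t *: (u - p))).
      by exists m.+1, (dd k' v); split=> //; exact: sm_dd.
    move=> u t K Ou _ _.
    have h := @dirderZ R _ _ k' _ v _ (clamp t) (@sm_dirder R _ _ O k' _ v oO ks' (@Oray t u Ou)).
    have h2 : clamp t ^+ m *: (s^-1 *: (k' (p + clamp t *: (u - p) + s *: (clamp t *: v)) -
        k' (p + clamp t *: (u - p)))) @[s --> (0 : R)^'] -->
        clamp t ^+ m *: (clamp t *: dd k' v (p + clamp t *: (u - p))).
      by apply: cvgZl_tmp; exact: h.
    rewrite (_ : clamp t ^+ m.+1 * _ = clamp t ^+ m *: (clamp t *: dd k' v (p + clamp t *: (u - p)))).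
      apply: cvg_eq1 h2 => s /=.
      have -> : p + clamp t *: (u + s *: v - p) =
          p + clamp t *: (u - p) + s *: (clamp t *: v).
        by rewrite addrAC scalerDr !scalerA [s * _]mulrC addrA.
      by rewrite -mulrBr /GRing.scale /= mulrCA.
    by rewrite exprSr -mulrA.
exists 0%N, k; split=> //.
by apply/funext => u; apply/funext => t; rewrite expr0 mul1r.
Qed.

(** [q i u] is the integral over [[0, 1]] of the i-th partial derivative of [h] along the segment
    from [p] to [u]; at [u = p] the integrand is constant. *)
Lemma hadamard (h : 'rV[R]_n -> R^o) : smo O h ->
  exists q : 'I_n -> 'rV[R]_n -> R^o,
  [/\ forall i, smo O (q i),
      forall u, O u -> h u = h p + \sum_(i < n) (u - p) 0 i * q i u &
      forall i, q i p = dd h (delta_mx 0 i) p].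
Proof.
move=> hs; pose k i := dd h (delta_mx 0 i).
have ks i : smo O (k i) by exact: sm_dd.
exists (fun i u => prim (fun t => k i (p + clamp t *: (u - p))) 1); split.
- by move=> i; exact: continuous_prim_smooth.
- move=> u Ou; pose L := \sum_(i < n) (u - p) 0 i * prim (fun t => k i (p + clamp t *: (u - p))) 1.
  (* The derivative of [D] vanishes on [[0, 1]], so [D 1 = D 0], which is the asserted expansion. *)
  pose D (s : R) : R^o := h (p + s *: (u - p)) -
     \sum_(i < n) (u - p) 0 i * prim (fun t => k i (p + clamp t *: (u - p))) s.
  have kc i : continuous (fun t => k i (p + clamp t *: (u - p)) : R).
    rewrite (_ : (fun t => _) = fun t => clamp t ^+ 0 * k i (p + clamp t *: (u - p))).
      by move=> t; exact: (cont_slice (@ray_cont 0 (k i) u t (ks i) Ou)).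
    by apply/funext => t; rewrite expr0 mul1r.
  have D0 : D 0 = h p.
    rewrite /D scale0r addr0 big1 ?subr0// => i _.
    by have [-> _] := primP (kc i); rewrite mulr0.
  have D1 : D 1 = h u - L by rewrite /D scale1r [p + _]addrC subrK.
  suff : `|D 1 - D 0| <= 0.
    by rewrite normr_le0 D0 D1 subr_eq0 => /eqP <-; rewrite subrK.
  apply: (@mean_value_ineq _ R^o D) => s s01; exists 0; last by rewrite normr0.
  have sE := clamp_id s01.
  have Os : O (p + s *: (u - p)) by rewrite -sE; exact: Oray.
  have s2 : `|s| < 2.
    by case/andP: s01 => s0 s1; rewrite ger0_norm// (le_lt_trans s1)// ltr1n.
  have dh := @sm_dirder R _ _ O h _ (u - p) oO hs Os.
  have dk i : dirder (prim (fun t => k i (p + clamp t *: (u - p))) : R^o -> R^o) s (1 : R^o)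
      (k i (p + s *: (u - p))).
    by have [_ /(_ s s2)] := primP (kc i); rewrite sE.
  have ds : t^-1 *: (\sum_(i < n) (u - p) 0 i * prim (fun t => k i (p + clamp t *: (u - p))) (s + t *: (1 : R^o)) -
      \sum_(i < n) (u - p) 0 i * prim (fun t => k i (p + clamp t *: (u - p))) s : R^o)
      @[t --> (0 : R)^'] --> (\sum_(i < n) (u - p) 0 i *: k i (p + s *: (u - p)) : R^o).
    apply: (@cvg_eq1 _ _ _ (fun t : R => \sum_(i < n) (u - p) 0 i *:
        (t^-1 *: (prim (fun t => k i (p + clamp t *: (u - p))) (s + t *: (1 : R^o)) -
        prim (fun t => k i (p + clamp t *: (u - p))) s) : R^o) : R^o)); last first.
      by apply: cvg_bigsum => i; apply: cvgZl_tmp; exact: dk.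
    move=> t /=; rewrite -sumrB scaler_sumr; apply: eq_bigr => i _.
    by rewrite /GRing.scale /=; ring.
  have E0 : dd h (u - p) (p + s *: (u - p)) -
      (\sum_(i < n) (u - p) 0 i *: k i (p + s *: (u - p)) : R^o) = 0.
    by rewrite (dd_rowE _ oO hs Os) subrr.
  rewrite /is_dirder -[X in _ --> X]E0.
  apply: cvg_eq1 (cvgB dh ds) => t /=; rewrite /D -scalerBr; congr (_ *: _).
  have -> : t *: (1 : R^o) = t by rewrite /GRing.scale /= mulr1.
  rewrite scalerDl addrA; ring.
- move=> i; rewrite (_ : (fun t => _) = fun=> k i p).
    by rewrite prim_cst ?mulr1// normr1 ltr1n.
  by apply/funext => t; rewrite subrr scaler0 addr0.
Qed.
End Hadamard.

(** * Left-invariant derivatives *)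

Section LieDerivative.
Context {R : realType} {n : nat} {G : lieGroupType R n}.
Implicit Types V W : normedModType R.
Implicit Types c d : chart R n G.
Notation dirder := (is_dirder (idfun : R -> R)).

Lemma dirder_slice V V' W (Phi : V * V' -> W) (u : V) (w xi : V') l :
  dirder Phi (u, w) (0, xi) l -> dirder (fun w => Phi (u, w)) w xi l.
Proof.
apply: cvg_trans; apply: near_eq_cvg; apply: nearW => t /=.
by congr (_ *: (Phi _ - _)); congr pair => /=; rewrite scaler0 addr0.
Qed.

Lemma Gsm_mul2 c d : atlas c -> atlas d -> Gsm (chart_img c `*` chart_img d)
  (fun p : 'rV[R]_n * 'rV[R]_n => (chart_inv c p.1 * chart_inv d p.2)%g).
Proof.
move=> ac ad.
have oO : open (chart_img c `*` chart_img d).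
  rewrite openE => -[a b] [/= ca db]; exists (chart_img c, chart_img d) => //=.
  by split; apply: open_nbhs_nbhs; split=> //; exact: chart_imgO.
apply: Gsm_mul => //.
  apply: (@Gsm_comp R n G _ _ (chart_img c) _ (chart_inv c) (fun p => p.1)).
  - exact: fdim_rV.
  - exact: chart_imgO.
  - by move=> p [].
  - exact: Gsm_chart.
  - exact: sm_fst.
apply: (@Gsm_comp R n G _ _ (chart_img d) _ (chart_inv d) (fun p => p.2)).
- exact: fdim_rV.
- exact: chart_imgO.
- by move=> p [].
- exact: Gsm_chart.
- exact: sm_snd.
Qed.

Lemma open_chart2 c d : atlas c -> atlas d -> open (chart_img c `*` chart_img d).
Proof.
move=> ac ad; rewrite openE => -[a b] [/= ca db]; exists (chart_img c, chart_img d) => //=.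
by split; apply: open_nbhs_nbhs; split=> //; exact: chart_imgO.
Qed.

Variables (e : chart R n G) (ae : atlas e) (e1 : chart_dom e 1%g).
Let p1 := chart_map e 1%g.
Let ep1 : chart_img e p1. Proof. exact: chart_imgP. Qed.
Let einv1 : chart_inv e p1 = 1%g. Proof. exact: chart_mapK. Qed.

(** The left-invariant field with value [xi] at 1. Unlike an element of [lieAlg G], it also acts on
    functions with values in a normed space, such as orbit maps. *)
Definition Lder W (xi : 'rV[R]_n) (F : G -> W) (g : G) : W :=
  dd (fun v => F (g * chart_inv e v)%g) xi p1.

Lemma smooth_lslice W (F : G -> W) (g : G) : smooth_map idfun F ->
  smo (chart_img e) (fun v => F (g * chart_inv e v)%g).
Proof.
move=> Fs; have oe := chart_imgO ae; apply: smooth_comp => //.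
by apply: Gsm_mul => //; [exact: Gsm_cst|exact: Gsm_chart].
Qed.

Lemma Lder_dirder W (F : G -> W) g xi : smooth_map idfun F ->
  dirder (fun v => F (g * chart_inv e v)%g) p1 xi (Lder xi F g).
Proof. by move=> Fs; exact: (sm_dirder (chart_imgO ae) (smooth_lslice g Fs) ep1). Qed.

(** In charts this is a partial derivative, in the second variable at [p1], of a jointly smooth
    function [Phi] of two variables. *)
Lemma Lder_smooth W (F : G -> W) xi : smooth_map idfun F -> smooth_map idfun (Lder xi F).
Proof.
move=> Fs c ac; have oe := chart_imgO ae; have oc := chart_imgO ac.
pose Phi (p : 'rV[R]_n * 'rV[R]_n) := F (chart_inv c p.1 * chart_inv e p.2)%g.
have oO := open_chart2 ac ae.
have Phis : smo (chart_img c `*` chart_img e) Phi.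
  by apply: smooth_comp => //; exact: Gsm_mul2.
apply: (@sm_eq _ _ _ _ (fun u => dd Phi (0, xi) (u, p1))) => //.
  move=> u cu; apply/esym/ddE; apply: (@dirder_slice _ _ _ Phi).
  by apply: (sm_dirder oO Phis).
apply: (@sm_comp _ _ _ _ (chart_img c `*` chart_img e) _ (dd Phi (0, xi)) (fun u => (u, p1))) => //.
- by apply: fdim_prod; exact: fdim_rV.
- exact: sm_dd.
- by apply: sm_pair; [exact: sm_id|exact: sm_cst].
Qed.

Lemma Lder_lin W (F K : G -> W) xi r g : smooth_map idfun F -> smooth_map idfun K ->
  Lder xi (fun h => r *: F h + K h) g = r *: Lder xi F g + Lder xi K g.
Proof.
move=> Fs Ks; apply: ddE; have h1 := Lder_dirder (g := g) (xi := xi) Fs; have h2 := Lder_dirder (g := g) (xi := xi) Ks.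
apply: (@cvg_eq1 _ _ _ _ _ _ _ (cvgD (cvgZl_tmp (k := r) h1) h2)) => t /=.
rewrite scalerA [r * _]mulrC -scalerA -scalerDr; congr (_ *: _).
by rewrite scalerBr opprD addrACA.
Qed.

Lemma Lder_mul (F K : G -> R^o) xi g : smooth_map idfun F -> smooth_map idfun K ->
  Lder xi (fun h => F h * K h : R^o) g = Lder xi F g * K g + F g * Lder xi K g.
Proof.
move=> Fs Ks; apply: ddE; have h1 := Lder_dirder (g := g) (xi := xi) Fs; have h2 := Lder_dirder (g := g) (xi := xi) Ks.
have kc : K (g * chart_inv e (p1 + t *: xi))%g @[t --> (0 : R)^'] --> K g.
  have := cvg_cont (L := fun v => K (g * chart_inv e v)%g) (@cvg_line R _ p1 xi)
    (sm_cont (smooth_lslice g Ks) ep1).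
  by rewrite einv1 mulg1.
pose y (t : R) := p1 + t *: xi.
have h1' : (t^-1 * (F (g * chart_inv e (y t))%g - F (g * chart_inv e p1)%g)) * K (g * chart_inv e (y t))%g
    @[t --> (0 : R)^'] --> (Lder xi F g * K g : R) by apply: cvgM => //; exact: h1.
have h2' : F g * (t^-1 * (K (g * chart_inv e (y t))%g - K (g * chart_inv e p1)%g))
    @[t --> (0 : R)^'] --> (F g * Lder xi K g : R).
  by apply: cvgM; [exact: cvg_cst|exact: h2].
apply: cvg_eq1 (cvgD h1' h2') => t /=.
by rewrite einv1 mulg1 /GRing.scale /=; ring.
Qed.

Lemma Lder_row W (F : G -> W) xi g : smooth_map idfun F ->
  Lder xi F g = \sum_(i < n) xi 0 i *: Lder (delta_mx 0 i) F g.
Proof.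
by move=> Fs; apply: (dd_rowE _ (chart_imgO ae)) => //; exact: smooth_lslice.
Qed.

Lemma Lder_translate W (F : G -> W) xi a g :
  Lder xi (fun h => F (a * h)%g) g = Lder xi F (a * g)%g.
Proof. by rewrite /Lder; congr dd; apply/funext => v; rewrite mulgA. Qed.

Lemma smooth_translate W (F : G -> W) a b : smooth_map idfun F ->
  smooth_map idfun (fun h => F (a * h * b)%g).
Proof.
move=> Fs c ac; have oc := chart_imgO ac; apply: smooth_comp => //.
apply: Gsm_mul => //; last exact: Gsm_cst.
by apply: Gsm_mul => //; [exact: Gsm_cst|exact: Gsm_chart].
Qed.

(** The chain rule for a curve of which only its first order behaviour at time 0 is known; this
    applies to integral curves and to curves cut out by charts alike. *)
Lemma Lder_curve W (F : G -> W) xi g (de : R -> G) : smooth_map idfun F ->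
  de t @[t --> (0 : R)^'] --> (1%g : G) ->
  t^-1 *: (chart_map e (de t) - p1) @[t --> (0 : R)^'] --> xi ->
  t^-1 *: (F (g * de t)%g - F g) @[t --> (0 : R)^'] --> Lder xi F g.
Proof.
move=> Fs d1 dxi.
have oe := chart_imgO ae; have ss := smooth_lslice g Fs.
have bco : fbasis (fun i => delta_mx 0 i) (fun i (v : 'rV[R]_n) => v 0 i).
  split.
  - by move=> w; exact: row_sum_delta.
  - by move=> i; exact: coord_continuous.
  - by move=> i r u w; rewrite !mxE.
have := @dirder_curve R _ W n _ _ (fun v => F (g * chart_inv e v)%g)
  (fun i => dd (fun v => F (g * chart_inv e v)%g) (delta_mx 0 i)) p1
  (fun t => chart_map e (de t)) xi bco.
rewrite -/(Lder xi F g) (Lder_row _ _ Fs) => h.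
have := h _ _ dxi; rewrite einv1 mulg1 => {}h.
apply: cvg_trans (h _ _); last 2 first.
- move=> i; have := open_nbhs_nbhs (conj oe ep1); apply: filterS => y Oy.
  exact: (sm_dirder oe ss Oy).
- by move=> i; apply: sm_cont ep1; exact: sm_dd.
apply: near_eq_cvg.
have : \forall t \near (0 : R)^', chart_dom e (de t).
  exact: (d1 _ (open_nbhs_nbhs (conj (chart_domO ae) e1))).
by apply: filterS => t et; rewrite chart_mapK.
Qed.

(** The Maurer-Cartan form in the chart [c]: the coordinate vector [w] at [u], moved to 1 by left
    translation and read in [e]. *)
Definition chart_coef c (w u : 'rV[R]_n) : 'rV[R]_n :=
  dd (fun u' => chart_map e ((chart_inv c u)^-1 * chart_inv c u')%g) w u.

Let two_chart c : atlas c -> exists O, [/\ open O,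
  forall u, chart_img c u -> O (u, u) &
  smo O (fun p : 'rV[R]_n * 'rV[R]_n =>
    chart_map e ((chart_inv c p.1)^-1 * chart_inv c p.2)%g)].
Proof.
move=> ac; have oc := chart_imgO ac; have oO := open_chart2 ac ac.
have gs : Gsm (chart_img c `*` chart_img c) (fun p : 'rV[R]_n * 'rV[R]_n =>
    ((chart_inv c p.1)^-1 * chart_inv c p.2)%g).
  apply: Gsm_mul => //.
    apply: Gsm_inv => //.
    apply: (@Gsm_comp R n G _ _ (chart_img c) _ (chart_inv c) (fun p => p.1)) => //.
    - exact: fdim_rV.
    - by move=> p [].
    - exact: Gsm_chart.
    - exact: sm_fst.
  apply: (@Gsm_comp R n G _ _ (chart_img c) _ (chart_inv c) (fun p => p.2)) => //.
  - exact: fdim_rV.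
  - by move=> p [].
  - exact: Gsm_chart.
  - exact: sm_snd.
exists ((chart_img c `*` chart_img c) `&` (fun p : 'rV[R]_n * 'rV[R]_n =>
    ((chart_inv c p.1)^-1 * chart_inv c p.2)%g) @^-1` chart_dom e); split.
- by apply: open_preim => //; [exact: chart_domO|exact: gs.1].
- by move=> u cu; split=> //=; rewrite mulVg.
- exact: gs.2.
Qed.

Lemma chart_coef_smooth c w : atlas c -> smo (chart_img c) (chart_coef c w).
Proof.
move=> ac; have [Q [Qo Od Os]] := two_chart ac; have oc := chart_imgO ac.
pose Phi (p : 'rV[R]_n * 'rV[R]_n) : 'rV[R]_n :=
  chart_map e ((chart_inv c p.1)^-1 * chart_inv c p.2)%g.
apply: (@sm_eq _ _ _ _ (fun u => dd Phi (0, w) (u, u)) (chart_coef c w) oc).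
  move=> u cu; apply/esym/ddE; apply: (@dirder_slice _ _ _ Phi).
  exact: (sm_dirder Qo Os (Od u cu)).
apply: (@sm_comp _ _ _ _ Q _ (dd Phi (0, w)) (fun u => (u, u)) _ Qo Od).
- by apply: fdim_prod; exact: fdim_rV.
- exact: sm_dd.
- by apply: sm_pair; exact: sm_id.
Qed.

(** Coordinate derivatives are left-invariant ones with variable coefficients: left division by
    [chart_inv c u] turns the coordinate line into a curve through 1, to which [Lder_curve]
    applies. *)
Lemma chart_dirder W (F : G -> W) c (u w : 'rV[R]_n) : atlas c -> chart_img c u ->
  smooth_map idfun F ->
  dirder (fun v => F (chart_inv c v)) u w (Lder (chart_coef c w u) F (chart_inv c u)).
Proof.
move=> ac cu Fs; have [Q [Qo Od Os]] := two_chart ac; have oc := chart_imgO ac.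
have h : t^-1 *: (F (chart_inv c u * ((chart_inv c u)^-1 * chart_inv c (u + t *: w)))%g - F (chart_inv c u))
    @[t --> (0 : R)^'] --> Lder (chart_coef c w u) F (chart_inv c u).
  apply: Lder_curve => //.
    rewrite -[X in _ --> X](mulVg (chart_inv c u)); apply: cvg_mulG; first exact: cvg_cst.
    by apply: (cvg_cont (L := chart_inv c) (@cvg_line R _ u w)); exact: chart_inv_cont.
  have := @dirder_slice _ _ _ (fun p : 'rV[R]_n * 'rV[R]_n =>
    chart_map e ((chart_inv c p.1)^-1 * chart_inv c p.2)%g) u u w _
    (@sm_dirder _ _ _ _ _ _ (0, w) Qo Os (Od u cu)).
  move=> h; have := h; rewrite -(ddE h) /is_dirder /= mulVg; exact.
by apply: cvg_eq1 h => t; rewrite mulgA mulgV mul1g.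
Qed.

End LieDerivative.

(** * The Lie algebra and tangent vectors at 1 *)

Section LieTangent.
Context {R : realType} {n : nat} {G : lieGroupType R n}.
Implicit Types c d : chart R n G.
Notation dirder := (is_dirder (idfun : R -> R)).

Definition cube (p : 'rV[R]_n) (r : R) : set 'rV[R]_n :=
  [set v | forall i, `[p 0 i - r, p 0 i + r]%classic (v ord0 i)].

Lemma cube_compact p r : compact (cube p r).
Proof.
by apply: (@rV_compact R n (fun i => `[p 0 i - r, p 0 i + r]%classic)) => i; exact: segment_compact.
Qed.

Lemma normrV_lt (u : 'rV[R]_n) r : 0 < r -> (forall i, `|u 0 i| < r) -> `|u| < r.
Proof.
move=> r0 ui; rewrite /Num.norm /= mx_normrE; apply/bigmax_ltP; split=> //= -[a i] _ /=.
by rewrite (ord1 a).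
Qed.

Lemma normrV_ge (u : 'rV[R]_n) i : `|u 0 i| <= `|u|.
Proof.
by rewrite [leRHS]/Num.norm /= mx_normrE; apply/bigmax_geP; right; exists (0, i).
Qed.

Lemma cube_ball p r rho : 0 < rho -> r < rho -> cube p r `<=` ball p rho.
Proof.
move=> rho0 rr v vc; rewrite -ball_normE /= distrC; apply: normrV_lt => // i.
have := vc i; rewrite /= in_itv /= => /andP[h1 h2].
rewrite !mxE (le_lt_trans _ rr)// ler_norml lerBlDr lerBrDr.
by rewrite addrC h1 addrC h2.
Qed.

Lemma bump_out_cube p r v : 0 < r -> ~ cube p r v -> bump p r v = 0.
Proof.
move=> r0 nc; apply/eqP; rewrite eq_le bump_ge0 andbT leNgt bump_gt0//.
apply/negP => vp; apply: nc => i /=; rewrite in_itv /=.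
have := le_lt_trans (normrV_ge (v - p) i) vp; rewrite !mxE ltr_norml.
move=> /andP[]; change (v ord0 i) with (v 0 i); move: (v 0 i) (p 0 i) => a b h1 h2.
by apply/andP; split; lra.
Qed.

Lemma chart_ball c g (N : set G) : atlas c -> chart_dom c g -> open N -> N g ->
  exists2 rho : R, 0 < rho & forall u, ball (chart_map c g) rho u ->
    chart_img c u /\ N (chart_inv c u).
Proof.
move=> ac cg oN Ng.
have oQ : open (chart_img c `&` chart_inv c @^-1` N).
  by apply: open_preim => //; [exact: chart_imgO|move=> u; exact: chart_inv_cont].
have Qg : (chart_img c `&` chart_inv c @^-1` N) (chart_map c g).
  by split; [exact: chart_imgP|rewrite /= chart_mapK].
have /nbhs_ballP[rho /= rho0 rhoP] := open_nbhs_nbhs (conj oQ Qg).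
by exists rho => // u /rhoP.
Qed.

Lemma smooth_bump_ext c p rho r (W : normedModType R) (h : 'rV[R]_n -> W) : atlas c ->
  0 < r -> r < rho -> ball p rho `<=` chart_img c -> smo (ball p rho) h ->
  smooth_map idfun (chart_ext c (ball p rho) (fun u => bump p r u *: h u)).
Proof.
move=> ac r0 rr Oc hs.
have oB : open (ball p rho) by exact: ball_open.
apply: (@smooth_chart_ext _ _ _ _ _ _ (cube p r)) => //.
- exact: cube_compact.
- by apply: cube_ball => //; exact: lt_trans rr.
- by move=> u _ nc; rewrite bump_out_cube// scale0r.
- by apply: sm_scale => //; apply: sm_sub (sm_bump p r).
Qed.

Lemma G_bump (g : G) (N : set G) : open N -> N g ->
  exists (chi : G -> R^o) (K : set G), [/\ smooth_map idfun chi, 0 < (chi g : R),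
    forall h, 0 <= (chi h : R), compact K /\ K `<=` N & forall h, ~ K h -> chi h = 0].
Proof.
move=> oN Ng; have [c ac cg] := atlas_cover g.
have [rho rho0 rhoP] := chart_ball ac cg oN Ng.
set p := chart_map c g in rhoP *.
have r0 : 0 < rho / 2 by exact: divr_gt0.
have rr : rho / 2 < rho by rewrite ltr_pdivrMr// ltr_pMr// ltr1n.
have Oc : ball p rho `<=` chart_img c by move=> u /rhoP[].
exists (chart_ext c (ball p rho) (fun u => bump p (rho / 2) u *: (1 : R^o))),
  (chart_inv c @` cube p (rho / 2)); split.
- by apply: smooth_bump_ext => //; exact: sm_cst.
- rewrite /chart_ext asboolT; last by split=> //; exact: ballxx.
  by rewrite /GRing.scale /= mulr1 bump_gt0// subrr normr0.
- move=> h; rewrite /chart_ext; case: asboolP => // _.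
  by rewrite /GRing.scale /= mulr1 bump_ge0.
- split.
    have h : cube p (rho / 2) `<=` chart_img c.
      by move=> u up; apply: Oc; exact: cube_ball up.
    exact: (compact_chart ac h (@cube_compact p _)).
  move=> _ [u up <-]; suff : ball p rho u by move=> /rhoP[].
  exact: cube_ball up.
- move=> h nK; rewrite /chart_ext; case: asboolP => // -[ch Oh].
  rewrite bump_out_cube ?scale0r// => kh; apply: nK; exists (chart_map c h) => //.
  exact: chart_mapK.
Qed.

Lemma smoothfun_smooth (f : smoothfun G) : smooth_map idfun (f : G -> R^o).
Proof. by apply/asboolP; exact: smoothfunP. Qed.

Lemma smooth_real_in (f : G -> R^o) : smooth_map idfun f -> f \in @smooth_real R n G.
Proof. by move=> fs; apply/asboolP. Qed.

Definition mk_smooth (f : G -> R^o) (fs : smooth_map idfun f) : smoothfun G :=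
  SmoothFun (smooth_real_in fs).

Variables (e : chart R n G) (ae : atlas e) (e1 : chart_dom e 1%g).
Let p1 := chart_map e 1%g.
Notation Ld := (Lder e).

Definition Lder_sf (xi : 'rV[R]_n) (f : smoothfun G) : smoothfun G :=
  mk_smooth (Lder_smooth ae e1 xi (smoothfun_smooth f)).

Lemma Lder_sf_derivation xi : left_invariant_derivation (Lder_sf xi).
Proof.
split.
- move=> r f g; apply/val_inj/funext => x /=.
  exact: (Lder_lin ae e1 _ _ _ (smoothfun_smooth f) (smoothfun_smooth g)).
- move=> f g; apply/val_inj/funext => x /=.
  exact: (Lder_mul ae e1 _ _ (smoothfun_smooth f) (smoothfun_smooth g)).
- move=> a f h fh g /=; rewrite -Lder_translate; congr Lder.
  by apply/funext => x; exact: fh.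
Qed.

(** Turns a tangent vector into an element of the Lie algebra, so that chart derivatives can be
    expressed by the derived representation. *)
Definition lie_of (xi : 'rV[R]_n) : lieAlg G :=
  LieAlg (introT (asboolP _) (Lder_sf_derivation xi) : Lder_sf xi \in @lie_pred R n G).

Lemma lie_ofE xi (f : smoothfun G) g : lie_of xi f g = Ld xi (f : G -> R^o) g.
Proof. by []. Qed.

(* A point derivation is a directional derivative: by Hadamard's lemma, the
   square of a bump function times [f - f 1] is a sum of products of two
   smooth functions, the first of which vanishes at the point. *)
Lemma lie_tangent (x : lieAlg G) :
  exists xi, forall (f : smoothfun G) g, x f g = Ld xi (f : G -> R^o) g.
Proof.
have /asboolP[xl xL xi] := lieAlgP x.
have [rho rho0 rhoP] := chart_ball ae e1 openT I.
have r0 : 0 < rho / 2 by exact: divr_gt0.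
have rr : rho / 2 < rho by rewrite ltr_pdivrMr// ltr_pMr// ltr1n.
have Oc : ball p1 rho `<=` chart_img e by move=> u /rhoP[].
pose b := bump p1 (rho / 2).
pose ext (h : 'rV[R]_n -> R^o) := chart_ext e (ball p1 rho) (fun u => b u *: h u).
have exts h : smo (ball p1 rho) h -> smooth_map idfun (ext h).
  by move=> hs; exact: smooth_bump_ext.
have ext1 h : ext h 1%g = b p1 * h p1.
  by rewrite /ext /chart_ext asboolT//; split=> //; exact: ballxx.
have b1 : b p1 != 0 by rewrite gt_eqF// bump_gt0// subrr normr0.
pose chi := mk_smooth (exts _ (sm_cst (ball p1 rho) (1 : R^o))).
have chi1 : chi 1%g = b p1 by rewrite /= ext1 mulr1.
have cs i : smo (ball p1 rho) (fun u => u 0 i - p1 0 i : R^o).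
  by apply: sm_add; [exact: sm_coord|exact: sm_cst].
pose co i := mk_smooth (exts _ (cs i)).
have co1 i : co i 1%g = 0 by rewrite /= ext1 subrr mulr0.
(* The forced choice: [co i] is the i-th coordinate centred at 1 times a bump, so its derivative at
   1 is the i-th component times [b p1]. *)
pose v : 'rV[R]_n := \row_i (x (co i) 1%g / b p1).
exists v => f g.
(* By left invariance it is enough to evaluate at 1, after translating [f]. *)
pose fg := mk_smooth (smooth_translate g 1%g (smoothfun_smooth f)).
have fgE h : fg h = f (g * h)%g by rewrite /= mulg1.
have <- : x fg 1%g = x f g by rewrite (xi g f fg)// mulg1.
have -> : Ld v (f : G -> R^o) g = Ld v (fg : G -> R^o) 1%g.
  rewrite -[g in LHS]mulg1 -Lder_translate; congr Lder.
  by apply/funext => h; rewrite -fgE.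
move: fg {fgE} => h {f g}.
have hs : smo (ball p1 rho) (fun u => h (chart_inv e u) : R^o).
  exact: sm_sub Oc (smoothfun_smooth h ae).
have [q [qs qE q1]] := hadamard hs.
pose Q i := mk_smooth (exts _ (qs i)).
have xS (I : Type) (r : seq I) (F : I -> smoothfun G) : x (\sum_(i <- r) F i) = \sum_(i <- r) x (F i).
  have xD f g : x (f + g) = x f + x g by rewrite -[f in LHS]scale1r xl scale1r.
  have x0 : x 0 = 0 by have := xD 0 0; rewrite addr0 -[LHS]addr0 => /addrI.
  by apply: (big_morph _ xD x0).
have sfS (I : Type) (r : seq I) (F : I -> smoothfun G) g :
    (\sum_(i <- r) F i : smoothfun G) g = \sum_(i <- r) F i g.
  by elim/big_rec2 : _ => // i y1 y2 _ <-.
(* The square of [chi] appears because [co i] and [Q i] each carry a factor [b]; outside the ball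
   all terms vanish. *)
have key : smooth_mul (smooth_mul chi chi) h =
    h 1%g *: smooth_mul chi chi + \sum_i smooth_mul (co i) (Q i).
  apply/val_inj/funext => g.
  change (chi g * chi g * h g = h 1%g * (chi g * chi g) + (\sum_i smooth_mul (co i) (Q i) : smoothfun G) g).
  rewrite sfS.
  have [[eg Og]|ng] := pselect (chart_dom e g /\ ball p1 rho (chart_map e g)).
    have extg k : ext k g = b (chart_map e g) * k (chart_map e g).
      by rewrite /ext /chart_ext asboolT.
    have -> : chi g = b (chart_map e g) by rewrite /= extg mulr1.
    have := qE _ Og; rewrite /= !chart_mapK// => ->.
    rewrite mulrDr mulr_sumr mulrC; congr (_ + _); apply: eq_bigr => i _.
    change (b (chart_map e g) * b (chart_map e g) *
      ((chart_map e g - p1) 0 i * q i (chart_map e g)) = ext (fun u => u 0 i - p1 0 i) g * ext (q i) g).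
    by rewrite !extg !mxE; ring.
  have extg k : ext k g = 0 by rewrite /ext /chart_ext asboolF.
  have -> : chi g = 0 by rewrite /= extg.
  rewrite !mul0r mulr0 add0r big1// => i _.
  by change (ext (fun u => u 0 i - p1 0 i) g * ext (q i) g = 0); rewrite extg mul0r.
have xk : x (smooth_mul (smooth_mul chi chi) h) 1%g =
  h 1%g * x (smooth_mul chi chi) 1%g + \sum_i x (co i) 1%g * (b p1 * q i p1).
  rewrite key xl xS.
  change (h 1%g * x (smooth_mul chi chi) 1%g + (\sum_i x (smooth_mul (co i) (Q i)) : smoothfun G) 1%g =
   h 1%g * x (smooth_mul chi chi) 1%g + \sum_i x (co i) 1%g * (b p1 * q i p1)).
  congr (_ + _); rewrite sfS; apply: eq_bigr => i _; rewrite xL.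
  change (x (co i) 1%g * ext (q i) 1%g + co i 1%g * x (Q i) 1%g = x (co i) 1%g * (b p1 * q i p1)).
  by rewrite co1 mul0r addr0 ext1.
have : x (smooth_mul (smooth_mul chi chi) h) 1%g =
    x (smooth_mul chi chi) 1%g * h 1%g + (chi 1%g * chi 1%g) * x h 1%g.
  by rewrite xL.
rewrite xk mulrC chi1 => /addrI e2.
have : x h 1%g = (b p1 * b p1)^-1 * \sum_i x (co i) 1%g * (b p1 * q i p1).
  by rewrite e2 mulKf// mulf_neq0.
move=> ->; rewrite (Lder_row ae e1 _ _ (smoothfun_smooth h)) mulr_sumr.
apply: eq_bigr => i _; rewrite q1 mxE /Lder.
have -> : (fun v => h (1 * chart_inv e v)%g : R^o) = (fun u => h (chart_inv e u) : R^o).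
  by apply/funext => u; rewrite mul1g.
rewrite /GRing.scale /=.
by field.
Qed.

End LieTangent.

(** * Integral curves and the exponential map *)

Section IntegralCurves.
Context {R : realType} {n : nat} {G : lieGroupType R n}.
Implicit Types c d : chart R n G.
Notation dirder := (is_dirder (idfun : R -> R)).
Variables (e : chart R n G) (ae : atlas e) (e1 : chart_dom e 1%g).
Let p1 := chart_map e 1%g.
Let ep1 : chart_img e p1. Proof. exact: chart_imgP. Qed.
Let einv1 : chart_inv e p1 = 1%g. Proof. exact: chart_mapK. Qed.
Notation Ld := (Lder e).

Definition tangent_curve (xi : 'rV[R]_n) (de : R -> G) : Prop :=
  de t @[t --> (0 : R)^'] --> (1%g : G) /\
  t^-1 *: (chart_map e (de t) - p1) @[t --> (0 : R)^'] --> xi.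

Lemma cvg_row (T : Type) (F : set_system T) (f : T -> 'rV[R]_n) (l : 'rV[R]_n) : Filter F ->
  (forall i, f t 0 i @[t --> F] --> (l 0 i : R)) -> f t @[t --> F] --> l.
Proof.
move=> FF h; rewrite [X in _ --> X](row_sum_delta l).
apply: (@cvg_eq1 _ _ _ (fun t => \sum_(i < n) f t 0 i *: delta_mx 0 i)).
  by move=> t; rewrite -row_sum_delta.
by apply: cvg_bigsum => i; apply: cvgZr_tmp; exact: h.
Qed.

(** Bump functions force the curve into every neighbourhood of 1. A coordinate times a bump then
    gives the velocity, after division by the bump, which does not vanish near 1. *)
Lemma tangent_curveP xi (de : R -> G) :
  (forall f : G -> R^o, smooth_map idfun f ->
     t^-1 *: (f (de t) - f 1%g) @[t --> (0 : R)^'] --> Ld xi f 1%g) ->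
  tangent_curve xi de.
Proof.
move=> H.
have fc (f : G -> R^o) : smooth_map idfun f -> f (de t) @[t --> (0 : R)^'] --> (f 1%g : R).
  move=> fs.
  have h : t * (t^-1 *: (f (de t) - f 1%g) : R) @[t --> (0 : R)^'] --> (0 * Ld xi f 1%g : R).
    by apply: cvgM; [exact: cvg_within|exact: (H f fs)].
  rewrite mul0r in h.
  rewrite -[X in _ --> X]add0r; apply: cvg_trans (cvgD h (cvg_cst (f 1%g : R))).
  apply: near_eq_cvg; apply/dnbhs0P; exists 1 => // t t0 _ /=.
  change (t * (t^-1 * (f (de t) - f 1%g)) + f 1%g = f (de t)).
  by rewrite mulrA mulfV// mul1r subrK.
have d1 : de t @[t --> (0 : R)^'] --> (1%g : G).
  move=> A; rewrite nbhsE => -[N [oN N1] NA].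
  have [chi [K [cs c1 _ [cK KN] c0]]] := G_bump oN N1.
  have h : \forall t \near (0 : R)^', 0 < (chi (de t) : R).
    exact: (cvgr_gt _ (fc chi cs)).
  apply: filterS h => t ct; apply/NA/KN; apply: contrapT => nK.
  by move: ct; rewrite c0// ltxx.
split=> //; apply: cvg_row => i.
have [rho rho0 rhoP] := chart_ball ae e1 openT I.
have r0 : 0 < rho / 2 by exact: divr_gt0.
have rr : rho / 2 < rho by rewrite ltr_pdivrMr// ltr_pMr// ltr1n.
have Oc : ball p1 rho `<=` chart_img e by move=> u /rhoP[].
pose b := bump p1 (rho / 2).
have cs : smo (ball p1 rho) (fun u => u 0 i - p1 0 i : R^o).
  by apply: sm_add; [exact: sm_coord|exact: sm_cst].
have fs := smooth_bump_ext ae r0 rr Oc cs.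
set f := chart_ext _ _ _ in fs.
have fE h : chart_dom e h -> ball p1 rho (chart_map e h) ->
    f h = b (chart_map e h) * (chart_map e h 0 i - p1 0 i).
  by move=> eh Oh; rewrite /f /chart_ext asboolT.
have f1 : f 1%g = 0.
  by rewrite fE//; [rewrite subrr mulr0|exact: ballxx].
have b1 : b p1 != 0 by rewrite gt_eqF// bump_gt0// subrr normr0.
have bc : {for p1, continuous b} by apply: (sm_cont (@sm_bump R n p1 (rho / 2))).
have Lf : Ld xi f 1%g = b p1 * xi 0 i.
  apply: ddE; rewrite /is_dirder mul1g -/p1 einv1 f1.
  have h : b (p1 + t *: xi) * xi 0 i @[t --> (0 : R)^'] --> (b p1 * xi 0 i : R).
    apply: cvgM; last exact: cvg_cst.
    by apply: (cvg_cont (L := b)) => //; exact: cvg_line.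
  apply: cvg_trans h; apply: near_eq_cvg.
  have : \forall t \near (0 : R)^', ball p1 rho (p1 + t *: xi).
    by apply: (cvg_nbhs (@cvg_line R _ p1 xi)); exact: nbhsx_ballx.
  have : \forall t \near (0 : R)^', t != 0 by apply/dnbhs0P; exists 1.
  apply: filterS2 => t t0 Ot; rewrite mul1g fE ?chart_invK//; last 3 first.
  - exact: Oc.
  - by apply: chart_inv_dom => //; exact: Oc.
  - exact: Oc.
  rewrite subr0 !mxE [p1 0 i + _]addrC addrK /GRing.scale /=.
  by rewrite mulrCA mulKf.
have ec : chart_map e (de t) @[t --> (0 : R)^'] --> p1.
  by apply: (cvg_cont (L := chart_map e) d1); exact: chart_map_cont.
have bdc : b (chart_map e (de t)) @[t --> (0 : R)^'] --> (b p1 : R).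
  exact: (cvg_cont (L := b) ec bc).
have -> : xi 0 i = (b p1)^-1 * Ld xi f 1%g by rewrite Lf mulKf.
have h : (b (chart_map e (de t)))^-1 * (t^-1 * (f (de t) - f 1%g))
    @[t --> (0 : R)^'] --> ((b p1)^-1 * Ld xi f 1%g : R).
  by apply: cvgM; [exact: cvgV|exact: (H f fs)].
apply: cvg_trans h; apply: near_eq_cvg.
have dome : \forall t \near (0 : R)^', chart_dom e (de t).
  exact: (d1 _ (open_nbhs_nbhs (conj (chart_domO ae) e1))).
have inb : \forall t \near (0 : R)^', ball p1 rho (chart_map e (de t)).
  by apply: (cvg_nbhs ec); exact: nbhsx_ballx.
have bn0 : \forall t \near (0 : R)^', 0 < (b (chart_map e (de t)) : R).
  by apply: (cvgr_gt _ bdc); rewrite bump_gt0// subrr normr0.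
apply: filterS3 dome inb bn0 => t et Ot bt.
rewrite /= f1 subr0 fE// !mxE /GRing.scale /=.
by rewrite mulrCA mulKf// gt_eqF.
Qed.

Variables (x : lieAlg G) (xi : 'rV[R]_n).
Hypothesis x_xi : forall (f : smoothfun G) g, x f g = Ld xi (f : G -> R^o) g.

Lemma integral_curve_tangent (gam : R -> G) t : integral_curve x gam ->
  tangent_curve xi (fun s => (gam t)^-1 * gam (t + s))%g.
Proof.
move=> [g0 gD]; apply: tangent_curveP => f fs.
pose k := mk_smooth (smooth_translate ((gam t)^-1)%g 1%g fs).
have h := is_derive_dirder (gD t k); have kE g : k g = f ((gam t)^-1 * g)%g by rewrite /= mulg1.
have E1 : f 1%g = k (gam t) by rewrite kE mulVg.
have -> : Ld xi f 1%g = x k (gam t).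
  have kf : f = (fun u => k (gam t * u)%g).
    by apply/funext => u; rewrite kE mulgA mulVg mul1g.
  rewrite x_xi [X in Ld xi X _]kf (Lder_translate e (smoothfun_val k) xi (gam t)).
  by rewrite (mulg1 (gam t)).
apply: cvg_eq1 h => s; rewrite E1 -kE; congr (_ *: (k (gam (t + _)) - _)).
by rewrite /GRing.scale /= mulr1.
Qed.

Lemma smooth_separates (g : G) : (forall f : G -> R^o, smooth_map idfun f -> f g = f 1%g) ->
  g = 1%g.
Proof.
move=> H; apply: contrapT => /eqP g1.
have clg : closed [set g] by apply: (@accessible_closed_set1 G); exact/hausdorff_accessible/lie_hausdorff.
have [|chi [K [cs c1 _ [cK KN] c0]]] := G_bump (closed_openC clg) (g := 1%g).
  by move=> /= /esym/eqP; exact/negP.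
have := H chi cs; rewrite c0; first by move=> e0; move: c1; rewrite -e0 ltxx.
by move=> /KN /=; apply.
Qed.

(* The curve [g1 g2^-1] is constant: it is differentiable with derivative 0
   because both factors have the same velocity. *)
Lemma integral_curve_unique (g1 g2 : R -> G) : integral_curve x g1 ->
  integral_curve x g2 -> g1 = g2.
Proof.
move=> h1 h2.
have bco := fdim_prod (@fdim_rV R n) (@fdim_rV R n).
have [d [b [co bc]]] := bco.
have oe := chart_imgO ae; have oO := open_chart2 ae ae.
suff H t : (g1 t * (g2 t)^-1)%g = 1%g.
  by apply/funext => t; rewrite -[LHS]mulg1 -(mulVg (g2 t)) mulgA H mul1g.
apply: smooth_separates => f fs.
pose D (t : R) : R^o := f (g1 t * (g2 t)^-1)%g.
have D0 s : dirder (D : R^o -> R^o) s (1 : R^o) 0.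
  pose Phi (p : 'rV[R]_n * 'rV[R]_n) : R^o :=
    f (g1 s * (chart_inv e p.1 * (chart_inv e p.2)^-1) * (g2 s)^-1)%g.
  have Phis : smo (chart_img e `*` chart_img e) Phi.
    apply: smooth_comp => //; apply: Gsm_mul => //; last exact: Gsm_cst.
    apply: Gsm_mul => //; first exact: Gsm_cst.
    apply: Gsm_mul => //.
      apply: (@Gsm_comp R n G _ _ (chart_img e) _ (chart_inv e) (fun p => p.1)) => //.
      - exact: fdim_rV.
      - by move=> p [].
      - exact: Gsm_chart.
      - exact: sm_fst.
    apply: Gsm_inv => //.
    apply: (@Gsm_comp R n G _ _ (chart_img e) _ (chart_inv e) (fun p => p.2)) => //.
    - exact: fdim_rV.
    - by move=> p [].
    - exact: Gsm_chart.
    - exact: sm_snd.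
  have Op : (chart_img e `*` chart_img e) (p1, p1) by split.
  have curve (de : R -> 'rV[R]_n * 'rV[R]_n) w : t^-1 *: (de t - (p1, p1)) @[t --> (0 : R)^'] --> w ->
      t^-1 *: (Phi (de t) - Phi (p1, p1)) @[t --> (0 : R)^'] -->
      \sum_(i < d) co i w *: dd Phi (b i) (p1, p1).
    move=> hw; apply: (@dirder_curve R _ R^o d b co Phi (fun i => dd Phi (b i)) (p1, p1) de w bc) => //.
    - move=> i; have := open_nbhs_nbhs (conj oO Op); apply: filterS => y Oy.
      exact: (sm_dirder oO Phis Oy).
    - by move=> i; apply: (sm_cont _ Op); exact: sm_dd.
  (* [Phi] is constant on the diagonal, which gives its derivative in the direction [(xi, xi)]
     without computing partial derivatives. The pair of curves leaves [(p1, p1)] with just this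
     velocity. *)
  have L0 : \sum_(i < d) co i (xi, xi) *: dd Phi (b i) (p1, p1) = 0.
    have hc : t^-1 *: ((p1 + t *: xi, p1 + t *: xi) - (p1, p1)) @[t --> (0 : R)^'] -->
        ((xi, xi) : 'rV[R]_n * 'rV[R]_n).
      have : (xi, xi) @[_ --> (0 : R)^'] --> ((xi, xi) : 'rV[R]_n * 'rV[R]_n) by exact: cvg_cst.
      apply: cvg_trans; apply: near_eq_cvg; apply/dnbhs0P; exists 1 => // r r0 _.
      by congr pair; rewrite /= addrC addKr scalerA mulVf// scale1r.
    have := curve _ _ hc => {}hc.
    apply: (cvg_unique (@norm_hausdorff _ _) hc).
    apply: cvg_eq1 (cvg_cst 0) => r; rewrite /Phi /= !mulgV !mulg1.
    by rewrite subrr scaler0.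
  have [a1 a2] := integral_curve_tangent s h1; have [b1 b2] := integral_curve_tangent s h2.
  have hc : t^-1 *: ((chart_map e ((g1 s)^-1 * g1 (s + t))%g, chart_map e ((g2 s)^-1 * g2 (s + t))%g)
      - (p1, p1)) @[t --> (0 : R)^'] --> ((xi, xi) : 'rV[R]_n * 'rV[R]_n).
    exact: (cvg_pair a2 b2).
  have {}hc := curve _ _ hc; rewrite L0 in hc.
  apply: cvg_trans hc; apply: near_eq_cvg.
  have dm1 : \forall t \near (0 : R)^', chart_dom e ((g1 s)^-1 * g1 (s + t))%g.
    exact: (a1 _ (open_nbhs_nbhs (conj (chart_domO ae) e1))).
  have dm2 : \forall t \near (0 : R)^', chart_dom e ((g2 s)^-1 * g2 (s + t))%g.
    exact: (b1 _ (open_nbhs_nbhs (conj (chart_domO ae) e1))).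
  apply: filterS2 dm1 dm2 => r ht1 ht2.
  rewrite /Phi /= !chart_mapK// mulgV mulg1 /D.
  have -> : r *: (1 : R^o) = r by rewrite /GRing.scale /= mulr1.
  congr (_ *: (f _ - _)).
  by rewrite invgM invgK !mulgA mulgV mul1g -!mulgA mulgV mulg1.
have := @mean_value_seg R R^o R^o D 0 t 0 0.
rewrite add0r subr0 /D h1.1 h2.1 invg1 mulg1 => H.
apply/eqP; rewrite -subr_eq0 -normr_le0; apply: H => s _.
exists 0; last by rewrite subr0 normr0.
have -> : (t : R^o) = t *: (1 : R^o) by rewrite /GRing.scale /= mulr1.
by rewrite -[X in is_dirder _ _ _ _ X](scaler0 _ t); exact: dirderZ.
Qed.

End IntegralCurves.

Lemma lipschitz_continuous (R : realType) (V W : normedModType R) (f : V -> W) (L : R) :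
  0 < L -> (forall u v, `|f u - f v| <= L * `|u - v|) -> continuous f.
Proof.
move=> L0 fL u; apply/cvgrPdist_le => e e0; apply/nbhs_ballP.
exists (e / L) => /=; first exact: divr_gt0.
move=> v; rewrite -ball_normE /= => uv; rewrite (le_trans (fL u v))//.
by rewrite mulrC -ler_pdivlMr// ltW.
Qed.

Lemma uniform_limit_cont (R : realType) (T : topologicalType) (W : normedModType R)
    (u : nat -> T -> W) (y : T -> W) :
  (forall k, continuous (u k)) ->
  (forall e, 0 < e -> exists k, forall t, `|u k t - y t| <= e) -> continuous y.
Proof.
move=> uc uy t; apply/cvgrPdist_le => e e0.
have e3 : 0 < e / 3 by exact: divr_gt0.
have [k uk] := uy _ e3.
have /cvgrPdist_le /(_ _ e3) := uc k t; apply: filterS => s its.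
rewrite -(subrKA (u k t)) (le_trans (ler_normD _ _))//.
have h1 : `|y t - u k t| <= e / 3 by rewrite distrC.
have h2 : `|u k t - y s| <= e / 3 + e / 3.
  by rewrite -(subrKA (u k s)) (le_trans (ler_normD _ _))// lerD.
by move: h1 h2; lra.
Qed.

(** * Picard iteration for a Lipschitz field *)

Section Picard.
Context {R : realType} {n : nat}.
Notation dirder := (is_dirder (idfun : R -> R)).
Implicit Types y z : R -> 'rV[R]_n.

Lemma geometric_small (C e : R) : 0 < e -> exists k, C * 2^-1 ^+ k < e.
Proof.
move=> e0; have h : `|2^-1 : R| < 1.
  by rewrite gtr0_norm ?invr_gt0// invf_lt1// ltr1n.
have /cvgrPdist_lt /(_ e e0)[N _ NP] := @cvg_geometric R C _ h.
exists N; have := NP N (leqnn N); rewrite /= sub0r normrN => /(le_lt_trans (ler_norm _)).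
by [].
Qed.

Lemma geometric_limit (u : nat -> R) (C : R) : 0 <= C ->
  (forall k, `|u k.+1 - u k| <= C * 2^-1 ^+ k) ->
  exists l, forall k, `|u k - l| <= (2 * C) * 2^-1 ^+ k.
Proof.
move=> C0 H.
(* The subtracted term is the tail of the geometric series after [k + m] terms; it carries the bound
   through the induction on [m]. *)
have H2 k m : `|u (k + m)%N - u k| <= (2 * C) * 2^-1 ^+ k - (2 * C) * 2^-1 ^+ (k + m).
  elim: m => [|m IH]; first by rewrite addn0 !subrr normr0.
  rewrite addnS -(subrKA (u (k + m)%N)) (le_trans (ler_normD _ _))//.
  have := H (k + m)%N; have -> : (2 * C) * 2^-1 ^+ (k + m).+1 = C * 2^-1 ^+ (k + m).
    by rewrite exprS; field.
  move: IH; have -> : 2 * C * 2^-1 ^+ (k + m) = C * 2^-1 ^+ (k + m) + C * 2^-1 ^+ (k + m) by ring.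
  by lra.
have H3 k m : `|u (k + m)%N - u k| <= (2 * C) * 2^-1 ^+ k.
  by rewrite (le_trans (H2 k m))// gerBl mulr_ge0// ?mulr_ge0// exprn_ge0.
have uc : cvg (u @ \oo).
  apply/cauchy_cvgP/cauchyP => e e0; have [k ke] := geometric_small (2 * C) e0.
  exists (u k); exists k => // m /= km; rewrite -ball_normE /= distrC.
  by rewrite -(subnKC km) (le_lt_trans (H3 _ _)).
exists (lim (u @ \oo)) => k; apply/ler_addgt0Pr => e e0.
have /cvgrPdist_lt /(_ e e0)[N _ NP] := uc.
have := NP (k + N)%N (leq_addl _ _); rewrite /= => h.
rewrite -(subrKA (u (k + N)%N)) (le_trans (ler_normD _ _))// lerD//.
  by rewrite distrC.
by rewrite distrC ltW.
Qed.

Lemma normrV_le (u : 'rV[R]_n) r : 0 <= r -> (forall i, `|u 0 i| <= r) -> `|u| <= r.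
Proof.
move=> r0 ui; apply/ler_addgt0Pr => e e0; apply/ltW.
apply: (@le_lt_trans _ _ (r + e / 2)); last by rewrite ltrD2l ltr_pdivrMr// ltr_pMr// ltr1n.
rewrite ltW//; apply: normrV_lt; first by rewrite ltr_wpDl// divr_gt0.
by move=> i; rewrite (le_lt_trans (ui i))// ltrDl divr_gt0.
Qed.

Variables (X : 'rV[R]_n -> 'rV[R]_n) (p : 'rV[R]_n) (L : R).
Hypotheses (L0 : 0 < L) (XL : forall u v, `|X u - X v| <= L * `|u - v|).
(** The bound [(2 * L)^-1] gives contraction factor 1/2, and the bound 1 stays inside the range on
    which [prim] is a primitive. *)
Let de : R := Num.min 1 (2 * L)^-1.
Let de0 : 0 < de.
Proof. by rewrite lt_min ltr01 invr_gt0 mulr_gt0. Qed.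
Let de1 : de <= 1.
Proof. by rewrite ge_min lexx. Qed.
Let deL : de * L <= 2^-1.
Proof.
rewrite -ler_pdivlMr// -invfM ge_min; apply/orP; right.
by rewrite mulrC.
Qed.
(** Clamped time lets the Picard operator [T] act on functions defined on the whole line, with
    estimates uniform in [t]. *)
Let cl (t : R) : R := Num.max (- de) (Num.min de t).
Let cl_le t : `|cl t| <= de.
Proof.
rewrite ler_norml /cl le_max lexx/= ge_max ge_min lexx/= andbT.
by rewrite ge0_cp// ltW.
Qed.
Let cl2 t : `|cl t| < 2.
Proof. by rewrite (le_lt_trans (cl_le t))// (le_lt_trans de1)// ltr1n. Qed.
Let cl_id t : `|t| <= de -> cl t = t.
Proof. by rewrite ler_norml => /andP[h1 h2]; rewrite /cl (min_idPr h2) (max_idPr h1). Qed.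
Let cl_cont : continuous cl.
Proof.
move=> t; apply: (@continuous_max R R (fun=> - de) (fun t => Num.min de t)).
  exact: cst_continuous.
apply: (@continuous_min R R (fun=> de) (fun t => t)); first exact: cst_continuous.
exact: cvg_id.
Qed.

Let Xc : continuous X.
Proof. exact: (@lipschitz_continuous R 'rV[R]_n 'rV[R]_n X L). Qed.

Let Xyc y i : continuous y -> continuous (fun s => X (y s) 0 i : R).
Proof.
move=> yc s; apply: (cvg_cont (f := fun s => X (y s)) (L := fun v : 'rV[R]_n => v 0 i : R)).
  by apply: (cvg_cont (L := X) (yc s)); exact: Xc.
exact: coord_continuous.
Qed.

Let T y (t : R) : 'rV[R]_n := \row_i (p 0 i + prim (fun s => X (y s) 0 i) (cl t)).

Let Tc y : continuous y -> continuous (T y).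
Proof.
move=> yc t; have h i : T y s 0 i @[s --> t] --> (T y t 0 i : R).
  have [_ /(_ _ (cl2 t)) h] := primP (@Xyc _ i yc).
  have h1 : prim (fun s => X (y s) 0 i) (cl s) @[s --> t] --> prim (fun s => X (y s) 0 i) (cl t).
    exact: (cvg_cont (@cl_cont t) (dirder_cont_R h)).
  rewrite mxE; apply: (@cvg_eq1 _ _ _ (fun t => p 0 i + prim (fun s => X (y s) 0 i) (cl t))).
    by move=> s; rewrite mxE.
  exact: (cvgD (cvg_cst _) h1).
exact: (@cvg_row R n R (nbhs t) (T y) (T y t)).
Qed.

Let T_contract y z (M : R) : continuous y -> continuous z -> 0 <= M ->
  (forall t, `|y t - z t| <= M) -> forall t, `|T y t - T z t| <= 2^-1 * M.
Proof.
move=> yc zc M0 yz t; apply: normrV_le; first by rewrite mulr_ge0.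
move=> i; rewrite !mxE opprD addrACA subrr add0r.
have := @is_prim_bnd _ _ _ _ _ 1 (cl t) (L * M) (primP (@Xyc _ i yc)) (primP (@Xyc _ i zc)) (cl2 t).
rewrite mul1r => h; rewrite (le_trans (h _))//.
  move=> s _; rewrite mul1r; have := normrV_ge (X (y (s * cl t)) - X (z (s * cl t))) i.
  rewrite !mxE => /le_trans; apply; rewrite (le_trans (XL _ _))//.
  by rewrite ler_wpM2l// ltW.
by rewrite mulrA ler_wpM2r// (le_trans _ deL)// ler_wpM2r// ltW.
Qed.

Let it (k : nat) : R -> 'rV[R]_n := iter k T (fun=> p).
Let itc k : continuous (it k).
Proof.
elim: k => [|k IH]; first by move=> t; exact: cst_continuous.
by rewrite /it iterS; exact: Tc.
Qed.

Let it_geo k t : `|it k.+1 t - it k t| <= `|X p| * 2^-1 ^+ k.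
Proof.
elim: k t => [|k IH] t; last first.
  rewrite exprS mulrCA; apply: (@T_contract (it k.+1) (it k)) => //.
rewrite expr0 mulr1; apply: normrV_le => // i; rewrite !mxE addrAC subrr add0r.
rewrite prim_cst// normrM (le_trans (_ : _ <= `|X p| * 1))//.
  by rewrite ler_pM//; [exact: normrV_ge|exact: le_trans (cl_le t) de1].
by rewrite mulr1.
Qed.

(** Successive iterates differ by at most [|X p|] times [2^-k], so their coordinatewise limits are
    approached uniformly; the limit is continuous and fixed by [T]. For [|t| < de] the clamp is the
    identity and the fixed point equation can be differentiated. *)
Lemma picard : exists (d : R) (y : R -> 'rV[R]_n), [/\ 0 < d, y 0 = p, continuous y &
  forall t, `|t| < d -> dirder (y : R^o -> 'rV[R]_n) t (1 : R^o) (X (y t))].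
Proof.
have /choice[y0 y0P] : forall ti : R * 'I_n, exists l, forall k,
    `|it k ti.1 0 ti.2 - l| <= (2 * `|X p|) * 2^-1 ^+ k.
  move=> [t i] /=; apply: geometric_limit => // k.
  rewrite (le_trans _ (it_geo k t))//.
  by have := normrV_ge (it k.+1 t - it k t) i; rewrite !mxE.
pose y t : 'rV[R]_n := \row_i y0 (t, i).
have yP k t : `|it k t - y t| <= (2 * `|X p|) * 2^-1 ^+ k.
  apply: normrV_le => [|i]; first by rewrite !mulr_ge0// exprn_ge0.
  by have := y0P (t, i) k; rewrite !mxE.
have yc : continuous y.
  apply: (@uniform_limit_cont R R 'rV[R]_n it) => [k|e e0]; first exact: itc.
  have [k ke] := geometric_small (2 * `|X p|) e0.
  by exists k => t; rewrite (le_trans (yP k t))// ltW.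
have Ty t : T y t = y t.
  apply/eqP; rewrite -subr_eq0 -normr_le0; apply/ler_addgt0Pr => e e0.
  rewrite add0r; have [k ke] := geometric_small (4 * `|X p|) e0.
  rewrite -(subrKA (it k.+1 t)) (le_trans (ler_normD _ _))//.
  have M0 : 0 <= (2 * `|X p|) * 2^-1 ^+ k by rewrite !mulr_ge0// exprn_ge0.
  have h1 := @T_contract y (it k) _ yc (@itc k) M0 (fun t => le_trans (eq_ind_r (fun x => x <= _) (yP k t) (distrC _ _)) (lexx _)) t.
  have h2 := yP k.+1 t; rewrite exprS in h2.
  move: h1 h2 ke; rewrite -/(it k.+1); move: (2^-1 ^+ k) => q.
  have -> : T (it k) t = it k.+1 t by [].
  by lra.
exists de, y; split => //.
  rewrite -Ty; apply/rowP => i; rewrite mxE cl_id ?normr0 ?ltW//.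
  by have [-> _] := primP (@Xyc _ i yc); rewrite addr0.
move=> t td.
apply: cvg_row => i.
have [_ /(_ t) h] := primP (@Xyc _ i yc).
have t2 : `|t| < 2 by rewrite (lt_trans td)// (le_lt_trans de1)// ltr1n.
apply: cvg_trans (h t2); apply: near_eq_cvg.
have nt : \forall s \near (0 : R)^', `|t + s *: (1 : R^o)| < de.
  have h1 : `|t + s *: (1 : R^o)| @[s --> (0 : R)^'] --> `|t|.
    by apply: cvg_norm; exact: (@cvg_line R R^o t 1).
  exact: (cvg_nbhs h1 (lt_nbhsl td)).
apply: filterS nt => s st.
rewrite -!Ty !mxE !cl_id ?ltW//.
by rewrite opprD addrACA subrr add0r.
Qed.

End Picard.

(** * Global integral curves and one-parameter subgroups *)

Section LieExp.
Context {R : realType} {n : nat} {G : lieGroupType R n}.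
Implicit Types c d : chart R n G.
Notation dirder := (is_dirder (idfun : R -> R)).

Lemma local_lipschitz (W : normedModType R) (O : set 'rV[R]_n) (f : 'rV[R]_n -> W) p :
  open O -> smo O f -> O p -> exists C rho : R, [/\ 0 < C, 0 < rho, ball p rho `<=` O &
    forall u v, ball p rho u -> ball p rho v -> `|f u - f v| <= C * `|u - v|].
Proof.
move=> oO fs Op.
pose K i := `|dd f (delta_mx 0 i) p| + 1.
have K0 i : 0 <= K i by rewrite addr_ge0.
have near_all : \forall y \near p, O y /\ forall i : 'I_n, `|dd f (delta_mx 0 i) y| <= K i.
  apply: filterI; first exact: open_nbhs_nbhs.
  apply: (@filter_forall _ _ _ _ (nbhs_filter p)) => i.
  have h : `|dd f (delta_mx 0 i) y| @[y --> p] --> `|dd f (delta_mx 0 i) p|.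
    have fc : {for p, continuous (dd f (delta_mx 0 i))}.
      by apply: (sm_cont _ Op); exact: sm_dd.
    exact: (cvg_norm fc).
  have h2 : `|dd f (delta_mx 0 i) p| < K i by rewrite ltrDl.
  by have := cvg_nbhs h (lt_nbhsl h2); apply: filterS => y /ltW.
have /nbhs_ballP[rho /= rho0 rhoP] := near_all.
exists (\sum_i K i + 1), rho; split => //.
- by rewrite ltr_wpDl// sumr_ge0.
- by move=> u /rhoP[].
move=> u v; rewrite -ball_normE /= => pu pv.
have -> : u = v + (u - v) by rewrite addrC subrK.
rewrite addrAC subrr add0r -[f (v + _) - f v]subr0.
apply: mean_value_seg => s /andP[s0 s1].
have Os : ball p rho (v + s *: (u - v)).
  rewrite -ball_normE /=.
  have -> : p - (v + s *: (u - v)) = (1 - s) *: (p - v) + s *: (p - u).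
    rewrite scalerBl scale1r !scalerBr !opprD !opprK !addrA.
    by rewrite [RHS](AC 6 (1*2*6*4*(3*5)))/= addNr addr0.
  rewrite (le_lt_trans (ler_normD _ _))// !normrZ (ger0_norm s0) ger0_norm ?subr_ge0//.
  have [->|sn0] := eqVneq s 0; first by rewrite subr0 mul1r mul0r addr0.
  have s00 : 0 < s by rewrite lt_neqAle eq_sym sn0.
  have h1 : (1 - s) * `|p - v| <= (1 - s) * rho by rewrite ler_wpM2l ?subr_ge0// ltW.
  have h2 : s * `|p - u| < s * rho by rewrite ltr_pM2l.
  by rewrite (lt_le_trans (ler_ltD h1 h2))// -mulrDl subrK mul1r.
have [Oy Ky] := rhoP _ Os.
exists (dd f (u - v) (v + s *: (u - v))); first exact: (sm_dirder oO fs).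
rewrite subr0 (dd_rowE _ oO fs Oy) (le_trans (ler_norm_sum _ _ _))//.
rewrite mulrDl mul1r mulr_suml (le_trans (_ : _ <= \sum_i K i * `|u - v|))//.
  apply: ler_sum => i _; rewrite normrZ mulrC.
  by apply: ler_pM => //; exact: normrV_ge.
by rewrite lerDl.
Qed.

Variables (e : chart R n G) (ae : atlas e) (e1 : chart_dom e 1%g).
Let p1 := chart_map e 1%g.
Let ep1 : chart_img e p1. Proof. exact: chart_imgP. Qed.
Let einv1 : chart_inv e p1 = 1%g. Proof. exact: chart_mapK. Qed.
Notation Ld := (Lder e).

Lemma local_integral_curve (xi : 'rV[R]_n) : exists (d : R) (g0 : R -> G),
  [/\ 0 < d, g0 0 = 1%g & forall (f : G -> R^o) t, smooth_map idfun f -> `|t| < d ->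
    dirder (fun s : R^o => f (g0 s) : R^o) t (1 : R^o) (Ld xi f (g0 t))].
Proof.
have oe := chart_imgO ae.
pose M (q : 'rV[R]_n * 'rV[R]_n) := chart_map e (chart_inv e q.1 * chart_inv e q.2)%g.
have ms := Gsm_mul2 ae ae.
pose O2 := (chart_img e `*` chart_img e) `&`
  (fun q : 'rV[R]_n * 'rV[R]_n => (chart_inv e q.1 * chart_inv e q.2)%g) @^-1` chart_dom e.
have oO2 : open O2 by apply: open_preim; [exact: open_chart2|exact: chart_domO|exact: ms.1].
have Ms : smo O2 M by exact: ms.2.
have O2d y : chart_img e y -> O2 (y, p1).
  by move=> ey; split=> //=; rewrite einv1 mulg1; exact: chart_inv_dom.
(* The left-invariant field of [xi] read in the chart [e]: the derivative of the multiplication in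
   its second factor at 1. *)
pose X y := dd M (0, xi) (y, p1).
have Xs : smo (chart_img e) X.
  apply: (@sm_comp _ _ _ _ O2 _ (dd M (0, xi)) (fun u => (u, p1))) => //.
  - by apply: fdim_prod; exact: fdim_rV.
  - exact: sm_dd.
  - by apply: sm_pair; [exact: sm_id|exact: sm_cst].
have [C [rho [C0 rho0 rhoO XL]]] := local_lipschitz oe Xs ep1.
pose r := rho / 2.
have r0 : 0 < r by exact: divr_gt0.
have rr : r < rho by rewrite ltr_pdivrMr// ltr_pMr// ltr1n.
pose cc (a : R) := Num.max (- r) (Num.min r a).
have cc_le a : `|cc a| <= r.
  rewrite ler_norml /cc le_max lexx/= ge_max ge_min lexx/= andbT.
  by rewrite ge0_cp// ltW.
have cc_id a : `|a| <= r -> cc a = a.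
  by rewrite ler_norml => /andP[h1 h2]; rewrite /cc (min_idPr h2) (max_idPr h1).
have cc_lip a b : `|cc a - cc b| <= `|a - b|.
  wlog ab : a b / a <= b.
    by case: (leP a b) => [|/ltW] ab hw; [exact: hw|rewrite distrC [leRHS]distrC; exact: hw].
  rewrite distrC [leRHS]distrC [leRHS]ger0_norm ?subr_ge0//.
  rewrite /cc; case: (leP r a) => ra; case: (leP r b) => rb; try lra.
  - by rewrite subrr normr0 subr_ge0.
  - rewrite (max_idPr _); last by lra.
    by case: (leP (- r) a) => ra'; rewrite ger0_norm; lra.
  - by case: (leP (- r) a) => ra'; case: (leP (- r) b) => rb'; rewrite ger0_norm; lra.
(* A retraction onto the cube of radius [r] around [p1], with Lipschitz constant 1 in the maximum
   norm. Composed with it, [X] becomes globally Lipschitz, as [picard] demands, and is unchanged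
   near [p1]. *)
pose cv (y : 'rV[R]_n) : 'rV[R]_n := \row_i (p1 0 i + cc (y 0 i - p1 0 i)).
have cvO y : ball p1 rho (cv y).
  rewrite -ball_normE /= distrC; apply: normrV_lt => // i.
  by rewrite !mxE [p1 0 i + _]addrC addrK (le_lt_trans (cc_le _)).
have cv_id y : `|y - p1| <= r -> cv y = y.
  move=> yr; apply/rowP => i; rewrite mxE cc_id; first by rewrite addrC subrK.
  by have := le_trans (normrV_ge (y - p1) i) yr; rewrite !mxE.
have XtL u v : `|X (cv u) - X (cv v)| <= C * `|u - v|.
  rewrite (le_trans (XL _ _ (cvO u) (cvO v)))// ler_wpM2l ?(ltW C0)//.
  apply: normrV_le => // i; rewrite !mxE opprD addrACA subrr add0r.
  rewrite (le_trans (cc_lip _ _))//.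
  have := normrV_ge (u - v) i; rewrite !mxE => /(le_trans _); apply.
  by rewrite opprB addrA subrK.
have [d [y [d0 y0 yc yD]]] := @picard R n (fun u => X (cv u)) p1 C C0 XtL.
have yn : \forall t \near (0 : R), `|y t - p1| < r.
  have h : y t @[t --> (0 : R)] --> p1 by rewrite -y0; exact: yc.
  have := cvg_nbhs h (nbhsx_ballx p1 r r0); apply: filterS => t.
  by rewrite -ball_normE /= distrC.
have [d' d'0 d'P] := (iffLR (nbhs0P _)) yn.
exists (Num.min d d'), (fun t => chart_inv e (y t)); split.
- by rewrite lt_min d0.
- by rewrite y0.
move=> f t fs; rewrite lt_min => /andP[td td'].
have yr := d'P t td'.
have eyt : chart_img e (y t).
  by apply: rhoO; rewrite -ball_normE /= distrC (lt_trans yr).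
have := yD t td; rewrite cv_id ?(ltW yr)// => {}yD.
pose h v : R^o := f (chart_inv e v).
have hs : smo (chart_img e) h by exact: fs.
have bco : fbasis (fun i => delta_mx 0 i) (fun i (v : 'rV[R]_n) => v 0 i).
  split.
  - by move=> w; exact: row_sum_delta.
  - by move=> i; exact: coord_continuous.
  - by move=> i a u w; rewrite !mxE.
have curve (de : R -> 'rV[R]_n) (w : 'rV[R]_n) : s^-1 *: (de s - y t) @[s --> (0 : R)^'] --> w ->
    s^-1 *: (h (de s) - h (y t)) @[s --> (0 : R)^'] -->
    \sum_(i < n) w 0 i *: dd h (delta_mx 0 i) (y t).
  move=> hw; apply: (@dirder_curve R _ R^o n _ _ h (fun i => dd h (delta_mx 0 i)) (y t) de w bco) => //.
  - move=> i; have := open_nbhs_nbhs (conj oe eyt); apply: filterS => z Oz.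
    exact: (sm_dirder oe hs Oz).
  - by move=> i; apply: (sm_cont _ eyt); exact: sm_dd.
have -> : Ld xi f (chart_inv e (y t)) = \sum_(i < n) X (y t) 0 i *: dd h (delta_mx 0 i) (y t).
  have MD := dirder_slice (sm_dirder (v := (0, xi)) oO2 Ms (O2d _ eyt)).
  have {}MD : s^-1 *: (M (y t, p1 + s *: xi) - y t) @[s --> (0 : R)^'] --> X (y t).
    apply: cvg_eq1 MD => s; rewrite {2}/M /= einv1 mulg1 chart_invK//.
  apply: ddE; apply: cvg_trans (curve _ _ MD); apply: near_eq_cvg.
  have : \forall s \near (0 : R)^', O2 (y t, p1 + s *: xi).
    have h1 : (y t, p1 + s *: xi) @[s --> (0 : R)^'] --> ((y t, p1) : 'rV[R]_n * 'rV[R]_n).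
      by apply: cvg_pairN; [exact: cvg_cst|exact: cvg_line].
    exact: (cvg_nbhs h1 (open_nbhs_nbhs (conj oO2 (O2d _ eyt)))).
  apply: filterS => s [_ /= Os].
  by rewrite /h /M /= einv1 mulg1 chart_mapK.
exact: (curve (fun s => y (t + s *: (1 : R^o))) _ yD).
Qed.

Definition zpow (a : G) (k : int) : G :=
  match k with Posz m => (a ^+ m)%g | Negz m => ((a^-1) ^+ m.+1)%g end.

Lemma zpowB1 a k : zpow a k = (zpow a (k - 1) * a)%g.
Proof.
case: k => [[|m]|m].
- by rewrite /= expg1 mulVg expg0.
- by rewrite /= subn1 /= expgSr.
- have -> : Negz m - 1 = Negz m.+1 by rewrite !NegzE [in RHS]intS opprD addrC.
  by rewrite /zpow [in RHS]expgSr -mulgA mulVg mulg1.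
Qed.

(** Left translates of a local integral curve are again integral curves, so the piece on [[0, h]] is
    repeated after multiplication by powers of [g0 h]. The number of the cell containing [t] is the
    floor of [t / h]. *)
Lemma ex_integral_curve (x : lieAlg G) : exists gam, integral_curve x gam.
Proof.
have [xi xxi] := lie_tangent ae e1 x.
have [d [g0 [d0 g00 gD]]] := local_integral_curve xi.
pose h := d / 2; have h0 : 0 < h by exact: divr_gt0.
have hd : h < d by rewrite ltr_pdivrMr// ltr_pMr// ltr1n.
pose k (t : R) := Num.floor (t / h).
pose gam t := (zpow (g0 h) (k t) * g0 (t - (k t)%:~R * h))%g.
have kP t : (k t)%:~R * h <= t < (k t)%:~R * h + h.
  have := floor_itv (t / h); rewrite -/(k t) ler_pdivlMr// ltr_pdivrMr// => /andP[-> /=].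
  by rewrite rmorphD /= mulrDl mul1r.
have kE t (m : int) : m%:~R * h <= t < m%:~R * h + h -> k t = m.
  move=> /andP[m1 m2]; apply: floor_def; rewrite ler_pdivlMr// m1 /= ltr_pdivrMr//.
  by rewrite rmorphD /= mulrDl mul1r.
have gammaD (m : int) t (f : smoothfun G) : 0 <= t < d ->
    dirder (fun s : R^o => f (zpow (g0 h) m * g0 s)%g : R^o) t (1 : R^o)
      (x f (zpow (g0 h) m * g0 t)%g).
  move=> /andP[t0 td].
  rewrite xxi -Lder_translate.
  have fs := smooth_translate (zpow (g0 h) m) 1%g (smoothfun_smooth f).
  have E : (fun g => f (zpow (g0 h) m * g * 1)%g : R^o) = (fun g => f (zpow (g0 h) m * g)%g).
    by apply/funext => g; rewrite mulg1.
  rewrite E in fs; apply: gD => //; by rewrite ger0_norm.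
exists gam; split.
  have k0 : k 0 = 0 by apply: kE; rewrite mulr0z mul0r lexx add0r.
  by rewrite /gam k0 mulr0z mul0r subr0 g00 mulg1.
move=> t f; apply: dirder_is_derive; apply/dirderP => eps eps0.
have /andP[k1 k2] := kP t; set m := k t in k1 k2.
pose tau := t - m%:~R * h.
have tau0 : 0 <= tau by rewrite subr_ge0.
have tauh : tau < h by rewrite ltrBlDl.
have D1 := gammaD m tau f _; rewrite tau0 (lt_trans tauh hd) in D1.
have D2 := gammaD (m - 1) h f _; rewrite (ltW h0) hd in D2.
have /dirderP/(_ _ eps0)[d1 d10 d1P] := D1 isT.
have /dirderP/(_ _ eps0)[d2 d20 d2P] := D2 isT.
have one (s : R) : s *: (1 : R^o) = s by rewrite /GRing.scale /= mulr1.
(* Inside a cell, steps shorter than [tau] do not reach its left end; at a junction, steps shorter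
   than [h] stay within the preceding cell. *)
pose d3 := if tau == 0 then h else tau.
have d30 : 0 < d3 by rewrite /d3; case: eqVneq => // tn0; rewrite lt_neqAle eq_sym tn0.
exists (Num.min (Num.min d1 d2) (Num.min (h - tau) d3)).
  by rewrite !lt_min d10 d20 d30 subr_gt0 tauh.
move=> s; rewrite !lt_min => /andP[/andP[s1 s2] /andP[s3 s4]].
have gt : gam t = (zpow (g0 h) m * g0 tau)%g by [].
case: (leP (- tau) s) => stau.
  have -> : gam (t + s *: (1 : R^o)) = (zpow (g0 h) m * g0 (tau + s *: (1 : R^o)))%g.
    rewrite /gam (kE _ m).
      by rewrite /tau; congr (_ * g0 _)%g; rewrite addrAC.
    rewrite one; move: s3 stau; rewrite ltr_norml /tau => /andP[] *.
    by apply/andP; split; lra.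
  by rewrite gt; exact: d1P.
(* The step goes below the current cell, which by the choice of [d3] happens from a junction only.
   There the preceding piece takes over; it is differentiable at its end [h] because [h < d]. *)
have tauE : tau = 0.
  move: s4; rewrite /d3; case: eqVneq => // _; rewrite ltr_norml => /andP[+ _].
  by rewrite ltNge (ltW stau).
have sh : - h < s by move: s4; rewrite /d3 tauE eqxx ltr_norml => /andP[].
have s0 : s < 0 by rewrite -oppr0 -tauE.
have gt2 : gam t = (zpow (g0 h) (m - 1) * g0 h)%g by rewrite gt tauE g00 mulg1 zpowB1.
have -> : gam (t + s *: (1 : R^o)) = (zpow (g0 h) (m - 1) * g0 (h + s *: (1 : R^o)))%g.
  have tE : t = m%:~R * h by apply/eqP; rewrite -subr_eq0; apply/eqP.
  rewrite /gam (kE _ (m - 1)).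
    congr (_ * g0 _)%g; rewrite one rmorphB /= mulrBl mul1r {1}tE; ring.
  by rewrite one rmorphB /= mulrBl mul1r; apply/andP; split; lra.
by rewrite gt2; exact: d2P.
Qed.

(** The curve run at speed [t] is an integral curve of [t *: x], and uniqueness identifies it with
    the one chosen in [lexp]. *)
Lemma lexp_curve (x : lieAlg G) (gam : R -> G) : integral_curve x gam ->
  forall t, lexp (t *: x) = gam t.
Proof.
move=> hg t; have [g0 gD] := hg.
have hc : integral_curve (t *: x) (fun s => gam (t * s)).
  split; first by rewrite mulr0.
  move=> s f; apply: dirder_is_derive.
  have h := dirderZ (a := t) (is_derive_dirder (gD (t * s) f)).
  change (dirder (fun s : R^o => f (gam (t * s)) : R^o) s (1 : R^o) (t *: x f (gam (t * s)))).
  apply: cvg_eq1 h => r; congr (_ *: (f (gam _) - _)).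
  by rewrite /GRing.scale /=; ring.
have [xi txi] := lie_tangent ae e1 (t *: x).
rewrite /lexp; case: xgetP => [g2 -> /= h2|/(_ _ hc)//].
by rewrite (integral_curve_unique ae e1 txi h2 hc) mulr1.
Qed.

End LieExp.

(** * Test functions and the action of the enveloping algebra *)

Section JointlySmooth.
Context {R : realType} {n : nat} {G : lieGroupType R n}.
Implicit Types V W : normedModType R.
Implicit Types c d : chart R n G.
Notation dirder := (is_dirder (idfun : R -> R)).

Lemma smooth_realify (W : normedModType R[i]) (f : G -> W) :
  smooth_map (fun r : R => r%:C) f <-> smooth_map idfun (f : G -> realify W).
Proof.
split=> fs c ac k; first by rewrite -Ck_realify; exact: fs.
by rewrite Ck_realify; exact: fs.
Qed.

(** Joint smoothness of a family of functions on the group; the parameter is a row vector because in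
    all uses it is a group element read in a chart. *)
Definition jsm W (O : set 'rV[R]_n) (B : 'rV[R]_n -> G -> W) : Prop :=
  forall d, atlas d -> smo (O `*` chart_img d) (fun p => B p.1 (chart_inv d p.2)).

Lemma openX_img (O : set 'rV[R]_n) d : open O -> atlas d -> open (O `*` chart_img d).
Proof.
move=> oO ad; rewrite openE => -[a b] [/= ca db]; exists (O, chart_img d) => //=.
by split; apply: open_nbhs_nbhs; split=> //; exact: chart_imgO.
Qed.

Lemma dirder_slice1 V V' W (Phi : V * V' -> W) (u : V) (w : V') (xi : V) l :
  dirder Phi (u, w) (xi, 0) l -> dirder (fun u => Phi (u, w)) u xi l.
Proof.
apply: cvg_trans; apply: near_eq_cvg; apply: nearW => t /=.
by congr (_ *: (Phi _ - _)); congr pair => /=; rewrite scaler0 addr0.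
Qed.

Lemma jsm_dirder W O (B : 'rV[R]_n -> G -> W) u v h : open O -> jsm O B -> O u ->
  dirder (fun u => B u h) u v (dd (B^~ h) v u).
Proof.
move=> oO Bs Ou; have [d ad dh] := atlas_cover h.
have dO := chart_imgP dh.
have hh := @sm_dirder R _ _ _ _ (u, chart_map d h) (v, 0) (openX_img oO ad) (Bs d ad) (conj Ou dO).
have {}hh := dirder_slice1 hh; move: hh => /=.
rewrite chart_mapK// => hh; by have -> := ddE hh.
Qed.

Lemma jsm_dd W O (B : 'rV[R]_n -> G -> W) v : open O -> jsm O B ->
  jsm O (fun u h => dd (B^~ h) v u).
Proof.
move=> oO Bs d ad; have oX := openX_img oO ad.
apply: (@sm_eq _ _ _ _ (dd (fun p => B p.1 (chart_inv d p.2)) (v, 0))) => //.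
  move=> [u y] [/= Ou dy]; apply/esym/ddE.
  exact: (@dirder_slice1 _ _ _ (fun p => B p.1 (chart_inv d p.2)) u y v _
    (@sm_dirder _ _ _ _ _ (u, y) (v, 0) oX (Bs d ad) (conj Ou dy))).
by apply: sm_dd => //; exact: Bs.
Qed.

Lemma jsm_slice W O (B : 'rV[R]_n -> G -> W) u : open O -> jsm O B -> O u ->
  smooth_map idfun (B u).
Proof.
move=> oO Bs Ou d ad.
apply: (@sm_comp _ _ _ _ (O `*` chart_img d) _ (fun p => B p.1 (chart_inv d p.2)) (fun y => (u, y))).
- by apply: fdim_prod; exact: fdim_rV.
- exact: openX_img.
- by [].
- exact: Bs.
- by apply: sm_pair; [exact: sm_cst|exact: sm_id].
Qed.

Lemma jsm_cont W O (B : 'rV[R]_n -> G -> W) u h : open O -> jsm O B -> O u ->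
  {for (u, h), continuous (fun p : 'rV[R]_n * G => B p.1 p.2)}.
Proof.
move=> oO Bs Ou; have [d ad dh] := atlas_cover h.
have hc : B p.1 (chart_inv d (chart_map d p.2)) @[p --> ((u, h) : 'rV[R]_n * G)] -->
    B u (chart_inv d (chart_map d h)).
  apply: (cvg_cont (f := fun p : 'rV[R]_n * G => (p.1, chart_map d p.2))
    (l := (u, chart_map d h) : 'rV[R]_n * 'rV[R]_n)
    (L := fun p : 'rV[R]_n * 'rV[R]_n => B p.1 (chart_inv d p.2))).
    apply: cvg_pairN; first exact: cvg_fst.
    by apply: (cvg_cont (L := chart_map d)); [exact: cvg_snd|exact: chart_map_cont].
  by apply: (sm_cont (Bs d ad)); split=> //; exact: chart_imgP.
rewrite chart_mapK// in hc; rewrite /prop_for /continuous_at /=; apply: cvg_trans hc; apply: near_eq_cvg.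
have h2 : p.2 @[p --> ((u, h) : 'rV[R]_n * G)] --> h by exact: cvg_snd.
have := h2 _ (open_nbhs_nbhs (conj (chart_domO ad) dh)).
move=> hd; apply: (@filterS _ _ (nbhs_filter ((u, h) : 'rV[R]_n * G)) _ _ _ hd) => p cp.
by rewrite chart_mapK.
Qed.

Lemma jsm_comp W O (F : G -> W) (psi : 'rV[R]_n -> G -> G) : open O ->
  smooth_map idfun F ->
  (forall d, atlas d -> Gsm (O `*` chart_img d) (fun p => psi p.1 (chart_inv d p.2))) ->
  jsm O (fun u h => F (psi u h)).
Proof.
move=> oO Fs ps d ad.
by apply: (smooth_comp (al := fun p => psi p.1 (chart_inv d p.2))); [exact: openX_img| |exact: ps].
Qed.

Lemma Gsm_fst O c d : atlas c -> open O -> O `<=` chart_img c ->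
  Gsm (O `*` chart_img d) (fun p : 'rV[R]_n * 'rV[R]_n => chart_inv c p.1).
Proof.
move=> ac oO Oc; apply: (@Gsm_comp R n G _ _ O _ (chart_inv c) (fun p => p.1)) => //.
- exact: fdim_rV.
- by move=> p [].
- exact: (Gsm_sub Oc (Gsm_chart ac)).
- exact: sm_fst.
Qed.

Lemma Gsm_snd (O : set 'rV[R]_n) d : atlas d ->
  Gsm (O `*` chart_img d) (fun p : 'rV[R]_n * 'rV[R]_n => chart_inv d p.2).
Proof.
move=> ad; apply: (@Gsm_comp R n G _ _ (chart_img d) _ (chart_inv d) (fun p => p.2)) => //.
- exact: fdim_rV.
- exact: chart_imgO.
- by move=> p [].
- exact: Gsm_chart.
- exact: sm_snd.
Qed.

Definition csupp W (K : set G) (f : G -> W) : Prop := forall h, ~ K h -> f h = 0.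

(** Uniformity near each parameter is what keeps derivatives in the parameter supported in the same
    compact set. *)
Definition lcsupp W (O : set 'rV[R]_n) (B : 'rV[R]_n -> G -> W) : Prop :=
  forall u, O u -> exists2 K, compact K & \forall u' \near u, csupp K (B u').

Lemma lcsupp_dd W O (B : 'rV[R]_n -> G -> W) v : lcsupp O B ->
  lcsupp O (fun u h => dd (B^~ h) v u).
Proof.
move=> Bs u Ou; have [K cK KP] := Bs u Ou; exists K => //.
have := nbhs_interior KP; apply: (@filterS _ (nbhs u)) => u' Ku' h nKh.
apply: ddE.
apply: (@dirder_near _ _ _ (fun=> 0)).
  by move: Ku'; apply: (@filterS _ (nbhs u')) => y Ky; rewrite Ky.
by rewrite /is_dirder; apply: cvg_eq1 (cvg_cst 0) => t; rewrite subrr scaler0.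
Qed.

Definition cc_smooth W (f : G -> W) : Prop :=
  smooth_map idfun f /\ exists2 K, compact K & csupp K f.

Lemma smooth_lin W (r : R) (f g : G -> W) : smooth_map idfun f -> smooth_map idfun g ->
  smooth_map idfun (fun t => r *: f t + g t).
Proof. by move=> fs gs c ac; apply: sm_lin; [exact: fs|exact: gs]. Qed.

Lemma cc_smooth_lin W (r : R) (f g : G -> W) : cc_smooth f -> cc_smooth g ->
  cc_smooth (fun t => r *: f t + g t).
Proof.
move=> [fs [K cK Kf]] [gs [L cL Lg]]; split; first exact: smooth_lin.
exists (K `|` L); first exact: compactU.
by move=> h nh; rewrite Kf ?Lg ?scaler0 ?addr0// => ?; apply: nh; [right|left].
Qed.

Section Param.
Variables (W W' : normedModType R) (Lam : (G -> W) -> W').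
Hypothesis Lam_lin : forall (r : R) f g, cc_smooth f -> cc_smooth g ->
  Lam (fun t => r *: f t + g t) = r *: Lam f + Lam g.
Hypothesis Lam_bnd : forall K, compact K -> exists2 C : R, 0 <= C & forall f (M : R),
  cc_smooth f -> csupp K f -> 0 <= M -> (forall t, K t -> `|f t| <= M) -> `|Lam f| <= C * M.
Variables (O : set 'rV[R]_n) (B : 'rV[R]_n -> G -> W).
Hypotheses (oO : open O) (Bs : jsm O B) (Bc : lcsupp O B).

Let P (B : 'rV[R]_n -> G -> W) := jsm O B /\ lcsupp O B.

Let family : param_family (@cc_smooth W) compact (@csupp W) O P.
Proof.
move=> D [Ds Dc]; split.
- move=> u Ou; split; first exact: (jsm_slice oO Ds Ou).
  by have [K cK KP] := Dc u Ou; exists K => //; exact: nbhs_singleton KP.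
- by move=> u Ou; have [K cK KP] := Dc u Ou; exists K.
- move=> u K e Ou cK e0; apply: tube_lemma => // t _.
  exact: (@jsm_cont _ O D u t oO Ds Ou).
- move=> v; exists (fun u h => dd (D^~ h) v u).
    by split; [exact: jsm_dd|exact: lcsupp_dd].
  by move=> u t K Ou _ _; exact: (@jsm_dirder _ O D u v t oO Ds Ou).
Qed.

Let sp_lin (r : R) K (f g : G -> W) : csupp K f -> csupp K g ->
  csupp K (fun t => r *: f t + g t).
Proof. by move=> Kf Kg h nh; rewrite Kf ?Kg ?scaler0 ?addr0. Qed.
Let sp_mono K K' (f : G -> W) : K `<=` K' -> csupp K f -> csupp K' f.
Proof. by move=> KK Kf h nh; apply: Kf => /KK. Qed.

Lemma jsm_param_smooth : smo O (fun u => Lam (B u)).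
Proof.
apply: (@param_smooth R _ W' W G Lam (@cc_smooth W) compact (@csupp W) _ _ _ _ _ _ O P B) => //.
- exact: cc_smooth_lin.
- exact: compactU.
Qed.

Lemma jsm_param_dirder u v : O u ->
  dirder (fun u => Lam (B u)) u v (Lam (fun h => dd (B^~ h) v u)).
Proof.
move=> Ou; apply: (@param_dirder R _ W' W G Lam (@cc_smooth W) compact (@csupp W) _ _ _ _ _ _ O P
  B (fun u h => dd (B^~ h) v u)) => //.
- exact: cc_smooth_lin.
- exact: compactU.
- by split; [exact: jsm_dd|exact: lcsupp_dd].
- by move=> u' t K Ou' _ _; exact: (@jsm_dirder _ O B u' v t oO Bs Ou').
Qed.

End Param.
End JointlySmooth.

Section TestFunctionAction.
Context {R : realType} {n : nat} {G : lieGroupType R n}.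
Implicit Types W : normedModType R.
Implicit Types c d : chart R n G.
Notation dirder := (is_dirder (idfun : R -> R)).
Local Notation CR := (realify (R[i]^o : normedModType R[i])).

Lemma test_functionP (a : G -> R[i]) : test_function a <-> cc_smooth (a : G -> CR).
Proof.
split=> -[/smooth_realify as_ h]; split=> //.
  exists (closure [set g | a g != 0]) => // g ng; apply/eqP/negPn/negP => ag.
  by apply: ng; exact: subset_closure.
case: h => K cK Ka; apply: (@subclosed_compact _ _ K) => //; first exact: closed_closure.
have clK : closed K by apply: compact_closed => //; exact: lie_hausdorff.
rewrite [X in _ `<=` X](closure_id K).1//; apply: closure_subset => g /= ag.
by apply: contrapT => /Ka a0; move: ag; rewrite a0 eqxx.
Qed.

Lemma compact_mulG (K L : set G) : compact K -> compact L ->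
  compact [set g | exists a b, [/\ K a, L b & g = (a * b)%g]].
Proof.
move=> cK cL.
have -> : [set g | exists a b, [/\ K a, L b & g = (a * b)%g]] =
    (fun p : G * G => (p.1 * p.2)%g) @` (K `*` L).
  apply/seteqP; split=> g.
    by move=> [a [b [Ka Lb ->]]]; exists (a, b).
  by move=> [[a b] [/= Ka Lb] <-]; exists a, b.
apply: continuous_compact; last exact: compact_setX.
by apply: continuous_subspaceT; exact: lie_mul_continuous.
Qed.

Lemma compact_invG (K : set G) : compact K -> compact [set g | K (g^-1)%g].
Proof.
move=> cK.
have -> : [set g | K (g^-1)%g] = (fun g => g^-1)%g @` K.
  by apply/seteqP; split=> [g Kg|_ [g Kg <-] /=]; [exists (g^-1)%g; rewrite ?invgK|rewrite invgK].
apply: continuous_compact => //.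
by apply: continuous_subspaceT; exact: lie_inv_continuous.
Qed.

Lemma chart_compact_nbhs c u : atlas c -> chart_img c u ->
  exists2 K : set G, compact K & \forall u' \near u, K (chart_inv c u').
Proof.
move=> ac cu; have := open_nbhs_nbhs (conj (chart_imgO ac) cu).
move=> /nbhs_ballP[rho /= rho0 rhoP].
have r0 : 0 < rho / 2 by exact: divr_gt0.
have rr : rho / 2 < rho by rewrite ltr_pdivrMr// ltr_pMr// ltr1n.
exists (chart_inv c @` cube u (rho / 2)).
  by apply: compact_chart => //; [move=> v /(cube_ball rho0 rr) /rhoP|exact: cube_compact].
apply: (@filterS _ _ (nbhs_filter _) (ball u (rho / 2))); last exact: nbhsx_ballx.
move=> v uv; exists v => // i /=; rewrite in_itv /=.
move: uv; rewrite -ball_normE /= => uv.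
have := le_lt_trans (normrV_ge (u - v) i) uv; rewrite !mxE ltr_norml.
change (v ord0 i) with (v 0 i); move: (v 0 i) (u 0 i) => a b /andP[h1 h2].
by apply/andP; split; lra.
Qed.

Section Families.
Variables (W : normedModType R) (a : G -> W) (c : chart R n G) (ac : atlas c).
Hypothesis (a_s : smooth_map idfun a).

Lemma ltrans_jsm : jsm (chart_img c) (fun u h => a ((chart_inv c u)^-1 * h)%g).
Proof.
apply: jsm_comp => //; first exact: chart_imgO.
move=> d ad; have oX := open_chart2 ac ad.
apply: Gsm_mul => //; last exact: Gsm_snd.
by apply: Gsm_inv => //; apply: Gsm_fst => //; exact: chart_imgO.
Qed.

Lemma rtrans_jsm : jsm (chart_img c) (fun u h => a (h * chart_inv c u)%g).
Proof.
apply: jsm_comp => //; first exact: chart_imgO.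
move=> d ad; have oX := open_chart2 ac ad.
apply: Gsm_mul => //; first exact: Gsm_snd.
by apply: Gsm_fst => //; exact: chart_imgO.
Qed.

Hypothesis a_c : exists2 K, compact K & csupp K a.

Lemma ltrans_lcsupp : lcsupp (chart_img c) (fun u h => a ((chart_inv c u)^-1 * h)%g).
Proof.
move=> u cu; have [K cK Ka] := a_c; have [N cN uN] := chart_compact_nbhs ac cu.
exists [set g | exists a b, [/\ N a, K b & g = (a * b)%g]]; first exact: compact_mulG.
move: uN; apply: (@filterS _ _ (nbhs_filter _)) => u' Nu' h nh; apply: Ka => Kh.
by apply: nh; exists (chart_inv c u'), ((chart_inv c u')^-1 * h)%g; rewrite mulgA mulgV mul1g.
Qed.

Lemma rtrans_lcsupp : lcsupp (chart_img c) (fun u h => a (h * chart_inv c u)%g).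
Proof.
move=> u cu; have [K cK Ka] := a_c; have [N cN uN] := chart_compact_nbhs ac cu.
exists [set g | exists a b, [/\ K a, [set g | N (g^-1)%g] b & g = (a * b)%g]].
  by apply: compact_mulG => //; exact: compact_invG.
move: uN; apply: (@filterS _ _ (nbhs_filter _)) => u' Nu' h nh; apply: Ka => Kh.
apply: nh; exists (h * chart_inv c u')%g, (chart_inv c u')^-1%g; split=> //=.
  by rewrite invgK.
by rewrite -mulgA mulgV mulg1.
Qed.
End Families.

Lemma cc_smooth_ltrans W (a : G -> W) g : cc_smooth a -> cc_smooth (fun h => a (g * h)%g).
Proof.
move=> [as_ [K cK Ka]]; split.
  have -> : (fun h => a (g * h)%g) = (fun h => a (g * h * 1)%g).
    by apply/funext => h; rewrite mulg1.
  exact: smooth_translate.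
exists [set h | exists a b, [/\ [set g^-1%g] a, K b & h = (a * b)%g]].
  by apply: compact_mulG => //; exact: compact_set1.
move=> h nh; apply: Ka => Kh; apply: nh; exists g^-1%g, (g * h)%g; split=> //.
by rewrite mulgA mulVg mul1g.
Qed.

Lemma CR_normE (z : CR) : `|z|%:C = `|z : R[i]|.
Proof. exact: rify_normE. Qed.

Lemma CR_Re_le (z : CR) : `|complex.Re (z : R[i])| <= `|z|.
Proof. by rewrite -lecR CR_normE; exact: normc_ge_Re. Qed.

Lemma CR_Im_le (z : CR) : `|complex.Im (z : R[i])| <= `|z|.
Proof.
have h : `|(- 'i)%C : R[i]| = 1.
  by rewrite normc_def /= oppr0 expr0n /= add0r sqrrN expr1n sqrtr1.
have := normc_ge_Re ((- 'i)%C * (z : R[i])); rewrite normrM h mul1r -CR_normE lecR.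
apply: le_trans; rewrite le_eqVlt; apply/orP; left; apply/eqP; congr `|_|; case: (z) => a b /=; ring.
Qed.

Lemma CR_le_ReIm (z : CR) : `|z| <= `|complex.Re (z : R[i])| + `|complex.Im (z : R[i])|.
Proof.
rewrite -lecR CR_normE rmorphD /= {1}[z in `|z|]complexE (le_trans (ler_normD _ _))//.
rewrite lerD//; first by rewrite normc_def /= expr0n /= addr0 sqrtr_sqr.
rewrite normrM normc_def /= expr0n /= add0r expr1n sqrtr1 mul1r.
by rewrite normc_def /= expr0n /= addr0 sqrtr_sqr.
Qed.

Lemma CR_M (z w : R[i]) : `|(z * w : CR)| = `|(z : CR)| * `|(w : CR)|.
Proof. by apply: complexI; rewrite rmorphM /= !CR_normE normrM. Qed.

Definition reC (z : CR) : R^o := complex.Re (z : R[i]).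
Definition imC (z : CR) : R^o := complex.Im (z : R[i]).

Lemma reC_lin (r : R) (u v : CR) : reC (r *: u + v) = r *: reC u + reC v.
Proof. by case: u v => a b [p q]; rewrite /reC /GRing.scale /=; ring. Qed.
Lemma imC_lin (r : R) (u v : CR) : imC (r *: u + v) = r *: imC u + imC v.
Proof. by case: u v => a b [p q]; rewrite /imC /GRing.scale /=; ring. Qed.

Lemma reC_cont : continuous reC.
Proof.
apply: (@lipschitz_continuous _ _ _ _ 1) => // u v; rewrite mul1r.
have -> : reC u - reC v = reC (u - v) by case: u v => a b [].
exact: CR_Re_le.
Qed.
Lemma imC_cont : continuous imC.
Proof.
apply: (@lipschitz_continuous _ _ _ _ 1) => // u v; rewrite mul1r.
have -> : imC u - imC v = imC (u - v) by case: u v => a b [].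
exact: CR_Im_le.
Qed.

Lemma conjC_lin (r : R) (u v : CR) :
  ((r *: u + v : CR) : R[i])^* = r *: (((u : R[i])^*)%C : CR) + (((v : R[i])^*)%C : CR) :> CR.
Proof. by case: u v => a b [p q]; rewrite /GRing.scale /= /GRing.scale /=; simpc; congr Complex; ring. Qed.

Lemma conjC_cont : continuous (fun z : CR => ((z : R[i])^* )%C : CR).
Proof.
apply: (@lipschitz_continuous _ _ _ _ 1) => // u v; rewrite mul1r.
rewrite -lecR !CR_normE; case: u v => a b [p q].
by rewrite !normc_def /= -opprD sqrrN.
Qed.

Lemma mulCl_lin (c : R[i]) (r : R) (u v : CR) :
  c * (r *: u + v : CR) = r *: (c * u : CR) + (c * v) :> CR.
Proof.
by case: c u v => c d [a b] [p q]; rewrite /GRing.scale /= /GRing.scale /=; simpc; congr Complex; ring.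
Qed.

Lemma mulCl_cont (c : R[i]) : continuous (fun z : CR => c * (z : R[i]) : CR).
Proof.
apply: (@lipschitz_continuous _ _ _ _ (`|(c : CR)| + 1)) => [|u v]; first by rewrite ltr_wpDl.
have -> : c * (u : R[i]) - c * (v : R[i]) = c * ((u : R[i]) - v) by rewrite mulrBr.
by rewrite CR_M ler_wpM2r// lerDl.
Qed.

Lemma sm_mulC (V : normedModType R) (O : set V) (f g : V -> CR) : smo O f -> smo O g ->
  smo O (fun x => (f x : R[i]) * g x : CR).
Proof.
move=> fs gs.
have -> : (fun x => (f x : R[i]) * g x : CR) =
    (fun x => reC (f x) *: g x + imC (f x) *: ('i%C * (g x : R[i]) : CR)).
  apply/funext => x; rewrite /reC /imC; case: (f x) (g x) => a b [p q].
  by rewrite /GRing.scale /= /GRing.scale /=; simpc; congr Complex; ring.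
apply: sm_add; apply: sm_scale => //.
- by apply: (sm_linmap (L := reC)) => //; [exact: reC_lin|exact: reC_cont].
- by apply: (sm_linmap (L := imC)) => //; [exact: imC_lin|exact: imC_cont].
apply: (sm_linmap (L := fun z : CR => 'i%C * (z : R[i]) : CR)) => //.
- by move=> *; exact: mulCl_lin.
- exact: mulCl_cont.
Qed.

Lemma jsm_mulC O (A B : 'rV[R]_n -> G -> CR) : jsm O A -> jsm O B ->
  jsm O (fun u h => (A u h : R[i]) * B u h : CR).
Proof. by move=> As Bs d ad; apply: sm_mulC; [exact: As|exact: Bs]. Qed.

Lemma conv_jsm (a b : G -> CR) c : atlas c -> smooth_map idfun a -> smooth_map idfun b ->
  jsm (chart_img c) (fun u h => (a h : R[i]) * b (h^-1 * chart_inv c u)%g : CR).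
Proof.
move=> ac as_ bs; have oc := chart_imgO ac; apply: jsm_mulC.
  by apply: (jsm_comp (psi := fun _ h => h)) => // d ad; exact: Gsm_snd.
apply: (jsm_comp (psi := fun u h => (h^-1 * chart_inv c u)%g)) => //.
move=> d ad; have oX := open_chart2 ac ad.
apply: Gsm_mul => //; last exact: Gsm_fst.
by apply: Gsm_inv => //; exact: Gsm_snd.
Qed.

End TestFunctionAction.

(** * The action of the Lie algebra on test functions *)

Section EnvelopingAction.
Context {R : realType} {n : nat} {G : lieGroupType R n}.
Implicit Types c d : chart R n G.
Notation dirder := (is_dirder (idfun : R -> R)).
Local Notation CR := (realify (R[i]^o : normedModType R[i])).

Lemma is_deriv0P (W : normedModType R[i]) (F : R -> W) (l : W) :
  is_deriv0 F l <-> dirder (F : R^o -> realify W) (0 : R^o) (1 : R^o) l.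
Proof.
have e (t : R) : (0 : R^o) + t *: (1 : R^o) = t by rewrite add0r /GRing.scale /= mulr1.
by split; apply: cvg_eq1 => t /=; rewrite e.
Qed.

Lemma integral_curveD (x : lieAlg G) gam s t : integral_curve x gam ->
  gam (s + t) = (gam s * gam t)%g.
Proof.
move=> hg; have [c ac c1] := atlas_cover (1%g : G); have [xi0 x_xi] := lie_tangent ac c1 x.
suff h : integral_curve x (fun t => (gam s)^-1 * gam (s + t))%g.
  have := congr1 (fun f => f t) (integral_curve_unique ac c1 x_xi hg h) => /= ->.
  by rewrite mulgA mulgV mul1g.
split; first by rewrite addr0 mulVg.
move=> {}t f; have /asboolP[_ _ xi] := lieAlgP x.
pose f1 := mk_smooth (smooth_translate (gam s)^-1%g 1%g (smoothfun_smooth f)).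
have <- : x f1 (gam (s + t)) = x f ((gam s)^-1 * gam (s + t))%g.
  by apply: xi => g /=; rewrite mulg1.
apply: (@dirder_is_derive R R^o R^o).
have := @is_derive_dirder R R^o R^o _ _ _ _ (hg.2 (s + t) f1); apply: cvg_eq1 => r /=.
by rewrite !mulg1 addrA.
Qed.

Lemma integral_curveN (x : lieAlg G) gam t : integral_curve x gam ->
  gam (- t) = (gam t)^-1%g.
Proof.
move=> hg; have := integral_curveD (- t) t hg; rewrite addNr hg.1 => h.
by rewrite -[LHS]mulg1 -(mulgV (gam t)) mulgA -h mul1g.
Qed.

Variables (e : chart R n G) (ae : atlas e) (e1 : chart_dom e 1%g).
Let p1 := chart_map e 1%g.
Let ep1 : chart_img e p1. Proof. exact: chart_imgP. Qed.
Let einv1 : chart_inv e p1 = 1%g. Proof. exact: chart_mapK. Qed.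
Notation Ld := (Lder e).

Lemma Lder_integral_curve (x : lieAlg G) xi gam (W : normedModType R) (F : G -> W) g :
  (forall (f : smoothfun G) g, x f g = Ld xi (f : G -> R^o) g) ->
  integral_curve x gam -> smooth_map idfun F ->
  dirder (fun t : R^o => F (g * gam t)%g) (0 : R^o) (1 : R^o) (Ld xi F g).
Proof.
move=> x_xi hg Fs; have [t1 t2] := integral_curve_tangent ae e1 x_xi 0 hg.
have h : t^-1 *: (F (g * ((gam 0)^-1 * gam (0 + t)))%g - F g) @[t --> (0 : R)^'] --> Ld xi F g.
  by apply: Lder_curve.
apply: cvg_eq1 h => t.
have -> : (0 : R^o) + t *: (1 : R^o) = t by rewrite add0r /GRing.scale /= mulr1.
by rewrite add0r hg.1 invg1 mul1g mulg1.
Qed.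

Lemma smooth_inv_translate (W : normedModType R) (F : G -> W) g : smooth_map idfun F ->
  smooth_map idfun (fun h => F (h^-1 * g)%g).
Proof.
move=> Fs c ac; have oc := chart_imgO ac; apply: smooth_comp => //.
apply: Gsm_mul => //; last exact: Gsm_cst.
by apply: Gsm_inv => //; exact: Gsm_chart.
Qed.

(** [e^(-tx)] is the inverse of the integral curve at time [t], so the definition by [lexp] and
    [xget] becomes a chart derivative at 1 of the left translates of [a]. In this form it can be
    taken under integrals and under [rho]. *)
Lemma vtildeE (x : lieAlg G) xi (a : G -> CR) g :
  (forall (f : smoothfun G) g, x f g = Ld xi (f : G -> R^o) g) ->
  smooth_map idfun a -> vtilde x a g = dd (fun v => a ((chart_inv e v)^-1 * g)%g) xi p1.
Proof.
move=> x_xi as_; have [gam hg] := ex_integral_curve ae e1 x.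
have lexpE t : lexp (- (t *: x)) = (gam t)^-1%g.
  by rewrite -scaleNr (lexp_curve ae e1 hg) (integral_curveN _ hg).
have h := Lder_integral_curve (g := 1%g) x_xi hg (smooth_inv_translate g as_).
rewrite /vtilde.
have -> : (fun t : R => a (lexp (- (t *: x)) * g)%g : R[i]^o) =
    (fun t : R => a ((1 * gam t)^-1 * g)%g : R[i]^o).
  by apply/funext => t; rewrite lexpE mul1g.
have hE : dd (fun v => a ((chart_inv e v)^-1 * g)%g) xi p1 = Ld xi (fun h => a (h^-1 * g)%g) 1%g.
  rewrite /Lder; have -> // : (fun v => a ((chart_inv e v)^-1 * g)%g) =
      (fun v => a ((1 * chart_inv e v)^-1 * g)%g).
  by apply/funext => v; rewrite (mul1g (chart_inv e v)).
rewrite hE; case: xgetP => [l _ /is_deriv0P hl|].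
  exact: (dirder_unique hl h).
by move=> /(_ (Ld xi (fun h => a (h^-1 * g)%g) 1%g)) []; apply/is_deriv0P.
Qed.

Lemma cc_smooth_vtilde (x : lieAlg G) (a : G -> CR) : cc_smooth a -> cc_smooth (vtilde x a : G -> CR).
Proof.
move=> [as_ a_c]; have [xi x_xi] := lie_tangent ae e1 x.
have -> : vtilde x a = (fun h => dd (fun v => a ((chart_inv e v)^-1 * h)%g) xi p1).
  by apply/funext => g; exact: vtildeE.
have js := jsm_dd xi (chart_imgO ae) (ltrans_jsm ae as_).
have ls := lcsupp_dd xi (ltrans_lcsupp ae a_c).
split; first exact: (jsm_slice (chart_imgO ae) js ep1).
by have [K cK KP] := ls _ ep1; exists K => //; exact: nbhs_singleton KP.
Qed.
End EnvelopingAction.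

Section TermAction.
Context {R : realType} {n : nat} {G : lieGroupType R n}.
Local Notation CR := (realify (R[i]^o : normedModType R[i])).

Lemma test_function_vtilde (x : lieAlg G) (a : G -> R[i]) :
  test_function a -> test_function (vtilde x a).
Proof.
have [e ae e1] := atlas_cover (1%g : G).
by move=> /test_functionP h; apply/test_functionP; exact: (cc_smooth_vtilde ae e1 x h).
Qed.

Lemma test_function0 : @test_function R n G (fun=> 0).
Proof.
apply/test_functionP; split; first by move=> c ac; exact: (@sm_cst _ _ CR _ 0).
by exists set0 => //; exact: compact0.
Qed.

Lemma test_function_lin (c : R[i]) (a b : G -> R[i]) : test_function a -> test_function b ->
  test_function (fun g => c * a g + b g).
Proof.
move=> /test_functionP[as_ [K cK Ka]] /test_functionP[bs [L cL Lb]].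
apply/test_functionP; split.
  move=> d ad; apply: sm_add; last exact: bs.
  apply: (sm_linmap (L := fun z : CR => c * (z : R[i]) : CR)); last exact: as_.
  - by move=> *; exact: mulCl_lin.
  - exact: mulCl_cont.
exists (K `|` L); first exact: compactU.
move=> h nh; rewrite Ka ?Lb ?mulr0 ?addr0// => ?; apply: nh; [by right|by left].
Qed.

Lemma test_functionZ (c : R[i]) (a : G -> R[i]) : test_function a ->
  test_function (fun g => c * a g).
Proof.
move=> ta; have := test_function_lin c ta test_function0.
by congr test_function; apply/funext => g; rewrite addr0.
Qed.

Lemma test_functionD (a b : G -> R[i]) : test_function a -> test_function b ->
  test_function (fun g => a g + b g).
Proof.
move=> ta tb; have := test_function_lin 1 ta tb.
by congr test_function; apply/funext => g; rewrite mul1r.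
Qed.

Lemma test_function_act (s : uterm (lieAlg G)) (a : G -> R[i]) :
  test_function a -> test_function (uterm_act s a).
Proof.
elim: s a => [x|c|s IHs t IHt|s IHs t IHt] a ta /=.
- exact: test_function_vtilde.
- exact: test_functionZ.
- by apply: test_functionD; [exact: IHs|exact: IHt].
- by apply: IHs; exact: IHt.
Qed.

Lemma test_function_ltrans (a : G -> R[i]) g : test_function a ->
  test_function (fun h => a (g * h)%g).
Proof. by move=> /test_functionP h; apply/test_functionP; exact: cc_smooth_ltrans. Qed.

End TermAction.

(** * Haar integrals of functions of compact support *)

Section CompactIntegration.
Context {R : realType} {n : nat} {G : lieGroupType R n}.
Variables (mu : {measure set (borel G) -> \bar R}) (hmu : radon mu).
Implicit Types (f : G -> R) (K : set G).

Lemma compact_measurable K : compact K -> measurable (K : set (borel G)).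
Proof.
move=> cK; have clK : closed K by apply: compact_closed => //; exact: lie_hausdorff.
rewrite -(setCK K); apply: measurableC; apply: sub_sigma_algebra.
exact: closed_openC.
Qed.

Lemma continuous_measurable f : continuous (f : G -> R^o) ->
  measurable_fun setT (f : borel G -> R).
Proof.
move=> fc; apply: (measurability _ (measurable_realfun.RGenOpens.measurableE R)) => _ [_ [a [b ->]] <-].
rewrite setTI; apply: sub_sigma_algebra; apply: open_comp; last exact: interval_open.
by move=> x _; exact: fc.
Qed.

Lemma compact_bounded f K : continuous (f : G -> R^o) -> compact K ->
  exists2 M : R, 0 <= M & forall h, K h -> `|f h| <= M.
Proof.
move=> fc cK.
have /compact_bounded [M [Mr MP]] : compact ((f : G -> R^o) @` K).
  by apply: continuous_compact => //; exact: continuous_subspaceT.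
exists (`|M| + 1) => [|h Kh]; first by rewrite addr_ge0.
by apply: MP; [rewrite (le_lt_trans (ler_norm M))// ltrDl|exists h].
Qed.

Lemma integrable_compact f K (A : set (borel G)) : continuous (f : G -> R^o) -> compact K ->
  measurable A -> A `<=` K -> mu.-integrable A (EFin \o f).
Proof.
move=> fc cK mA AK; have [M M0 MP] := compact_bounded fc cK.
apply: measurable_bounded_integrable => //.
- have [hK _ _] := hmu; apply: le_lt_trans (hK K cK).
  by apply: le_measure => //; rewrite inE//; exact: compact_measurable.
- by apply: measurable_funTS; exact: continuous_measurable.
- exists M; split; first exact: num_real.
  by move=> x Mx h Ah; apply: (le_trans (MP h (AK h Ah))); exact: ltW.
Qed.

Lemma restrict_supp f K : (forall h, ~ K h -> f h = 0) -> (f \_ K)%classic = f.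
Proof.
move=> Kf; apply/funext => h; rewrite patchE; case: ifPn => // /negP; rewrite inE.
by move=> /Kf.
Qed.

Lemma integrable_cc f K : continuous (f : G -> R^o) -> compact K ->
  (forall h, ~ K h -> f h = 0) -> mu.-integrable setT (EFin \o f).
Proof.
move=> fc cK Kf; have mK := compact_measurable cK.
have := (@integrable_mkcond _ (borel G) R mu K (EFin \o f) mK).1 (integrable_compact fc cK mK (@subset_refl _ K)).
congr (mu.-integrable _ _); apply/funext => h.
by rewrite -[in RHS](restrict_supp Kf) /= /patch; case: ifP.
Qed.

Lemma Rintegral_supp f K : (forall h, ~ K h -> f h = 0) ->
  Rintegral mu setT f = Rintegral mu K f.
Proof. by move=> Kf; rewrite [RHS]Rintegral_mkcond restrict_supp. Qed.

Lemma Rintegral_bound f K (A : set (borel G)) (c r : R) : continuous (f : G -> R^o) -> compact K ->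
  measurable A -> A `<=` K -> (forall h, A h -> `|f h - c| <= r) ->
  `|Rintegral mu A f - c * fine (mu A)| <= r * fine (mu A).
Proof.
move=> fc cK mA AK fr.
have cc : continuous ((fun=> - c) : G -> R^o) by exact: cst_continuous.
have gc : continuous ((fun h => f h - c) : G -> R^o).
  by move=> h; apply: cvgD; [exact: fc|exact: cc].
have nc : continuous ((fun h => `|f h - c|) : G -> R^o).
  by move=> h; apply: cvg_norm; exact: gc.
have -> : Rintegral mu A f - c * fine (mu A) = Rintegral mu A (fun h => f h - c).
  rewrite RintegralD//; last exact: integrable_compact cc cK mA AK.
    by rewrite Rintegral_cst// mulNr.
  exact: integrable_compact fc cK mA AK.
rewrite (le_trans (le_normr_Rintegral _ _))//; first exact: integrable_compact gc cK mA AK.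
rewrite -Rintegral_cst//; apply: le_Rintegral => //.
- exact: integrable_compact nc cK mA AK.
- by apply: (@integrable_compact (fun=> r) K) => //; exact: cst_continuous.
Qed.

Lemma compact_mu_fin K : compact K -> mu K \is a fin_num.
Proof. by move=> cK; have [hK _ _] := hmu; rewrite ge0_fin_numE//; exact: hK. Qed.

Lemma Rintegral_le f K (M : R) : continuous (f : G -> R^o) -> compact K ->
  (forall h, ~ K h -> f h = 0) -> (forall h, K h -> `|f h| <= M) ->
  `|Rintegral mu setT f| <= fine (mu K) * M.
Proof.
move=> fc cK Kf fM; rewrite (Rintegral_supp Kf).
have := @Rintegral_bound f K K 0 M fc cK (compact_measurable cK) (@subset_refl _ K).
rewrite mul0r subr0 [leRHS]mulrC; apply => h Kh; rewrite subr0; exact: fM.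
Qed.

Section RiemannSums.
Variables (I : Type) (f : I -> G -> R) (K : set G).
Hypotheses (cK : compact K) (fc : forall i, continuous (f i : G -> R^o)).

(** Each step of the induction cuts the part of [A] inside [N h0] off and uses its measure as the
    weight of [h0]. Neither points nor weights depend on the index [i]. *)
Let sum_on (A : set (borel G)) (N : G -> set G) (ep : R) (s : seq G) : measurable A -> A `<=` K ->
  (forall h, open (N h)) -> (forall h h' i, N h h' -> `|f i h' - f i h| <= ep) ->
  (forall h, A h -> exists2 h', h' \in s & N h' h) -> 
  exists w : seq (R * G), [/\ forall p, p \in w -> 0 <= p.1 /\ p.2 \in s,
    \sum_(p <- w) p.1 = fine (mu A) &
    forall i, `|Rintegral mu A (f i) - \sum_(p <- w) p.1 * f i p.2| <= ep * fine (mu A)].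
Proof.
elim: s A => [|h0 s IH] A mA AK oN Nf As.
  have A0 : A = set0 by rewrite -subset0 => h /As [].
  exists [::]; split=> [//||i]; first by rewrite big_nil A0 measure0.
  by rewrite big_nil A0 Rintegral_set0 measure0 mulr0 subrr normr0.
have mN : measurable (N h0 : set (borel G)) by exact: sub_sigma_algebra.
have mB : measurable (A `&` N h0) by exact: measurableI.
have mC : measurable (A `\` N h0) by exact: measurableD.
have BK : A `&` N h0 `<=` K by move=> h [/AK].
have CK : A `\` N h0 `<=` K by move=> h [/AK].
have As' h : (A `\` N h0) h -> exists2 h', h' \in s & N h' h.
  by move=> [/As [h' +] Nh' nh]; rewrite inE => /orP[/eqP hh|]; [rewrite -hh in nh|exists h'].
have [w [w1 w2 w3]] := IH _ mC CK oN Nf As'.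
have dj : (A `&` N h0) `&` (A `\` N h0) = set0.
  by rewrite -subset0 => h [[_ ?] [_ ?]].
have muA : fine (mu A) = fine (mu (A `&` N h0)) + fine (mu (A `\` N h0)).
  have fK : (mu K < +oo)%E by rewrite ltey_eq compact_mu_fin.
  have fin (B : set (borel G)) : measurable B -> B `<=` K -> mu B \is a fin_num.
    move=> mB' BK'; rewrite ge0_fin_numE//; apply: le_lt_trans fK.
    by apply: le_measure => //; rewrite inE//; exact: compact_measurable.
  rewrite -fineD; [|exact: fin|exact: fin]; congr fine.
  by rewrite -[in LHS](setUIDK A (N h0)) measureU.
exists ((fine (mu (A `&` N h0)), h0) :: w); split.
- move=> p; rewrite inE => /orP[/eqP -> /=|/w1 [? ps]].
    by rewrite mem_head fine_ge0.
  by rewrite inE ps orbT.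
- by rewrite big_cons /= w2 muA.
- move=> i; rewrite big_cons /= muA -[in Rintegral _ A _](setUIDK A (N h0)).
  rewrite Rintegral_setU//; last 2 first.
  + by rewrite setUIDK; exact: integrable_compact (@fc i) cK mA AK.
  + by apply/disj_set2P.
  have b1 := @Rintegral_bound (f i) K _ (f i h0) ep (@fc i) cK mB BK.
  rewrite mulrDr opprD addrACA (le_trans (ler_normD _ _))// lerD//.
  by rewrite [_ * f i h0]mulrC; apply: b1 => h [_ Nh]; exact: Nf.
Qed.

(** Equicontinuity gives neighbourhoods common to the whole family and compactness a finite cover by
    them, so one list of points and weights serves for every index at once, without any condition on
    the size of [I]. *)
Lemma riemann_sums (ep : R) : 0 < ep ->
  (forall h e, K h -> 0 < e -> \forall h' \near h, forall i, `|f i h' - f i h| <= e) ->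
  (forall i h, ~ K h -> f i h = 0) ->
  exists w : seq (R * G), [/\ forall p, p \in w -> 0 <= p.1 /\ K p.2,
    \sum_(p <- w) p.1 = fine (mu K) &
    forall i, `|Rintegral mu setT (f i) - \sum_(p <- w) p.1 * f i p.2| <= ep].
Proof.
move=> ep0 feq Kf.
have e0 : 0 < ep / (fine (mu K) + 1).
  by rewrite divr_gt0// ltr_wpDl// fine_ge0.
set e := ep / _ in e0.
pose N h : set G := if `[< K h >] then
  interior [set h' | forall i, `|f i h' - f i h| <= e] else set0.
have oN h : open (N h).
  by rewrite /N; case: ifP => _; [exact: open_interior|exact: open0].
have Nf h h' i : N h h' -> `|f i h' - f i h| <= e.
  by rewrite /N; case: ifP => // _ /interior_subset; exact.
have KN h : K h -> N h h.
  by move=> Kh; rewrite /N asboolT//; exact: feq.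
have := cK; rewrite compact_cover => /(_ G K N (fun h _ => oN h)).
case=> [h Kh|D DK KD]; first by exists h => //; exact: KN.
have [|w [w1 w2 w3]] := @sum_on K N e (finmap.enum_fset D) (compact_measurable cK) (@subset_refl _ K) oN Nf.
  by move=> h /KD [h' /= hD Nh]; exists h'.
exists w; split=> //.
- move=> p /w1 [? pD]; split=> //.
  by apply/set_mem; apply: DK.
- move=> i; rewrite (Rintegral_supp (Kf i)) (le_trans (w3 i))// /e.
  have m0 : 0 <= fine (mu K) by rewrite fine_ge0.
  by rewrite -mulrA ler_piMr ?(ltW ep0)// mulrC ler_pdivrMr ?ltr_wpDl// mul1r lerDl.
Qed.

End RiemannSums.
End CompactIntegration.

Section HaarIntegral.
Context {R : realType} {n : nat} {G : lieGroupType R n}.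
Variables (mu : {measure set (borel G) -> \bar R}).
Implicit Types (f : G -> R) (K : set G).
Notation Rint := (Rintegral mu setT).

Lemma continuous_measurableG (phi : G -> G) : continuous phi ->
  measurable_fun setT (phi : borel G -> borel G).
Proof.
move=> pc; apply: (@measurability _ _ (borel G) (borel G) setT phi (@open G)) => // _ [B oB <-].
rewrite setTI; apply: sub_sigma_algebra; apply: open_comp => // x _; exact: pc.
Qed.

Lemma mulG_contl g : continuous (fun h : G => (g * h)%g).
Proof. by move=> h; apply: cvg_mulG; [exact: cvg_cst|exact: cvg_id]. Qed.
Lemma mulG_contr g : continuous (fun h : G => (h * g)%g).
Proof. by move=> h; apply: cvg_mulG; [exact: cvg_id|exact: cvg_cst]. Qed.

Definition ccont (f : G -> R) : Prop :=
  continuous (f : G -> R^o) /\ exists2 K : set G, compact K & forall h, ~ K h -> f h = 0.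

Lemma ccont_ltrans g f : ccont f -> ccont (fun h => f (g * h)%g).
Proof.
move=> [fc [K cK Kf]]; split.
  by move=> h; apply: (cvg_cont (L := (f : G -> R^o)) (@mulG_contl g h)); exact: fc.
exists ((fun h => g^-1 * h)%g @` K).
  by apply: continuous_compact => //; apply: continuous_subspaceT; exact: mulG_contl.
move=> h nh; apply: Kf => Kh; apply: nh; exists (g * h)%g => //.
by rewrite mulgA mulVg mul1g.
Qed.

Lemma ccont_rtrans g f : ccont f -> ccont (fun h => f (h * g)%g).
Proof.
move=> [fc [K cK Kf]]; split.
  by move=> h; apply: (cvg_cont (L := (f : G -> R^o)) (@mulG_contr g h)); exact: fc.
exists ((fun h => h * g^-1)%g @` K).
  by apply: continuous_compact => //; apply: continuous_subspaceT; exact: mulG_contr.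
move=> h nh; apply: Kf => Kh; apply: nh; exists (h * g)%g => //.
by rewrite -mulgA mulgV mulg1.
Qed.

Lemma ccont_lin (r : R) f f' : ccont f -> ccont f' -> ccont (fun h => r * f h + f' h).
Proof.
move=> [fc [K cK Kf]] [fc' [K' cK' Kf']]; split.
  move=> h; apply: cvgD; last exact: fc'.
  by apply: (cvgZl_tmp (k := r)); exact: fc.
exists (K `|` K'); first exact: compactU.
by move=> h nh; rewrite Kf ?Kf' ?mulr0 ?addr0// => ?; apply: nh; [right|left].
Qed.

Lemma ccontM f f' : continuous (f : G -> R^o) -> ccont f' -> ccont (fun h => f h * f' h).
Proof.
move=> fc [fc' [K cK Kf]]; split; last by exists K => // h /Kf ->; rewrite mulr0.
by move=> h; apply: (@cvgM R _ _ _ (f : G -> R^o) (f' : G -> R^o)); [exact: fc|exact: fc'].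
Qed.

Hypothesis hmu : left_haar mu.
Let rmu : radon mu. Proof. by case: hmu. Qed.

Lemma ccont_int f : ccont f -> mu.-integrable setT (EFin \o f).
Proof. by move=> [fc [K cK Kf]]; exact: (integrable_cc rmu fc cK Kf). Qed.

Lemma Rint_lin (r : R) f f' : ccont f -> ccont f' ->
  Rint (fun h => r * f h + f' h) = r * Rint f + Rint f'.
Proof.
move=> cf cf'; rewrite RintegralD//; last exact: ccont_int.
  by rewrite RintegralZl//; exact: ccont_int.
have c0 : ccont (fun=> 0).
  split; first by move=> h; exact: cvg_cst.
  by exists set0 => //; exact: compact0.
have := ccont_int (ccont_lin r cf c0).
by congr (mu.-integrable _ _); apply/funext => h /=; rewrite addr0.
Qed.

Lemma Rint_ltrans g f : ccont f -> Rint (fun h => f (g * h)%g) = Rint f.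
Proof.
move=> cf; have mp := continuous_measurableG (@mulG_contl g).
rewrite /Rintegral; congr fine.
have := @integral_pushforward _ _ _ _ R _ mp mu setT (EFin \o f) _ _ measurableT.
rewrite preimage_setT => h; rewrite -h.
- apply: eq_measure_integral => A mA _; rewrite /pushforward.
  have [_ _ linv] := hmu.
  rewrite -(linv g^-1%g A mA); congr (mu _); apply/seteqP; split=> a /=.
    by move=> Aa; exists (g * a)%g => //; rewrite mulgA mulVg mul1g.
  by move=> [b Ab <-]; rewrite mulgA mulgV mul1g.
- by apply/measurable_EFinP; apply: continuous_measurable; case: cf.
- exact: ccont_int (ccont_ltrans g cf).
Qed.

Variables (m : G -> R) (hm : modular_function mu m).

(** [mu] has density [m] with respect to a right Haar measure. Writing [m h] as
    [(m g)^-1 * m (h * g)] and substituting [h * g] leaves the right Haar measure unchanged and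
    brings out the constant. *)
Lemma modular_rtrans g (A : set (borel G)) : measurable A ->
  mu [set h | A (h * g)%g] = (((m g)^-1)%:E * mu A)%E.
Proof.
move=> mA; have [mc m0 mM [mur [rmur _ rinv] mE]] := hm.
have mp := continuous_measurableG (@mulG_contr g).
have mB : measurable ([set h | A (h * g)%g] : set (borel G)).
  by rewrite -[X in measurable X]setTI; exact: mp.
have g0 : m g != 0 by rewrite gt_eqF.
have mm : measurable_fun setT ((m : borel G -> R)) by exact: continuous_measurable.
have mF : measurable_fun A (fun y : borel G => ((m g)^-1 * m y)%:E).
  apply/measurable_EFinP; apply: measurable_funM; first exact: measurable_cst.
  exact: measurable_funTS.
rewrite (mE _ mB).
transitivity (\int[pushforward mur (fun h : borel G => (h * g)%g : borel G)]_(y in A) ((m g)^-1 * m y)%:E)%E.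
  rewrite (@ge0_integral_pushforward _ _ _ _ R _ mp mur A (fun y : borel G => ((m g)^-1 * m y)%:E) mA mF).
    apply: eq_integral => h _ /=; congr (_%:E).
    by rewrite mM mulrC mulfK.
  by move=> y _; rewrite lee_fin mulr_ge0// ?invr_ge0 ltW.
transitivity (\int[mur]_(y in A) ((m g)^-1 * m y)%:E)%E.
  apply: eq_measure_integral => B mB' _; rewrite /pushforward.
  rewrite -(rinv g^-1%g B mB'); congr (mur _); apply/seteqP; split=> a /=.
    by move=> Aa; exists (a * g)%g => //; rewrite -mulgA mulgV mulg1.
  by move=> [b Ab <-]; rewrite -mulgA mulVg mulg1.
under eq_integral do rewrite EFinM.
rewrite ge0_integralZl//.
- by rewrite -mE.
- by apply/measurable_EFinP; exact: measurable_funTS.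
- by move=> x _; rewrite lee_fin ltW.
- by rewrite lee_fin invr_ge0 ltW.
Qed.

Lemma Rint_rtrans g f : ccont f -> Rint (fun h => f (h * g)%g) = (m g)^-1 * Rint f.
Proof.
move=> cf; have mp := continuous_measurableG (@mulG_contr g).
have [_ m0 _ _] := hm.
have k0 : 0 <= (m g)^-1 by rewrite invr_ge0 ltW.
rewrite /Rintegral; pose k := NngNum k0.
have fi := ccont_int cf.
have mf : measurable_fun setT (EFin \o f : borel G -> \bar R).
  by apply/measurable_EFinP; apply: continuous_measurable; case: cf.
have fin : (\int[mu]_x (EFin \o f) x)%E \is a fin_num by exact: integrable_fin_num.
have -> : (m g)^-1 * fine (\int[mu]_x (f x)%:E)%E = fine ((m g)^-1%:E * \int[mu]_x (EFin \o f) x)%E.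
  by rewrite fineM.
congr fine.
have := @integral_pushforward _ _ _ _ R _ mp mu setT (EFin \o f) _ _ measurableT.
rewrite preimage_setT => h; rewrite -h//; last exact: ccont_int (ccont_rtrans g cf).
have -> : (\int[pushforward mu (fun h : borel G => (h * g)%g : borel G)]_x (EFin \o f) x)%E =
    (\int[mscale k mu]_x (EFin \o f) x)%E.
  by apply: eq_measure_integral => A mA _; exact: (modular_rtrans g mA).
(* The scaling of the measure is applied to positive and negative parts separately; finiteness of
   the negative one allows the factor to be put outside the difference. *)
rewrite integralE [in RHS]integralE.
rewrite ge0_integral_mscale//; last exact: measurable_funepos.
rewrite ge0_integral_mscale//; last exact: measurable_funeneg.
apply/esym; apply: muleBr => //; apply: fin_num_adde_defl.
by rewrite fin_numN; exact: integrable_neg_fin_num.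
Qed.

End HaarIntegral.

(** * Interchange of integrals with compact support *)

Section Fubini.
Context {R : realType} {n : nat} {G : lieGroupType R n}.
Variables (mu : {measure set (borel G) -> \bar R}) (hmu : left_haar mu).
Implicit Types (f : G -> R).
Notation Rint := (Rintegral mu setT).
Let rmu : radon mu. Proof. by case: hmu. Qed.

Lemma ccont0 : @ccont R n G (fun=> 0).
Proof.
split; first by move=> h; exact: cvg_cst.
by exists set0 => //; exact: compact0.
Qed.

Lemma Rint0 : Rint (fun=> 0 : R) = 0.
Proof. by rewrite Rintegral_cst// mul0r. Qed.

Lemma ccont_sum (T : Type) (w : seq (R * T)) (F : T -> G -> R) : (forall t, ccont (F t)) ->
  ccont (fun g => \sum_(p <- w) p.1 * F p.2 g) /\
  Rint (fun g => \sum_(p <- w) p.1 * F p.2 g) = \sum_(p <- w) p.1 * Rint (F p.2).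
Proof.
move=> cF; elim: w => [|p w [c e]].
  have -> : (fun g => \sum_(p <- [::]) p.1 * F p.2 g) = (fun=> 0).
    by apply/funext => g; rewrite big_nil.
  by rewrite big_nil Rint0; split=> //; exact: ccont0.
have -> : (fun g => \sum_(q <- p :: w) q.1 * F q.2 g) =
    (fun g => p.1 * F p.2 g + \sum_(q <- w) q.1 * F q.2 g).
  by apply/funext => g; rewrite big_cons.
split; first exact: ccont_lin.
by rewrite (Rint_lin hmu)// e big_cons.
Qed.

(** [tube_lemma] gives the estimate for [g] in [K], and the support condition extends it to all [g]:
    this is the equicontinuity that Riemann sums ask for. *)
Lemma near_uniform (W : normedModType R) (T : topologicalType) (F : T -> G -> W) (K : set T) h (e : R) : compact K ->
  (forall g h, ~ K g -> F g h = 0) -> continuous (fun p : T * G => F p.1 p.2) -> 0 < e ->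
  \forall h' \near h, forall g, `|F g h' - F g h| <= e.
Proof.
move=> cK Fs Fc e0.
have := @tube_lemma R G T W K (fun h g => F g h) h e cK _ e0.
have hc : forall t, K t -> {for (h, t), continuous (fun p : G * T => F p.2 p.1)}.
  move=> t Kt.
  apply: (cvg_cont (f := fun p : G * T => (p.2, p.1)) (l := (t, h)) (L := fun p : T * G => F p.1 p.2)).
    by apply: cvg_pair; [exact: cvg_snd|exact: cvg_fst].
  exact: Fc.
move=> /(_ hc); apply: filterS => h' H g; have [/H//|/Fs Fg] := pselect (K g).
by rewrite !Fg subrr normr0 ltW.
Qed.

Section Two.
Variables (F : G -> G -> R) (K L : set G).
Hypotheses (cK : compact K) (cL : compact L).
Hypothesis Fc : continuous (fun p : G * G => F p.1 p.2 : R^o).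
Hypothesis Fs : forall g h, ~ (K g /\ L h) -> F g h = 0.

Lemma ccont_slice1 g : ccont (F g).
Proof.
split; last by exists L => // h nh; apply: Fs => -[].
move=> h; have h1 : (g, h') @[h' --> h] --> (g, h).
  by apply: cvg_pair; [exact: cvg_cst|exact: cvg_id].
exact: (cvg_cont h1 (@Fc (g, h))).
Qed.

Lemma ccont_slice2 h : ccont (F^~ h).
Proof.
split; last by exists K => // g nh; apply: Fs => -[].
move=> g; have h1 : (g', h) @[g' --> g] --> (g, h).
  by apply: cvg_pair; [exact: cvg_id|exact: cvg_cst].
exact: (cvg_cont h1 (@Fc (g, h))).
Qed.

Lemma Rint_near h (e : R) : 0 < e -> \forall h' \near h, `|Rint (F^~ h') - Rint (F^~ h)| <= e.
Proof.
move=> e0; have m0 : 0 <= fine (mu K) by rewrite fine_ge0.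
have e1 : 0 < e / (fine (mu K) + 1) by rewrite divr_gt0// ltr_wpDl.
have := @near_uniform R^o G F K h _ cK (fun g h nK => Fs (fun kl => nK kl.1)) Fc e1.
apply: filterS => h' H.
have -> : Rint (F^~ h') - Rint (F^~ h) = Rint (fun g => (-1) * F g h + F g h').
  rewrite (Rint_lin hmu); [|exact: ccont_slice2|exact: ccont_slice2].
  by rewrite mulN1r addrC.
have [gc _] := ccont_lin (-1) (ccont_slice2 h) (ccont_slice2 h').
apply: (le_trans (@Rintegral_le _ _ _ mu rmu _ K (e / (fine (mu K) + 1)) gc cK _ _)).
- by move=> g nK; rewrite !Fs ?mulr0 ?addr0// => -[].
- by move=> g Kg; rewrite mulN1r addrC.
- by rewrite mulrA ler_pdivrMr ?ltr_wpDl// mulrC ler_wpM2l ?(ltW e0)// lerDl.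
Qed.

Lemma ccont_Rint : ccont (fun h => Rint (F^~ h)).
Proof.
split; last first.
  exists L => // h nL; rewrite -[RHS]Rint0; congr Rintegral; apply/funext => g.
  by apply: Fs => -[].
by move=> h; apply/cvgrPdist_le => e e0; have := @Rint_near h e e0; apply: filterS => h'; rewrite distrC.
Qed.

End Two.

Lemma continuous_swap (T T' U : topologicalType) (F : T -> T' -> U) :
  continuous (fun p : T * T' => F p.1 p.2) -> continuous (fun p : T' * T => F p.2 p.1).
Proof.
move=> Fc [t' t]; have h1 : (p.2, p.1) @[p --> (t', t)] --> (t, t').
  by apply: cvg_pair; [exact: cvg_snd|exact: cvg_fst].
exact: (cvg_cont h1 (@Fc (t, t'))).
Qed.

(** For finite sums the interchange is linearity of the integral. Riemann sums in [h] that are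
    uniform in [g] bring both iterated integrals close to the same number [S]. *)
Lemma fubini_cc (F : G -> G -> R) (K L : set G) : compact K -> compact L ->
  continuous (fun p : G * G => F p.1 p.2 : R^o) ->
  (forall g h, ~ (K g /\ L h) -> F g h = 0) ->
  Rint (fun g => Rint (F g)) = Rint (fun h => Rint (F^~ h)).
Proof.
move=> cK cL Fc Fs.
have m0 : 0 <= fine (mu K) by rewrite fine_ge0.
have c1 := ccont_slice1 cL Fc Fs; have c2 := ccont_slice2 cK Fc Fs.
have cR := ccont_Rint cK cL Fc Fs.
have cA : ccont (fun g => Rint (F g)).
  apply: (@ccont_Rint (fun h g => F g h) L K cL cK).
    exact: continuous_swap Fc.
  by move=> g h nK; apply: Fs => -[? ?]; apply: nK.
apply/eqP; rewrite -subr_eq0 -normr_le0; apply/ler_addgt0Pl => e e0; rewrite addr0.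
have d0 : 0 < fine (mu K) + 1 by rewrite ltr_wpDl.
have e1 : 0 < e / (fine (mu K) + 1) by rewrite divr_gt0.
set ep := e / _ in e1.
(* The index [None] puts the inner integral into the family, so that it is approximated with the
   same points and weights as the slices [F g]. *)
pose I := option G; pose f (i : I) := if i is Some g then F g else fun h => Rint (F^~ h).
have fc i : ccont (f i).
  by case: i => [g|]; [exact: c1|exact: cR].
have [||w [w1 w2 w3]] := @riemann_sums _ _ _ mu rmu I f L cL (fun i => (fc i).1) ep e1.
- move=> h r _ r0.
  have n1 := @near_uniform R^o G F K h _ cK (fun g h nK => Fs g h (fun kl => nK kl.1)) Fc r0.
  have := @Rint_near F K L cK Fc Fs h r r0; move: n1; apply: filterS2 => h' n1 n2 [g|]; last exact: n2.
  exact: n1.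
- case=> [g|] h nL /=; first by apply: Fs => -[].
  by rewrite -[RHS]Rint0; congr Rintegral; apply/funext => g; apply: Fs => -[].
have [sc sE] := ccont_sum w c2.
have w0 := w3 None; rewrite /= -sE in w0.
set S := Rint (fun g => \sum_(p <- w) p.1 * F g p.2) in sE w0.
have wA : `|Rint (fun g => Rint (F g)) - S| <= fine (mu K) * ep.
  have -> : Rint (fun g => Rint (F g)) - S =
      Rint (fun g => (-1) * \sum_(p <- w) p.1 * F g p.2 + Rint (F g)).
    by rewrite (Rint_lin hmu)// mulN1r addrC.
  have [gc _] := ccont_lin (-1) sc cA.
  apply: (@Rintegral_le _ _ _ mu rmu _ K ep gc cK) => g Kg.
    have F0 : F g = fun=> 0 by apply/funext => h; apply: Fs => -[].
    by rewrite F0 Rint0 big1 ?mulr0 ?addr0// => p _; rewrite mulr0.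
  by rewrite mulN1r addrC; exact: (w3 (Some g)).
rewrite -(subrKA S) (le_trans (ler_normD _ _))//.
rewrite [X in _ + X]distrC (le_trans (lerD wA w0))//.
by rewrite -[X in _ + X]mul1r -mulrDl mulrC /ep divfK ?gt_eqF.
Qed.
End Fubini.

(** * Positivity of the Haar integral and the inversion formula *)

Section Inversion.
Context {R : realType} {n : nat} {G : lieGroupType R n}.
Variables (mu : {measure set (borel G) -> \bar R}) (hmu : left_haar mu).
Implicit Types (f : G -> R).
Notation Rint := (Rintegral mu setT).
Let rmu : radon mu. Proof. by case: hmu. Qed.

Lemma RintZ (r : R) f : ccont f -> Rint (fun h => r * f h) = r * Rint f.
Proof.
move=> cf; have := Rint_lin hmu r cf (@ccont0 R n G); rewrite Rint0 addr0 => <-.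
by congr Rintegral; apply/funext => h; rewrite addr0.
Qed.

(* If the integral vanished, finitely many translates of [chi > chi 1 / 2]
   would cover any compact set by null sets. *)
Lemma Rint_gt0 (chi : G -> R) : ccont chi -> (forall h, 0 <= chi h) -> 0 < chi 1%g ->
  0 < Rint chi.
Proof.
move=> cchi chi0 chi1; rewrite lt_neqAle; apply/andP; split; last first.
  by apply: Rintegral_ge0 => h _; exact: chi0.
apply/eqP => I0; have [cc _] := cchi.
set c := chi 1%g / 2; have c0 : 0 < c by exact: divr_gt0.
pose V : set G := [set h | c < chi h].
have oV : open V.
  by apply: (@open_comp _ _ (chi : G -> R^o) [set x | c < x]); [move=> x _; exact: cc|exact: open_gt].
have V1 : V 1%g by rewrite /V /= /c ltr_pdivrMr// ltr_pMr// ltr1n.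
have mV : measurable (V : set (borel G)) by exact: sub_sigma_algebra.
have ci := ccont_int hmu cchi.
have Vle : (c%:E * mu V <= 0)%E.
  rewrite -integral_cst//.
  have -> : 0%E = (\int[mu]_(x in setT) (chi x)%:E)%E.
    have fin : (\int[mu]_x (EFin \o chi) x)%E \is a fin_num by exact: integrable_fin_num.
    by rewrite -[RHS](fineK fin); congr EFin.
  have mchi : measurable_fun setT (EFin \o chi : borel G -> \bar R).
    by apply/measurable_EFinP; apply: continuous_measurable.
  apply: (@le_trans _ _ (\int[mu]_(x in V) (chi x)%:E)%E).
    apply: ge0_le_integral => //.
    - by move=> x _; rewrite lee_fin ltW.
    - exact: measurable_funTS.
    - by move=> x Vx; rewrite lee_fin ltW.
  by apply: ge0_subset_integral => // x _; rewrite lee_fin.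
have muV : mu V = 0.
  apply/eqP; rewrite eq_le measure_ge0 andbT.
  by move: Vle; rewrite pmule_rle0.
have [_ mu0 linv] := hmu; move: mu0; apply/negP; rewrite negbK.
(* Inner regularity on the open set [setT] reduces the vanishing of [mu] to compact sets. *)
have [_ _ hin] := rmu; rewrite (hin _ openT) eq_le; apply/andP; split; last first.
  by apply: ereal_sup_ubound; exists set0; rewrite ?measure0//; split=> //; exact: compact0.
apply: ge_ereal_sup => _ [K [cK _] <-].
pose N (g : G) : set G := [set (g * a)%g | a in V].
have NE g : N g = [set h | V (g^-1 * h)%g].
  apply/seteqP; split=> h /=; first by move=> [a Va <-]; rewrite mulgA mulVg mul1g.
  by move=> Vh; exists (g^-1 * h)%g => //; rewrite mulgA mulgV mul1g.
have oN g : open (N g).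
  by rewrite NE; apply: (open_comp _ oV) => x _; exact: mulG_contl.
have mN g : measurable (N g : set (borel G)) by exact: sub_sigma_algebra.
have N0 g : mu (N g) = 0 by rewrite linv.
have := cK; rewrite compact_cover => /(_ G K N (fun h _ => oN h)).
case=> [h Kh|D DK KD]; first by exists h => //; rewrite NE /= mulVg.
have [B [mB KB B0]] : exists B : set (borel G),
    [/\ measurable B, forall g, g \in finmap.enum_fset D -> N g `<=` B & mu B = 0].
  elim: (finmap.enum_fset D) => [|g s [B [mB sB B0]]]; first by exists set0; rewrite measure0.
  exists (N g `|` B); split; first exact: measurableU.
  - move=> g'; rewrite inE => /orP[/eqP ->|/sB sg']; first exact: subsetUl.
    by apply: (subset_trans sg'); exact: subsetUr.
  - by rewrite measureU0.
rewrite -B0; apply: le_measure; rewrite ?inE//; first exact: compact_measurable.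
by move=> h /KD [g Dg Ng]; exact: (KB g).
Qed.

Lemma ex_unit_bump (N : set G) : open N -> N 1%g -> exists chi : G -> R^o,
  [/\ smooth_map idfun chi, forall h, 0 <= (chi h : R), Rint chi = 1 &
      exists2 K, compact K & K `<=` N /\ forall h, ~ K h -> chi h = 0].
Proof.
move=> oN N1; have [chi [K [chis chi1 chi0 [cK KN] Kchi]]] := G_bump oN N1.
have cchi : @ccont R n G chi.
  by split; [exact: (smooth_map_cont chis)|exists K].
have I0 := Rint_gt0 cchi chi0 chi1.
exists (fun h => (Rint chi)^-1 *: chi h + 0); split.
- by apply: smooth_lin => // c ac; exact: sm_cst.
- by move=> h; rewrite addr0 mulr_ge0// invr_ge0 ltW.
- by rewrite (Rint_lin hmu)//; [rewrite Rint0 addr0 mulVf// gt_eqF|exact: ccont0].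
- by exists K => //; split=> // h /Kchi ->; rewrite scaler0 addr0.
Qed.

Variables (m : G -> R) (hm : modular_function mu m).

Lemma modular1 : m 1%g = 1.
Proof.
have [_ m0 mM _] := hm; have := mM 1%g 1%g; rewrite mulg1 => /eqP.
by rewrite -subr_eq0 -{1}[m _]mulr1 -mulrBr mulf_eq0 gt_eqF//= subr_eq0 => /eqP.
Qed.

Lemma modularV g : m (g^-1)%g = (m g)^-1.
Proof.
have [_ m0 mM _] := hm; have := mM g g^-1%g; rewrite mulgV modular1 => h.
by rewrite -[LHS](mulKf (x := m g)) ?gt_eqF// -h mulr1.
Qed.

Lemma modularV_cont : continuous (fun g => (m g)^-1 : R^o).
Proof.
have [mc m0 _ _] := hm => g; apply: (@cvgV R _ _ (nbhs_filter g) (m : G -> R^o) (m g : R)).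
  by rewrite gt_eqF.
exact: mc.
Qed.

Let fstc : continuous (fun p : G * G => p.1). Proof. by move=> p; exact: cvg_fst. Qed.
Let sndc : continuous (fun p : G * G => p.2). Proof. by move=> p; exact: cvg_snd. Qed.
Let compc (T U V : topologicalType) (f : U -> V) (g : T -> U) :
  continuous f -> continuous g -> continuous (fun t => f (g t)).
Proof. by move=> fc gc t; exact: (cvg_cont (@gc t) (@fc (g t))). Qed.
Let mulc (f g : G * G -> R^o) : continuous f -> continuous g ->
  continuous (fun p => (f p : R) * g p : R^o).
Proof. by move=> fc gc p; apply: (@cvgM R _ _ _ f g); [exact: fc|exact: gc]. Qed.
Let mulGc (f g : G * G -> G) : continuous f -> continuous g -> continuous (fun p => f p * g p)%g.
Proof. by move=> fc gc p; apply: cvg_mulG; [exact: fc|exact: gc]. Qed.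
Let invGc (f : G * G -> G) : continuous f -> continuous (fun p => (f p)^-1)%g.
Proof. by move=> fc p; apply: cvg_invG; exact: fc. Qed.

Lemma ccont_inv f : ccont f -> ccont (fun y => f (y^-1)%g).
Proof.
move=> [fc [K cK Kf]]; split.
  by apply: (compc (f := f : G -> R^o) (g := fun y : G => (y^-1)%g)) => //; exact: lie_inv_continuous.
by exists [set g | K (g^-1)%g]; [exact: compact_invG|move=> h nh; exact: Kf].
Qed.

(* Both sides are obtained from the integral of
   [chi x * m x * h (y^-1 * x) / m y] over [G * G]. *)
Lemma Rint_inv (h : G -> R) : ccont h ->
  Rint (fun y => (m y)^-1 * h (y^-1)%g) = Rint h.
Proof.
move=> ch; have [mc m0 mM _] := hm.
have m00 g : m g != 0 by rewrite gt_eqF.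
have [chi [chis chi0 chi1 [K cK [_ Kchi]]]] := ex_unit_bump openT I.
have chic := smooth_map_cont chis.
have cchi : @ccont R n G chi by split=> //; exists K.
have [hc [L cL Lh]] := ch.
pose k y := (m y)^-1 * h (y^-1)%g.
have ck : ccont k by apply: ccontM; [exact: modularV_cont|exact: ccont_inv].
pose L' : set G := [set g | exists a b, [/\ K a, [set g | L (g^-1)%g] b & g = (a * b)%g]].
have cL' : compact L' by apply: compact_mulG => //; exact: compact_invG.
pose F x y := (chi x * m x) * ((m y)^-1 * h (y^-1 * x)%g).
have Fc : continuous (fun p : G * G => F p.1 p.2 : R^o).
  apply: mulc; apply: mulc; [exact: compc|exact: compc| |].
    by apply: (compc (f := fun y => (m y)^-1 : R^o)) => //; exact: modularV_cont.
  by apply: (compc (f := h : G -> R^o)) => //; apply: mulGc => //; exact: invGc.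
have Fs x y : ~ (K x /\ L' y) -> F x y = 0.
  move=> nxy; rewrite /F; have [Kx|/Kchi ->] := pselect (K x); last by rewrite !mul0r.
  rewrite Lh ?mulr0// => Lxy; apply: nxy; split=> //.
  exists x, (x^-1 * y)%g; split=> //=; last by rewrite mulgA mulgV mul1g.
  by rewrite invgM invgK.
have fub := fubini_cc hmu cK cL' Fc Fs.
(* As a function of [y], [F x y] is [chi x] times a left translate of [k], whose integral does not
   depend on [x]. *)
have lhs : Rint (fun x => Rint (F x)) = Rint k.
  have -> : (fun x => Rint (F x)) = (fun x => Rint k * chi x).
    apply/funext => x.
    have -> : F x = (fun y => chi x * k (x^-1 * y)%g).
      apply/funext => y; rewrite /F /k invgM invgK mM modularV invfM invrK.
      by ring.
    rewrite (RintZ (chi x) (ccont_ltrans x^-1%g ck)) (Rint_ltrans hmu x^-1%g ck).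
    exact: mulrC.
  by rewrite (RintZ (Rint k) cchi) chi1 mulr1.
(* This is [F (y * x) y], where the multiplicativity of [m] cancels [m y]. Integrating over [y]
   afterwards gives [(m x)^-1], which cancels [m x]. *)
pose F2 x y := (chi (y * x)%g) * (m x * h x).
pose K2 : set G := [set g | exists a b, [/\ K a, [set g | L (g^-1)%g] b & g = (a * b)%g]].
have F2c : continuous (fun p : G * G => F2 p.1 p.2 : R^o).
  apply: mulc; first by apply: (compc (f := chi)) => //; exact: mulGc.
  by apply: mulc; [exact: (compc (f := m : G -> R^o))|exact: (compc (f := h : G -> R^o))].
have F2s x y : ~ (L x /\ K2 y) -> F2 x y = 0.
  move=> nxy; rewrite /F2; have [Lx|/Lh ->] := pselect (L x); last by rewrite !mulr0.
  rewrite Kchi ?mul0r// => Kyx; apply: nxy; split; first exact: Lx.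
  exists (y * x)%g, (x^-1)%g; rewrite /= invgK; split; [exact: Kyx|exact: Lx|].
  by rewrite -mulgA mulgV mulg1.
have fub2 := fubini_cc hmu cL cL' F2c F2s.
have mid y : Rint (F^~ y) = Rint (F2^~ y).
  rewrite -(Rint_ltrans hmu y (ccont_slice2 cK Fc Fs y)); congr Rintegral; apply/funext => x.
  have my0 := m00 y; rewrite /F /F2 mM (mulgA y^-1%g y x) mulVg (mul1g x).
  by move: (m y) my0 (m x) (h x) (chi (y * x)%g : R) => a a0 b c d; field.
change (Rint k = Rint h); rewrite -lhs fub.
under eq_Rintegral do rewrite mid.
rewrite -fub2; congr Rintegral; apply/funext => x.
have -> : F2 x = (fun y => (m x * h x) * chi (y * x)%g).
  by apply/funext => y; rewrite /F2 mulrC.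
rewrite (RintZ (m x * h x) (ccont_rtrans x cchi)) (Rint_rtrans hmu hm x cchi) chi1 mulr1.
by move: (m x) (m00 x) (h x) => a a0 b; field.
Qed.

End Inversion.

(** * Complex integrals; convolution and involution of test functions *)

Section ComplexIntegral.
Context {R : realType} {n : nat} {G : lieGroupType R n}.
Variables (mu : {measure set (borel G) -> \bar R}) (hmu : left_haar mu).
Local Notation CR := (realify (R[i]^o : normedModType R[i])).
Implicit Types (f g : G -> CR).
Notation Rint := (Rintegral mu setT).
Notation Cint := (Cintegral mu).
Let rmu : radon mu. Proof. by case: hmu. Qed.

Lemma cvg_mulC (T : Type) (F : set_system T) (f g : T -> CR) (a b : CR) : Filter F ->
  f x @[x --> F] --> a -> g x @[x --> F] --> b ->
  ((f x : R[i]) * g x : CR) @[x --> F] --> ((a : R[i]) * b : CR).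
Proof. by move=> FF fa gb; exact: (@cvgM R[i] _ F FF f g a b fa gb). Qed.

Definition ccontC (f : G -> R[i]) : Prop :=
  continuous (f : G -> CR) /\ exists2 K : set G, compact K & forall h, ~ K h -> f h = 0.

Lemma cc_smooth_ccontC f : cc_smooth f -> ccontC f.
Proof. by move=> [fs fK]; split=> //; exact: smooth_map_cont. Qed.

Lemma test_function_ccontC (f : G -> R[i]) : test_function f -> ccontC f.
Proof. by move=> /test_functionP; exact: cc_smooth_ccontC. Qed.

Lemma ccontC_re f : ccontC f -> @ccont R n G (fun h => complex.Re (f h)).
Proof.
move=> [fc [K cK Kf]]; split; last by exists K => // h /Kf ->.
by move=> h; exact: (cvg_cont (L := reC) (@fc h) (@reC_cont R (f h))).
Qed.

Lemma ccontC_im f : ccontC f -> @ccont R n G (fun h => complex.Im (f h)).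
Proof.
move=> [fc [K cK Kf]]; split; last by exists K => // h /Kf ->.
by move=> h; exact: (cvg_cont (L := imC) (@fc h) (@imC_cont R (f h))).
Qed.

Lemma ccontC0 : ccontC (fun=> 0).
Proof.
split; first by move=> h; exact: cvg_cst.
by exists set0 => //; exact: compact0.
Qed.

Lemma ccontCM f g : ccontC f -> continuous g -> ccontC (fun h => (f h : R[i]) * g h).
Proof.
move=> [fc [K cK Kf]] gc; split; last by exists K => // h /Kf ->; rewrite mul0r.
by move=> h; apply: cvg_mulC; [exact: fc|exact: gc].
Qed.

Lemma ccontC_ltrans a f : ccontC f -> ccontC (fun h => f (a * h)%g).
Proof.
move=> [fc [K cK Kf]]; split.
  by move=> h; exact: (cvg_cont (L := f) (@mulG_contl R n G a h) (@fc (a * h)%g)).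
exists ((fun h => a^-1 * h)%g @` K).
  by apply: continuous_compact => //; apply: continuous_subspaceT; exact: mulG_contl.
move=> h nh; apply: Kf => Kh; apply: nh; exists (a * h)%g => //.
by rewrite mulgA mulVg mul1g.
Qed.

Lemma Cint_lin (c : R[i]) f g : ccontC f -> ccontC g ->
  Cint (fun h => c * (f h : R[i]) + (g h : R[i])) = c * Cint f + Cint g.
Proof.
move=> cf cg; have fr := ccontC_re cf; have fi := ccontC_im cf.
have gr := ccontC_re cg; have gi := ccontC_im cg.
rewrite /Cintegral; case: c => a b.
have -> : (fun h => complex.Re ((a +i* b) * (f h : R[i]) + (g h : R[i]))) =
   (fun h => a * complex.Re (f h) + ((- b) * complex.Im (f h) + complex.Re (g h))).
  by apply/funext => h; case: (f h) (g h) => p q [r s] /=; ring.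
have -> : (fun h => complex.Im ((a +i* b) * (f h : R[i]) + (g h : R[i]))) =
   (fun h => a * complex.Im (f h) + (b * complex.Re (f h) + complex.Im (g h))).
  by apply/funext => h; case: (f h) (g h) => p q [r s] /=; ring.
rewrite (Rint_lin hmu a fr (ccont_lin (- b) fi gr)) (Rint_lin hmu (- b) fi gr).
rewrite (Rint_lin hmu a fi (ccont_lin b fr gi)) (Rint_lin hmu b fr gi).
by simpc; congr Complex; ring.
Qed.

Lemma Cint0 : Cint (fun=> 0) = 0.
Proof. by rewrite /Cintegral /= !Rint0. Qed.

Lemma CintZ (c : R[i]) f : ccontC f -> Cint (fun h => c * (f h : R[i])) = c * Cint f.
Proof.
move=> cf; have := Cint_lin c cf ccontC0; rewrite Cint0 addr0 => <-.
by congr Cintegral; apply/funext => h; rewrite addr0.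
Qed.

Lemma CintB f g : ccontC f -> ccontC g -> Cint (fun h => (f h : R[i]) - g h) = Cint f - Cint g.
Proof.
move=> cf cg; have := Cint_lin (-1) cg cf; rewrite mulN1r addrC => <-.
by congr Cintegral; apply/funext => h; rewrite mulN1r addrC.
Qed.

Lemma Cint_conj f : ccontC f -> Cint (fun h => ((f h : R[i])^*)%C) = ((Cint f)^*)%C.
Proof.
move=> cf; rewrite /Cintegral; congr Complex.
  by congr Rintegral; apply/funext => h; case: (f h).
have -> : (fun h => complex.Im (((f h : R[i])^*)%C)) = (fun h => (-1) * complex.Im (f h)).
  by apply/funext => h; case: (f h) => a b /=; rewrite mulN1r.
by rewrite (RintZ hmu (-1) (ccontC_im cf)) mulN1r.
Qed.

Lemma Cint_ltrans a f : ccontC f -> Cint (fun h => f (a * h)%g) = Cint f.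
Proof.
move=> cf; rewrite /Cintegral; congr Complex.
  exact: (Rint_ltrans hmu a (ccontC_re cf)).
exact: (Rint_ltrans hmu a (ccontC_im cf)).
Qed.

Lemma Cint_le f K (M : R) : ccontC f -> compact K -> (forall h, ~ K h -> f h = 0) ->
  (forall h, K h -> `|f h| <= M) -> `|(Cint f : CR)| <= 2 * fine (mu K) * M.
Proof.
move=> cf cK Kf fM; rewrite (le_trans (CR_le_ReIm _))//= -mulrA mulr2n mulrDl mul1r lerD//.
  apply: (@Rintegral_le _ _ _ mu rmu _ K M (ccontC_re cf).1 cK) => h Kh; first by rewrite Kf.
  exact: (le_trans (CR_Re_le _) (fM h Kh)).
apply: (@Rintegral_le _ _ _ mu rmu _ K M (ccontC_im cf).1 cK) => h Kh; first by rewrite Kf.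
exact: (le_trans (CR_Im_le _) (fM h Kh)).
Qed.

Lemma L1normE (f : G -> CR) : L1norm mu f = Rint (fun h => `|f h|).
Proof. by []. Qed.

Lemma ccont_norm f : ccontC f -> @ccont R n G (fun h => `|f h|).
Proof.
move=> [fc [K cK Kf]]; split; last by exists K => // h /Kf ->; rewrite normr0.
by move=> h; apply: cvg_norm; exact: fc.
Qed.

Lemma Rint_le_norm (f : G -> R) (g : G -> R) : ccont f -> ccont g ->
  (forall h, `|f h| <= g h) -> `|Rint f| <= Rint g.
Proof.
move=> cf cg fg; have fi := ccont_int hmu cf.
rewrite (le_trans (le_normr_Rintegral _ _))//; apply: le_Rintegral => //.
- have nf : ccont (fun h => `|f h|).
    case: cf => fc [K cK Kf]; split; last by exists K => // h /Kf ->; rewrite normr0.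
    by move=> h; apply: cvg_norm; exact: fc.
  exact: (ccont_int hmu nf).
- exact: (ccont_int hmu cg).
Qed.

(** The factor 2 comes from estimating real and imaginary parts separately. It is harmless, since
    [continuous_tf] asks for some constant. *)
Lemma Cint_norm f : ccontC f -> `|(Cint f : CR)| <= 2 * L1norm mu f.
Proof.
move=> cf; have cn := ccont_norm cf.
rewrite L1normE (le_trans (CR_le_ReIm _))//= mulr2n mulrDl mul1r lerD//.
  by apply: Rint_le_norm => // [|h]; [exact: ccontC_re|exact: CR_Re_le].
by apply: Rint_le_norm => // [|h]; [exact: ccontC_im|exact: CR_Im_le].
Qed.

Lemma L1norm_le f K (M : R) : ccontC f -> compact K -> (forall h, ~ K h -> f h = 0) ->
  (forall h, K h -> `|f h| <= M) -> L1norm mu f <= fine (mu K) * M.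
Proof.
move=> cf cK Kf fM; rewrite L1normE (le_trans (ler_norm _))//.
apply: (@Rintegral_le _ _ _ mu rmu _ K M (ccont_norm cf).1 cK) => h Kh.
  by rewrite Kf// normr0.
by rewrite normr_id; exact: fM.
Qed.

Lemma Cint_fubini (F : G -> G -> CR) (K L : set G) : compact K -> compact L ->
  continuous (fun p : G * G => F p.1 p.2) ->
  (forall x y, ~ (K x /\ L y) -> F x y = 0) ->
  Cint (fun x => Cint (F x)) = Cint (fun y => Cint (F^~ y)).
Proof.
move=> cK cL Fc Fs.
have hre := @fubini_cc _ _ _ mu hmu (fun x h => complex.Re (F x h)) K L cK cL.
have him := @fubini_cc _ _ _ mu hmu (fun x h => complex.Im (F x h)) K L cK cL.
apply: (f_equal2 (@Complex R) (hre _ _) (him _ _)).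
- by move=> p; exact: (cvg_cont (L := reC) (@Fc p) (@reC_cont R _)).
- by move=> x h ngh; rewrite Fs.
- by move=> p; exact: (cvg_cont (L := imC) (@Fc p) (@imC_cont R _)).
- by move=> x h ngh; rewrite Fs.
Qed.

(** Real and imaginary parts form one real family indexed by [I * bool], so that they share points
    and weights. *)
Lemma Cint_riemann (I : Type) (f : I -> G -> CR) (K : set G) (ep : R) : compact K ->
  (forall i, continuous (f i)) -> 0 < ep ->
  (forall h e, K h -> 0 < e -> \forall h' \near h, forall i, `|f i h' - f i h| <= e) ->
  (forall i h, ~ K h -> f i h = 0) ->
  exists w : seq (R * G), forall i,
    `|(Cint (f i) - \sum_(p <- w) p.1%:C * (f i p.2 : R[i]) : CR)| <= ep.
Proof.
move=> cK fc ep0 feq Kf.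
pose J := (I * bool)%type.
pose f2 (j : J) (h : G) : R := if j.2 then complex.Re (f j.1 h) else complex.Im (f j.1 h).
have f2c j : continuous (f2 j : G -> R^o).
  case: j => i [] h; rewrite /f2 /=.
    exact: (cvg_cont (L := reC) (@fc i h) (@reC_cont R _)).
  exact: (cvg_cont (L := imC) (@fc i h) (@imC_cont R _)).
have e2 : 0 < ep / 2 by exact: divr_gt0.
have [||w [w1 w2 w3]] := @riemann_sums _ _ _ mu rmu J f2 K cK f2c _ e2.
- move=> h e Kh e0; have := feq h e Kh e0; apply: filterS => h' H [i b].
  rewrite /f2 /=; apply: le_trans (H i); case: b.
    by apply: le_trans (CR_Re_le _); case: (f i h) (f i h') => ? ? [].
  by apply: le_trans (CR_Im_le _); case: (f i h) (f i h') => ? ? [].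
- by move=> [i []] h nK; rewrite /f2 /= Kf.
exists w => i.
have ReS : complex.Re (\sum_(p <- w) p.1%:C * (f i p.2 : R[i])) = \sum_(p <- w) p.1 * f2 (i, true) p.2.
  elim: w {w1 w2 w3} => [|p w IH]; first by rewrite !big_nil.
  rewrite !big_cons -IH /f2 /=; case: (f i p.2) => a b /=.
  by case: (\sum_(_ <- _) _) => c d /=; ring.
have ImS : complex.Im (\sum_(p <- w) p.1%:C * (f i p.2 : R[i])) = \sum_(p <- w) p.1 * f2 (i, false) p.2.
  elim: w {w1 w2 w3 ReS} => [|p w IH]; first by rewrite !big_nil.
  rewrite !big_cons -IH /f2 /=; case: (f i p.2) => a b /=.
  by case: (\sum_(_ <- _) _) => c d /=; ring.
rewrite (le_trans (CR_le_ReIm _))// [leRHS](splitr ep) lerD//.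
  have := w3 (i, true); rewrite -ReS; apply: le_trans; rewrite le_eqVlt; apply/orP; left.
  apply/eqP; congr `|_|; by rewrite /Cintegral /=; case: (\sum_(_ <- _) _).
have := w3 (i, false); rewrite -ImS; apply: le_trans; rewrite le_eqVlt; apply/orP; left.
apply/eqP; congr `|_|; by rewrite /Cintegral /=; case: (\sum_(_ <- _) _).
Qed.

Lemma Cint_cc_lin (r : R) (f g : G -> CR) : cc_smooth f -> cc_smooth g ->
  (Cint (fun t => r *: f t + g t) : CR) = r *: (Cint f : CR) + Cint g.
Proof.
by move=> /cc_smooth_ccontC cf /cc_smooth_ccontC cg; exact: (Cint_lin r%:C cf cg).
Qed.

Lemma Cint_cc_bnd K : compact K -> exists2 C : R, 0 <= C & forall (f : G -> CR) (M : R),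
  cc_smooth f -> csupp K f -> 0 <= M -> (forall t, K t -> `|f t| <= M) -> `|(Cint f : CR)| <= C * M.
Proof.
move=> cK; exists (2 * fine (mu K)); first by rewrite mulr_ge0// fine_ge0.
by move=> f M /cc_smooth_ccontC cf Kf M0 fM; exact: Cint_le.
Qed.

Lemma test_function_conv (a b : G -> R[i]) : test_function a -> test_function b ->
  test_function (Defs.conv mu a b).
Proof.
move=> /test_functionP[as_ [K cK Ka]] /test_functionP[bs [L cL Lb]].
apply/test_functionP; split.
  move=> c ac; have oc := chart_imgO ac.
  apply: (@jsm_param_smooth R n G CR CR Cint Cint_cc_lin Cint_cc_bnd (chart_img c)
    (fun u h => (a h : R[i]) * b (h^-1 * chart_inv c u)%g) oc).
    exact: conv_jsm.
  move=> u cu; exists K => //; apply: (@filterE _ (nbhs u)) => u' h nK.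
  by rewrite Ka// mul0r.
exists [set g | exists a b, [/\ K a, L b & g = (a * b)%g]]; first exact: compact_mulG.
move=> g ng; rewrite -[RHS]Cint0; congr Cintegral; apply/funext => h.
have [Kh|/Ka ->] := pselect (K h); last by rewrite mul0r.
rewrite Lb ?mulr0// => Lh; apply: ng; exists h, (h^-1 * g)%g; split=> //.
by rewrite mulgA mulgV mul1g.
Qed.

Variables (m : G -> R) (hm : modular_function mu m).

Lemma Cint_rtrans a f : ccontC f -> Cint (fun h => f (h * a)%g) = (m a)^-1%:C * Cint f.
Proof.
move=> cf; rewrite /Cintegral.
rewrite (Rint_rtrans hmu hm a (ccontC_re cf)) (Rint_rtrans hmu hm a (ccontC_im cf)).
by simpc.
Qed.

Lemma Cint_inv f : ccontC f -> Cint (fun y => (m y)^-1%:C * (f (y^-1)%g : R[i])) = Cint f.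
Proof.
move=> cf; rewrite /Cintegral; congr Complex.
  rewrite -(Rint_inv hmu hm (ccontC_re cf)); congr Rintegral; apply/funext => y.
  by case: (f _) => ? ? /=; ring.
rewrite -(Rint_inv hmu hm (ccontC_im cf)); congr Rintegral; apply/funext => y.
by case: (f _) => ? ? /=; ring.
Qed.

(* The right translation formula for a fixed bump function exhibits m^-1 as a
   smooth function of the translation parameter. *)
Lemma smooth_modularV : smooth_map idfun (fun x : G => (m x)^-1 : R^o).
Proof.
have [chi [chis chi0 chi1 [K cK [_ Kchi]]]] := ex_unit_bump hmu openT I.
have cchi : @ccont R n G chi by split=> //; [exact: smooth_map_cont|exists K].
have E x : (m x)^-1 = Rint (fun h => chi (h * x)%g).
  by rewrite (Rint_rtrans hmu hm x cchi) chi1 mulr1.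
have cc (f : G -> R^o) : cc_smooth f -> @ccont R n G f.
  by move=> [fs fK]; split=> //; exact: smooth_map_cont.
move=> c ac; have oc := chart_imgO ac.
have -> : (fun u => (m (chart_inv c u))^-1 : R^o) =
    (fun u => Rint (fun h => chi (h * chart_inv c u)%g) : R^o).
  by apply/funext => u; exact: E.
apply: (@jsm_param_smooth R n G R^o R^o Rint _ _ (chart_img c)
  (fun u h => chi (h * chart_inv c u)%g) oc).
- by move=> r f g /cc cf /cc cg; exact: (Rint_lin hmu r cf cg).
- move=> L cL; exists (fine (mu L)); first by rewrite fine_ge0.
  by move=> f M /cc cf Lf M0 fM; exact: (@Rintegral_le _ _ _ mu rmu f L M cf.1 cL).
- exact: rtrans_jsm.
- by apply: rtrans_lcsupp => //; exists K.
Qed.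

Lemma test_function_star (a : G -> R[i]) : test_function a -> test_function (tf_star m a).
Proof.
move=> /test_functionP[as_ [K cK Ka]]; apply/test_functionP; split; last first.
  exists [set g | K (g^-1)%g]; first exact: compact_invG.
  move=> h nK; have -> : tf_star m a h = (m h)^-1%:C * ((0 : R[i])^*)%C by rewrite /tf_star (Ka _ nK).
  by rewrite conjc0 mulr0.
have s1 : smooth_map idfun (fun x : G => ((a x^-1%g)^*)%C : CR).
  move=> c ac; have oc := chart_imgO ac.
  apply: (sm_linmap (L := fun z : CR => ((z : R[i])^*)%C : CR)).
  - exact: conjC_lin.
  - exact: conjC_cont.
  by apply: smooth_comp => //; apply: Gsm_inv => //; exact: Gsm_chart.
move=> c ac.
exact: (@sm_scale R _ CR (chart_img c) (fun u => (m (chart_inv c u))^-1 : R^o) _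
  (smooth_modularV ac) (s1 c ac)).
Qed.
End ComplexIntegral.

(** * Hilbert spaces and unitary representations *)

Section HilbertSpace.
Context {R : realType} {H : hilbertType R}.
Local Notation CR := (realify (R[i]^o : normedModType R[i])).
Local Notation HR := (realify (H : normedModType R[i])).
Implicit Types (u v w : H) (c : R[i]).

Lemma dotC u v : dot v u = ((dot u v)^*)%C.
Proof. exact: dot_conj. Qed.
Lemma dotDl u v w : dot (u + v) w = dot u w + dot v w.
Proof. by have := dot_linear 1 u v w; rewrite scale1r mul1r. Qed.
Lemma dot0l w : dot 0 w = 0.
Proof. by have := dotDl 0 0 w; rewrite addr0 -[LHS]addr0 => /addrI. Qed.
Lemma dotZl c u w : dot (c *: u) w = c * dot u w.
Proof. by have := dot_linear c u 0 w; rewrite !addr0 dot0l addr0. Qed.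
Lemma dotNl u w : dot (- u) w = - dot u w.
Proof. by rewrite -scaleN1r dotZl mulN1r. Qed.
Lemma dotBl u v w : dot (u - v) w = dot u w - dot v w.
Proof. by rewrite dotDl dotNl. Qed.
Lemma dotDr u v w : dot w (u + v) = dot w u + dot w v.
Proof. by rewrite dotC dotDl rmorphD /= -!dotC. Qed.
Lemma dotZr c u w : dot w (c *: u) = (c^*)%C * dot w u.
Proof. by rewrite dotC dotZl rmorphM /= -!dotC. Qed.
Lemma dot0r w : dot w 0 = 0.
Proof. by rewrite dotC dot0l conjc0. Qed.
Lemma dotNr u w : dot w (- u) = - dot w u.
Proof. by rewrite dotC dotNl rmorphN /= -dotC. Qed.
Lemma dotBr u v w : dot w (u - v) = dot w u - dot w v.
Proof. by rewrite dotDr dotNr. Qed.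
Lemma dot_suml (I : Type) (r : seq I) (F : I -> H) w :
  dot (\sum_(i <- r) F i) w = \sum_(i <- r) dot (F i) w.
Proof. by elim/big_rec2 : _ => [|i x y _ <-]; rewrite ?dot0l// dotDl. Qed.

Lemma CR_normR (r : R) : `|(r%:C : CR)| = `|r|.
Proof. by apply: complexI; rewrite CR_normE normc_def /= expr0n /= addr0 sqrtr_sqr. Qed.

Lemma HR_normE u : `|(u : HR)|%:C = `|u|.
Proof. exact: rify_normE. Qed.

Lemma HR_normZ c u : `|(c *: u : HR)| = `|(c : CR)| * `|(u : HR)|.
Proof. by apply: complexI; rewrite rmorphM /= HR_normE CR_normE HR_normE normrZ. Qed.

Lemma dot_normR u : dot u u = (`|(u : HR)| ^+ 2)%:C.
Proof. by rewrite dot_norm -HR_normE rmorphXn. Qed.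

Lemma cauchy_schwarz u v : `|(dot u v : CR)| <= `|(u : HR)| * `|(v : HR)|.
Proof.
have [->|v0] := eqVneq v 0.
  by rewrite dot0r normr0 mulr_ge0.
have Nv : 0 < `|(v : HR)| by rewrite normr_gt0.
set a := `|(u : HR)|; set b := `|(v : HR)| in Nv *; set d := `|(dot u v : CR)|.
have dE : (d ^+ 2)%:C = dot u v * ((dot u v)^*)%C.
  by rewrite rmorphXn /= CR_normE sqr_normc.
(* [b ^+ 2] times the component of [u] orthogonal to [v]; its norm is nonnegative. *)
pose w := (b ^+ 2)%:C *: u - dot u v *: v.
have cR (r : R) : ((r%:C)^*)%C = r%:C by rewrite /= oppr0.
have : dot w w = (b ^+ 2 * (b ^+ 2 * a ^+ 2 - d ^+ 2))%:C.
  rewrite /w dotBl !dotBr !dotZl !dotZr !dot_normR cR -/a -/b (dotC u v).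
  have E (x y z : R) : (x * (x * y - z))%:C = x%:C * (x%:C * y%:C - z%:C) :> R[i].
    by rewrite rmorphM /= rmorphB /= rmorphM.
  by rewrite E dE; ring.
rewrite dot_normR => /complexI h.
have : 0 <= b ^+ 2 * (b ^+ 2 * a ^+ 2 - d ^+ 2) by rewrite -h sqr_ge0.
rewrite pmulr_rge0 ?exprn_gt0// subr_ge0 -exprMn => h2.
have d0 : 0 <= d by exact: normr_ge0.
have ab0 : 0 <= b * a by rewrite mulr_ge0 ?(ltW Nv)// /a normr_ge0.
by rewrite mulrC -(@ler_pXn2r _ 2).
Qed.

Lemma dot_eq0 u : (forall v, dot u v = 0) -> u = 0.
Proof.
move=> /(_ u); rewrite dot_normR => /complexI/eqP; rewrite sqrf_eq0 => /eqP h.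
exact: (@normr0_eq0 _ HR u h).
Qed.

Lemma dot_inj u v : (forall w, dot u w = dot v w) -> u = v.
Proof.
move=> h; apply/eqP; rewrite -subr_eq0; apply/eqP; apply: dot_eq0 => w.
by rewrite dotBl h subrr.
Qed.

Lemma dotl_lin v (r : R) (u w : HR) :
  (dot (r *: u + w : HR) v : CR) = r *: (dot u v : CR) + (dot w v : CR).
Proof. exact: (dot_linear r%:C u w v). Qed.

Lemma dotr_lin v (r : R) (u w : HR) :
  (dot v (r *: u + w : HR) : CR) = r *: (dot v u : CR) + (dot v w : CR).
Proof.
by rewrite dotDr; congr (_ + _); rewrite [LHS](dotZr r%:C u v) /= oppr0.
Qed.

Lemma dotl_cont v : continuous (fun u : HR => dot u v : CR).
Proof.
apply: (@lipschitz_continuous _ _ _ _ (`|(v : HR)| + 1)) => [|u w]; first by rewrite ltr_wpDl.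
have -> : (dot u v : CR) - dot w v = dot (u - w) v by rewrite dotBl.
rewrite (le_trans (cauchy_schwarz _ _))// mulrC ler_wpM2r// lerDl//.
Qed.

Lemma dotr_cont v : continuous (fun u : HR => dot v u : CR).
Proof.
apply: (@lipschitz_continuous _ _ _ _ (`|(v : HR)| + 1)) => [|u w]; first by rewrite ltr_wpDl.
have -> : (dot v u : CR) - dot v w = dot v (u - w) by rewrite dotBr.
by rewrite (le_trans (cauchy_schwarz _ _))// ler_wpM2r// lerDl.
Qed.

Lemma dense_approx (D : set H) w (e : R) : dense D -> 0 < e ->
  exists2 v, D v & `|(w - v : HR)| < e.
Proof.
move=> dD e0; have := dD (ball w e%:C).
case; [by exists w; apply: ballxx; rewrite ltcR|by apply: ball_open; rewrite ltcR|].
move=> v [wv Dv]; exists v => //.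
by move: wv; rewrite -ball_normE /= -ltcR HR_normE.
Qed.

(** Norms of weakly defined vectors are estimated in this way: [w] is approximated by elements of
    [D] in [dot w w], and the error is made arbitrarily small. *)
Lemma dense_norm_le (D : set H) w (M : R) : dense D -> 0 <= M ->
  (forall v, D v -> `|(dot w v : CR)| <= M * `|(v : HR)|) -> `|(w : HR)| <= M.
Proof.
move=> dD M0 h; set a := `|(w : HR)|.
have [a0|a0] := eqVneq a 0; first by rewrite a0.
have ap : 0 < a by rewrite lt_neqAle eq_sym a0 normr_ge0.
rewrite -(ler_pM2r ap); apply/ler_addgt0Pl => e e0.
have aM : 0 < M + a + 1 by rewrite ltr_wpDl// addr_ge0// ltW.
have [v Dv wv] := dense_approx w dD (divr_gt0 e0 aM).
set ep := e / _ in wv.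
have ep0 : 0 < ep by exact: divr_gt0.
have -> : a * a = `|(dot w w : CR)|.
  by rewrite dot_normR CR_normR -/a ger0_norm ?sqr_ge0// expr2.
have -> : dot w w = dot w v + dot w (w - v) by rewrite dotBr addrC subrK.
rewrite (le_trans (@ler_normD _ CR _ _))//.
have h1 := h v Dv; have h2 := cauchy_schwarz w (w - v).
have h3 : `|(v : HR)| <= a + ep.
  have -> : (v : HR) = (w : HR) - (w - v : HR) by rewrite opprB addrC subrK.
  by rewrite (le_trans (@ler_normB _ HR _ _))// lerD// ltW.
have h4 : M * `|(v : HR)| <= M * (a + ep) by rewrite ler_wpM2l.
have h5 : a * `|(w - v : HR)| <= a * ep by rewrite ler_wpM2l ?ltW.
have h6 : ep * (M + a + 1) = e by rewrite /ep divfK ?gt_eqF.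
rewrite -h6; move: h1 h2; rewrite -/a; move: h4 h5 ep0 M0; lra.
Qed.

Lemma dense_dot_inj (D : set H) u v : dense D -> (forall w, D w -> dot u w = dot v w) -> u = v.
Proof.
move=> dD h; apply/eqP; rewrite -subr_eq0; apply/eqP; apply: (@normr0_eq0 _ HR).
apply/eqP; rewrite -normr_le0 normr_id; apply: (dense_norm_le dD) => // w Dw.
by rewrite dotBl h// subrr normr0 mul0r.
Qed.

(** The test vector is [w] divided by its norm, for which the right-hand side is [2 * e]. The affine
    form of the bound goes with the normalization by [1 + |v|] used for weak integrals. *)
Lemma affine_norm_le w (e : R) : 0 <= e ->
  (forall v, `|(dot w v : CR)| <= e * (1 + `|(v : HR)|)) -> `|(w : HR)| <= 2 * e.
Proof.
move=> e0 h; have [->|w0] := eqVneq w 0; first by rewrite normr0 mulr_ge0.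
set a := `|(w : HR)|; have a0 : 0 < a by rewrite normr_gt0.
have := h (a^-1%:C *: w); rewrite HR_normZ dotZr.
have -> : `|(a^-1%:C : CR)| = a^-1.
  by rewrite CR_normR ger0_norm// invr_ge0 ltW.
have -> : ((a^-1%:C)^*)%C * dot w w = a%:C.
  rewrite dot_normR -/a; have -> : ((a^-1%:C)^*)%C = a^-1%:C by rewrite /= oppr0.
  by rewrite -rmorphM /= expr2 mulKf ?gt_eqF.
have -> : `|(a%:C : CR)| = a.
  by rewrite CR_normR ger0_norm// ltW.
rewrite -/a mulVf ?gt_eqF//; lra.
Qed.

Lemma hilbert_complete (u : nat -> H) :
  (forall p q, `|(u p - u q : HR)| <= p.+1%:R^-1 + q.+1%:R^-1) ->
  exists l, forall p, `|(u p - l : HR)| <= p.+1%:R^-1.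
Proof.
move=> ue.
have inv_small (d : R) : 0 < d -> exists k, forall p, (k <= p)%N -> p.+1%:R^-1 < d.
  move=> d0; have := near_infty_natSinv_lt (PosNum d0); case=> k _ kP.
  by exists k => p kp; exact: (kP p kp).
have : cvg (u k @[k --> \oo]).
  apply/cauchy_cvgP; apply: cauchy_exP => eps eps0.
  have epsE : eps = (complex.Re eps)%:C by rewrite RRe_real// gtr0_real.
  have d0 : 0 < complex.Re eps by rewrite -ltcR -epsE.
  have [k kP] := inv_small _ (divr_gt0 d0 (ltr0Sn R 1)).
  exists (u k), k => // p /= kp.
  rewrite -ball_normE /= epsE -HR_normE ltcR (le_lt_trans (ue k p))//.
  by rewrite [ltRHS]splitr ltrD// kP.
move=> /cvg_ex[l ul]; exists l => p; apply/ler_addgt0Pl => d d0.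
have d2 : 0 < d / 2 by exact: divr_gt0.
have [k kP] := inv_small _ d2.
have /cvgrPdist_lt/(_ (d / 2)%:C) := ul; rewrite ltcR => /(_ d2) [k' _ k'P].
pose q := maxn k k'.
have h1 := k'P q (leq_maxr k k'); have h2 := kP q (leq_maxl k k').
have h3 : `|(l - u q : HR)| < d / 2 by rewrite -ltcR HR_normE.
have -> : (u p - l : HR) = (u p - u q : HR) - (l - u q : HR) by rewrite opprB addrA subrK.
rewrite (le_trans (@ler_normB _ HR _ _))// (le_trans (lerD (ue p q) (ltW h3)))//.
by move: h2; move: (q.+1%:R^-1) (p.+1%:R^-1) => x y; lra.
Qed.

End HilbertSpace.

(** * Weak integrals of vector-valued functions *)

Section WeakIntegral.
Context {R : realType} {n : nat} {G : lieGroupType R n} {H : hilbertType R}.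
Variables (mu : {measure set (borel G) -> \bar R}) (hmu : left_haar mu).
Local Notation CR := (realify (R[i]^o : normedModType R[i])).
Local Notation HR := (realify (H : normedModType R[i])).
Notation Cint := (Cintegral mu).

(* For a fixed finite sequence of points and weights, the Riemann sums of all
   the functions [h |-> dot (F h) v] come from one vector; as the points and
   weights can be chosen independently of v, these vectors converge. *)
Lemma weak_integral (F : G -> HR) (K : set G) : continuous F -> compact K ->
  (forall h, ~ K h -> F h = 0) ->
  exists w : H, forall v, dot w v = Cint (fun h => dot (F h) v).
Proof.
move=> Fc cK KF.
have nv0 (v : H) : 0 < 1 + `|(v : HR)| by rewrite ltr_wpDr.
(* The division makes the matrix coefficients equicontinuous uniformly in [v]; the [1 +] covers
   [v = 0]. *)
pose f (v : H) (h : G) : CR := (1 + `|(v : HR)|)^-1 *: (dot (F h) v : CR).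
have fc v : continuous (f v).
  move=> h; apply: cvgZl_tmp; exact: (cvg_cont (L := fun u : HR => dot u v : CR) (@Fc h) (@dotl_cont R H v (F h))).
have dc v : ccontC (fun h => dot (F h) v).
  split; last by exists K => // h /KF ->; rewrite dot0l.
  by move=> h; exact: (cvg_cont (L := fun u : HR => dot u v : CR) (@Fc h) (@dotl_cont R H v (F h))).
have fKf v h : ~ K h -> f v h = 0 by move=> nK; rewrite /f KF// dot0l scaler0.
have feq h e : K h -> 0 < e -> \forall h' \near h, forall v, `|f v h' - f v h| <= e.
  move=> Kh e0; have /cvgrPdist_le/(_ e e0) := @Fc h; apply: filterS => h' H' v.
  rewrite -scalerBr normrZ gtr0_norm ?invr_gt0// mulrC ler_pdivrMr//.
  have -> : (dot (F h') v : CR) - dot (F h) v = dot (F h' - F h) v by rewrite dotBl.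
  rewrite (le_trans (cauchy_schwarz _ _))// ler_pM//; last by rewrite lerDr.
  by rewrite -normrN opprB.
(* The quarter leaves room for the factor 2 of [affine_norm_le] and for the final limit. *)
have hk (k : nat) : exists w : seq (R * G), forall v,
    `|(Cint (f v) - \sum_(p <- w) p.1%:C * (f v p.2 : R[i]) : CR)| <= k.+1%:R^-1 / 4.
  by apply: (Cint_riemann hmu cK) => //; rewrite divr_gt0// invr_gt0.
have /boolp.choice [w wP] := hk.
pose S k : H := \sum_(p <- w k) p.1%:C *: (F p.2 : H).
have SP k v : `|(Cint (fun h => dot (F h) v) - dot (S k) v : CR)| <=
    k.+1%:R^-1 / 4 * (1 + `|(v : HR)|).
  have := wP k v.
  have -> : Cint (f v) = (1 + `|(v : HR)|)^-1%:C * Cint (fun h => dot (F h) v).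
    exact: (CintZ hmu _ (dc v)).
  have -> : \sum_(p <- w k) p.1%:C * (f v p.2 : R[i]) = (1 + `|(v : HR)|)^-1%:C * dot (S k) v.
    rewrite dot_suml mulr_sumr; apply: eq_bigr => p _; rewrite dotZl mulrCA.
    by congr (_ * _).
  rewrite -mulrBr CR_M CR_normR gtr0_norm ?invr_gt0//.
  by rewrite mulrC ler_pdivrMr.
have k0 (k : nat) : 0 <= (k.+1%:R^-1 : R) by rewrite invr_ge0.
have [|l lP] := @hilbert_complete R H S.
  move=> p q; set e := p.+1%:R^-1; set e' := q.+1%:R^-1.
  have -> : e + e' = 2 * ((e + e') / 2) by rewrite mulrC divfK.
  apply: affine_norm_le; first by rewrite divr_ge0// addr_ge0 ?k0.
  move=> v; have h1 := SP p v; have h2 := SP q v; have v1 := nv0 v.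
  set I0 := Cint _ in h1 h2.
  have -> : (dot (S p - S q) v : CR) = ((I0 - dot (S q) v : R[i]) : CR) - ((I0 - dot (S p) v : R[i]) : CR).
    rewrite dotBl; change (dot (S p) v - dot (S q) v = (I0 - dot (S q) v) - (I0 - dot (S p) v) :> R[i]).
    by ring.
  rewrite (le_trans (@ler_normB _ CR _ _))// (le_trans (lerD h2 h1))//.
  have e0 : 0 <= e by exact: k0.
  have e'0 : 0 <= e' by exact: k0.
  rewrite -mulrDl ler_wpM2r ?(ltW v1)// -mulrDl -/e -/e'.
  by move: e e' e0 e'0 => a b a0 b0; lra.
exists l => v; apply/esym/eqP; rewrite -subr_eq0; apply/eqP.
apply: (@normr0_eq0 _ CR); apply/eqP; rewrite -normr_le0 normr_id; apply/ler_addgt0Pl => d d0.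
rewrite addr0; set b := 1 + `|(v : HR)|; have b0 : 0 < b := nv0 v.
have [k _ kP] := near_infty_natSinv_lt (PosNum (divr_gt0 d0 (mulr_gt0 (ltr0Sn R 1) b0))).
have {}kP : k.+1%:R^-1 < d / (2 * b) by exact: (kP k (leqnn k)).
have h1 := SP k v; rewrite -/b in h1.
have h2 : `|(dot (S k - l) v : CR)| <= k.+1%:R^-1 * b.
  rewrite (le_trans (cauchy_schwarz _ _))// ler_pM//; last by rewrite /b lerDr.
set I0 := Cint _ in h1 *.
have -> : (I0 - dot l v : CR) = ((I0 - dot (S k) v : R[i]) : CR) + (dot (S k - l) v : CR).
  by rewrite dotBl; change (I0 - dot l v = (I0 - dot (S k) v) + (dot (S k) v - dot l v) :> R[i]); ring.
rewrite (le_trans (@ler_normD _ CR _ _))// (le_trans (lerD h1 h2))//.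
have h3 : k.+1%:R^-1 * b < d / 2.
  by move: kP; rewrite invfM mulrA -ltr_pdivlMr// -[X in _ < X]mulrA.
have h4 := k0 k; move: h3 h4 b0; move: (k.+1%:R^-1 : R) => x h3 h4 b0.
have : 0 <= x * b by rewrite mulr_ge0// ltW.
by move: h3; rewrite mulrAC; move: (x * b) => y; lra.
Qed.
End WeakIntegral.

Section UnitaryRep.
Context {R : realType} {n : nat} {G : lieGroupType R n} {H : hilbertType R}.
Local Notation CR := (realify (R[i]^o : normedModType R[i])).
Local Notation HR := (realify (H : normedModType R[i])).
Notation dirder := (is_dirder (idfun : R -> R)).
Variables (U : G -> H -> H) (hU : unitary_rep U).

Lemma rep_lin g (c : R[i]) u v : U g (c *: u + v) = c *: U g u + U g v.
Proof. by have [/(_ g)[Ul _ _] _ _] := hU; exact: Ul. Qed.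
Lemma rep_dot g u v : dot (U g u) (U g v) = dot u v.
Proof. by have [/(_ g)[_ Ud _] _ _] := hU. Qed.
Lemma repM g h u : U (g * h)%g u = U g (U h u).
Proof. by have [_ ->] := hU. Qed.
Lemma rep_cont u : continuous ((fun g => U g u) : G -> HR).
Proof. by have [_ _] := hU; exact. Qed.
Lemma rep_norm g u : `|(U g u : HR)| = `|(u : HR)|.
Proof.
apply/eqP; rewrite -(@eqrXn2 _ 2)//; apply/eqP/complexI.
by rewrite -!dot_normR rep_dot.
Qed.
Lemma repD g u v : U g (u + v) = U g u + U g v.
Proof. by have := rep_lin g 1 u v; rewrite !scale1r. Qed.
Lemma rep0 g : U g 0 = 0.
Proof. by have := repD g 0 0; rewrite addr0 -[LHS]addr0 => /addrI. Qed.
Lemma repZ g c u : U g (c *: u) = c *: U g u.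
Proof. by have := rep_lin g c u 0; rewrite !addr0 rep0 addr0. Qed.
Lemma repB g u v : U g (u - v) = U g u - U g v.
Proof. by rewrite repD -scaleN1r repZ scaleN1r. Qed.
(** [U 1] is an idempotent isometry: it maps [U 1 u - u] to 0. *)
Lemma rep1 u : U 1%g u = u.
Proof.
apply/eqP; rewrite -subr_eq0; apply/eqP; apply: (@normr0_eq0 _ HR).
by rewrite -(rep_norm 1%g) repB -repM mulg1 subrr normr0.
Qed.
Lemma repKV g u : U g (U g^-1%g u) = u.
Proof. by rewrite -repM mulgV rep1. Qed.
Lemma rep_adj g u v : dot (U g u) v = dot u (U g^-1%g v).
Proof. by rewrite -(rep_dot g u) repKV. Qed.
Lemma rep_clin g : continuous (U g : HR -> HR).
Proof.
apply: (@lipschitz_continuous _ _ _ _ 1) => // u v.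
by rewrite mul1r -(rep_norm g (u - v)) repB.
Qed.
End UnitaryRep.

(** * Smooth vectors and the derived representation *)

Section SmoothVectors.
Context {R : realType} {n : nat} {G : lieGroupType R n} {H : hilbertType R}.
Local Notation CR := (realify (R[i]^o : normedModType R[i])).
Local Notation HR := (realify (H : normedModType R[i])).
Notation dirder := (is_dirder (idfun : R -> R)).

Lemma dirder_linmap (V W W' : normedModType R) (L : W -> W') (f : V -> W) x v l :
  (forall (r : R) u w, L (r *: u + w) = r *: L u + L w) -> continuous L ->
  dirder f x v l -> dirder (fun y => L (f y)) x v (L l).
Proof.
move=> Ll Lc h.
have L0 : L 0 = 0 by have := Ll 1 0 0; rewrite !scale1r addr0 -[LHS]addr0 => /addrI.
have LZ r u : L (r *: u) = r *: L u by have := Ll r u 0; rewrite !addr0 L0 addr0.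
have LB u w : L (u - w) = L u - L w.
  by have := Ll (-1) w u; rewrite !scaleN1r addrC => ->; rewrite addrC.
by apply: cvg_eq1 (cvg_cont h (@Lc l)) => t; rewrite LZ LB.
Qed.

Variables (U : G -> H -> H) (hU : unitary_rep U).

Definition orbit_map (u : H) : G -> HR := fun g => U g u.
Definition smoothv (u : H) : Prop := smooth_map idfun (orbit_map u).

Lemma smooth_vectorsE u : smooth_vectors U u <-> smoothv u.
Proof. exact: smooth_realify. Qed.

Lemma smoothv_rep g u : smoothv u -> smoothv (U g u).
Proof.
move=> su; have := smooth_translate 1%g g su; rewrite /smoothv.
by congr smooth_map; apply/funext => h; rewrite /orbit_map mul1g (repM hU).
Qed.

Lemma smooth_linmap (W W' : normedModType R) (L : W -> W') (F : G -> W) :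
  (forall (r : R) u w, L (r *: u + w) = r *: L u + L w) -> continuous L ->
  smooth_map idfun F -> smooth_map idfun (fun g => L (F g)).
Proof. by move=> Ll Lc Fs c ac; apply: sm_linmap => //; exact: Fs. Qed.

Lemma scaleC_lin (c : R[i]) (r : R) (u w : HR) :
  (c *: (r *: u + w : HR) : HR) = r *: (c *: u : HR) + (c *: w : HR).
Proof. by rewrite !rify_scaleE scalerDr !scalerA mulrC. Qed.

Lemma scaleC_cont (c : R[i]) : continuous (fun u : HR => c *: u : HR).
Proof.
apply: (@lipschitz_continuous _ _ _ _ (`|(c : CR)| + 1)) => [|u w]; first by rewrite ltr_wpDl.
have -> : (c *: (u : H) : HR) - (c *: (w : H) : HR) = (c *: ((u : H) - (w : H)) : HR).
  by rewrite scalerBr.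
by rewrite HR_normZ ler_wpM2r// lerDl.
Qed.

Lemma smoothv_lin (c : R[i]) u v : smoothv u -> smoothv v -> smoothv (c *: u + v).
Proof.
move=> su sv d ad; rewrite /orbit_map.
have -> : (fun y => U (chart_inv d y) (c *: u + v) : HR) =
   (fun y => (c *: orbit_map u (chart_inv d y) : HR) + orbit_map v (chart_inv d y)).
  by apply/funext => y; exact: (rep_lin hU).
apply: sm_add; last exact: sv.
by apply: (sm_linmap (L := fun u : HR => c *: (u : H) : HR)); [exact: scaleC_lin|exact: scaleC_cont|exact: su].
Qed.

Lemma smoothv0 : smoothv 0.
Proof.
have -> : smoothv 0 = smooth_map idfun (fun _ : G => 0 : HR).
  by rewrite /smoothv; congr smooth_map; apply/funext => g; exact: (rep0 hU).
by move=> c ac; exact: sm_cst.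
Qed.

Lemma smoothvZ (c : R[i]) u : smoothv u -> smoothv (c *: u).
Proof. by move=> su; have := smoothv_lin c su smoothv0; rewrite addr0. Qed.

Lemma smoothvD u v : smoothv u -> smoothv v -> smoothv (u + v).
Proof. by move=> su sv; have := smoothv_lin 1 su sv; rewrite scale1r. Qed.

Definition dgen (x : lieAlg G) (u : H) : H :=
  xget 0 [set l | is_deriv0 (fun t : R => U (lexp (t *: x)) u) l].

Section Chart.
Variables (e : chart R n G) (ae : atlas e) (e1 : chart_dom e 1%g).
Notation Ld := (Lder e).
Let einv1 : chart_inv e (chart_map e 1%g) = 1%g. Proof. exact: chart_mapK. Qed.

Lemma Lder_linmap (W W' : normedModType R) (L : W -> W') (F : G -> W) xi g :
  (forall (r : R) u w, L (r *: u + w) = r *: L u + L w) -> continuous L ->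
  smooth_map idfun F -> Ld xi (fun h => L (F h)) g = L (Ld xi F g).
Proof.
move=> Ll Lc Fs; apply: ddE.
exact: (dirder_linmap Ll Lc (Lder_dirder ae e1 (g := g) (xi := xi) Fs)).
Qed.

Variables (x : lieAlg G) (xi : 'rV[R]_n).
Hypothesis x_xi : forall (f : smoothfun G) g, x f g = Ld xi (f : G -> R^o) g.

Lemma dgen_deriv u : smoothv u ->
  is_deriv0 (fun t : R => U (lexp (t *: x)) u) (Ld xi (orbit_map u) 1%g).
Proof.
move=> su; apply/is_deriv0P; have [gam hg] := ex_integral_curve ae e1 x.
have := Lder_integral_curve ae e1 (g := 1%g) x_xi hg su.
have -> : (fun t : R^o => orbit_map u (1 * gam t)%g) = (fun t : R => U (lexp (t *: x)) u : HR).
  by apply/funext => t; rewrite mul1g (lexp_curve ae e1 hg).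
by [].
Qed.

Lemma dgenE u : smoothv u -> dgen x u = Ld xi (orbit_map u) 1%g.
Proof.
move=> su; have h := dgen_deriv su; rewrite /dgen; case: xgetP => [l _ hl|].
  exact: (dirder_unique (W := HR) ((is_deriv0P _ _).1 hl) ((is_deriv0P _ _).1 h)).
by move=> /(_ _ h).
Qed.

(** The orbit map of [dgen x u] is the left-invariant derivative of that of [u]: [U g] passes
    through the derivative at 1 and acts on the orbit map as left translation. Stability of the
    smooth vectors follows from [Lder_smooth]. *)
Lemma rep_dgen g u : smoothv u -> U g (dgen x u) = Ld xi (orbit_map u) g.
Proof.
move=> su; rewrite dgenE// -(@Lder_linmap HR HR (U g)).
- have -> : (fun h => U g (orbit_map u h) : HR) = (fun h => orbit_map u (g * h)%g).
    by apply/funext => h; rewrite /orbit_map (repM hU).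
  by rewrite (Lder_translate _ (orbit_map u)) mulg1.
- by move=> r v w; exact: (rep_lin hU).
- exact: (rep_clin hU).
- exact: su.
Qed.

Lemma smoothv_dgen_chart u : smoothv u -> smoothv (dgen x u).
Proof.
move=> su; have := Lder_smooth ae e1 xi su; rewrite /smoothv.
by congr smooth_map; apply/funext => g; rewrite /orbit_map rep_dgen.
Qed.

Lemma dgen_lin_chart (c : R[i]) u v : smoothv u -> smoothv v ->
  dgen x (c *: u + v) = c *: dgen x u + dgen x v.
Proof.
move=> su sv; rewrite dgenE; last exact: smoothv_lin.
have -> : orbit_map (c *: u + v) = (fun h => 1 *: (c *: orbit_map u h : HR) + orbit_map v h).
  by apply/funext => h; rewrite scale1r; exact: (rep_lin hU).
rewrite (Lder_lin ae e1); last exact: sv.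
  by rewrite scale1r (Lder_linmap _ _ (scaleC_lin c) (@scaleC_cont c) su) -!dgenE.
exact: (smooth_linmap (scaleC_lin c) (@scaleC_cont c) su).
Qed.

(* Elements of [lieAlg G] act on real-valued functions only; replacing [v] by
   ['i *: v] recovers the imaginary part, see [re_dot_inj]. *)
Lemma coef_smooth u v : smoothv u -> smooth_map idfun (fun g => reC (dot (U g u) v)).
Proof.
move=> su; apply: (smooth_linmap (@reC_lin R) (@reC_cont R)).
exact: (smooth_linmap (@dotl_lin R H v) (@dotl_cont R H v) su).
Qed.

Lemma lie_coef u v (su : smoothv u) g :
  x (mk_smooth (coef_smooth v su)) g = reC (dot (U g (dgen x u)) v).
Proof.
rewrite x_xi rep_dgen//=.
rewrite (Lder_linmap _ _ (@reC_lin R) (@reC_cont R)).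
  by rewrite (Lder_linmap _ _ (@dotl_lin R H v) (@dotl_cont R H v) su).
exact: (smooth_linmap (@dotl_lin R H v) (@dotl_cont R H v) su).
Qed.

End Chart.

Lemma ex_tangent : exists2 e : chart R n G, atlas e /\ chart_dom e 1%g &
  forall x : lieAlg G, exists xi, forall (f : smoothfun G) g, x f g = Lder e xi (f : G -> R^o) g.
Proof.
have [e ae e1] := atlas_cover (1%g : G); exists e => // x; exact: (lie_tangent ae e1 x).
Qed.

Lemma smoothv_dgen x u : smoothv u -> smoothv (dgen x u).
Proof.
have [e [ae e1] /(_ x)[xi x_xi]] := ex_tangent; exact: (smoothv_dgen_chart ae e1 x_xi).
Qed.

Lemma dgen_lin x (c : R[i]) u v : smoothv u -> smoothv v ->
  dgen x (c *: u + v) = c *: dgen x u + dgen x v.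
Proof.
have [e [ae e1] /(_ x)[xi x_xi]] := ex_tangent; exact: (dgen_lin_chart ae e1 x_xi).
Qed.

(** Passing to coefficient functions turns [dgen x] into the derivation [x]. Sum, multiple and
    bracket of derivations are given by formulas, so the corresponding relations for [dgen] can be
    read off at 1. *)
Lemma lie_coefE (x : lieAlg G) u v (su : smoothv u) :
  x (mk_smooth (coef_smooth v su)) = mk_smooth (coef_smooth v (smoothv_dgen x su)).
Proof.
have [e [ae e1] /(_ x)[xi x_xi]] := ex_tangent.
by apply/val_inj/funext => g /=; exact: (lie_coef ae e1 x_xi).
Qed.

Lemma re_dot_inj (a b : H) : (forall v, reC (dot a v) = reC (dot b v)) -> a = b.
Proof.
move=> h; apply: dot_inj => w; have h1 := h w; have h2 := h ('i%C *: w).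
move: h1 h2; rewrite !dotZr /reC; case: (dot a w) (dot b w) => p q [r s] /= -> h2.
by congr Complex; move: h2; lra.
Qed.

Lemma coef1 u v (su : smoothv u) : mk_smooth (coef_smooth v su) 1%g = reC (dot u v).
Proof. by rewrite /= (rep1 hU). Qed.

Lemma smoothfunDE (f g : smoothfun G) h : (f + g) h = f h + g h.
Proof. by []. Qed.
Lemma smoothfunBE (f g : smoothfun G) h : (f - g) h = f h - g h.
Proof. by []. Qed.
Lemma smoothfunZE (r : R) (f : smoothfun G) h : (r *: f) h = r * f h.
Proof. by []. Qed.
Lemma lieDE (x y : lieAlg G) (f : smoothfun G) : (x + y) f = x f + y f.
Proof. by []. Qed.
Lemma lieZE (r : R) (x : lieAlg G) (f : smoothfun G) : (r *: x) f = r *: x f.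
Proof. by []. Qed.

Lemma reCD (z w : R[i]) : reC (z + w) = reC z + reC w.
Proof. by case: z w => ? ? []. Qed.
Lemma reCB (z w : R[i]) : reC (z - w) = reC z - reC w.
Proof. by case: z w => ? ? []. Qed.
Lemma reCZ (r : R) (z : R[i]) : reC (r%:C * z) = r * reC z.
Proof. by case: z => a b; rewrite /reC /=; ring. Qed.

Lemma dgenD x y u : smoothv u -> dgen (x + y) u = dgen x u + dgen y u.
Proof.
move=> su; apply: re_dot_inj => v.
rewrite -(coef1 v (smoothv_dgen (x + y) su)) -lie_coefE lieDE smoothfunDE !lie_coefE !coef1.
by rewrite dotDl reCD.
Qed.

Lemma dgenZ (r : R) x u : smoothv u -> dgen (r *: x) u = r%:C *: dgen x u.
Proof.
move=> su; apply: re_dot_inj => v.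
rewrite -(coef1 v (smoothv_dgen (r *: x) su)) -lie_coefE lieZE smoothfunZE !lie_coefE !coef1.
by rewrite dotZl reCZ.
Qed.

Lemma dgen_br x y u : smoothv u ->
  dgen (lie_bracket x y) u = dgen x (dgen y u) - dgen y (dgen x u).
Proof.
move=> su; apply: re_dot_inj => v.
rewrite -(coef1 v (smoothv_dgen (lie_bracket x y) su)) -lie_coefE.
have -> : lie_bracket x y (mk_smooth (coef_smooth v su)) =
  x (y (mk_smooth (coef_smooth v su))) - y (x (mk_smooth (coef_smooth v su))) by [].
rewrite smoothfunBE !lie_coefE !coef1.
by rewrite dotBl reCB.
Qed.

(** The adjoint of [U] at [e^(tx)] is [U] at [e^(-tx)]; both sides are derivatives at 0 of the same
    function of [t]. *)
Lemma dgen_adj x u v : smoothv u -> smoothv v -> dot (dgen x u) v = dot u (dgen (- x) v).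
Proof.
move=> su sv; have [e [ae e1] tg] := ex_tangent.
have [xi x_xi] := tg x; have [xi' x_xi'] := tg (- x).
have [gam hg] := ex_integral_curve ae e1 x.
have h1 := dgen_deriv ae e1 x_xi su; rewrite -(dgenE ae e1 x_xi su) in h1.
have h2 := dgen_deriv ae e1 x_xi' sv; rewrite -(dgenE ae e1 x_xi' sv) in h2.
move/is_deriv0P: h1 => h1; move/is_deriv0P: h2 => h2.
have {}h1 := dirder_linmap (@dotl_lin R H v) (@dotl_cont R H v) h1.
have {}h2 := dirder_linmap (@dotr_lin R H u) (@dotr_cont R H u) h2.
apply: (dirder_unique (W := CR) h1); move: h2.
suff -> : (fun t : R^o => dot u (U (lexp (t *: - x)) v) : CR) =
          (fun t : R^o => dot (U (lexp (t *: x)) u) v : CR) by [].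
apply/funext => t; rewrite (rep_adj hU) (lexp_curve ae e1 hg) -(integral_curveN _ hg).
by rewrite scalerN -scaleNr (lexp_curve ae e1 hg).
Qed.

Notation term := (uterm (lieAlg G)).

Fixpoint dterm (s : term) (u : H) : H :=
  match s with
  | UGen x => dgen x u
  | UCst c => c *: u
  | UAdd s t => dterm s u + dterm t u
  | UMul s t => dterm s (dterm t u)
  end.

Lemma smoothv_dterm s u : smoothv u -> smoothv (dterm s u).
Proof.
elim: s u => [x|c|s IHs t IHt|s IHs t IHt] u su /=.
- exact: smoothv_dgen.
- exact: smoothvZ.
- by apply: smoothvD; [exact: IHs|exact: IHt].
- by apply: IHs; exact: IHt.
Qed.

Lemma dterm_lin s (c : R[i]) u v : smoothv u -> smoothv v ->
  dterm s (c *: u + v) = c *: dterm s u + dterm s v.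
Proof.
elim: s u v => [x|d|s IHs t IHt|s IHs t IHt] u v su sv /=.
- exact: dgen_lin.
- by rewrite scalerDr !scalerA mulrC.
- by rewrite IHs// IHt// scalerDr addrACA.
- by rewrite IHt// IHs//; exact: smoothv_dterm.
Qed.

Lemma dtermZ s (c : R[i]) u : smoothv u -> dterm s (c *: u) = c *: dterm s u.
Proof.
have s0 : dterm s 0 = 0.
  by have := dterm_lin s 1 smoothv0 smoothv0; rewrite !scale1r addr0 -[LHS]addr0 => /addrI.
by move=> su; have := dterm_lin s c su smoothv0; rewrite !addr0 s0 addr0.
Qed.

Lemma dtermD s u v : smoothv u -> smoothv v -> dterm s (u + v) = dterm s u + dterm s v.
Proof. by move=> su sv; have := dterm_lin s 1 su sv; rewrite !scale1r. Qed.

(** On smooth vectors the action respects the relations of the enveloping algebra, so [dop],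
    computed on a representative, is independent of it. *)
Lemma dterm_ueq s t : ueq (@lie_bracket R n G) s t -> forall u, smoothv u -> dterm s u = dterm t u.
Proof.
elim=> {s t} //=.
- by move=> s t _ IH u su; rewrite IH.
- by move=> s t r _ IH _ IH' u su; rewrite IH// IH'.
- by move=> s s' t t' _ IH _ IH' u su; rewrite IH// IH'.
- by move=> s s' t t' _ IH _ IH' u su; rewrite IH'// IH//; exact: smoothv_dterm.
- by move=> s t r u su; rewrite addrA.
- by move=> s t u su; rewrite addrC.
- by move=> s u su; rewrite scale0r add0r.
- by move=> s u su; rewrite scale1r.
- by move=> s u su; rewrite scale1r.
- by move=> s t r u su; rewrite dtermD//; exact: smoothv_dterm.
- by move=> a b u su; rewrite scalerDl.
- by move=> a b u su; rewrite scalerA.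
- by move=> s u su; rewrite !scale0r.
- by move=> a s u su; rewrite dtermZ.
- by move=> x y u su; rewrite dgenD.
- by move=> r x u su; rewrite dgenZ.
- by move=> x y u su; rewrite dgen_br// scaleN1r.
Qed.

Lemma dterm_adj s u v : smoothv u -> smoothv v ->
  dot (dterm s u) v = dot u (dterm (uterm_star s) v).
Proof.
elim: s u v => [x|d|s IHs t IHt|s IHs t IHt] u v su sv /=.
- exact: dgen_adj.
- by rewrite dotZl dotZr conjcK.
- by rewrite dotDl dotDr IHs// IHt.
- by rewrite IHs//; [rewrite IHt//; exact: smoothv_dterm|exact: smoothv_dterm].
Qed.

End SmoothVectors.

(** * Uniqueness of the derived representation *)

Section StarRepUniqueness.
Context {R : realType} {n : nat} {G : lieGroupType R n} {H : hilbertType R}.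
Local Notation ucl := (@ucls R (lieAlg G) (@lie_bracket R n G)).

Lemma ucls_lin (c : R[i]) s t :
  (c *: (ucl s : lie_env G) + (ucl t : lie_env G) : lie_env G) = ucl (UAdd (UMul (UCst _ c) s) t).
Proof. by rewrite -uaddE -umulE. Qed.

Lemma ucls_mul s t : ((ucl s : lie_env G) * (ucl t : lie_env G) : lie_env G) = ucl (UMul s t).
Proof. by rewrite -umulE. Qed.

Lemma ucls1 : (1 : lie_env G) = ucl (UCst _ 1). Proof. by []. Qed.

(** The enveloping algebra is generated by the Lie algebra, so induction on a representing term
    suffices. The value at 0 is obtained from linearity at [-1 *: 1 + 1]. *)
Lemma star_rep_ext (p q : @oprep R H n G) : star_rep p -> star_rep q -> rdom p = rdom q ->
  (forall x u, rdom p u -> rop p (lie_gen x) u = rop q (lie_gen x) u) ->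
  forall x u, rdom p u -> rop p x u = rop q x u.
Proof.
move=> [_ pL pl pM p1] [_ qL ql qM q1] pq gen x u pu.
rewrite -(ucls_repr (x : uea (@lie_bracket R n G))).
have pstab y v : rdom p v -> rdom p (rop p y v) by have [_ h _ _ _] := pL y; exact: h.
have qd v : rdom p v -> rdom q v by rewrite pq.
have p0 v : rdom p v -> rop p 0 v = 0.
  by move=> pv; have := pl (-1) 1 1 v pv; rewrite scaleN1r addNr p1// scaleN1r addNr.
have q0 v : rdom p v -> rop q 0 v = 0.
  by move=> /qd pv; have := ql (-1) 1 1 v pv; rewrite scaleN1r addNr q1// scaleN1r addNr.
elim: (repr _) u pu => [y|c|s IHs t IHt|s IHs t IHt] u pu.
- exact: gen.
- have -> : ucl (UCst _ c) = (c *: (1 : lie_env G) + 0 : lie_env G).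
    have c1 : (c *: (1 : lie_env G) : lie_env G) = ucl (UCst _ c).
      change (umul (ucst _ c) (ucst _ 1) = ucst _ c :> uea (@lie_bracket R n G)).
      by rewrite -ucstM mulr1.
    by rewrite addr0 c1.
  have qu := qd u pu.
  rewrite (pl c 1 0 u pu) (ql c 1 0 u qu).
  by rewrite (p1 u pu) (q1 u qu) (p0 u pu) (q0 u pu).
- have -> : ucl (UAdd s t) = (1 *: (ucl s : lie_env G) + (ucl t : lie_env G) : lie_env G).
    by rewrite scale1r -uaddE.
  by rewrite (pl 1 (ucl s) (ucl t) u pu) (ql 1 (ucl s) (ucl t) u (qd u pu)) (IHs u pu) (IHt u pu).
- rewrite -ucls_mul (pM (ucl s) (ucl t) u pu) (qM (ucl s) (ucl t) u (qd u pu)) -(IHt u pu).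
  by apply: IHs; exact: pstab.
Qed.
End StarRepUniqueness.

Section DerivedRepresentation.
Context {R : realType} {n : nat} {G : lieGroupType R n} {H : hilbertType R}.
Local Notation CR := (realify (R[i]^o : normedModType R[i])).
Local Notation HR := (realify (H : normedModType R[i])).
Notation dirder := (is_dirder (idfun : R -> R)).
Variables (U : G -> H -> H) (hU : unitary_rep U).
Local Notation ucl := (@ucls R (lieAlg G) (@lie_bracket R n G)).
Local Notation dt := (dterm U).

Definition dop (x : lie_env G) (u : H) : H := dt (repr (x : uea (@lie_bracket R n G))) u.

Lemma dop_ucls s u : smoothv U u -> dop (ucl s) u = dt s u.
Proof. by move=> su; apply: (dterm_ueq hU) => //; exact: repr_ucls. Qed.

(** The domain is left open because the lemma serves twice: with all smooth vectors for [dU], and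
    with the span of the range of [rho] for [rho_tilde]. *)
Lemma dop_star_rep (D : set H) : Defs.subspace D -> dense D -> (forall u, D u -> smoothv U u) ->
  (forall s u, D u -> D (dt s u)) -> star_rep (@OpRep R H n G D dop).
Proof.
move=> sD dD Ds Dt; split => //=.
- move=> x; split.
  + by move=> c u v /Ds su /Ds sv; exact: (dterm_lin hU).
  + by move=> u Du; exact: Dt.
  + by move=> c u v /Ds su /Ds sv; exact: (dterm_lin hU).
  + by move=> u Du; exact: Dt.
  + move=> u v /Ds su /Ds sv; rewrite /ustar.
    by rewrite dop_ucls// (dterm_adj hU).
- move=> c x y u /Ds su.
  rewrite -(ucls_repr (x : uea (@lie_bracket R n G))) -(ucls_repr (y : uea (@lie_bracket R n G))).
  by rewrite ucls_lin !dop_ucls.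
- move=> x y u Du; have su := Ds u Du.
  rewrite -(ucls_repr (x : uea (@lie_bracket R n G))) -(ucls_repr (y : uea (@lie_bracket R n G))).
  by rewrite ucls_mul !dop_ucls//; exact: (smoothv_dterm hU).
- by move=> u /Ds su; rewrite ucls1 dop_ucls//= scale1r.
Qed.

Hypothesis dsv : dense (smooth_vectors U).

Lemma dU_rep_is_dU : is_dU U (OpRep (smooth_vectors U) dop).
Proof.
split => //=.
- apply: dop_star_rep => //.
  + split; first by apply/smooth_vectorsE; exact: smoothv0.
    by move=> c u v /smooth_vectorsE su /smooth_vectorsE sv; apply/smooth_vectorsE; exact: smoothv_lin.
  + by move=> s u /smooth_vectorsE su; apply/smooth_vectorsE; exact: smoothv_dterm.
- move=> x u /smooth_vectorsE su; rewrite dop_ucls//=.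
  have [e [ae e1] /(_ x)[xi x_xi]] := @ex_tangent R n G.
  by rewrite (dgenE ae e1 x_xi su); exact: (dgen_deriv ae e1 x_xi su).
Qed.

(** The candidate [dop] shows that the choice in [dU] is made from a nonempty set, and uniqueness
    identifies the chosen representation with it. *)
Lemma dU_spec : rdom (dU U) = smooth_vectors U /\
  forall x u, smooth_vectors U u -> rop (dU U) x u = dop x u.
Proof.
have [s0 d0 g0] := dU_rep_is_dU.
have [s1 d1 g1] : is_dU U (dU U) by exact: (xgetPex _ (ex_intro _ _ dU_rep_is_dU)).
split=> // x u su; apply: (star_rep_ext s1 s0) => //; last by rewrite d1.
move=> y v; rewrite d1 => sv.
exact: (dirder_unique (W := HR) ((is_deriv0P _ _).1 (g1 y v sv)) ((is_deriv0P _ _).1 (g0 y v sv))).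
Qed.

End DerivedRepresentation.

Section LinearSpan.
Context {R : realType} {H : hilbertType R}.
Variable A : set H.

Lemma span0 : linear_span A 0.
Proof.
exists 0%N, (fun=> 0), (fun=> 0); split; first by case.
by rewrite big_ord0.
Qed.

Lemma span_cons (c : R[i]) u v : A u -> linear_span A v -> linear_span A (c *: u + v).
Proof.
move=> Au [k [d [w [Aw ->]]]].
exists k.+1, (fun i => oapp d c (unlift ord0 i)), (fun i => oapp w u (unlift ord0 i)); split.
  by move=> i; case: (unlift ord0 i) => [j|] /=.
rewrite big_ord_recl unlift_none /=; congr (_ + _).
by apply: eq_bigr => i _; rewrite liftK.
Qed.

Lemma span_ind (P : H -> Prop) : P 0 ->
  (forall c u v, A u -> linear_span A v -> P v -> P (c *: u + v)) ->
  forall w, linear_span A w -> P w.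
Proof.
move=> P0 PS w [k [c [v [Av ->]]]].
suff : linear_span A (\sum_(i < k) c i *: v i) /\ P (\sum_(i < k) c i *: v i) by case.
elim: k c v Av => [|k IH] c v Av; first by rewrite big_ord0; split=> //; exact: span0.
rewrite big_ord_recl.
have [h1 h2] := IH (fun i => c (lift ord0 i)) (fun i => v (lift ord0 i)) (fun i => Av _).
by split; [exact: span_cons|exact: PS].
Qed.

Lemma span_subspace : Defs.subspace (linear_span A).
Proof.
split; first exact: span0.
move=> c u v su sv; elim/span_ind : u / su => [|d u w Au _ IH].
  by rewrite scaler0 add0r.
by rewrite scalerDr -addrA scalerA; exact: span_cons.
Qed.

Lemma span_sub u : A u -> linear_span A u.
Proof. by move=> Au; have := span_cons 1 Au span0; rewrite scale1r addr0. Qed.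
End LinearSpan.

(** * The closure of the representation on the span of the range *)

Section SmoothComp2.
Context {R : realType} {n : nat} {G : lieGroupType R n}.
Implicit Types V W : normedModType R.
Notation dirder := (is_dirder (idfun : R -> R)).

Definition smooth2 W (K : G -> G -> W) : Prop := forall c d, atlas c -> atlas d ->
  smo (chart_img c `*` chart_img d) (fun p => K (chart_inv c p.1) (chart_inv d p.2)).

Lemma smooth_comp2 V W (O : set V) (K : G -> G -> W) (al be : V -> G) : open O ->
  smooth2 K -> Gsm O al -> Gsm O be -> smo O (fun x => K (al x) (be x)).
Proof.
move=> oO Ks [alc als] [bec bes]; apply: sm_loc => // x Ox.
have [c ac cx] := atlas_cover (al x); have [d ad dx] := atlas_cover (be x).
pose Q := (O `&` al @^-1` chart_dom c) `&` (O `&` be @^-1` chart_dom d).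
have oQ : open Q by apply: openI; apply: open_preim => //; exact: chart_domO.
exists Q; split=> //.
apply: (@sm_eq _ _ _ _ (fun x => K (chart_inv c (chart_map c (al x))) (chart_inv d (chart_map d (be x))))) => //.
  by move=> y [[_ cy] [_ dy]]; rewrite !chart_mapK.
apply: (@sm_comp _ _ _ _ (chart_img c `*` chart_img d) _
  (fun p => K (chart_inv c p.1) (chart_inv d p.2)) (fun y => (chart_map c (al y), chart_map d (be y)))).
- by apply: fdim_prod; exact: fdim_rV.
- exact: open_chart2.
- by move=> y [[_ cy] [_ dy]]; split; exact: chart_imgP.
- exact: Ks.
apply: sm_pair.
  by apply: sm_sub (als c ac) => y [[]].
by apply: sm_sub (bes d ad) => y [_ []].
Qed.

Variables (e : chart R n G) (ae : atlas e) (e1 : chart_dom e 1%g).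

(** [Lder_smooth] with an additional group variable [g], in which joint smoothness has to be
    preserved. *)
Lemma smooth2_Lder W (K : G -> G -> W) xi : smooth2 K ->
  smooth2 (fun h g => Lder e xi (K^~ g) h).
Proof.
move=> Ks c d ac ad; pose V2 : normedModType R := ('rV[R]_n * 'rV[R]_n)%type.
have oc := chart_imgO ac; have od := chart_imgO ad; have oe := chart_imgO ae.
have ocd := open_chart2 ac ad; have ep := chart_imgP e1.
pose O : set (V2 * 'rV[R]_n) := (chart_img c `*` chart_img d) `*` chart_img e.
have oO : open O.
  rewrite openE => -[a b] [/= ca eb]; exists (chart_img c `*` chart_img d, chart_img e) => //=.
  by split; apply: open_nbhs_nbhs; split.
pose Phi (q : V2 * 'rV[R]_n) : W := K (chart_inv c q.1.1 * chart_inv e q.2)%g (chart_inv d q.1.2).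
have Phis : smo O Phi.
  apply: smooth_comp2 => //; last first.
    apply: (@Gsm_comp R n G _ _ (chart_img d) _ (chart_inv d) (fun q : V2 * 'rV[R]_n => q.1.2)) => //.
    - exact: fdim_rV.
    - by move=> q [[]].
    - exact: Gsm_chart.
    - apply: (@sm_comp _ _ _ _ setT _ (fun p : V2 => p.2) (fun q : V2 * 'rV[R]_n => q.1)) => //.
      + by apply: fdim_prod; exact: fdim_rV.
      + exact: openT.
      + exact: sm_snd.
      + exact: sm_fst.
  apply: Gsm_mul => //.
    apply: (@Gsm_comp R n G _ _ (chart_img c) _ (chart_inv c) (fun q : V2 * 'rV[R]_n => q.1.1)) => //.
    - exact: fdim_rV.
    - by move=> q [[]].
    - exact: Gsm_chart.
    - apply: (@sm_comp _ _ _ _ setT _ (fun p : V2 => p.1) (fun q : V2 * 'rV[R]_n => q.1)) => //.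
      + by apply: fdim_prod; exact: fdim_rV.
      + exact: openT.
      + exact: sm_fst.
      + exact: sm_fst.
  apply: (@Gsm_comp R n G _ _ (chart_img e) _ (chart_inv e) (fun q : V2 * 'rV[R]_n => q.2)) => //.
  - exact: fdim_rV.
  - by move=> q [].
  - exact: Gsm_chart.
  - exact: sm_snd.
apply: (@sm_eq _ _ _ _ (fun p : V2 => dd Phi (0, xi) (p, chart_map e 1%g))) => //.
  move=> [u y] [/= cu dy]; apply/esym/ddE.
  have h := @sm_dirder _ _ _ O Phi ((u, y), chart_map e 1%g) (0, xi) oO Phis (conj (conj cu dy) ep).
  exact: (@dirder_slice R V2 'rV[R]_n W Phi (u, y) (chart_map e 1%g) xi _ h).
apply: (@sm_comp _ _ _ _ O _ (dd Phi (0, xi)) (fun p : V2 => (p, chart_map e 1%g))) => //.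
- by apply: fdim_prod; [apply: fdim_prod; exact: fdim_rV|exact: fdim_rV].
- exact: sm_dd.
- by apply: sm_pair; [exact: sm_id|exact: sm_cst].
Qed.

Lemma smooth2_cont1 W (K : G -> G -> W) : smooth2 K -> continuous (K 1%g).
Proof.
move=> Ks g; have [d ad dg] := atlas_cover g.
have h : K (chart_inv e (chart_map e 1%g)) (chart_inv d (chart_map d g')) @[g' --> g] -->
   K (chart_inv e (chart_map e 1%g)) (chart_inv d (chart_map d g)).
  apply: (cvg_cont (f := fun g' : G => (chart_map e 1%g, chart_map d g'))
    (l := (chart_map e 1%g, chart_map d g) : 'rV[R]_n * 'rV[R]_n)
    (L := fun p : 'rV[R]_n * 'rV[R]_n => K (chart_inv e p.1) (chart_inv d p.2))).
    by apply: cvg_pairN; [exact: cvg_cst|exact: chart_map_cont].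
  by apply: (sm_cont (Ks e d ae ad)); split; exact: chart_imgP.
rewrite !chart_mapK// in h; apply: cvg_trans h; apply: near_eq_cvg.
have := open_nbhs_nbhs (conj (chart_domO ad) dg).
by apply: filterS => p cp; rewrite chart_mapK.
Qed.
End SmoothComp2.

(** * The Garding space: vectors in the span of the range of [rho] *)

Section Gaarding.
Context {R : realType} {n : nat} {G : lieGroupType R n} {H : hilbertType R}.
Variables (mu : {measure set (borel G) -> \bar R}) (hmu : left_haar mu).
Variables (m : G -> R).
Local Notation CR := (realify (R[i]^o : normedModType R[i])).
Local Notation HR := (realify (H : normedModType R[i])).
Notation dirder := (is_dirder (idfun : R -> R)).
Notation Cint := (Cintegral mu).
Variables (U : G -> H -> H) (hU : unitary_rep U) (rho : (G -> R[i]) -> H -> H).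
Hypotheses (hrho : star_rep_tf mu m rho) (hcont : continuous_tf mu rho).
Hypothesis hnd : nondegenerate_tf rho.
Hypothesis hw : forall a, test_function a -> forall u v,
  dot (rho a u) v = Cint (fun g => a g * dot (U g u) v).
Local Notation dt := (dterm U).

Lemma coef_cont u v : continuous ((fun g => dot (U g u) v) : G -> CR).
Proof.
move=> g; exact: (cvg_cont (L := fun w : HR => dot w v : CR) (@rep_cont _ _ _ _ _ hU u g) (@dotl_cont R H v _)).
Qed.

Lemma rep_rho g b u : test_function b ->
  U g (rho b u) = rho (fun h => b (g^-1 * h)%g) u.
Proof.
move=> tb; have tb' := test_function_ltrans g^-1%g tb.
apply: dot_inj => v; rewrite (rep_adj hU) (hw tb) (hw tb').
rewrite -[RHS](Cint_ltrans hmu g).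
  congr Cintegral; apply/funext => h; rewrite mulgA mulVg mul1g.
  by rewrite (repM hU) (rep_adj hU g).
by apply: ccontCM; [exact: test_function_ccontC|exact: coef_cont].
Qed.

Lemma rho_cc_lin u (r : R) (f g : G -> CR) : cc_smooth f -> cc_smooth g ->
  (rho (fun t => r *: f t + g t) u : HR) = r *: (rho f u : HR) + rho g u.
Proof.
have [_ rl _ _] := hrho.
by move=> /test_functionP tf /test_functionP tg; exact: (rl r%:C f g tf tg u).
Qed.

Lemma rho_norm_le : exists2 C : R, 0 <= C & forall a u, test_function a ->
  `|(rho a u : HR)| <= C * L1norm mu a * `|(u : HR)|.
Proof.
have [C CP] := hcont; exists `|C| => // a u ta.
have L0 : 0 <= L1norm mu a by apply: Rintegral_ge0 => g _; exact: (@normr_ge0 _ CR).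
apply: (@le_trans _ _ (C * L1norm mu a * `|(u : HR)|)).
  by rewrite -lecR HR_normE rmorphM /= HR_normE; exact: CP.
by rewrite !ler_wpM2r// ler_norm.
Qed.

Lemma rho_cc_bnd u K : compact K -> exists2 C : R, 0 <= C & forall (f : G -> CR) (M : R),
  cc_smooth f -> csupp K f -> 0 <= M -> (forall t, K t -> `|f t| <= M) -> `|(rho f u : HR)| <= C * M.
Proof.
move=> cK; have [C C0 CP] := rho_norm_le.
have m0 : 0 <= fine (mu K) by rewrite fine_ge0.
exists (C * fine (mu K) * `|(u : HR)|); first by rewrite !mulr_ge0.
move=> f M fs Kf M0 fM; have tf : test_function f by apply/test_functionP.
apply: (le_trans (CP f u tf)).
have -> : C * fine (mu K) * `|(u : HR)| * M = C * (fine (mu K) * M) * `|(u : HR)| by ring.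
rewrite ler_wpM2r// ler_wpM2l//; apply: (L1norm_le hmu) => //; exact: cc_smooth_ccontC.
Qed.

(** For fixed [u], [rho] is linear in the test function and bounded by its L^1 norm, so it can be
    differentiated under like an integral. As [U] does not occur in the statement, the lemma also
    yields the continuity of the representation constructed from [rho]. *)
Lemma rho_ltrans_smooth b u : test_function b ->
  smooth_map idfun (fun g => rho (fun h => b (g^-1 * h)%g) u : HR).
Proof.
move=> tb c ac; have oc := chart_imgO ac; have /test_functionP [bs bK] := tb.
apply: (@jsm_param_smooth R n G CR HR (fun f => rho f u) (rho_cc_lin u) (@rho_cc_bnd u) (chart_img c)
  (fun y h => b ((chart_inv c y)^-1 * h)%g) oc).
- exact: ltrans_jsm.
- exact: ltrans_lcsupp.
Qed.

Lemma smoothv_rho b u : test_function b -> smoothv U (rho b u).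
Proof.
move=> tb; have := rho_ltrans_smooth u tb; rewrite /smoothv.
by congr smooth_map; apply/funext => g; rewrite -rep_rho.
Qed.

(** [U g] acts on [rho b u] by left translation of [b]; the derivative at 1 passes under [rho] and
    there produces [vtilde x b]. *)
Lemma dgen_rho x b u : test_function b -> dgen U x (rho b u) = rho (vtilde x b) u.
Proof.
move=> tb; have [e [ae e1] /(_ x)[xi x_xi]] := @ex_tangent R n G.
have /test_functionP [bs bK] := tb; have oe := chart_imgO ae.
rewrite (dgenE ae e1 x_xi (smoothv_rho u tb)) /Lder; apply: (@ddE R _ HR).
have -> : (fun v => orbit_map U (rho b u) (1 * chart_inv e v)%g) =
    (fun y => rho (fun h => b ((chart_inv e y)^-1 * h)%g) u : HR).
  by apply/funext => y; rewrite mul1g; exact: rep_rho.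
have -> : vtilde x b = (fun h => dd (fun v => b ((chart_inv e v)^-1 * h)%g : CR) xi (chart_map e 1%g)).
  by apply/funext => g; exact: (vtildeE ae e1 g x_xi bs).
apply: (@jsm_param_dirder R n G CR HR (fun f => rho f u) (rho_cc_lin u) (@rho_cc_bnd u) (chart_img e)
  (fun y h => b ((chart_inv e y)^-1 * h)%g) oe).
- exact: ltrans_jsm.
- exact: ltrans_lcsupp.
- exact: chart_imgP.
Qed.

Lemma dterm_rho s b u : test_function b -> dt s (rho b u) = rho (uterm_act s b) u.
Proof.
have [_ rl _ _] := hrho.
have t0 := @test_function0 R n G.
elim: s b => [x|c|s IHs t IHt|s IHs t IHt] b tb /=.
- exact: dgen_rho.
- have := rl c b _ tb t0 u; have := rl (-1) _ _ t0 t0 u; rewrite scaleN1r addNr.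
  have -> : (fun g : G => -1 * (0 : R[i]) + 0) = (fun=> 0) by apply/funext => g; rewrite mulr0 addr0.
  by move=> ->; rewrite addr0 => <-; congr rho; apply/funext => g; rewrite addr0.
- rewrite IHs// IHt//; have := rl 1 _ _ (test_function_act s tb) (test_function_act t tb) u.
  by rewrite scale1r => <-; congr rho; apply/funext => g; rewrite mul1r.
- by rewrite IHt// IHs//; exact: test_function_act.
Qed.

Lemma smoothv_span u : range_span rho u -> smoothv U u.
Proof.
move: u; apply: span_ind => [|c v w [a [v' [ta ->]]] _ sw]; first exact: smoothv0.
by apply: smoothv_lin => //; exact: smoothv_rho.
Qed.

Lemma dterm_span s u : range_span rho u -> range_span rho (dt s u).
Proof.
move: u; apply: (@span_ind _ _ _ (fun u => range_span rho (dt s u))) => [|c v w [a [v' [ta ->]]] sw IH].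
  have := dtermZ hU s 0 (smoothv0 hU); rewrite !scale0r => ->; exact: span0.
rewrite (dterm_lin hU); [|exact: smoothv_rho|exact: smoothv_span].
rewrite dterm_rho//; apply: span_cons => //.
by exists (uterm_act s a), v'; split=> //; exact: test_function_act.
Qed.

Lemma dense_smooth_vectors : dense (smooth_vectors U).
Proof.
move=> O O0 oO; have [w [Ow Dw]] := hnd O0 oO; exists w; split=> //.
by apply/smooth_vectorsE; exact: smoothv_span.
Qed.

(** Existence is witnessed by [dop] restricted to the span. Conversely, a representation meeting
    [is_rho_tilde] is prescribed on the vectors [rho b u] and linear, hence determined on their
    span. *)
Lemma rho_tilde_spec : rdom (rho_tilde rho) = range_span rho /\
  forall x u, range_span rho u -> rop (rho_tilde rho) x u = dop U x u.
Proof.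
have h0 : is_rho_tilde rho (@OpRep R H n G (range_span rho) (dop U)).
  split=> //=.
  - apply: (dop_star_rep hU) => //.
    + exact: span_subspace.
    + exact: smoothv_span.
    + exact: dterm_span.
  - by move=> x b u tb; exact: dterm_rho.
have [s1 d1 g1] : is_rho_tilde rho (rho_tilde rho) by exact: (xgetPex _ (ex_intro _ _ h0)).
split=> // x u.
have [_ /(_ x)[l1 _ _ _ _] _ _ _] := s1; rewrite d1 in l1.
have l0 : rop (rho_tilde rho) x 0 = 0.
  have := l1 1 0 0 (span0 _) (span0 _); rewrite !scale1r addr0 -[LHS]addr0.
  by move/addrI.
move: u; apply: (@span_ind _ _ _ (fun u => rop (rho_tilde rho) x u = dop U x u)) => [|c v w [a [v' [ta ->]]] sw IH].
  by rewrite l0 /dop; have := dtermZ hU (repr (x : uea (@lie_bracket R n G))) 0 (smoothv0 hU); rewrite !scale0r.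
have sv : range_span rho (rho a v') by apply: span_sub; exists a, v'.
rewrite (l1 c _ _ sv sw) IH g1// /dop (dterm_lin hU); [|exact: smoothv_rho|exact: smoothv_span].
by rewrite dterm_rho.
Qed.

End Gaarding.

Section ClosureOfRhoTilde.
Context {R : realType} {n : nat} {G : lieGroupType R n} {H : hilbertType R}.
Variables (mu : {measure set (borel G) -> \bar R}) (hmu : left_haar mu).
Variables (m : G -> R).
Local Notation CR := (realify (R[i]^o : normedModType R[i])).
Local Notation HR := (realify (H : normedModType R[i])).
Notation dirder := (is_dirder (idfun : R -> R)).
Notation Cint := (Cintegral mu).
Variables (U : G -> H -> H) (hU : unitary_rep U).
Local Notation dt := (dterm U).

Lemma op_graph_closureP (D : set H) (T : H -> H) (u v : H) :
  closure (op_graph D T) (u, v) <->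
  forall d : R, 0 < d -> exists w, [/\ D w, `|(u - w : HR)| < d & `|(v - T w : HR)| < d].
Proof.
split=> [cl d d0|h B [[A1 A2] [/= nA1 nA2] AB]].
  have dC : 0 < d%:C :> R[i] by rewrite ltcR.
  have nb : nbhs (u, v) (ball u d%:C `*` ball v d%:C).
    by exists (ball u d%:C, ball v d%:C) => //; split; exact: nbhsx_ballx.
  have [[a b] [[/= Da ->] [/= ha hb]]] := cl _ nb; exists a; split=> //.
    by move: ha; rewrite -ball_normE /= -HR_normE ltcR.
  by move: hb; rewrite -ball_normE /= -HR_normE ltcR.
have dist (x : H) (A : set H) : nbhs x A -> exists2 d : R, 0 < d & forall y, `|(x - y : HR)| < d -> A y.
  move=> /nbhs_ballP[d /= d0 dA]; have dE : d = (complex.Re d)%:C by rewrite RRe_real// gtr0_real.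
  exists (complex.Re d); first by rewrite -ltcR -dE.
  by move=> y xy; apply: dA; rewrite -ball_normE /= dE -HR_normE ltcR.
have [d1 d10 dA1] := dist u A1 nA1; have [d2 d20 dA2] := dist v A2 nA2.
have dm : 0 < Num.min d1 d2 by rewrite lt_min d10.
have [w [Dw h1 h2]] := h _ dm.
exists (w, T w); split; first by split.
apply: AB; split=> /=.
  by apply: dA1; rewrite (lt_le_trans h1)// ge_min lexx.
by apply: dA2; rewrite (lt_le_trans h2)// ge_min lexx orbT.
Qed.

Lemma smooth2_orbit u : smoothv U u -> smooth2 (fun h g => U h (U g u) : HR).
Proof.
move=> su c d ac ad; have oX := open_chart2 ac ad.
have -> : (fun p : 'rV[R]_n * 'rV[R]_n => U (chart_inv c p.1) (U (chart_inv d p.2) u) : HR) =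
   (fun p => orbit_map U u (chart_inv c p.1 * chart_inv d p.2)%g).
  by apply/funext => p; rewrite /orbit_map (repM hU).
by apply: smooth_comp => //; exact: Gsm_mul2.
Qed.

(** The variable [h] is added so that induction on [s] is possible: each generator is a derivative
    in [h], while [g] is a mere parameter. At [h = 1] the continuity of [g |-> dt s (U g u)] comes
    out. *)
Lemma smooth2_dterm s (D : G -> H) : (forall g, smoothv U (D g)) ->
  smooth2 (fun h g => U h (D g) : HR) -> smooth2 (fun h g => U h (dt s (D g)) : HR).
Proof.
elim: s D => [x|c|s IHs t IHt|s IHs t IHt] D sD s2 /=.
- have [e [ae e1] /(_ x)[xi x_xi]] := @ex_tangent R n G.
  have := smooth2_Lder ae e1 xi s2; congr smooth2; apply/funext => h; apply/funext => g.
  by rewrite (rep_dgen hU ae e1 x_xi h (sD g)).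
- have -> : (fun h g => U h (c *: D g) : HR) = (fun h g => c *: U h (D g) : HR).
    by apply/funext => h; apply/funext => g; rewrite (repZ hU).
  move=> a b aa ab; apply: (sm_linmap (L := fun u : HR => c *: (u : H) : HR)).
  + exact: scaleC_lin.
  + exact: scaleC_cont.
  + exact: s2.
- have -> : (fun h g => U h (dt s (D g) + dt t (D g)) : HR) =
     (fun h g => (U h (dt s (D g)) : HR) + U h (dt t (D g))).
    by apply/funext => h; apply/funext => g; rewrite (repD hU).
  by move=> a b aa ab; apply: sm_add; [exact: IHs|exact: IHt].
- apply: IHs; last exact: IHt.
  by move=> g; exact: smoothv_dterm.
Qed.

Lemma dterm_rep_cont s u : smoothv U u -> continuous ((fun g => dt s (U g u)) : G -> HR).
Proof.
move=> su; have [e ae e1] := atlas_cover (1%g : G).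
have h := smooth2_cont1 ae e1 (smooth2_dterm s (fun g => smoothv_rep hU g su) (smooth2_orbit su)).
move=> g; have := h g.
by have -> : (fun g => U 1%g (dt s (U g u)) : HR) = (fun g => dt s (U g u))
  by apply/funext => g'; exact: (rep1 hU).
Qed.

Lemma Cint_avg (chi : G -> R) (f : G -> CR) (M : R) : @ccont R n G chi -> (forall h, 0 <= chi h) ->
  Rintegral mu setT chi = 1 -> continuous f -> (forall h, chi h != 0 -> `|f h| <= M) ->
  `|(Cint (fun h => (chi h)%:C * (f h : R[i])) : CR)| <= 2 * M.
Proof.
move=> cchi chi0 chi1 fc fM.
have cM : ccont (fun h => M * chi h) by apply: ccontM => //; exact: cst_continuous.
have cc : ccontC (fun h => (chi h)%:C * (f h : R[i])).
  case: cchi => chic [K cK Kchi]; split; last by exists K => // h /Kchi ->; rewrite mul0r.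
  move=> h; exact: (@cvgZ R CR _ (nbhs h) _ (fun h => chi h : R^o) f _ _ (@chic h) (@fc h)).
have IM : Rintegral mu setT (fun h => M * chi h) = M by rewrite (RintZ hmu)// chi1 mulr1.
have nM h : `|(((chi h)%:C * (f h : R[i])) : CR)| <= M * chi h.
  rewrite CR_M CR_normR ger0_norm// mulrC.
  have [->|/fM hM] := eqVneq (chi h) 0; first by rewrite !mulr0.
  by rewrite ler_wpM2r.
rewrite (le_trans (CR_le_ReIm _))// mulr2n mulrDl mul1r lerD//.
  rewrite -[leRHS]IM; apply: (Rint_le_norm hmu (ccontC_re cc) cM) => h.
  exact: (le_trans (CR_Re_le _) (nM h)).
rewrite -[leRHS]IM; apply: (Rint_le_norm hmu (ccontC_im cc) cM) => h.
exact: (le_trans (CR_Im_le _) (nM h)).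
Qed.

Lemma Cint_chi (chi : G -> R) (z : R[i]) : @ccont R n G chi -> Rintegral mu setT chi = 1 ->
  Cint (fun h => (chi h)%:C * z) = z.
Proof.
move=> cchi chi1; rewrite /Cintegral; case: z => a b.
have -> : (fun h => complex.Re ((chi h)%:C * (a +i* b))) = (fun h => a * chi h).
  by apply/funext => h /=; ring.
have -> : (fun h => complex.Im ((chi h)%:C * (a +i* b))) = (fun h => b * chi h).
  by apply/funext => h /=; ring.
by rewrite !(RintZ hmu)// chi1 !mulr1.
Qed.

(** The same [a] works for all functions [f], hence for all matrix coefficients of a vector at once,
    as norm estimates by duality demand. The factor 2 stems from real and imaginary parts. *)
Lemma approx_identity (N : set G) : nbhs (1%g : G) N -> exists2 a : G -> R[i], test_function a &
  forall (f : G -> CR) (z : CR) (M : R), continuous f -> (forall g, N g -> `|z - f g| <= M) ->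
  `|z - (Cint (fun g => a g * (f g : R[i])) : CR)| <= 2 * M.
Proof.
move=> nN; have [chi [chis chi0 chi1 [K cK [KN Kchi]]]] := ex_unit_bump hmu (@open_interior _ N) nN.
have cchi : @ccont R n G chi by split; [exact: smooth_map_cont|exists K].
have ta : test_function (fun g => (chi g : R)%:C).
  apply/test_functionP; split; last by exists K => // h /Kchi ->.
  move=> c ac; have -> : (fun y => (chi (chart_inv c y) : R)%:C : CR) = (fun y => chi (chart_inv c y) *: (1%:C : CR)).
    by apply/funext => y; rewrite rify_scaleE /GRing.scale /= mulr1.
  by apply: sm_scale; [exact: chis|exact: sm_cst].
exists (fun g => (chi g : R)%:C) => // f z M fc fM.
pose f' : G -> CR := fun g => z - f g.
have -> : z - (Cint (fun g => (chi g : R)%:C * (f g : R[i])) : CR) =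
    Cint (fun g => (chi g : R)%:C * (f' g : R[i])).
  rewrite -[in LHS](Cint_chi z cchi chi1) -[LHS](CintB hmu).
  - by congr Cintegral; apply/funext => g; rewrite -mulrBr.
  - by apply: ccontCM; [exact: test_function_ccontC ta|exact: cst_continuous].
  - by apply: ccontCM; [exact: test_function_ccontC ta|exact: fc].
apply: (@Cint_avg chi f' M cchi chi0 chi1).
  by move=> g; apply: (@cvgB _ CR); [exact: cvg_cst|exact: fc].
move=> g cg; apply: fM; apply: interior_subset; apply: KN; apply: contrapT => /Kchi c0.
by rewrite c0 eqxx in cg.
Qed.

Section WithRho.
Variable (rho : (G -> R[i]) -> H -> H).
Hypotheses (hrho : star_rep_tf mu m rho) (hcont : continuous_tf mu rho).
Hypothesis hnd : nondegenerate_tf rho.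
Hypothesis hw : forall a, test_function a -> forall u v,
  dot (rho a u) v = Cint (fun g => a g * dot (U g u) v).
Let dsv : dense (smooth_vectors U). Proof. exact: (dense_smooth_vectors hmu hU hrho hcont hnd hw). Qed.

(* Averaging over a small neighbourhood of 1 approximates u and dt s u
   simultaneously, since dt s (U g u) is continuous in g. *)
Lemma smoothv_in_closure s u : smoothv U u ->
  closure (op_graph (range_span rho) (dt s)) (u, dt s u).
Proof.
move=> su; apply/op_graph_closureP => d d0.
(* [approx_identity] doubles the tolerance, and [d / 2] is still strictly less than [d]. *)
have d4 : 0 < d / 4 by rewrite divr_gt0.
pose N0 := [set g | `|(u - U g u : HR)| <= d / 4 /\ `|(dt s u - dt s (U g u) : HR)| <= d / 4].
have nN0 : nbhs (1%g : G) N0.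
  have /cvgrPdist_le/(_ _ d4) h1 := @rep_cont _ _ _ _ _ hU u 1%g.
  have /cvgrPdist_le/(_ _ d4) h2 := @dterm_rep_cont s u su 1%g.
  by apply: filterS2 h1 h2 => g; rewrite (rep1 hU).
have [a ta aP] := approx_identity nN0; exists (rho a u).
have small : 2 * (d / 4) < d by move: d0; lra.
have d40 : 0 <= 2 * (d / 4) by rewrite mulr_ge0// ltW.
split.
- by apply: span_sub; exists a, u.
- apply: le_lt_trans small; apply: (dense_norm_le dsv) => // v _.
  rewrite dotBl (hw ta) -mulrA; apply: aP; first exact: (coef_cont hU).
  move=> g [h _]; have -> : (dot u v : CR) - dot (U g u) v = dot (u - U g u) v by rewrite dotBl.
  by rewrite (le_trans (cauchy_schwarz _ _))// ler_wpM2r.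
(* Smooth test vectors allow [dt s] to be moved to the other side, where the weak formula for
   [rho a u] applies, and back again inside the integral. *)
- apply: le_lt_trans small; apply: (dense_norm_le dsv) => // v /smooth_vectorsE sv.
  have sr := smoothv_rho hmu hU hrho hcont hw u ta.
  rewrite dotBl (dterm_adj hU s sr sv) (hw ta) -mulrA; apply: aP; first exact: (coef_cont hU).
  move=> g [_ h]; rewrite -(dterm_adj hU s (smoothv_rep hU g su) sv).
  have -> : (dot (dt s u) v : CR) - dot (dt s (U g u)) v = dot (dt s u - dt s (U g u)) v by rewrite dotBl.
  by rewrite (le_trans (cauchy_schwarz _ _))// ler_wpM2r.
Qed.

(** The adjoint relation holds on the graph and is continuous in both of its entries, so it persists
    in the closure. *)
Lemma closure_weak s u v : closure (op_graph (range_span rho) (dt s)) (u, v) ->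
  forall w, smoothv U w -> dot v w = dot u (dt (uterm_star s) w).
Proof.
move=> /op_graph_closureP cl w sw; set w' := dt _ w.
apply/eqP; rewrite -subr_eq0; apply/eqP; apply: (@normr0_eq0 _ CR).
apply/eqP; rewrite -normr_le0 normr_id; apply/ler_addgt0Pl => d d0; rewrite addr0.
set b := `|(w : HR)| + `|(w' : HR)| + 1; have b0 : 0 < b by rewrite ltr_wpDl// addr_ge0.
have [x [Dx ux vx]] := cl _ (divr_gt0 d0 b0).
have sx := smoothv_span hmu hU hrho hcont hw Dx.
have -> : (dot v w - dot u w' : CR) = (dot (v - dt s x) w : CR) - (dot (u - x) w' : CR).
  rewrite !dotBl (dterm_adj hU s sx sw) -/w'.
  by change (dot v w - dot u w' = (dot v w - dot x w') - (dot u w' - dot x w') :> R[i]); ring.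
rewrite (le_trans (@ler_normB _ CR _ _))//.
have h1 := cauchy_schwarz (v - dt s x) w; have h2 := cauchy_schwarz (u - x) w'.
rewrite (le_trans (lerD h1 h2))//.
have h3 : `|(v - dt s x : HR)| * `|(w : HR)| <= d / b * `|(w : HR)| by rewrite ler_wpM2r// ltW.
have h4 : `|(u - x : HR)| * `|(w' : HR)| <= d / b * `|(w' : HR)| by rewrite ler_wpM2r// ltW.
rewrite (le_trans (lerD h3 h4))// -mulrDr mulrAC ler_pdivrMr// ler_wpM2l ?(ltW d0)//.
by rewrite /b lerDl.
Qed.
End WithRho.
End ClosureOfRhoTilde.

(** * Weakly smooth vectors are smooth *)

Section WeaklySmooth.
Context {R : realType} {n : nat} {G : lieGroupType R n} {H : hilbertType R}.
Local Notation CR := (realify (R[i]^o : normedModType R[i])).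
Local Notation HR := (realify (H : normedModType R[i])).
Notation dirder := (is_dirder (idfun : R -> R)).
Variables (U : G -> H -> H) (hU : unitary_rep U).
Hypothesis dsv : dense (smooth_vectors U).
Local Notation dt := (dterm U).

(** [u] lies in the domain of the adjoint of every [dt (uterm_star s)]. This is all that membership
    in the domain of the closure provides. *)
Definition weakly_smooth (u : H) : Prop := forall s, exists v, forall w, smoothv U w ->
  dot v w = dot u (dt (uterm_star s) w).

Variables (e : chart R n G) (ae : atlas e) (e1 : chart_dom e 1%g).

Lemma weakly_smooth_gen (x : lieAlg G) u : weakly_smooth u -> exists v, weakly_smooth v /\
  forall w, smoothv U w -> dot v w = dot u (dgen U (- x) w).
Proof.
move=> wu; have [v vP] := wu (UGen x); exists v; split=> // s.
(* The star reverses products, so that [- x] stands on the left and can be absorbed into [v]. *)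
have [v' v'P] := wu (UMul s (UGen x)); exists v' => w sw.
by rewrite v'P//= vP//; exact: smoothv_dterm.
Qed.

(** Here it is the second vector that is smooth: moving [U g] across the inner product leaves the
    orbit map of [w] at [g^-1]. *)
Lemma coef_inv_smooth u w : smoothv U w -> smooth_map idfun (fun g => dot (U g u) w : CR).
Proof.
move=> sw.
have -> : (fun g => dot (U g u) w : CR) = (fun g => dot u (orbit_map U w (g^-1)%g) : CR).
  by apply/funext => g; rewrite (rep_adj hU).
apply: (smooth_linmap (@dotr_lin R H u) (@dotr_cont R H u)) => c ac.
have oc := chart_imgO ac; apply: smooth_comp => //.
by apply: Gsm_inv => //; exact: Gsm_chart.
Qed.

Lemma Lder_coef_inv xi u v w g : smoothv U w ->
  (forall w, smoothv U w -> dot v w = dot u (dgen U (- lie_of ae e1 xi) w)) ->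
  Lder e xi (fun g => dot (U g u) w : CR) g = dot (U g v) w.
Proof.
move=> sw vP; pose x := lie_of ae e1 xi; have x_xi := lie_ofE ae e1 xi.
have [gam hg] := ex_integral_curve ae e1 x.
have h1 := Lder_integral_curve ae e1 (g := g) x_xi hg (coef_inv_smooth u sw).
have sgw := smoothv_rep hU (g^-1)%g sw.
have [xi' x_xi'] := lie_tangent ae e1 (- x).
have := dgen_deriv ae e1 x_xi' sgw; rewrite -(dgenE ae e1 x_xi' sgw) => /is_deriv0P h2.
have {}h2 := dirder_linmap (@dotr_lin R H u) (@dotr_cont R H u) h2.
rewrite -vP// -(rep_adj hU) in h2.
apply: (dirder_unique (W := CR) h1); move: h2.
suff -> : (fun t : R^o => dot u (U (lexp (t *: - x)) (U (g^-1)%g w)) : CR) =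
   (fun t : R^o => dot (U (g * gam t)%g u) w : CR) by [].
apply/funext => t; rewrite scalerN -scaleNr (lexp_curve ae e1 hg) (integral_curveN _ hg).
by rewrite -(repM hU) -invgM -(rep_adj hU).
Qed.

(** The candidate derivative [X] combines the orbit maps of the weak derivatives [psi i] with smooth
    chart coefficients. Its continuity is known beforehand, since orbit maps are continuous and the
    induction hypothesis applies to [psi i]; this makes the mean value estimate of the coefficients
    uniform in [w], and density of the smooth vectors turns it into an estimate in norm. *)
Lemma weakly_smooth_Ck k u c : atlas c -> weakly_smooth u ->
  Ck (idfun : R -> R) k (chart_img c) (fun y => orbit_map U u (chart_inv c y)).
Proof.
move=> ac; have oc := chart_imgO ac.
have cont u0 y : chart_img c y -> {for y, continuous (fun y => orbit_map U u0 (chart_inv c y))}.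
  move=> cy; exact: (cvg_cont (L := orbit_map U u0) (chart_inv_cont ac cy) (@rep_cont _ _ _ _ _ hU u0 _)).
elim: k u => [|k IH] u wu; split=> //; try exact: cont.
move=> v.
have /boolp.choice [psi psiP] : forall i : 'I_n, exists v, weakly_smooth v /\
    forall w, smoothv U w -> dot v w = dot u (dgen U (- lie_of ae e1 (delta_mx 0 i)) w).
  by move=> i; exact: weakly_smooth_gen.
pose X (y : 'rV[R]_n) : HR := \sum_(i < n) (chart_coef e c v y 0 i : R^o) *: orbit_map U (psi i) (chart_inv c y).
have coefs i : smo (chart_img c) (fun y => chart_coef e c v y 0 i : R^o).
  have := @sm_comp R _ _ _ setT (chart_img c) (fun u : 'rV[R]_n => u 0 i : R^o) (chart_coef e c v)
    (fdim_rV n) openT (fun _ _ => I) (sm_coord setT i) (chart_coef_smooth ae e1 v ac).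
  by [].
have XC : Ck (idfun : R -> R) k (chart_img c) X.
  apply: Ck_sum => i; apply: Ck_scale; first exact: coefs.
  by apply: IH; case: (psiP i).
exists X; split=> // y cy.
have Xc : {for y, continuous X} by exact: (Ck_cont XC cy).
have deriv w y' : smoothv U w -> chart_img c y' ->
    dirder (fun y => dot (orbit_map U u (chart_inv c y)) w : CR) y' v (dot (X y') w : CR).
  move=> sw cy'; have := chart_dirder (c := c) (w := v) ae e1 ac cy' (coef_inv_smooth u sw).
  rewrite (Lder_row ae e1 _ _ (coef_inv_smooth u sw)).
  suff -> : \sum_(i < n) chart_coef e c v y' 0 i *: Lder e (delta_mx 0 i) (fun g => dot (U g u) w : CR) (chart_inv c y')
     = (dot (X y') w : CR) by [].
  rewrite /X dot_suml; apply: eq_bigr => i _.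
  rewrite (Lder_coef_inv _ sw (psiP i).2).
  by rewrite rify_scaleE [RHS]dotZl.
apply/dirderP => d d0.
have nX : \forall y' \near y, chart_img c y' /\ `|X y - X y'| <= d.
  have h1 := open_nbhs_nbhs (conj oc cy).
  have /cvgrPdist_le/(_ d d0) h2 := Xc.
  by apply: (@filterS2 _ _ (nbhs_filter y) _ _ _ _ h1 h2) => y' ? ?; split.
have [r r0 rP] := near_line v nX; exists r => // t tr.
apply: (dense_norm_le dsv); first by rewrite mulr_ge0// ltW.
move=> w /smooth_vectorsE sw.
have := @mean_value_seg R _ CR (fun y => dot (orbit_map U u (chart_inv c y)) w : CR) y (t *: v)
  (t *: (dot (X y) w : CR)) (d * `|t| * `|(w : HR)|).
have -> : (dot (orbit_map U u (chart_inv c (y + t *: v))) w : CR) -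
   dot (orbit_map U u (chart_inv c y)) w - t *: (dot (X y) w : CR) =
   dot (orbit_map U u (chart_inv c (y + t *: v)) - orbit_map U u (chart_inv c y) - t *: X y : HR) w.
  rewrite [RHS]dotBl dotBl; congr (_ - _).
  by rewrite rify_scaleE [RHS]dotZl.
apply=> s /andP[s0 s1]; rewrite scalerA.
have str : `|s * t| < r by rewrite normrM (ger0_norm s0) (le_lt_trans _ tr)// ler_piMl.
have [cs Xs] := rP _ str.
exists (t *: (dot (X (y + (s * t) *: v)) w : CR)).
  by apply: dirderZ; exact: deriv.
rewrite -scalerBr normrZ [d * _]mulrC -mulrA ler_wpM2l//.
have -> : (dot (X (y + (s * t) *: v)) w : CR) - dot (X y) w = dot (X (y + (s * t) *: v) - X y : HR) w.
  by rewrite dotBl.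
rewrite (le_trans (cauchy_schwarz _ _))// ler_wpM2r//.
by rewrite -normrN opprB.
Qed.

End WeaklySmooth.

Section SameRepresentation.
Context {R : realType} {n : nat} {G : lieGroupType R n} {H : hilbertType R}.
Variables (mu : {measure set (borel G) -> \bar R}) (hmu : left_haar mu) (m : G -> R).
Variables (U : G -> H -> H) (hU : unitary_rep U) (rho : (G -> R[i]) -> H -> H).
Hypotheses (hrho : star_rep_tf mu m rho) (hcont : continuous_tf mu rho).
Hypothesis hnd : nondegenerate_tf rho.
Hypothesis hw : forall a, test_function a -> forall u v,
  dot (rho a u) v = Cintegral mu (fun g => a g * dot (U g u) v).

Lemma weakly_smooth_smoothv u : dense (smooth_vectors U) -> weakly_smooth U u -> smoothv U u.
Proof.
move=> dsv wu; have [e ae e1] := atlas_cover (1%g : G).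
by move=> c ac k; exact: (weakly_smooth_Ck hU dsv ae e1 k ac wu).
Qed.

Lemma same_rho_prime_dU : same_rep (rho_prime rho) (dU U).
Proof.
have dsv := dense_smooth_vectors hmu hU hrho hcont hnd hw.
have [r1 r2] := rho_tilde_spec hmu hU hrho hcont hnd hw.
have [d1 d2] := dU_spec hU dsv.
pose rp (x : lie_env G) : uterm (lieAlg G) := repr (x : uea (@lie_bracket R n G)).
have grE x : op_graph (rdom (rho_tilde rho)) (rop (rho_tilde rho) x) =
    op_graph (range_span rho) (dterm U (rp x)).
  rewrite r1; apply/seteqP; split=> -[u v] [/= Du ->]; split=> //=; first exact: r2.
  by rewrite r2.
have cl_value x u v : smoothv U u ->
    closure (op_graph (range_span rho) (dterm U (rp x))) (u, v) -> v = dterm U (rp x) u.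
  move=> su cl; apply: (dense_dot_inj dsv) => w /smooth_vectorsE sw.
  by rewrite (closure_weak hmu hU hrho hcont hw cl sw) (dterm_adj hU).
have domE : rdom (rho_prime rho) = smooth_vectors U.
  apply/seteqP; split=> u /=; last first.
    move=> /smooth_vectorsE su x; exists (dterm U (rp x) u).
    rewrite grE; exact: (smoothv_in_closure hmu hU hrho hcont hnd hw).
  move=> h; apply/smooth_vectorsE; apply: weakly_smooth_smoothv => // s.
  (* [cl] speaks of the chosen representative of the class of [s], which may differ from [s]; by
     [ustarE] the stars of both act alike on smooth vectors. *)
  have [v] := h (ucls _ s : lie_env G); rewrite grE => cl; exists v => w sw.
  rewrite (closure_weak hmu hU hrho hcont hw cl sw); congr dot.
  have := dop_ucls hU (uterm_star (rp (ucls _ s : lie_env G))) sw.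
  rewrite -(dop_ucls hU (uterm_star s) sw) => <-; congr (dop U _ w).
  by rewrite -!ustarE /rp ucls_repr.
split; first by rewrite domE d1.
move=> x u; rewrite domE => Du; have su := (smooth_vectorsE _ _).1 Du.
rewrite d2// /rho_prime /rep_closure /= grE.
have cl := smoothv_in_closure hmu hU hrho hcont hnd hw (s := rp x) su.
case: xgetP => [v _ hv|/(_ _ cl)//]; exact: (cl_value x u v su hv).
Qed.
End SameRepresentation.

(** * The integrated representation of test functions *)

Section IntegratedRepresentation.
Context {R : realType} {n : nat} {G : lieGroupType R n} {H : hilbertType R}.
Variables (mu : {measure set (borel G) -> \bar R}) (hmu : left_haar mu).
Variables (m : G -> R) (hm : modular_function mu m).
Local Notation CR := (realify (R[i]^o : normedModType R[i])).
Local Notation HR := (realify (H : normedModType R[i])).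
Notation Cint := (Cintegral mu).
Variables (U : G -> H -> H) (hU : unitary_rep U).

Definition integrated_rep (a : G -> R[i]) (u : H) : H :=
  xget 0 [set w | forall v, dot w v = Cint (fun g => a g * dot (U g u) v)].
Notation rho := integrated_rep.

Lemma ccontC_coef a u v : ccontC a -> ccontC (fun g => a g * dot (U g u) v).
Proof. by move=> ca; apply: ccontCM => //; exact: (coef_cont hU). Qed.

Lemma integrated_repP a : ccontC a -> forall u v,
  dot (rho a u) v = Cint (fun g => a g * dot (U g u) v).
Proof.
move=> [ac [K cK Ka]] u.
have Fc : continuous (fun g => a g *: U g u : HR).
  by move=> g; apply: (@cvgZ R[i] H _ (nbhs g) _ (a : G -> R[i]^o) (fun g => U g u)); [exact: ac|exact: (rep_cont hU)].
have F0 h : ~ K h -> (a h *: U h u : HR) = 0 by move=> /Ka ->; rewrite scale0r.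
have [w wP] := weak_integral hmu Fc cK F0.
rewrite /integrated_rep; case: xgetP => [w' _ //|/(_ w) []] v.
by rewrite wP; congr Cintegral; apply/funext => h; rewrite dotZl.
Qed.

Lemma integrated_lin a : test_function a -> linear_on setT (rho a).
Proof.
move=> /test_function_ccontC ca c u v _ _; apply: dot_inj => w.
rewrite dotDl dotZl !integrated_repP// -(Cint_lin hmu c); [|exact: ccontC_coef|exact: ccontC_coef].
by congr Cintegral; apply/funext => g; rewrite (rep_lin hU) dotDl dotZl mulrDr mulrCA.
Qed.

Lemma integrated_linf (c : R[i]) a b : test_function a -> test_function b ->
  forall u, rho (fun g => c * a g + b g) u = c *: rho a u + rho b u.
Proof.
move=> ta tb u; have ca := test_function_ccontC ta; have cb := test_function_ccontC tb.
have cab := test_function_ccontC (test_function_lin c ta tb).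
apply: dot_inj => w; rewrite dotDl dotZl !integrated_repP//.
rewrite -(Cint_lin hmu c); [|exact: ccontC_coef|exact: ccontC_coef].
by congr Cintegral; apply/funext => g; rewrite mulrDl mulrA.
Qed.

Let fstc : continuous (fun p : G * G => p.1). Proof. by move=> p; exact: cvg_fst. Qed.
Let sndc : continuous (fun p : G * G => p.2). Proof. by move=> p; exact: cvg_snd. Qed.
Let compc (T S V : topologicalType) (f : S -> V) (g : T -> S) :
  continuous f -> continuous g -> continuous (fun t => f (g t)).
Proof. by move=> fc gc t; exact: (cvg_cont (@gc t) (@fc (g t))). Qed.

Lemma conv_integrand_cont (a b : G -> CR) : continuous a -> continuous b ->
  continuous (fun p : G * G => (a p.1 : R[i]) * b (p.1^-1 * p.2)%g : CR).
Proof.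
move=> ac bc p; apply: cvg_mulC; first exact: (compc ac fstc).
have gc : continuous (fun p : G * G => (p.1^-1 * p.2)%g).
  by move=> q; apply: cvg_mulG; [apply: cvg_invG; exact: fstc|exact: sndc].
exact: (compc bc gc).
Qed.

(** After the interchange of integrals, the inner one is translated by [h], which splits [U (h * g)]
    into [U h] and [U g]. *)
Lemma integrated_conv a b : test_function a -> test_function b ->
  forall u, rho (Defs.conv mu a b) u = rho a (rho b u).
Proof.
move=> ta tb u; have ca := test_function_ccontC ta; have cb := test_function_ccontC tb.
have cab := test_function_ccontC (test_function_conv hmu ta tb).
apply: dot_inj => v; rewrite !integrated_repP//.
pose D g := dot (U g u) v; have Dc : continuous (D : G -> CR) by exact: (coef_cont hU).
have [ac [K cK Ka]] := ca; have [bc [L cL Lb]] := cb.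
pose L' : set G := [set g | exists a b, [/\ K a, L b & g = (a * b)%g]].
pose F h g : CR := (a h * b (h^-1 * g)%g) * D g.
have Fc : continuous (fun p : G * G => F p.1 p.2).
  move=> p; have h1 := @conv_integrand_cont a b ac bc p; have h2 := @compc _ _ _ _ _ Dc sndc p.
  exact: (@cvg_mulC R _ _ _ _ _ _ _ h1 h2).
have Fs h g : ~ (K h /\ L' g) -> F h g = 0.
  move=> nhg; rewrite /F; have [Kh|/Ka ->] := pselect (K h); last by rewrite !mul0r.
  rewrite Lb ?mulr0 ?mul0r// => Lhg; apply: nhg; split=> //.
  by exists h, (h^-1 * g)%g; split=> //; rewrite mulgA mulgV mul1g.
have fub := Cint_fubini hmu cK (compact_mulG cK cL) Fc Fs.
have cconv g : ccontC (fun h => a h * b (h^-1 * g)%g).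
  have gc : continuous (fun h : G => (h^-1 * g)%g).
    by move=> h; apply: cvg_mulG; [exact: lie_inv_continuous|exact: cvg_cst].
  exact: (@ccontCM R n G a (fun h => b (h^-1 * g)%g) ca (compc bc gc)).
have -> : (fun g => Defs.conv mu a b g * dot (U g u) v) = (fun g => Cint (F^~ g)).
  apply/funext => g; rewrite mulrC -[RHS]/(Cint (fun h => F h g)).
  have -> : (fun h => F h g) = (fun h => D g * (a h * b (h^-1 * g)%g)).
    by apply/funext => h; rewrite /F mulrC.
  by rewrite (CintZ hmu _ (cconv g)).
rewrite -fub; congr Cintegral; apply/funext => h.
have cbh : ccontC (fun g => b (h^-1 * g)%g * D g).
  exact: (@ccontCM R n G _ D (ccontC_ltrans h^-1%g cb) Dc).
have -> : F h = (fun g => a h * (b (h^-1 * g)%g * D g)).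
  by apply/funext => g; rewrite /F mulrA.
rewrite (CintZ hmu _ cbh) -(Cint_ltrans hmu h cbh); congr (_ * _).
rewrite (rep_adj hU h (rho b u) v) (integrated_repP cb); congr Cintegral; apply/funext => g.
by rewrite mulgA mulVg mul1g -(rep_adj hU) /D (repM hU).
Qed.

(** The factor [m^-1] in [tf_star] is exactly the density in the inversion formula [Cint_inv], and
    [U] at [g^-1] is the adjoint of [U g]. *)
Lemma integrated_adj a : test_function a -> adjoint_on setT (rho a) (rho (tf_star m a)).
Proof.
move=> ta u v _ _; have ca := test_function_ccontC ta.
have cs := test_function_ccontC (test_function_star hmu hm ta).
rewrite [RHS]dotC !integrated_repP// -(Cint_conj hmu); last exact: ccontC_coef.
have cf := ccontC_coef u v ca.
rewrite -(Cint_inv hmu hm cf); congr Cintegral; apply/funext => g.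
rewrite (rep_adj hU (g^-1)%g u v) invgK [dot u _]dotC /tf_star !rmorphM /=.
by rewrite -mulrA; congr (_ * (_ * _)); rewrite ?conjcK// /= ?oppr0.
Qed.

Lemma integrated_star_rep : star_rep_tf mu m rho.
Proof.
split; [exact: integrated_lin|exact: integrated_linf|exact: integrated_conv|exact: integrated_adj].
Qed.

Lemma Cint_coef_le a u v : ccontC a ->
  `|(Cint (fun g => a g * dot (U g u) v) : CR)| <= 2 * L1norm mu a * (`|(u : HR)| * `|(v : HR)|).
Proof.
move=> ca; have cf := ccontC_coef u v ca.
rewrite (le_trans (Cint_norm hmu cf))// -mulrA ler_wpM2l// mulrC !(@L1normE R n G mu).
rewrite -(RintZ hmu _ (ccont_norm ca)); apply: (le_trans (ler_norm _)).
have cn := ccont_norm ca; have cn2 := ccont_norm cf.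
apply: (Rint_le_norm hmu cn2 (ccontM _ cn)); first exact: cst_continuous.
move=> h; rewrite normr_id CR_M mulrC ler_wpM2r//.
by rewrite (le_trans (cauchy_schwarz _ _))// (rep_norm hU).
Qed.

Lemma dense_setT : dense (setT : set H).
Proof. by move=> O [x Ox] _; exists x. Qed.

Lemma integrated_norm a u : ccontC a -> `|(rho a u : HR)| <= 2 * L1norm mu a * `|(u : HR)|.
Proof.
move=> ca; apply: (dense_norm_le dense_setT) => [|v _].
  rewrite mulr_ge0// mulr_ge0//; apply: Rintegral_ge0 => g _; exact: (@normr_ge0 _ CR).
by rewrite integrated_repP// -mulrA; exact: Cint_coef_le.
Qed.

Lemma integrated_continuous : continuous_tf mu rho.
Proof.
exists 2 => a /test_function_ccontC ca u.
by rewrite -!HR_normE -rmorphM lecR; exact: integrated_norm.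
Qed.

Lemma integrated_nondegenerate : nondegenerate_tf rho.
Proof.
move=> O [w Ow] oO.
have /nbhs_ballP[d /= d0 dO] : nbhs w O by exact: open_nbhs_nbhs.
have dE : d = (complex.Re d)%:C by rewrite RRe_real// gtr0_real.
set r := complex.Re d in dE; have r0 : 0 < r by rewrite -ltcR -dE.
have r4 : 0 < r / 4 by rewrite divr_gt0.
have /cvgrPdist_le/(_ _ r4) h1 := @rep_cont _ _ _ _ _ hU w 1%g.
have [a ta aP] := approx_identity hmu h1.
exists (rho a w); split; last by apply: span_sub; exists a, w.
apply: dO; rewrite -ball_normE /= dE -HR_normE ltcR.
apply: (@le_lt_trans _ _ (2 * (r / 4))); last by move: r0; lra.
apply: (dense_norm_le dense_setT) => [|v _]; first by rewrite mulr_ge0// ltW.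
rewrite dotBl (integrated_repP (test_function_ccontC ta)) -mulrA; apply: aP.
  exact: (coef_cont hU).
move=> g; rewrite (rep1 hU) => h.
have -> : (dot w v : CR) - dot (U g w) v = dot (w - U g w) v by rewrite dotBl.
by rewrite (le_trans (cauchy_schwarz _ _))// ler_wpM2r.
Qed.

Lemma integrated_same_rep : same_rep (rho_prime rho) (dU U).
Proof.
apply: (same_rho_prime_dU hmu hU integrated_star_rep integrated_continuous integrated_nondegenerate).
by move=> a /test_function_ccontC ca; exact: integrated_repP.
Qed.
End IntegratedRepresentation.

(** * The group representation defined by test functions *)

Section GroupRepresentation.
Context {R : realType} {n : nat} {G : lieGroupType R n} {H : hilbertType R}.
Variables (mu : {measure set (borel G) -> \bar R}) (hmu : left_haar mu).
Variables (m : G -> R) (hm : modular_function mu m).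
Local Notation CR := (realify (R[i]^o : normedModType R[i])).
Local Notation HR := (realify (H : normedModType R[i])).
Notation Cint := (Cintegral mu).
Variable (rho : (G -> R[i]) -> H -> H).
Hypotheses (hrho : star_rep_tf mu m rho) (hcont : continuous_tf mu rho).
Hypothesis hnd : nondegenerate_tf rho.

Definition ltrans (g : G) (b : G -> R[i]) : G -> R[i] := fun h => b (g^-1 * h)%g.

Lemma ltransM g h b : ltrans g (ltrans h b) = ltrans (g * h)%g b.
Proof. by apply/funext => x; rewrite /ltrans invgM mulgA. Qed.
Lemma ltrans1 b : ltrans 1%g b = b.
Proof. by apply/funext => x; rewrite /ltrans invg1 mul1g. Qed.
Lemma test_function_ltransE g b : test_function b -> test_function (ltrans g b).
Proof. exact: test_function_ltrans. Qed.

(** Substituting [h * g] for [h] in the second integral multiplies it by [(m g)^-1], and the weight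
    [m^-1] in [tf_star] produces the same factor, which cancels. *)
Lemma conv_star_ltrans g a b : test_function a -> test_function b ->
  Defs.conv mu (tf_star m (ltrans g a)) b = Defs.conv mu (tf_star m a) (ltrans g^-1%g b).
Proof.
move=> ta tb; apply/funext => x; have [_ m0 mM _] := hm.
have gx : m g != 0 by rewrite gt_eqF.
have cs := test_function_ccontC (test_function_star hmu hm ta).
have [bc _] := test_function_ccontC (test_function_ltransE g^-1%g tb).
pose k (h : G) : CR := tf_star m a h * ltrans g^-1%g b (h^-1 * x)%g.
have gc : continuous (fun h : G => (h^-1 * x)%g).
  by move=> h; apply: cvg_mulG; [exact: lie_inv_continuous|exact: cvg_cst].
have bcc : continuous ((fun h => ltrans g^-1%g b (h^-1 * x)%g) : G -> CR).
  by move=> h; exact: (cvg_cont (L := ltrans g^-1%g b : G -> CR) (@gc h) (@bc _)).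
have ck : ccontC k := @ccontCM R n G _ _ cs bcc.
have cl := @ccontCM R n G _ _ (test_function_ccontC (test_function_star hmu hm (test_function_ltransE g ta))).
have := Cint_rtrans hmu hm g ck.
have -> : (fun h => k (h * g)%g) =
    (fun h => (m g)^-1%:C * (tf_star m (ltrans g a) h * b (h^-1 * x)%g)).
  apply/funext => h; rewrite /k /tf_star /ltrans !invgM invgK !mulgA mulgV mul1g.
  by rewrite mM invfM rmorphM /= !mulrA [(m h)^-1%:C * _]mulrC.
rewrite (CintZ hmu) => [/mulfI h|]; last first.
  apply: cl => h.
  have [bc' _] := test_function_ccontC tb.
  exact: (cvg_cont (L := b : G -> CR) (@gc h) (@bc' _)).
apply: h; rewrite -(rmorph0 (@real_complex R)) (inj_eq (@complexI R)) invr_eq0//.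
Qed.

Lemma rho_ltrans_adj g a b u w : test_function a -> test_function b ->
  dot (rho (ltrans g a) u) (rho b w) = dot (rho a u) (rho (ltrans g^-1%g b) w).
Proof.
have [_ _ rM rS] := hrho; move=> ta tb.
have ta' := test_function_ltransE g ta; have tb' := test_function_ltransE g^-1%g tb.
rewrite (rS _ ta')// (rS _ ta)// -rM//; last exact: (test_function_star hmu hm).
by rewrite -rM// ?(conv_star_ltrans g ta tb)//; exact: (test_function_star hmu hm).
Qed.

(** [v] is the future image of [u] under [g], described by its coefficients against the range of
    [rho]. With a relation, no consistency check is required for values prescribed on sums of
    vectors [rho b w]; uniqueness of [v] comes from non-degeneracy. *)
Definition intertwined (g : G) (u v : H) : Prop := forall b w, test_function b ->
  dot v (rho b w) = dot u (rho (ltrans g^-1%g b) w).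

Notation span := (range_span rho).

Lemma intertwined_rho g a u : test_function a -> intertwined g (rho a u) (rho (ltrans g a) u).
Proof. by move=> ta b w tb; exact: rho_ltrans_adj. Qed.

Lemma intertwined_sym g u v : intertwined g u v -> intertwined g^-1%g v u.
Proof.
move=> guv b w tb; rewrite invgK (guv _ _ (test_function_ltransE g tb)).
by rewrite ltransM mulVg ltrans1.
Qed.

Lemma intertwined_lin g (c : R[i]) u v u' v' : intertwined g u v -> intertwined g u' v' ->
  intertwined g (c *: u + u') (c *: v + v').
Proof. by move=> h h' b w tb; rewrite !dotDl !dotZl h// h'. Qed.

Lemma intertwinedM g h u v w : intertwined h u v -> intertwined g v w ->
  intertwined (g * h)%g u w.
Proof.
move=> huv gvw b x tb; rewrite gvw// huv; last exact: test_function_ltransE.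
by rewrite ltransM invgM.
Qed.

Lemma dot_span_inj u v : (forall b w, test_function b -> dot u (rho b w) = dot v (rho b w)) -> u = v.
Proof.
move=> h; apply: (dense_dot_inj hnd).
apply: (@span_ind _ _ _ (fun x => dot u x = dot v x)); first by rewrite !dot0r.
by move=> c _ x [b [w [tb ->]]] _ IH; rewrite !dotDr !dotZr IH h.
Qed.

Lemma intertwined_unique g u v v' : intertwined g u v -> intertwined g u v' -> v = v'.
Proof. by move=> h h'; apply: dot_span_inj => b w tb; rewrite h// h'. Qed.

Lemma intertwined_span g u : span u -> exists2 v, span v & intertwined g u v.
Proof.
move: u; apply: span_ind => [|c _ v [b [w [tb ->]]] _ [v' sv' hv']].
  by exists 0; [exact: span0|move=> b w tb; rewrite !dot0l].
exists (c *: rho (ltrans g b) w + v').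
  by apply: span_cons => //; exists (ltrans g b), w; split=> //; exact: test_function_ltransE.
by apply: intertwined_lin => //; exact: intertwined_rho.
Qed.

Lemma intertwined_dot g u v x : intertwined g u v -> span x ->
  exists2 x', span x' & intertwined g^-1%g x x' /\ dot v x = dot u x'.
Proof.
move=> guv; move: x; apply: span_ind => [|c _ x [b [w [tb ->]]] _ [x' sx' [hx' e]]].
  by exists 0; [exact: span0|split; [move=> b w tb; rewrite !dot0l|rewrite !dot0r]].
exists (c *: rho (ltrans g^-1%g b) w + x').
  by apply: span_cons => //; exists (ltrans g^-1%g b), w; split=> //; exact: test_function_ltransE.
split; first by apply: intertwined_lin => //; exact: intertwined_rho.
by rewrite !dotDr !dotZr e guv.
Qed.

(** [dot v v] equals [dot u x'] with [x'] the partner of [v] under [g^-1], and uniqueness forces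
    [x' = u]. *)
Lemma intertwined_iso g u v : span v -> intertwined g u v -> `|(v : HR)| = `|(u : HR)|.
Proof.
move=> sv guv; have [x' sx' [hx' e]] := intertwined_dot guv sv.
have := intertwined_unique hx' (intertwined_sym guv) => xu; rewrite xu !dot_normR in e.
by move: e => /complexI/eqP; rewrite eqrXn2// => /eqP.
Qed.

Lemma intertwined_le g u v : intertwined g u v -> `|(v : HR)| <= `|(u : HR)|.
Proof.
move=> guv; apply: (dense_norm_le hnd) => // x sx.
have [x' sx' [hx' ->]] := intertwined_dot guv sx.
by rewrite (le_trans (cauchy_schwarz _ _))// (intertwined_iso sx' hx').
Qed.

(** Approximations of [u] in the span have partners in the span, which form a Cauchy sequence by
    [intertwined_le]. The relation is tested against fixed vectors and thus survives the limit. *)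
Lemma intertwined_ex g u : exists v, intertwined g u v.
Proof.
have /boolp.choice [x xP] : forall k : nat, exists x, span x /\ `|(u - x : HR)| < k.+1%:R^-1.
  move=> k; have k0 : 0 < (k.+1%:R^-1 : R) by rewrite invr_gt0.
  by have [x sx xu] := dense_approx u hnd k0; exists x.
have /boolp.choice [y yP] : forall k : nat, exists y, span y /\ intertwined g (x k) y.
  by move=> k; have [y sy hy] := intertwined_span g (xP k).1; exists y.
have [|l lP] := @hilbert_complete R H y.
  move=> p q; have hd : intertwined g (-1 *: x q + x p) (-1 *: y q + y p).
    by apply: intertwined_lin; [exact: (yP q).2|exact: (yP p).2].
  have -> : (y p - y q : HR) = (-1 *: y q + y p : H) by rewrite scaleN1r addrC.
  rewrite (le_trans (intertwined_le hd))//.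
  have -> : (-1 *: x q + x p : H) = ((u - x q : HR) - (u - x p : HR)) :> HR.
    by rewrite scaleN1r opprB [RHS]addrC addrA subrK addrC.
  by rewrite (le_trans (@ler_normB _ HR _ _))// addrC lerD// ltW//; [exact: (xP p).2|exact: (xP q).2].
exists l => b w tb; apply/eqP; rewrite -subr_eq0; apply/eqP; apply: (@normr0_eq0 _ CR).
apply/eqP; rewrite -normr_le0 normr_id; apply/ler_addgt0Pl => d d0; rewrite addr0.
set B := rho b w; set B' := rho _ w.
set r := `|(B : HR)| + `|(B' : HR)| + 1; have r0 : 0 < r by rewrite ltr_wpDl// addr_ge0.
have [k _ kP] := near_infty_natSinv_lt (PosNum (divr_gt0 d0 r0)).
have {}kP : k.+1%:R^-1 < d / r by exact: (kP k (leqnn k)).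
have e1 : dot (y k) B = dot (x k) B' by exact: (yP k).2.
have -> : (dot l B - dot u B' : R[i]) = - dot (y k - l) B - dot (u - x k) B'.
  by rewrite !dotBl e1; ring.
rewrite (le_trans (@ler_normB _ CR _ _))// normrN.
have h1 := cauchy_schwarz (y k - l) B; have h2 := cauchy_schwarz (u - x k) B'.
rewrite (le_trans (lerD h1 h2))//.
have h3 : `|(y k - l : HR)| * `|(B : HR)| <= d / r * `|(B : HR)|.
  by rewrite ler_wpM2r// (le_trans (lP k))// ltW.
have h4 : `|(u - x k : HR)| * `|(B' : HR)| <= d / r * `|(B' : HR)|.
  by rewrite ler_wpM2r// ltW// (lt_trans (xP k).2).
rewrite (le_trans (lerD h3 h4))// -mulrDr mulrAC ler_pdivrMr// ler_wpM2l ?(ltW d0)//.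
by rewrite /r lerDl.
Qed.

Definition group_rep (g : G) (u : H) : H := xget 0 [set v | intertwined g u v].
Notation U := group_rep.

Lemma group_repP g u : intertwined g u (U g u).
Proof. exact: (xgetPex _ (intertwined_ex g u)). Qed.

Lemma group_repE g u v : intertwined g u v -> U g u = v.
Proof. by move=> h; exact: (intertwined_unique (group_repP g u) h). Qed.

Lemma group_repM g h u : U (g * h)%g u = U g (U h u).
Proof. by apply: group_repE; apply: intertwinedM; exact: group_repP. Qed.

Lemma group_rep1 u : U 1%g u = u.
Proof. by apply: group_repE => b w tb; rewrite invg1 ltrans1. Qed.

Lemma group_rep_lin g (c : R[i]) u v : U g (c *: u + v) = c *: U g u + U g v.
Proof. by apply: group_repE; apply: intertwined_lin; exact: group_repP. Qed.

Lemma group_rep_norm g u : `|(U g u : HR)| = `|(u : HR)|.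
Proof.
apply/eqP; rewrite eq_le (intertwined_le (group_repP g u)) /=.
exact: (intertwined_le (intertwined_sym (group_repP g u))).
Qed.

(** Polarization recovers real parts from norms, and replacing [v] by ['i *: v] the imaginary
    parts. *)
Lemma group_rep_dot g u v : dot (U g u) (U g v) = dot u v.
Proof.
have reE (x y : H) : reC (dot x y) = (`|(x + y : HR)| ^+ 2 - `|(x : HR)| ^+ 2 - `|(y : HR)| ^+ 2) / 2.
  have : dot (x + y) (x + y) = dot x x + dot y y + (dot x y + ((dot x y)^*)%C).
    by rewrite dotDl !dotDr [dot y x]dotC; ring.
  rewrite !dot_normR; case: (dot x y) => a b /(congr1 (@complex.Re R)) /= ->.
  by rewrite /reC /=; field.
have UD x y : U g (x + y) = U g x + U g y.
  by have := group_rep_lin g 1 x y; rewrite !scale1r.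
have Re x y : reC (dot (U g x) (U g y)) = reC (dot x y).
  rewrite !reE !group_rep_norm; congr ((_ ^+ 2 - _ - _) / 2).
  by rewrite -(group_rep_norm g (x + y)) UD.
have UZ (c : R[i]) x : U g (c *: x) = c *: U g x.
  have U0 : U g 0 = 0 by have := UD 0 0; rewrite addr0 -[LHS]addr0 => /addrI.
  by have := group_rep_lin g c x 0; rewrite U0 !addr0.
have h1 := Re u v; have h2 := Re u ('i%C *: v).
move: h1 h2; rewrite UZ !dotZr /reC; case: (dot (U g u) _) (dot u v) => p q [r s] /= -> h2.
by congr Complex; move: h2; lra.
Qed.

Lemma group_rep_rho g b u : test_function b -> U g (rho b u) = rho (ltrans g b) u.
Proof. by move=> tb; apply: group_repE; exact: intertwined_rho. Qed.

(** On the span, continuity comes from [rho_ltrans_smooth]. As every [U g] is isometric,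
    approximation of [u] from the span is uniform in [g]. *)
Lemma group_rep_cont u : continuous ((fun g => U g u) : G -> HR).
Proof.
have cspan v : span v -> continuous ((fun g => U g v) : G -> HR).
  move: v; apply: span_ind => [|c _ v [b [w [tb ->]]] _ IH].
    have -> : (fun g => U g 0) = (fun=> 0).
      by apply/funext => g; apply: group_repE => b w tb; rewrite !dot0l.
    by move=> g; exact: cvg_cst.
  have -> : (fun g => U g (c *: rho b w + v)) = (fun g => c *: rho (ltrans g b) w + U g v).
    by apply/funext => g; rewrite group_rep_lin group_rep_rho.
  move=> g; apply: (@cvgD _ HR); last exact: IH.
  have sc := smooth_map_cont (rho_ltrans_smooth hmu hrho hcont w tb).
  exact: (cvg_cont (L := fun u : HR => c *: (u : H) : HR) (@sc g) (@scaleC_cont R H c _)).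
have /boolp.choice [x xP] : forall k : nat, exists x, span x /\ `|(u - x : HR)| < k.+1%:R^-1.
  move=> k; have k0 : 0 < (k.+1%:R^-1 : R) by rewrite invr_gt0.
  by have [x sx xu] := dense_approx u hnd k0; exists x.
apply: (@uniform_limit_cont R G HR (fun k g => U g (x k))) => [k|e e0].
  by apply: cspan; exact: (xP k).1.
have [k _ kP] := near_infty_natSinv_lt (PosNum e0).
exists k => g; have -> : (U g (x k) : HR) - U g u = U g (-1 *: u + x k).
  by rewrite group_rep_lin scaleN1r addrC.
rewrite group_rep_norm scaleN1r addrC -normrN opprB ltW// (lt_trans (xP k).2)//.
exact: (kP k (leqnn k)).
Qed.

Lemma group_rep_unitary : unitary_rep U.
Proof.
split; [|exact: group_repM|exact: group_rep_cont].
move=> g; split; [by move=> c u v _ _; exact: group_rep_lin|exact: group_rep_dot|].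
by move=> v; exists (U g^-1%g v); rewrite -group_repM mulgV group_rep1.
Qed.

End GroupRepresentation.

(** * Recovering [rho] as an integral of the group representation *)

Section IntegralFormula.
Context {R : realType} {n : nat} {G : lieGroupType R n} {H : hilbertType R}.
Variables (mu : {measure set (borel G) -> \bar R}) (hmu : left_haar mu).
Variables (m : G -> R) (hm : modular_function mu m).
Local Notation CR := (realify (R[i]^o : normedModType R[i])).
Local Notation HR := (realify (H : normedModType R[i])).
Notation Cint := (Cintegral mu).
Variable (rho : (G -> R[i]) -> H -> H).
Hypotheses (hrho : star_rep_tf mu m rho) (hcont : continuous_tf mu rho).
Hypothesis hnd : nondegenerate_tf rho.
Notation U := (group_rep rho).
Let hU : unitary_rep U. Proof. exact: (group_rep_unitary hmu hm hrho hcont hnd). Qed.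

Lemma rho_sum (w : seq (R * G)) (F : G -> G -> R[i]) u : (forall h, test_function (F h)) ->
  test_function (fun g => \sum_(p <- w) p.1%:C * F p.2 g) /\
  rho (fun g => \sum_(p <- w) p.1%:C * F p.2 g) u = \sum_(p <- w) p.1%:C *: rho (F p.2) u.
Proof.
have [_ rl _ _] := hrho; move=> tF; elim: w => [|p w [tw e]].
  have -> : (fun g : G => \sum_(p <- [::]) p.1%:C * F p.2 g) = (fun=> 0).
    by apply/funext => g; rewrite big_nil.
  split; first exact: test_function0.
  have t0 := @test_function0 R n G; have := rl (-1) _ _ t0 t0 u.
  rewrite scaleN1r addNr big_nil => <-; congr rho; apply/funext => g.
  by rewrite mulr0 addr0.
have -> : (fun g => \sum_(q <- p :: w) q.1%:C * F q.2 g) =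
    (fun g => p.1%:C * F p.2 g + \sum_(q <- w) q.1%:C * F q.2 g).
  by apply/funext => g; rewrite big_cons.
split; first exact: test_function_lin.
by rewrite big_cons rl// e.
Qed.

(* The Riemann sums of the integral defining [conv mu a b g] converge
   uniformly in g, hence in L^1 since the supports stay in a compact set. *)
Lemma rho_integral_range a b w v : test_function a -> test_function b ->
  dot (rho a (rho b w)) v = Cint (fun h => a h * dot (U h (rho b w)) v).
Proof.
move=> ta tb; have ca := test_function_ccontC ta; have cb := test_function_ccontC tb.
have [_ _ rM _] := hrho; rewrite -rM//.
have tab := test_function_conv hmu ta tb; have cab := test_function_ccontC tab.
have [ac [K cK Ka]] := ca; have [bc [L cL Lb]] := cb.
pose L' : set G := [set g | exists a b, [/\ K a, L b & g = (a * b)%g]].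
have cL' : compact L' by exact: compact_mulG.
pose F0 (g h : G) : CR := a h * b (h^-1 * g)%g.
(* The index [None] joins the matrix coefficient to the integrands of the convolution, so that one
   Riemann sum approximates both sides of the formula. *)
pose f (i : option G) (h : G) : CR := if i is Some g then F0 g h
  else a h * dot (U h (rho b w)) v.
have Fc : continuous (fun p : G * G => F0 p.2 p.1) := conv_integrand_cont ac bc.
have Fc' : continuous (fun p : G * G => F0 p.1 p.2) :=
  continuous_swap (T := G) (T' := G) (U := CR) (F := fun h g => F0 g h) Fc.
have fNone : ccontC (f None) by exact: (ccontC_coef hU).
have fs g h : ~ L' g -> F0 g h = 0.
  move=> nL; rewrite /F0; have [Kh|/Ka ->] := pselect (K h); last by rewrite mul0r.
  rewrite Lb ?mulr0// => Lhg; apply: nL.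
  by exists h, (h^-1 * g)%g; split=> //; rewrite mulgA mulgV mul1g.
have fc i : continuous (f i).
  case: i => [g|]; last exact: fNone.1.
  move=> h; have h1 : (h', g) @[h' --> h] --> (h, g) by apply: cvg_pair; [exact: cvg_id|exact: cvg_cst].
  exact: (cvg_cont h1 (@Fc (h, g))).
have feq h e : K h -> 0 < e -> \forall h' \near h, forall i, `|f i h' - f i h| <= e.
  move=> Kh e0.
  have h1 := @near_uniform R n G CR G F0 L' h e cL' fs Fc' e0.
  have /cvgrPdist_le/(_ e e0) h2 := fNone.1 h.
  by apply: filterS2 h1 h2 => h' h1 h2 [g|]; [exact: h1|rewrite distrC].
have fK i h : ~ K h -> f i h = 0 by move=> /Ka; rewrite /f /F0; case: i => [g|] ->; rewrite mul0r.
have [C C0 CP] := rho_norm_le hcont.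
apply/eqP; rewrite -subr_eq0; apply/eqP; apply: (@normr0_eq0 _ CR).
apply/eqP; rewrite -normr_le0 normr_id; apply/ler_addgt0Pl => d d0; rewrite addr0.
have m0 : 0 <= fine (mu L') by rewrite fine_ge0.
set r := C * fine (mu L') * `|(w : HR)| * `|(v : HR)| + 1.
have r0 : 0 < r by rewrite ltr_wpDl// !mulr_ge0.
have [s sP] := Cint_riemann hmu cK fc (divr_gt0 d0 r0) feq fK.
pose F h g := a h * b (h^-1 * g)%g.
have tF h : test_function (F h) by apply: test_functionZ; exact: test_function_ltrans.
have [tS SE] := rho_sum s w tF.
set S := (fun g => _) in tS SE.
(* The error of the Riemann sum as a test function: at most [d / r] everywhere and zero off [L'],
   hence small in L^1 and sent by [rho] to an operator of small norm. *)
pose D : G -> R[i] := fun g => -1 * S g + Defs.conv mu a b g.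
have tD : test_function D by exact: test_function_lin.
have DE : rho D w = rho (Defs.conv mu a b) w - rho S w.
  by have [_ rl _ _] := hrho; rewrite rl// scaleN1r addrC.
have D_le : L1norm mu D <= fine (mu L') * (d / r).
  apply: (L1norm_le hmu (test_function_ccontC tD) cL').
    move=> g nL; rewrite /D /S big1 ?mulr0 ?add0r; last by move=> p _; rewrite /F [a _ * _](fs g p.2 nL) mulr0.
    by rewrite -[RHS](@Cint0 R n G mu); congr Cintegral; apply/funext => h; exact: fs.
  by move=> g _; have := sP (Some g); rewrite /D mulN1r addrC.
have SD : dot (rho S w) v = \sum_(p <- s) p.1%:C * (f None p.2 : R[i]).
  rewrite SE dot_suml; apply: eq_bigr => p _; rewrite dotZl; congr (_ * _).
  have [_ rl _ _] := hrho; rewrite /f (group_rep_rho hmu hm hrho hnd)// -dotZl; congr dot.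
  have t0 := @test_function0 R n G; have := rl (a p.2) _ _ (test_function_ltrans p.2^-1%g tb) t0 w.
  have := rl (-1) _ _ t0 t0 w; rewrite scaleN1r addNr.
  have -> : (fun g : G => -1 * (0 : R[i]) + 0) = (fun=> 0) by apply/funext => g; rewrite mulr0 addr0.
  by move=> ->; rewrite addr0 => <-; congr rho; apply/funext => g; rewrite addr0.
have -> : (dot (rho (Defs.conv mu a b) w) v - Cint (fun h => a h * dot (U h (rho b w)) v) : CR) =
   (dot (rho D w) v : CR) - ((Cint (f None) - \sum_(p <- s) p.1%:C * (f None p.2 : R[i]) : R[i]) : CR).
  rewrite DE dotBl SD.
  change (dot (rho (Defs.conv mu a b) w) v - Cint (f None) =
    (dot (rho (Defs.conv mu a b) w) v - \sum_(p <- s) p.1%:C * (f None p.2 : R[i])) -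
    (Cint (f None) - \sum_(p <- s) p.1%:C * (f None p.2 : R[i])) :> R[i]).
  by ring.
rewrite (le_trans (@ler_normB _ CR _ _))//.
have h1 : `|(dot (rho D w) v : CR)| <= C * fine (mu L') * `|(w : HR)| * `|(v : HR)| * (d / r).
  rewrite (le_trans (cauchy_schwarz _ _))//.
  have -> : C * fine (mu L') * `|(w : HR)| * `|(v : HR)| * (d / r) =
    C * (fine (mu L') * (d / r)) * `|(w : HR)| * `|(v : HR)| by ring.
  rewrite ler_wpM2r// (le_trans (CP _ _ tD))// ler_wpM2r// ler_wpM2l//.
rewrite (le_trans (lerD h1 (sP None)))//.
have -> : C * fine (mu L') * `|(w : HR)| * `|(v : HR)| * (d / r) + d / r = r * (d / r) by rewrite /r; ring.
by rewrite mulrC divfK// gt_eqF.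
Qed.

(** Both sides are linear in [u] and bounded in norm, so the formula extends from the dense span of
    the range. *)
Lemma rho_integral a : test_function a -> forall u v,
  dot (rho a u) v = Cint (fun g => a g * dot (U g u) v).
Proof.
move=> ta u v; have ca := test_function_ccontC ta; have [rlin _ _ _] := hrho.
have hspan x : range_span rho x -> dot (rho a x) v = Cint (fun g => a g * dot (U g x) v).
  move: x; apply: span_ind => [|c _ x [b [w [tb ->]]] _ IH].
    have r0 : rho a 0 = 0.
      by have := rlin a ta 1 0 0 I I; rewrite !scale1r addr0 -[LHS]addr0 => /addrI.
    rewrite r0 dot0l -[LHS](@Cint0 R n G mu); congr Cintegral; apply/funext => g.
    by rewrite (rep0 hU) dot0l mulr0.
  rewrite (rlin a ta c _ _ I I) dotDl dotZl IH rho_integral_range//.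
  rewrite -(Cint_lin hmu c); [|exact: (ccontC_coef hU)|exact: (ccontC_coef hU)].
  by congr Cintegral; apply/funext => g; rewrite (rep_lin hU) dotDl dotZl mulrDr mulrCA.
have [C C0 CP] := rho_norm_le hcont.
have L0 : 0 <= L1norm mu a by apply: Rintegral_ge0 => g _; exact: (@normr_ge0 _ CR).
apply/eqP; rewrite -subr_eq0; apply/eqP; apply: (@normr0_eq0 _ CR).
apply/eqP; rewrite -normr_le0 normr_id; apply/ler_addgt0Pl => d d0; rewrite addr0.
(* The sum of the bounds of both sides as functionals of [u], plus 1 to be positive. *)
set r := (C * L1norm mu a + 2 * L1norm mu a) * `|(v : HR)| + 1.
have r0 : 0 < r by rewrite ltr_wpDl// mulr_ge0// addr_ge0// mulr_ge0.
have [x sx xu] := dense_approx u hnd (divr_gt0 d0 r0).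
have rB : rho a u - rho a x = rho a (u - x).
  by have := rlin a ta (-1) x u I I; rewrite !scaleN1r addrC => ->; rewrite addrC.
have IB : Cint (fun g => a g * dot (U g u) v) - Cint (fun g => a g * dot (U g x) v) =
    Cint (fun g => a g * dot (U g (u - x)) v).
  rewrite -(CintB hmu); [|exact: (ccontC_coef hU)|exact: (ccontC_coef hU)].
  by congr Cintegral; apply/funext => g; rewrite (repB hU) dotBl mulrBr.
have -> : (dot (rho a u) v - Cint (fun g => a g * dot (U g u) v) : CR) =
   (dot (rho a (u - x)) v : CR) - (Cint (fun g => a g * dot (U g (u - x)) v) : CR).
  rewrite -rB -IB dotBl (hspan x sx).
  set A := dot (rho a u) v; set B := Cint _; set E := Cint _.
  by change (A - B = (A - E) - (B - E) :> R[i]); ring.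
rewrite (le_trans (@ler_normB _ CR _ _))//.
have h1 : `|(dot (rho a (u - x)) v : CR)| <= C * L1norm mu a * `|(u - x : HR)| * `|(v : HR)|.
  by rewrite (le_trans (cauchy_schwarz _ _))// ler_wpM2r//; exact: CP.
have h2 := Cint_coef_le hmu hU (u - x) v ca.
rewrite (le_trans (lerD h1 h2))//.
have -> : C * L1norm mu a * `|(u - x : HR)| * `|(v : HR)| +
   2 * L1norm mu a * (`|(u - x : HR)| * `|(v : HR)|) = (r - 1) * `|(u - x : HR)| by rewrite /r; ring.
have h3 : (r - 1) * `|(u - x : HR)| <= r * `|(u - x : HR)| by rewrite ler_wpM2r// gerBl.
rewrite (le_trans h3)// mulrC -ler_pdivlMr//; exact: ltW.
Qed.
End IntegralFormula.

Theorem mainTheorem2 (R : realType) (n : nat) (G : lieGroupType R n)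
    (mu : {measure set (borel G) -> \bar R}) (m : G -> R)
    (hmu : left_haar mu) (hm : modular_function mu m) :
  (forall (H : hilbertType R) (rho : (G -> R[i]) -> H -> H),
     star_rep_tf mu m rho -> continuous_tf mu rho -> nondegenerate_tf rho ->
     exists U : G -> H -> H,
       unitary_rep U /\ same_rep (rho_prime rho) (dU U))
  /\
  (forall (H : hilbertType R) (U : G -> H -> H),
     unitary_rep U ->
     exists rho : (G -> R[i]) -> H -> H,
       [/\ star_rep_tf mu m rho, continuous_tf mu rho, nondegenerate_tf rho &
           same_rep (rho_prime rho) (dU U)]).
Proof.
split=> [H rho hrho hcont hnd|H U hU].
  have hU := group_rep_unitary hmu hm hrho hcont hnd.
  exists (group_rep rho); split=> //.
  exact: (same_rho_prime_dU hmu hU hrho hcont hnd (rho_integral hmu hm hrho hcont hnd)).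
exists (integrated_rep mu U); split.
- exact: (integrated_star_rep hmu hm hU).
- exact: (integrated_continuous hmu hU).
- exact: (integrated_nondegenerate hmu hU).
- exact: (integrated_same_rep hmu hm hU).
Qed.
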